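(* Let $\mu\in(0,1)$ and let $\omega_1\in L_{2,\mu}(\Omega)$. Let $\psi_1$ be a solution to the problem $$-\Delta\psi_1-\frac{2}{r}\psi_{1,r}=\omega_1\ \text{ in }\Omega,\qquad \psi_1=0\ \text{ on }S.$$ Then $$\|\psi_1-\psi_1(0)\|_{L_2(-a,a;H^2_\mu(0,R))}^2+\|\psi_{1,zr}\|_{L_{2,\mu}(\Omega)}^2+\|\psi_{1,zz}\|_{L_{2,\mu}(\Omega)}^2+2\mu(2-2\mu)\|\psi_{1,z}\|_{L_{2,\mu-1}(\Omega)}^2\le c\,\|\omega_1\|_{L_{2,\mu}(\Omega)}^2,$$ where $\psi_1(0)=\psi_1|_{r=0}$ (a function of $z$) and $c$ is a constant independent of $\psi_1$ and $\omega_1$.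
   Context: Let $a,R>0$. $\Omega=\{x\in\mathbb{R}^3: r<R,\ |z|<a\}$ is a bounded cylinder in cylindrical coordinates $(r,\varphi,z)$, with boundary $S=S_1\cup S_2$, $S_1=\{r=R,\ |z|<a\}$, $S_2=\{r<R,\ z\in\{-a,a\}\}$. All functions are real-valued and axially symmetric, i.e. functions of $(r,z)$ only, so $\Omega$ is identified with $(0,R)\times(-a,a)$ and $dx=r\,dr\,dz$. Subscripts after a comma denote partial derivatives, and $\Delta=\partial_r^2+\frac1r\partial_r+\partial_z^2$. A solution of the boundary value problem is understood in the weak sense: $\psi_1\in H^1(\Omega)$ (i.e. $\psi_1,\psi_{1,r},\psi_{1,z}\in L_2$ with respect to $r\,dr\,dz$), $\psi_1$ has zero trace on $S$, and the equation holds in the sense of distributions in the open rectangle $(0,R)\times(-a,a)$. Weighted spaces: for $\mu\in\mathbb{R}$, $$\|u\|_{L_{2,\mu}(\Omega)}^2=\int_\Omega |u(r,z)|^2 r^{2\mu}\,r\,dr\,dz;$$ for functions of $r\in(0,R)$ and $k\in\{0,1,2,\dots\}$, $$\|v\|_{H^k_\mu(0,R)}^2=\sum_{i=0}^k\int_0^R|\partial_r^i v|^2\,r^{2(\mu-k+i)}\,r\,dr.$$ $L_2(-a,a;X)$ denotes $X$-valued square-integrable functions of $z\in(-a,a)$. *)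

(* Defs.v *)
From HB Require Import structures.
From mathcomp Require Import all_boot all_order all_algebra.
From mathcomp Require Import all_classical all_reals all_analysis.

Set Implicit Arguments.
Unset Strict Implicit.
Unset Printing Implicit Defensive.

Import Order.TTheory GRing.Theory Num.Theory numFieldNormedType.Exports.

Local Open Scope classical_set_scope.
Local Open Scope ring_scope.

(* An axially symmetric function on the cylinder {r < rho, |z| < a} is a
   function of p = (r, z) on the open rectangle ]0, rho[ x ]-a, a[.  Elements
   of L2-type spaces are given by Borel representatives, and dx = r dr dz
   (no factor 2 pi). *)

Definition leb2 {R : realType} :=
  ((@lebesgue_measure R) \x (@lebesgue_measure R))%E.

Definition Omega {R : realType} (rho a : R) : set (R * R) :=
  [set p | 0 < p.1 < rho /\ - a < p.2 < a].

Definition pdr {R : realType} (f : R * R -> R) : R * R -> R :=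
  fun p => derive1 (fun r => f (r, p.2)) p.1.

Definition pdz {R : realType} (f : R * R -> R) : R * R -> R :=
  fun p => derive1 (fun z => f (p.1, z)) p.2.

(* The word s lists the successive partial derivatives: true for d/dr, false
   for d/dz. *)
Definition pds {R : realType} (s : seq bool) (f : R * R -> R) : R * R -> R :=
  foldr (fun b g => if b then pdr g else pdz g) f s.

Definition smooth {R : realType} (f : R * R -> R) : Prop :=
  forall s : seq bool,
    continuous (pds s f) /\
    forall p : R * R, derivable (fun r => pds s f (r, p.2)) p.1 1 /\
                      derivable (fun z => pds s f (p.1, z)) p.2 1.

Definition test_fun {R : realType} (rho a : R) (phi : R * R -> R) : Prop :=
  smooth phi /\
  exists K : set (R * R), [/\ compact K, K `<=` Omega rho a &
    forall p, ~ K p -> phi p = 0].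

Definition loc_int {R : realType} (rho a : R) (u : R * R -> R) : Prop :=
  measurable_fun (Omega rho a) u /\
  forall K : set (R * R), compact K -> K `<=` Omega rho a ->
    leb2.-integrable K (EFin \o u).

(* Distributions on the open rectangle are represented by functionals, of
   which only the values on test functions matter; a function u acts through
   integration against dr dz. *)

Definition distr {R : realType} (rho a : R) (u phi : R * R -> R) : R :=
  \int[leb2]_(p in Omega rho a) (u p * phi p).

Definition Dr {R : realType} (T : (R * R -> R) -> R) (phi : R * R -> R) : R :=
  - T (pdr phi).

Definition Dz {R : realType} (T : (R * R -> R) -> R) (phi : R * R -> R) : R :=
  - T (pdz phi).

Definition divr {R : realType} (T : (R * R -> R) -> R) (phi : R * R -> R) : R :=
  T (fun p => p.1^-1 * phi p).

Definition Lap {R : realType} (T : (R * R -> R) -> R) (phi : R * R -> R) : R :=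
  Dr (Dr T) phi + divr (Dr T) phi + Dz (Dz T) phi.

Definition distr_is {R : realType} (rho a : R) (T : (R * R -> R) -> R)
    (v : R * R -> R) : Prop :=
  loc_int rho a v /\
  forall phi, test_fun rho a phi -> T phi = distr rho a v phi.

(* Squared norm of L_{2,mu}(Omega). *)
Definition L2w_sq {R : realType} (rho a mu : R) (u : R * R -> R) : \bar R :=
  (\int[leb2]_(p in Omega rho a)
     (`|u p| ^+ 2 * p.1 `^ (2 * mu) * p.1)%:E)%E.

Definition L2w {R : realType} (rho a mu : R) (u : R * R -> R) : Prop :=
  measurable_fun (Omega rho a) u /\ (L2w_sq rho a mu u < +oo)%E.

Definition H1 {R : realType} (rho a : R) (u ur uz : R * R -> R) : Prop :=
  [/\ L2w rho a 0 u,
      distr_is rho a (Dr (distr rho a u)) ur /\ L2w rho a 0 ur &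
      distr_is rho a (Dz (distr rho a u)) uz /\ L2w rho a 0 uz].

(* Squared norm of L2(S): the surface measure is rho dz on the lateral
   boundary S1 and r dr on the two bases S2. *)
Definition L2S_sq {R : realType} (rho a : R) (f : R * R -> R) : \bar R :=
  (\int[@lebesgue_measure R]_(z in `](- a)%R, a[)
      (`|f (rho, z)| ^+ 2 * rho)%:E
   + \int[@lebesgue_measure R]_(r in `]0%R, rho[)
      ((`|f (r, a)| ^+ 2 + `|f (r, - a)| ^+ 2) * r)%:E)%E.

(* The trace operator is the continuous extension of f |-> f|_S from functions
   smooth up to the boundary to H^1(Omega).  The axis r = 0 is not part of
   the boundary S. *)
Definition zero_trace {R : realType} (rho a : R) (u ur uz : R * R -> R) : Prop :=
  exists f : nat -> R * R -> R,
    [/\ forall n, smooth (f n),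
        L2w_sq rho a 0 (f n \- u) @[n --> \oo] --> 0%E,
        L2w_sq rho a 0 (pdr (f n) \- ur) @[n --> \oo] --> 0%E,
        L2w_sq rho a 0 (pdz (f n) \- uz) @[n --> \oo] --> 0%E &
        L2S_sq rho a (f n) @[n --> \oo] --> 0%E].

Definition weak_solution {R : realType} (rho a : R) (omega psi : R * R -> R) :
    Prop :=
  (exists psir psiz, H1 rho a psi psir psiz /\ zero_trace rho a psi psir psiz) /\
  forall phi, test_fun rho a phi ->
    - Lap (distr rho a psi) phi - 2 * divr (Dr (distr rho a psi)) phi
    = distr rho a omega phi.

Definition test_fun1 {R : realType} (rho : R) (phi : R -> R) : Prop :=
  (forall n x, derivable (derive1n n phi) x 1) /\
  exists K : set R, [/\ compact K, K `<=` `]0, rho[ &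
    forall x, ~ K x -> phi x = 0].

(* w is the i-th weak derivative of v on ]0, rho[; for i = 0 this is equality
   almost everywhere. *)
Definition wderiv1 {R : realType} (rho : R) (i : nat) (v w : R -> R) : Prop :=
  [/\ locally_integrable `]0, rho[ v, locally_integrable `]0, rho[ w &
    forall phi, test_fun1 rho phi ->
      \int[@lebesgue_measure R]_(r in `]0, rho[) (v r * derive1n i phi r)
      = (-1) ^+ i * \int[@lebesgue_measure R]_(r in `]0, rho[) (w r * phi r)].

(* Squared norm in H^k_mu(0, rho) of a function with weak derivatives
   d 0, ..., d k. *)
Definition Hk_sq {R : realType} (rho : R) (k : nat) (mu : R) (d : nat -> R -> R) :
    \bar R :=
  (\sum_(i < k.+1) \int[@lebesgue_measure R]_(r in `]0%R, rho[)
     (`|d i r| ^+ 2 * r `^ (2 * (mu - k%:R + i%:R)) * r)%:E)%E.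

(* d i (., z) is the i-th weak derivative of u(., z) for almost every z.  The
   joint measurability of the d i amounts, when the norm below is finite, to
   the strong measurability of z |-> u(., z) in the separable Hilbert space
   H^k_mu(0, rho). *)
Definition r_derivs {R : realType} (rho a : R) (k : nat) (u : R * R -> R)
    (d : nat -> R * R -> R) : Prop :=
  forall i, (i <= k)%N -> measurable_fun (Omega rho a) (d i) /\
    {ae @lebesgue_measure R, forall z, - a < z < a ->
      wderiv1 rho i (fun r => u (r, z)) (fun r => d i (r, z))}.

(* Squared norm of L2(-a, a; H^k_mu(0, rho)). *)
Definition L2Hk_sq {R : realType} (rho a : R) (k : nat) (mu : R)
    (d : nat -> R * R -> R) : \bar R :=
  (\int[@lebesgue_measure R]_(z in `](- a)%R, a[)
     Hk_sq rho k mu (fun i r => d i (r, z)))%E.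

(* g(z) = u(0, z), for the almost everywhere equal version of u that is
   continuous in r up to r = 0 for almost every z; this determines g almost
   everywhere. *)
Definition axis_trace {R : realType} (rho a : R) (u : R * R -> R) (g : R -> R) :
    Prop :=
  exists u' : R * R -> R,
    {ae leb2, forall p, Omega rho a p -> u' p = u p} /\
    {ae @lebesgue_measure R, forall z, - a < z < a ->
      {within `[0, rho[, continuous (fun r => u' (r, z))} /\ u' (0, z) = g z}.

(* Main.v *)
(* Expand in the Dirichlet eigenfunctions e_n of d^2/dz^2 on ]-a, a[, with
   eigenvalues -l_n^2.  Since psi vanishes on the bases, its sine coefficient v_n
   solves - v'' - (3/r) v' = f_n - l_n^2 v on ]0, rho[ with v(rho) = 0, where f_n is
   the coefficient of omega.  As r^3 v' has no constant term (v' is square integrable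
   for r dr), v' = - r^-3 int_0^r s^3 (f_n - l_n^2 v) ds.  Testing with r^(2 mu - 2) v
   bounds l_n^4 |v|^2, 2 l_n^2 |v'|^2 and 4 mu (1 - mu) l_n^2 |v/r|^2, integrated
   against r^(2 mu + 1) dr, by the same integral of |f_n|^2.  Summing over n (Bessel and
   Riesz-Fischer) gives the derivatives psi_zz, psi_zr and psi_z with their estimates.
   Finally - psi_rr - (3/r) psi_r = omega + psi_zz =: G is integrated in r for almost
   every z, and two applications of Hardy's inequality bound psi - psi(0), psi_r and
   psi_rr by G. *)

Require Import Defs.
From HB Require Import structures.
From mathcomp Require Import all_boot all_order all_algebra.
From mathcomp Require Import all_classical all_reals all_analysis.
From mathcomp Require Import measurable_realfun.
From mathcomp Require Import ring lra.

Set Implicit Arguments.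
Unset Strict Implicit.
Unset Printing Implicit Defensive.

Import Order.TTheory GRing.Theory Num.Theory numFieldNormedType.Exports.

Local Open Scope classical_set_scope.
Local Open Scope ring_scope.

(** * Square integrable functions *)

(** Test functions vanish near the axis and near the bases, and psi is only in H^1, so neither r^(2
    mu - 2) psi nor a sine may be inserted directly in the equation. Du Bois-Reymond's lemma meets
    both obstacles: products of one-variable test functions show that the integrals of psi_z against
    r^3 xi(r), as functions of z, and r^3 times the radial derivative of a coefficient are almost
    everywhere primitives; from then on integration by parts is legitimate. The zero trace enters
    only through two integrations by parts carried to the limit along the smooth approximations: on
    the bases it turns the cosine coefficients of psi_z into multiples of the sine coefficients of
    psi, on the lateral side it forces v(rho) = 0. The energy identity is first written on ]d, rho[;
    of its boundary terms at d, one is nonnegative and the other at most of order d^(1 + mu), so an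
    inequality survives as d tends to 0. In the final constant, omega + psi_zz costs 4 times the
    squared norm of omega, and psi_zr, psi_zz, psi_z contribute 1/2, 1 and 1. *)

Section L2_tools.
Context {d : measure_display} {T : measurableType d} {R : realType}.
Variable mu : {measure set T -> \bar R}.
Variable D : set T.
Hypothesis mD : measurable D.
Implicit Types f g : T -> R.

Lemma integrable_dom f g : measurable_fun D f ->
  (forall x, D x -> `|f x| <= g x) -> mu.-integrable D (EFin \o g) ->
  mu.-integrable D (EFin \o f).
Proof.
move=> mf fg; apply: le_integrable => //; first exact/measurable_EFinP.
by move=> x Dx /=; rewrite lee_fin (le_trans (fg _ Dx))// ler_norm.
Qed.

Lemma integrable_mulbnd f g (M : R) : mu.-integrable D (EFin \o f) ->
  measurable_fun D g -> (forall x, D x -> `|g x| <= M) ->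
  mu.-integrable D (EFin \o (fun x => f x * g x)).
Proof.
move=> fi mg gM.
have mf : measurable_fun D f by apply/measurable_EFinP; exact: measurable_int fi.
apply: (@integrable_dom _ (fun x => M * `|f x|)).
- exact: measurable_funM.
- by move=> x Dx; rewrite normrM mulrC ler_wpM2r// gM.
- exact: (integrableZl mD M (integrable_norm fi)).
Qed.

Lemma integrableZE (k : R) f : mu.-integrable D (EFin \o f) ->
  mu.-integrable D (EFin \o (fun x => k * f x)).
Proof. by move=> fi; exact: (integrableZl mD k fi). Qed.

Lemma integrableDE f g : mu.-integrable D (EFin \o f) ->
  mu.-integrable D (EFin \o g) -> mu.-integrable D (EFin \o (fun x => f x + g x)).
Proof. by move=> fi gi; exact: (integrableD mD fi gi). Qed.

Lemma integrableBE f g : mu.-integrable D (EFin \o f) ->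
  mu.-integrable D (EFin \o g) -> mu.-integrable D (EFin \o (fun x => f x - g x)).
Proof. by move=> fi gi; exact: (integrableB mD fi gi). Qed.

Lemma integrable_sumE N (F : nat -> T -> R) :
  (forall n, (n < N)%N -> mu.-integrable D (EFin \o F n)) ->
  mu.-integrable D (EFin \o (fun x => \sum_(n < N) F n x)).
Proof.
move=> FN; have := @integrable_sum _ _ _ mu D mD _ (index_enum 'I_N) predT
  (fun n x => (F n x)%:E) (fun i _ => FN i (ltn_ord i)).
by apply: eq_integrable => // x _; rewrite sumEFin.
Qed.

Lemma Rintegral_sum N (F : nat -> T -> R) :
  (forall n, (n < N)%N -> mu.-integrable D (EFin \o F n)) ->
  \int[mu]_(x in D) (\sum_(n < N) F n x) = \sum_(n < N) \int[mu]_(x in D) F n x.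
Proof.
elim: N => [|N IH] FN.
  rewrite big_ord0; under eq_Rintegral do rewrite big_ord0.
  by rewrite /Rintegral integral0.
rewrite big_ord_recr/= -IH; last by move=> n nN; apply: FN; exact: ltnW.
rewrite -RintegralD//; last exact: FN.
  by apply: eq_Rintegral => x _; rewrite big_ord_recr.
by apply: integrable_sumE => n nN; apply: FN; exact: ltnW.
Qed.

Lemma Rintegral0 : \int[mu]_(x in D) 0 = 0.
Proof. by rewrite /Rintegral integral0. Qed.

Lemma ae_eq_Rintegral f g : measurable_fun D f -> measurable_fun D g ->
  {ae mu, forall x, D x -> f x = g x} ->
  \int[mu]_(x in D) f x = \int[mu]_(x in D) g x.
Proof.
move=> mf mg fg; congr fine; apply: ae_eq_integral => //; [exact/measurable_EFinP..|].
by apply: filterS fg => x + Dx => /(_ Dx) ->.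
Qed.

Lemma integral_Rintegral f : mu.-integrable D (EFin \o f) ->
  (\int[mu]_(x in D) (f x)%:E = (\int[mu]_(x in D) f x)%:E)%E.
Proof. by move=> fi; rewrite fineK//; exact: integrable_fin_num. Qed.

Lemma ae_eq_integrable f g : measurable_fun D g ->
  {ae mu, forall x, D x -> f x = g x} ->
  mu.-integrable D (EFin \o f) -> mu.-integrable D (EFin \o g).
Proof.
move=> mg fg /integrableP[mf fi]; apply/integrableP.
split; first exact/measurable_EFinP.
rewrite -(@ge0_ae_eq_integral _ _ _ mu D (fun x => `|(EFin \o f) x|%E))//.
- exact: measurableT_comp.
- by apply: measurableT_comp => //; exact/measurable_EFinP.
- by apply: filterS fg => x + Dx => /(_ Dx) /= ->.
Qed.

Lemma ge0_integrable f : measurable_fun D f -> (forall x, D x -> 0 <= f x) ->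
  (\int[mu]_(x in D) (f x)%:E < +oo)%E -> mu.-integrable D (EFin \o f).
Proof.
move=> mf f0 fi; apply/integrableP; split; first exact/measurable_EFinP.
rewrite (eq_integral (fun x => (f x)%:E))//.
by move=> x; rewrite inE => Dx /=; rewrite ger0_norm// f0.
Qed.

Definition L2 f := measurable_fun D f /\
  mu.-integrable D (EFin \o (fun x => f x ^+ 2)).

Lemma L2P f : measurable_fun D f ->
  (\int[mu]_(x in D) (f x ^+ 2)%:E < +oo)%E -> L2 f.
Proof.
move=> mf fi; split => //; apply: ge0_integrable => //.
- exact: measurable_funX.
- by move=> x _; rewrite sqr_ge0.
Qed.

Lemma L2_dom f g : measurable_fun D f ->
  (forall x, D x -> `|f x| <= `|g x|) -> L2 g -> L2 f.
Proof.
move=> mf fg [mg gi]; split => //.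
apply: integrable_dom gi; first exact: measurable_funX.
move=> x Dx; rewrite ger0_norm ?sqr_ge0//.
by rewrite -(real_normK (num_real (f x))) -(real_normK (num_real (g x))) lerXn2r ?nnegrE// fg.
Qed.

Lemma L2_mul f g : L2 f -> L2 g -> mu.-integrable D (EFin \o (fun x => f x * g x)).
Proof.
move=> [mf fi] [mg gi].
apply: (@integrable_dom _ (fun x => f x ^+ 2 + g x ^+ 2)).
- exact: measurable_funM.
- move=> x _; rewrite normrM.
  rewrite -(real_normK (num_real (f x))) -(real_normK (num_real (g x))).
  have := sqr_ge0 (`|f x| - `|g x|); have := normr_ge0 (f x); have := normr_ge0 (g x); nra.
- exact: integrableDE.
Qed.

Lemma L2D f g : L2 f -> L2 g -> L2 (fun x => f x + g x).
Proof.
move=> Lf Lg; have fg := L2_mul Lf Lg; case: Lf Lg => mf fi [mg gi].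
split; first exact: measurable_funD.
have -> : (fun x => (f x + g x) ^+ 2) =
    (fun x => (f x ^+ 2 + 2 * (f x * g x)) + g x ^+ 2) by apply/funext => x; ring.
by do 2 (apply: integrableDE => //); exact: integrableZE.
Qed.

Lemma L2Z (k : R) f : L2 f -> L2 (fun x => k * f x).
Proof.
move=> [mf fi]; split; first exact: measurable_funM.
have -> : (fun x => (k * f x) ^+ 2) = (fun x => k ^+ 2 * f x ^+ 2).
  by apply/funext => x; rewrite exprMn.
exact: integrableZE.
Qed.

Lemma L2_sum N (F : nat -> T -> R) : (forall n, (n < N)%N -> L2 (F n)) ->
  L2 (fun x => \sum_(n < N) F n x).
Proof.
elim: N => [|N IH] FN.
  have -> : (fun x => \sum_(n < 0) F n x) = cst 0.
    by apply/funext => x; rewrite big_ord0.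
  split => //=; have -> : (EFin \o (fun=> 0 ^+ 2 : R)) = cst (0%E : \bar R).
    by move=> t; apply/funext => x /=; rewrite expr0n.
  exact: integrable0.
have -> : (fun x => \sum_(n < N.+1) F n x) = (fun x => (\sum_(n < N) F n x) + F N x).
  by apply/funext => x; rewrite big_ord_recr.
by apply: L2D; [apply: IH => n nN; apply: FN; exact: ltnW|exact: FN].
Qed.

(** The form s^2 A + 2 s t C + t^2 B is the integral of (s f + t g)^2, hence nonnegative for all s
    and t; it is evaluated at one well-chosen point. *)
Lemma Rint_CS f g : L2 f -> L2 g ->
  (\int[mu]_(x in D) (f x * g x)) ^+ 2 <=
  (\int[mu]_(x in D) (f x ^+ 2)) * (\int[mu]_(x in D) (g x ^+ 2)).
Proof.
move=> Lf Lg; have fg := L2_mul Lf Lg; have [mf fi] := Lf; have [mg gi] := Lg.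
set A := \int[mu]_(x in D) (f x ^+ 2); set B := \int[mu]_(x in D) (g x ^+ 2).
set C := \int[mu]_(x in D) (f x * g x).
have A0 : 0 <= A by apply: Rintegral_ge0 => x _; rewrite sqr_ge0.
have B0 : 0 <= B by apply: Rintegral_ge0 => x _; rewrite sqr_ge0.
have key s t : 0 <= s ^+ 2 * A + (2 * s * t) * C + t ^+ 2 * B.
  rewrite /A /B /C -!RintegralZl// -!RintegralD//;
    try by do ?[exact: integrableZE | apply: integrableDE].
  apply: Rintegral_ge0 => x _.
  have -> : s ^+ 2 * f x ^+ 2 + 2 * s * t * (f x * g x) + t ^+ 2 * g x ^+ 2 =
    (s * f x + t * g x) ^+ 2 by ring.
  by rewrite sqr_ge0.
have [B00|B00] := eqVneq B 0.
  have [C0|C0] := eqVneq C 0; first by rewrite C0 B00 expr0n mulr0.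
  (* With B = 0 the form is affine in t, and this t gives it the value -1. *)
  have := key 1 (- (A + 1) / (2 * C)); rewrite B00 mulr0 addr0.
  have -> : 2 * 1 * (- (A + 1) / (2 * C)) * C = - (A + 1) by field.
  by lra.
have Bgt0 : 0 < B by rewrite lt_neqAle eq_sym B00.
(* The minimiser in t of the form at s = 1. *)
have := key 1 (- C / B).
have -> : 1 ^+ 2 * A + 2 * 1 * (- C / B) * C + (- C / B) ^+ 2 * B =
  (A * B - C ^+ 2) / B by field.
by rewrite pmulr_lge0 ?invr_gt0// subr_ge0.
Qed.

Lemma L2_cst_fin f : (mu D < +oo)%E -> L2 f -> mu.-integrable D (EFin \o f).
Proof.
move=> muD Lf; have := @L2_mul f (cst 1) Lf.
have -> : (fun x => f x * cst 1 x) = f by apply/funext => x; rewrite mulr1.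
apply; split => //; apply: measurable_bounded_integrable => //.
  exact: measurable_funX.
exists (1 ^+ 2); split; first exact: num_real.
by move=> y y1 x Dx /=; rewrite normrX normr1; exact: ltW.
Qed.

End L2_tools.
Arguments L2 {d T R} mu D f.

(** * Fubini on rectangles *)

Lemma ge0_integral_eq0_ae d (T : measurableType d) (R : realType)
    (mu : {measure set T -> \bar R}) (D : set T) (f : T -> \bar R) :
  measurable D -> measurable_fun D f -> (forall x, D x -> (0 <= f x)%E) ->
  (\int[mu]_(x in D) f x = 0)%E -> ae_eq mu D f (cst 0%E).
Proof.
move=> mD mf f0 h; apply: (@ae_eq_integral_abs _ _ _ mu D mD f mf).1.
by rewrite -[RHS]h; apply: eq_integral => x /set_mem Dx; rewrite gee0_abs// f0.
Qed.

Section ae_tools.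
Context {R : realType}.
Notation mu := (@lebesgue_measure R).

Lemma ae_imp (P Q : R -> Prop) : (forall x, P x -> Q x) ->
  {ae mu, forall x, P x} -> {ae mu, forall x, Q x}.
Proof.
by move=> PQ; apply: filterS => //; exact: (ae_filter_ringOfSetsType mu).
Qed.

Lemma ae_imp2 (P Q S : R -> Prop) : (forall x, P x -> Q x -> S x) ->
  {ae mu, forall x, P x} -> {ae mu, forall x, Q x} -> {ae mu, forall x, S x}.
Proof.
by move=> PQ; apply: filterS2 => //; exact: (ae_filter_ringOfSetsType mu).
Qed.

Lemma ae_all (P : R -> Prop) : (forall x, P x) -> {ae mu, forall x, P x}.
Proof.
move=> h; apply: filterS (filterT : {ae mu, forall x, True}) => //;
  exact: (ae_filter_ringOfSetsType mu).
Qed.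

Lemma ae_imp_leb2 (P Q : R * R -> Prop) : (forall x, P x -> Q x) ->
  {ae leb2, forall x, P x} -> {ae leb2, forall x, Q x}.
Proof.
by move=> PQ; apply: filterS => //; exact: (ae_filter_ringOfSetsType leb2).
Qed.

End ae_tools.

Section rectangle.
Context {R : realType}.
Notation mu := (@lebesgue_measure R).
Variables A B : set R.
Hypotheses (mA : measurable A) (mB : measurable B).

Lemma measurable_rect : measurable (A `*` B).
Proof. exact: measurableX. Qed.
Let mAB := measurable_rect.

Lemma integral_rect_restrictF (f : R * R -> \bar R) x :
  (\int[mu]_y (f \_ (A `*` B)) (x, y) =
   ((fun x => \int[mu]_(y in B) f (x, y)) \_ A) x)%E.
Proof.
rewrite patchE; case: ifPn => xA.
  rewrite [RHS]integral_mkcond; apply: eq_integral => y _.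
  by rewrite !patchE in_setX xA.
rewrite (eq_integral (cst 0%E)) ?integral0// => y _.
by rewrite patchE in_setX (negbTE xA).
Qed.

Lemma integral_rect_restrictG (f : R * R -> \bar R) y :
  (\int[mu]_x (f \_ (A `*` B)) (x, y) =
   ((fun y => \int[mu]_(x in A) f (x, y)) \_ B) y)%E.
Proof.
rewrite patchE; case: ifPn => yB.
  rewrite [RHS]integral_mkcond; apply: eq_integral => x _.
  by rewrite !patchE in_setX yB andbT.
rewrite (eq_integral (cst 0%E)) ?integral0// => x _.
by rewrite patchE in_setX (negbTE yB) andbF.
Qed.

Lemma measurable_sectionF d (T : measurableType d) (f : R * R -> T) x :
  measurable_fun (A `*` B) f -> A x -> measurable_fun B (fun y => f (x, y)).
Proof.
move=> mf Ax; have h : measurable_fun B (fun y : R => (x, y)).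
  apply: (measurable_funS measurableT) => //.
  exact: measurable_fun_pair.
apply: (measurable_comp mAB _ mf h).
by move=> _ [y By <-].
Qed.

Lemma measurable_sectionG d (T : measurableType d) (f : R * R -> T) y :
  measurable_fun (A `*` B) f -> B y -> measurable_fun A (fun x => f (x, y)).
Proof.
move=> mf Ay; have h : measurable_fun A (fun x : R => (x, y)).
  apply: (measurable_funS measurableT) => //; exact: pair2_measurable.
apply: (measurable_comp mAB _ mf h).
by move=> _ [x Bx <-].
Qed.

Section tonelli.
Variable f : R * R -> \bar R.
Hypothesis mf : measurable_fun (A `*` B) f.
Hypothesis f0 : forall p, (A `*` B) p -> (0 <= f p)%E.

Let mf' : measurable_fun setT (f \_ (A `*` B)).
Proof. by apply/(measurable_restrictT _ mAB). Qed.
Let f0' p : (0 <= (f \_ (A `*` B)) p)%E.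
Proof. by rewrite patchE; case: ifPn => // /set_mem; exact: f0. Qed.

Lemma tonelli_rect1 :
  (\int[leb2]_(p in A `*` B) f p = \int[mu]_(x in A) \int[mu]_(y in B) f (x, y))%E.
Proof.
rewrite integral_mkcond [RHS]integral_mkcond.
etransitivity; first exact: (fubini_tonelli1 (m1 := mu) (m2 := mu) _ mf' f0').
by apply: eq_integral => x _; rewrite -integral_rect_restrictF.
Qed.

Lemma measurable_tonelli_rect1 :
  measurable_fun A (fun x => \int[mu]_(y in B) f (x, y))%E.
Proof.
apply/(measurable_restrictT _ mA).
have := @measurable_fun_fubini_tonelli_F _ _ _ _ _ mu _ mf' f0'.
by apply: eq_measurable_fun => x _; rewrite -integral_rect_restrictF.
Qed.

Lemma measurable_tonelli_rect2 :
  measurable_fun B (fun y => \int[mu]_(x in A) f (x, y))%E.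
Proof.
apply/(measurable_restrictT _ mB).
have := @measurable_fun_fubini_tonelli_G _ _ _ _ _ mu _ mf' f0'.
by apply: eq_measurable_fun => x _; rewrite -integral_rect_restrictG.
Qed.

End tonelli.

Section fubini.
Variable f : R * R -> R.
Hypothesis fi : leb2.-integrable (A `*` B) (EFin \o f).

Let fi' : leb2.-integrable setT ((EFin \o f) \_ (A `*` B)).
Proof.
have h := (@integrable_mkcond _ _ R leb2 (A `*` B) (EFin \o f) mAB).1.
exact: h.
Qed.

Lemma fubini_ae1 :
  {ae mu, forall x, A x -> mu.-integrable B (fun y => (f (x, y))%:E)}.
Proof.
have := ae_integrable1 fi'; apply: filterS => x + Ax.
move=> h; apply/integrable_mkcond => //; apply: eq_integrable h => // y _.
by rewrite !patchE in_setX mem_set.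
Qed.

Lemma fubini_ae2 :
  {ae mu, forall y, B y -> mu.-integrable A (fun x => (f (x, y))%:E)}.
Proof.
have := ae_integrable2 fi'; apply: filterS => y + By.
move=> h; apply/integrable_mkcond => //; apply: eq_integrable h => // x _.
by rewrite !patchE in_setX (mem_set By) andbT.
Qed.

(** The real inner integral is [fine] of the extended one, which replaces infinite values by 0;
    since [fine] does not increase absolute values, integrability descends from the extended
    marginal. *)
Lemma fubini_integrable1 :
  mu.-integrable A (EFin \o (fun x => \int[mu]_(y in B) f (x, y))).
Proof.
have h : mu.-integrable A (fun x => \int[mu]_(y in B) (f (x, y))%:E)%E.
  apply/integrable_mkcond => //.
  have := integrable_fubini_F fi'; apply: eq_integrable => // x _.
  by rewrite /fubini_F integral_rect_restrictF.
have mh := measurable_int _ h; apply/integrableP; split.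
  by apply/measurable_EFinP; apply: measurableT_comp => //; exact: fine_measurable.
move/integrableP : h => [_]; apply: le_lt_trans.
apply: ge0_le_integral => //.
- apply: measurableT_comp => //; apply/measurable_EFinP.
  by apply: measurableT_comp => //; exact: fine_measurable.
- exact: measurableT_comp.
- move=> x Ax /=; rewrite /Rintegral.
  by case: (\int[mu]_(y in B) _)%E => [r||] //=; rewrite ?normr0 leey.
Qed.

Lemma fubini_integrable2 :
  mu.-integrable B (EFin \o (fun y => \int[mu]_(x in A) f (x, y))).
Proof.
have h : mu.-integrable B (fun y => \int[mu]_(x in A) (f (x, y))%:E)%E.
  apply/integrable_mkcond => //.
  have -> : (fun y => \int[mu]_(x in A) (f (x, y))%:E)%E \_ B =
      fubini_G mu ((EFin \o f) \_ (A `*` B)).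
    by apply/funext => y; rewrite /fubini_G integral_rect_restrictG.
  have mf' : measurable_fun setT ((EFin \o f) \_ (A `*` B)).
    exact: measurable_int fi'.
  apply/integrableP; split; first exact: (measurable_fubini_G fi').
  have lt := (integrable21ltyP mu mu mf').1 fi'.
  apply: le_lt_trans lt.
  apply: ge0_le_integral => //.
  - by apply: measurableT_comp => //; exact: (measurable_fubini_G fi').
  - have ma : measurable_fun setT (abse \o ((EFin \o f) \_ (A `*` B))).
      exact: measurableT_comp.
    exact: (measurable_fun_fubini_tonelli_G (m1 := mu) _ ma (fun=> abse_ge0 _)).
  - move=> y _; apply: le_abse_integral => //.
    exact: measurableT_comp.
have mh := measurable_int _ h; apply/integrableP; split.
  by apply/measurable_EFinP; apply: measurableT_comp => //; exact: fine_measurable.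
move/integrableP : h => [_]; apply: le_lt_trans.
apply: ge0_le_integral => //.
- apply: measurableT_comp => //; apply/measurable_EFinP.
  by apply: measurableT_comp => //; exact: fine_measurable.
- exact: measurableT_comp.
- move=> x Ax /=; rewrite /Rintegral.
  by case: (\int[mu]_(y in A) _)%E => [r||] //=; rewrite ?normr0 leey.
Qed.

Lemma fubini_rect1 :
  \int[leb2]_(p in A `*` B) f p = \int[mu]_(x in A) \int[mu]_(y in B) f (x, y).
Proof.
have h := fubini_integrable1; congr fine.
rewrite integral_mkcond -integral12_prod_meas1; last exact: fi'.
rewrite [RHS]integral_mkcond; apply: ae_eq_integral => //.
- exact: (measurable_fubini_F fi').
- apply/(measurable_restrictT _ mA); exact: measurable_int h.
apply: ae_imp fubini_ae1 => x hx _ /=.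
rewrite /fubini_F integral_rect_restrictF !patchE; case: ifPn => // /set_mem Ax.
by rewrite integral_Rintegral//; exact: hx.
Qed.

Lemma fubini_rect2 :
  \int[leb2]_(p in A `*` B) f p = \int[mu]_(y in B) \int[mu]_(x in A) f (x, y).
Proof.
have h := fubini_integrable2; congr fine.
rewrite integral_mkcond -integral21_prod_meas1; last exact: fi'.
rewrite [RHS]integral_mkcond; apply: ae_eq_integral => //.
- exact: (measurable_fubini_G fi').
- apply/(measurable_restrictT _ mB); exact: measurable_int h.
apply: ae_imp fubini_ae2 => x hx _ /=.
rewrite /fubini_G integral_rect_restrictG !patchE; case: ifPn => // /set_mem Ax.
by rewrite integral_Rintegral//; exact: hx.
Qed.

End fubini.

Lemma fubini_swap (f : R * R -> R) :
  leb2.-integrable (A `*` B) (EFin \o f) ->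
  \int[mu]_(x in A) \int[mu]_(y in B) f (x, y) =
  \int[mu]_(y in B) \int[mu]_(x in A) f (x, y).
Proof. by move=> fi; rewrite -fubini_rect1// fubini_rect2. Qed.

(** Tonelli applied to the indicator of the exceptional set: its double integral is 0, so its
    section at almost every height y is a null set. *)
Lemma ae_rect2 (P : R * R -> Prop) : {ae leb2, forall p, (A `*` B) p -> P p} ->
  {ae mu, forall y, B y -> {ae mu, forall x, A x -> P (x, y)}}.
Proof.
move=> [N [mN N0 PN]].
have mI : measurable_fun setT (EFin \o (\1_N : R * R -> R)).
  by apply/measurable_EFinP; exact: measurable_indic.
have I0 p : (0 <= (EFin \o (\1_N : R * R -> R)) p)%E by rewrite lee_fin.
have : (\int[mu]_y \int[mu]_x (\1_N (x, y))%:E = 0)%E.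
  have := fubini_tonelli2 (m1 := mu) (m2 := mu) _ mI I0.
  by rewrite /fubini_G => <-; rewrite integral_indic// setIT.
have mF := measurable_fun_fubini_tonelli_G (m1 := mu) _ mI I0.
move=> h; have : ae_eq mu setT (fun y => \int[mu]_x (\1_N (x, y))%:E)%E (cst 0%E).
  apply: ge0_integral_eq0_ae => // *; apply: integral_ge0 => *; exact: I0.
apply: ae_imp => y /(_ Logic.I) hx By.
exists (ysection N y); split.
- exact: measurable_ysection.
- transitivity (\int[mu]_x (\1_(ysection N y) x)%:E)%E.
    by rewrite integral_indic ?setIT//; exact: measurable_ysection.
  rewrite -[RHS]hx; apply: eq_integral => x _.
  by rewrite !indicE mem_ysection.
- move=> x /= hy; rewrite /ysection/= inE; apply: PN => /= hP; apply: hy => Ax.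
  exact: hP.
Qed.

(** The way back from sections to the plane: Tonelli applied to |f - g|, which is why f and g have
    to be jointly measurable. *)
Lemma rect_ae_eq (f g : R * R -> R) :
  measurable_fun (A `*` B) f -> measurable_fun (A `*` B) g ->
  {ae mu, forall x, A x -> {ae mu, forall y, B y -> f (x, y) = g (x, y)}} ->
  {ae leb2, forall p, (A `*` B) p -> f p = g p}.
Proof.
move=> mf mg fg.
pose h p := (`|f p - g p|)%:E.
have mh : measurable_fun (A `*` B) h.
  by apply/measurable_EFinP; apply: measurableT_comp => //; exact: measurable_funB.
have : ae_eq leb2 (A `*` B) (EFin \o (f \- g)) (cst 0%E).
  apply/ae_eq_integral_abs => //.
    by apply/measurable_EFinP; exact: measurable_funB.
  rewrite (tonelli_rect1 mh) => [|p _]; last by rewrite lee_fin.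
  rewrite (@ae_eq_integral _ _ _ mu A (cst 0%E)) ?integral0//.
    by apply: measurable_tonelli_rect1 => // p _; rewrite lee_fin.
  apply: ae_imp fg => x + Ax => /(_ Ax) hx /=.
  rewrite (@ae_eq_integral _ _ _ mu B (cst 0%E)) ?integral0//.
    exact: (measurable_sectionF mh).
  by apply: ae_imp hx => y + By => /(_ By); rewrite /h => ->; rewrite subrr normr0.
apply: ae_imp_leb2 => p + Ap => /(_ Ap) /= [] /eqP.
by rewrite subr_eq0 => /eqP.
Qed.

End rectangle.

Lemma OmegaE {R : realType} (rho a : R) : Omega rho a = `]0, rho[ `*` `](- a), a[.
Proof. by apply/seteqP; split => -[x y] /=; rewrite /Omega/= !in_itv/=. Qed.

Lemma integrable_prod {R : realType} (A B : set R) (f g : R -> R) :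
  measurable A -> measurable B ->
  (@lebesgue_measure R).-integrable A (EFin \o f) ->
  (@lebesgue_measure R).-integrable B (EFin \o g) ->
  leb2.-integrable (A `*` B) (EFin \o (fun p => f p.1 * g p.2)).
Proof.
move=> mA mB fi gi; have mAB := measurable_rect mA mB.
have mf : measurable_fun A f by apply/measurable_EFinP; exact: measurable_int fi.
have mg : measurable_fun B g by apply/measurable_EFinP; exact: measurable_int gi.
have m1 : measurable_fun (A `*` B) (fun p => f p.1).
  apply: (measurable_comp mA _ mf); first by move=> _ [p [? _] <-].
  by apply: (measurable_funS measurableT) => //; exact: measurable_fst.
have m2 : measurable_fun (A `*` B) (fun p => g p.2).
  apply: (measurable_comp mB _ mg); first by move=> _ [p [_ ?] <-].
  by apply: (measurable_funS measurableT) => //; exact: measurable_snd.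
have mfg : measurable_fun (A `*` B) (fun p => f p.1 * g p.2) by exact: measurable_funM.
apply/integrableP; split; first exact/measurable_EFinP.
rewrite (tonelli_rect1 mA mB); first last.
- by move=> p _; exact: abse_ge0.
- by apply: measurableT_comp => //; exact/measurable_EFinP.
have -> : (\int[lebesgue_measure]_(x in A) \int[lebesgue_measure]_(y in B)
      `|(EFin \o (fun p : R * R => (f p.1 * g p.2)%R)) (x, y)| =
    \int[lebesgue_measure]_(x in A)
      (`|f x|%:E * \int[lebesgue_measure]_(y in B) `|g y|%:E))%E.
  apply: eq_integral => x _; rewrite -ge0_integralZl_EFin//; first last.
    by apply/measurable_EFinP; exact: measurableT_comp.
  by apply: eq_integral => y _ /=; rewrite -EFinM normrM.
rewrite ge0_integralZr//; first last.
- by apply: integral_ge0 => y _; rewrite lee_fin.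
- by apply/measurable_EFinP; exact: measurableT_comp.
move/integrableP : fi => [_ fi]; move/integrableP : gi => [_ gi].
apply: lte_mul_pinfty => //; first by apply: integral_ge0 => x _; rewrite lee_fin.
by rewrite ge0_fin_numE//; apply: integral_ge0 => x _; rewrite lee_fin.
Qed.

(** * Calculus on intervals *)

Section intervals.
Context {R : realType}.
Notation mu := (@lebesgue_measure R).
Implicit Types (F f g k : R -> R) (x y z : R).

Lemma subset_oo x y x' y' : x <= x' -> y' <= y -> `]x', y'[ `<=` (`]x, y[ : set R).
Proof.
move=> xx yy t /=; rewrite !in_itv/= => /andP[xt ty].
by rewrite (le_lt_trans xx xt) (lt_le_trans ty yy).
Qed.

Lemma integrable_sub_oo x y x' y' f : x <= x' -> y' <= y ->
  mu.-integrable `]x, y[ (EFin \o f) -> mu.-integrable `]x', y'[ (EFin \o f).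
Proof. by move=> xx yy; apply: integrableS => //; exact: subset_oo. Qed.

Lemma measurable_int_fun (D : set R) f :
  mu.-integrable D (EFin \o f) -> measurable_fun D f.
Proof. by move=> fi; apply/measurable_EFinP; exact: measurable_int fi. Qed.

(** Endpoints carry no mass; the open interval serves as the normal form of integrals over an
    interval. *)
Lemma Rint_oo b0 b1 x y f : measurable_fun `]x, y[ f ->
  \int[mu]_(t in [set` Interval (BSide b0 x) (BSide b1 y)]) f t =
  \int[mu]_(t in `]x, y[) f t.
Proof.
by move=> mf; congr fine; apply: integral_itv_bndoo; exact/measurable_EFinP.
Qed.

Lemma integrable_itv_oo b0 b1 x y f : mu.-integrable `]x, y[ (EFin \o f) ->
  mu.-integrable [set` Interval (BSide b0 x) (BSide b1 y)] (EFin \o f).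
Proof.
move=> fi; have mf := measurable_int_fun fi.
have mcc : measurable_fun `[x, y] f by exact: measurable_fun_itv_cc mf.
have mb : measurable_fun [set` Interval (BSide b0 x) (BSide b1 y)] f.
  apply: measurable_funS mcc => // t /=.
  by case: (b0); case: (b1); rewrite !in_itv/= => /andP[? ?]; apply/andP; split;
    try exact: ltW.
apply/integrableP; split; first exact/measurable_EFinP.
move/integrableP : fi => [_]; rewrite [X in _ -> (X < _)%E]integral_itv_bndoo//.
by apply: (@measurableT_comp _ _ _ _ _ _ (@abse R)) => //; exact/measurable_EFinP.
Qed.

Lemma Rint_oo_split x y z f : x <= y -> y <= z ->
  mu.-integrable `]x, z[ (EFin \o f) ->
  \int[mu]_(t in `]x, z[) f t =
  \int[mu]_(t in `]x, y[) f t + \int[mu]_(t in `]y, z[) f t.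
Proof.
move=> xy yz fi.
have fi' : mu.-integrable `[x, z[ (EFin \o f) by exact: integrable_itv_oo.
have m1 : measurable_fun `]x, y[ f.
  exact: measurable_int_fun (integrable_sub_oo (lexx x) yz fi).
have m2 : measurable_fun `]y, z[ f.
  exact: measurable_int_fun (integrable_sub_oo xy (lexx z) fi).
rewrite -(@Rint_oo true true x z) ?measurable_int_fun//.
rewrite -(@Rint_oo true true x y)// -(@Rint_oo true true y z)//.
have E : `[x, z[%classic = (`[x, y[ `|` `[y, z[)%classic.
  by rewrite (@itv_bndbnd_setU _ _ _ (BLeft y)) ?bnd_simp.
rewrite E Rintegral_setU//; first by rewrite -E.
  apply/disj_set2P; rewrite -subset0 => t/=; rewrite !in_itv/= => -[/andP[_ ty] /andP[yt _]].
  by move: (lt_le_trans ty yt); rewrite ltxx.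
exact: measurable_int_fun fi.
Qed.

Lemma Rint_oo0 x f : \int[mu]_(t in `]x, x[) f t = 0.
Proof. by rewrite set_itvoo0 Rintegral_set0. Qed.

Lemma measurable_continuous_oo x y f : {within `[x, y], continuous f} ->
  measurable_fun `]x, y[ f.
Proof.
move=> cf; apply: (@measurable_funS _ _ _ _ `[x, y]) => //.
  exact: subset_itv_oo_cc.
exact: subspace_continuous_measurable_fun.
Qed.

Lemma integrable_continuous_oo x y f : {within `[x, y], continuous f} ->
  mu.-integrable `]x, y[ (EFin \o f).
Proof.
move=> cf; apply: (@integrableS _ _ _ mu `[x, y]) => //.
  exact: subset_itv_oo_cc.
by apply: continuous_compact_integrable => //; exact: segment_compact.
Qed.

(** Differentiability is asked only inside and x = y is allowed, so later uses need no case
    distinction on degenerate intervals. *)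
Lemma FTC_oo x y F f : x <= y -> {within `[x, y], continuous F} ->
  (forall t, x < t < y -> is_derive t 1 F (f t)) ->
  {within `[x, y], continuous f} ->
  \int[mu]_(t in `]x, y[) f t = F y - F x.
Proof.
rewrite le_eqVlt => /predU1P[<- _ _ _|xy cF dF cf]; first by rewrite Rint_oo0 subrr.
have [_ Fx Fy] := (continuous_within_itvP _ xy).1 cF.
rewrite -(@Rint_oo true false); last exact: measurable_continuous_oo.
rewrite /Rintegral (continuous_FTC2 (F := F) xy cf)//.
  by split => // t; rewrite in_itv/= => /dF dFt; exact: ex_derive.
by move=> t; rewrite in_itv/= => /dF dFt; rewrite derive1E derive_val.
Qed.

Lemma Rint_cst_oo x y (c : R) : x <= y -> \int[mu]_(t in `]x, y[) c = c * (y - x).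
Proof.
move=> xy.
have dF (t : R) : is_derive t 1 (fun t : R => c * t) c.
  by have := @is_deriveZ _ _ _ id c t 1 _ (is_derive_id _ _); rewrite /GRing.scale/= mulr1.
have cF : {within `[x, y], continuous (fun t : R => c * t)}.
  apply: continuous_subspaceT => t; apply: cvgM; [exact: cvg_cst|exact: cvg_id].
have cc : {within `[x, y], continuous (fun=> c : R)}.
  by apply: continuous_subspaceT => t; exact: cvg_cst.
by rewrite (FTC_oo xy cF (fun t _ => dF t) cc) mulrBr.
Qed.

Lemma is_derive_int x y f t : mu.-integrable `]x, y[ (EFin \o f) ->
  x < t < y -> {for t, continuous f} ->
  is_derive t 1 (fun s => \int[mu]_(u in `]x, s[) f u) (f t).
Proof.
move=> fi /andP[xt ty] cf.
have fi' : mu.-integrable `[x, y] (EFin \o f) by exact: integrable_itv_oo.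
have [h1 h2] := @continuous_FTC1_closed R f x t y ty fi' xt cf.
apply: (@near_eq_is_derive _ _ _ (fun s => \int[mu]_(u in `[x, s]) f u)).
  near=> s; rewrite Rint_oo//; apply: (measurable_funS _ _ (measurable_int_fun fi)) => //.
  apply: subset_oo => //; near: s; exact: lt_le_nbhsl.
split; [exact: h1|rewrite -derive1E; exact: h2].
Unshelve. all: by end_near. Qed.

Lemma continuous_int x y f : x <= y -> mu.-integrable `]x, y[ (EFin \o f) ->
  {within `[x, y], continuous (fun s => \int[mu]_(u in `]x, s[) f u)}.
Proof.
move=> xy fi.
have fi' : mu.-integrable `[x, y] (EFin \o f) by exact: integrable_itv_oo.
have := parameterized_integral_continuous xy fi'.
apply: subspace_eq_continuous => s; rewrite inE/= in_itv/= => /andP[xs sy].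
transitivity (\int[mu]_(u in `[x, s]) f u) => //; rewrite Rint_oo//.
by apply: (measurable_funS _ _ (measurable_int_fun fi)) => //; exact: subset_oo.
Qed.

(** Fubini on the triangle x < s < r < y, encoded by the indicator of s < r on the square, where
    g(s) k(r) is integrable because each factor is. *)
Lemma triangle x y g k : mu.-integrable `]x, y[ (EFin \o g) ->
  mu.-integrable `]x, y[ (EFin \o k) ->
  \int[mu]_(s in `]x, y[) (g s * \int[mu]_(r in `]s, y[) k r) =
  \int[mu]_(r in `]x, y[) (k r * \int[mu]_(s in `]x, r[) g s).
Proof.
move=> gi ki.
pose h (p : R * R) := g p.1 * k p.2 * \1_[set p | p.1 < p.2] p.
have memlt s r : ((s, r) \in [set p : R * R | p.1 < p.2]) = (s < r).
  by apply/idP/idP => [/set_mem|?]; last exact/mem_set.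
have mlt : measurable [set p : R * R | p.1 < p.2].
  rewrite -[X in measurable X]setTI.
  have := @measurable_fun_ltr _ _ R setT (fst : R * R -> R) snd measurable_fst measurable_snd.
  by move=> /(_ measurableT [set true]) /=; apply.
transitivity (\int[mu]_(s in `]x, y[) \int[mu]_(r in `]x, y[) h (s, r)).
  apply: eq_Rintegral => s; rewrite inE/= in_itv/= => /andP[xs sy].
  rewrite -RintegralZl//; last exact: integrable_sub_oo (ltW xs) _ ki.
  rewrite [LHS]Rintegral_mkcond [RHS]Rintegral_mkcond; congr Rintegral.
  apply/funext => r; rewrite /h !patchE indicE memlt/= !mem_setE !in_itv/=.
  by case: (ltP s r) => sr; case: (ltP r y) => ry; case: (ltP x r) => xr //=;
    rewrite ?mulr0 ?mulr1//; move: (lt_le_trans (lt_trans xs sr) xr); rewrite ltxx.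
transitivity (\int[mu]_(r in `]x, y[) \int[mu]_(s in `]x, y[) h (s, r)); last first.
  apply: eq_Rintegral => r; rewrite inE/= in_itv/= => /andP[xr ry].
  rewrite -RintegralZl//; last exact: integrable_sub_oo _ (ltW ry) gi.
  rewrite [LHS]Rintegral_mkcond [RHS]Rintegral_mkcond; congr Rintegral.
  apply/funext => s; rewrite /h !patchE indicE memlt/= !mem_setE !in_itv/=.
  by case: (ltP s r) => sr; case: (ltP s y) => sy; case: (ltP x s) => xs //=;
    rewrite ?mulr0 ?mulr1 1?mulrC//; move: (le_lt_trans sy (lt_trans sr ry)); rewrite ltxx.
have hi : leb2.-integrable (`]x, y[ `*` `]x, y[) (EFin \o h).
  apply: (@integrable_mulbnd _ _ R leb2 _ (measurable_rect _ _)
    (fun p => g p.1 * k p.2) (\1_[set p : R * R | p.1 < p.2]) 1) => //.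
  - exact: integrable_prod.
  - by move=> p _; rewrite indicE; case: (_ \in _); rewrite ?normr1 ?normr0.
exact: (fubini_swap _ _ hi).
Qed.

(** Nothing is differentiated: w enters only as a primitive with boundary value W at y, and
    exchanging the integrals on the triangle does the rest. Integration by parts thus becomes
    available for g and k that are merely integrable. *)
Lemma IBP_int x y W g k w : mu.-integrable `]x, y[ (EFin \o g) ->
  mu.-integrable `]x, y[ (EFin \o k) ->
  (forall s, x < s < y -> w s = W - \int[mu]_(r in `]s, y[) k r) ->
  mu.-integrable `]x, y[ (EFin \o (fun s => g s * w s)) ->
  \int[mu]_(s in `]x, y[) (g s * w s) =
  W * \int[mu]_(s in `]x, y[) g s -
  \int[mu]_(r in `]x, y[) (k r * \int[mu]_(s in `]x, r[) g s).
Proof.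
move=> gi ki wE gwi; rewrite -triangle// -RintegralZl// -RintegralB//; last 2 first.
- exact: integrableZE.
- have : mu.-integrable `]x, y[ (EFin \o (fun s => W * g s - g s * w s)).
    by apply: integrableBE => //; exact: integrableZE.
  apply: eq_integrable => // s; rewrite inE/= in_itv/= => xy.
  by rewrite wE//; congr EFin; ring.
apply: eq_Rintegral => s; rewrite inE/= in_itv/= => xy.
by rewrite wE//; ring.
Qed.

(** Extended by 0, f has a primitive that is constant near every point of the interval; by
    Lebesgue's differentiation theorem its derivative is f almost everywhere. *)
Lemma ae0_of_intervals x y f : mu.-integrable `]x, y[ (EFin \o f) ->
  (forall s t, x < s -> s < t -> t < y -> \int[mu]_(u in `]s, t[) f u = 0) ->
  {ae mu, forall t, x < t < y -> f t = 0}.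
Proof.
move=> fi f0; pose g := f \_ `]x, y[.
have gT : mu.-integrable setT (EFin \o g).
  rewrite /g -restrict_EFin.
  by apply: (@integrable_mkcond _ _ R mu `]x, y[ (EFin \o f) _).1.
have gy z : mu.-integrable `]-oo, z] (EFin \o g) by exact: integrableS gT.
have lg : locally_integrable setT g by exact: integrable_locally_restrict.
have := FTC1Ny gy lg; apply: ae_imp => t [dF FE] /andP[xt ty].
have <- : g t = f t by rewrite /g patchE mem_set//= in_itv/= xt ty.
rewrite -FE.
(* A base point strictly between x and t: the integral over ]m, s[ vanishes for all s near t, so the
   primitive is locally constant there. *)
pose m := (x + t) / 2.
have xm : x < m by rewrite /m; lra.
have mt : m < t by rewrite /m; lra.
rewrite derive1E (@near_eq_derive _ _ _ _ (cst (\int[mu]_(u in `]-oo, m]) g u))) ?derive_cst//.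
near=> s.
have ms : m < s by near: s; exact: lt_nbhsr.
have sy : s < y by near: s; exact: lt_nbhsl.
rewrite /= -[LHS](subrK (\int[mu]_(u in `]-oo, m]) g u)) Rintegral_itvB ?bnd_simp//; last exact: ltW.
rewrite Rint_oo; last by apply: measurable_funS (measurable_int_fun gT).
rewrite (@eq_Rintegral _ _ _ mu _ f) ?f0 ?add0r//.
move=> u; rewrite inE/= in_itv/= => /andP[mu' us].
by rewrite /g patchE mem_set//= in_itv/= (lt_trans xm mu') (lt_trans us sy).
Unshelve. all: by end_near. Qed.

End intervals.

(** * Smooth test functions *)

Section smooth1.
Context {R : realType}.
Notation mu := (@lebesgue_measure R).
Implicit Types (f g h : R -> R) (x y : R).

Record Cinf f : Prop := MkCinf { Cinf_der : forall n x, derivable (derive1n n f) x 1 }.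

(** A coinduction principle that avoids any formula for n-th derivatives: in a class stable under
    differentiation all iterated derivatives exist, by induction on the order. *)
Lemma Cinf_coind (S : (R -> R) -> Prop) :
  (forall f, S f -> exists2 f', S f' & forall x : R, is_derive x 1 f (f' x)) ->
  forall f, S f -> Cinf f.
Proof.
move=> HS f Sf; split=> n x.
have Sn : S (derive1n n f).
  elim: n => [//|n IH]; have [f' Sf' df] := HS _ IH.
  rewrite derive1nS; suff -> : derive1 (derive1n n f) = f' by [].
  by apply/funext => y; rewrite derive1E derive_val.
by have [f' _ df] := HS _ Sn; exact: ex_derive.
Qed.

Lemma Cinf_derivable f x : Cinf f -> derivable f x 1.
Proof. by move=> /Cinf_der /(_ 0 x). Qed.

Lemma Cinf_is_derive f x : Cinf f -> is_derive x 1 f ((derive1 f) x).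
Proof. by move=> Cf; split; [exact: Cinf_derivable|rewrite derive1E]. Qed.

Lemma Cinf_continuous f : Cinf f -> continuous f.
Proof.
by move=> Cf x; apply: differentiable_continuous; apply/derivable1_diffP; exact: Cinf_derivable.
Qed.

Lemma Cinf_measurable (D : set R) f : measurable D -> Cinf f -> measurable_fun D f.
Proof.
move=> mD Cf; apply: measurable_funTS.
by apply: continuous_measurable_fun; exact: Cinf_continuous.
Qed.

Lemma Cinf_derive1 f : Cinf f -> Cinf (derive1 f).
Proof. by move=> Cf; split=> n x; rewrite -derive1Sn; exact: Cinf_der. Qed.

Lemma Cinf_cst (c : R) : Cinf (fun=> c).
Proof.
apply: (@Cinf_coind (fun f => exists c, f = fun=> c)); last by exists c.
by move=> _ [d ->]; exists (fun=> 0); [exists 0|move=> x; exact: is_derive_cst].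
Qed.

Lemma Cinf_id : Cinf id.
Proof.
apply: (@Cinf_coind (fun f => f = id \/ exists c, f = fun=> c)); last by left.
move=> f [->|[c ->]].
- by exists (fun=> 1); [right; exists 1|move=> x; exact: is_derive_id].
- by exists (fun=> 0); [right; exists 0|move=> x; exact: is_derive_cst].
Qed.

(** Finite sums of products of smooth functions. The sums are there because Leibniz' rule leaves the
    class of mere products. *)
Inductive Cinf_alg : (R -> R) -> Prop :=
| Cinf_alg_mul f g : Cinf f -> Cinf g -> Cinf_alg (fun x => f x * g x)
| Cinf_alg_add f g : Cinf_alg f -> Cinf_alg g -> Cinf_alg (fun x => f x + g x).

Lemma Cinf_algP f : Cinf_alg f -> Cinf f.
Proof.
apply: Cinf_coind => {}f; elim=> {f} [f g Cf Cg|f g _ [f' Sf' df] _ [g' Sg' dg]].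
- exists (fun x => f x * (derive1 g) x + g x * (derive1 f) x).
    apply: Cinf_alg_add; apply: Cinf_alg_mul => //; exact: Cinf_derive1.
  move=> x; have df := Cinf_is_derive x Cf; have dg := Cinf_is_derive x Cg.
  exact: is_deriveM.
- exists (fun x => f' x + g' x); first exact: Cinf_alg_add.
  by move=> x; exact: is_deriveD.
Qed.

Lemma CinfM f g : Cinf f -> Cinf g -> Cinf (fun x => f x * g x).
Proof. by move=> Cf Cg; apply: Cinf_algP; exact: Cinf_alg_mul. Qed.

Lemma CinfZ (c : R) f : Cinf f -> Cinf (fun x => c * f x).
Proof. by move=> Cf; apply: CinfM => //; exact: Cinf_cst. Qed.

Lemma CinfD f g : Cinf f -> Cinf g -> Cinf (fun x => f x + g x).
Proof.
move=> Cf Cg; suff : Cinf (fun x => 1 * f x + 1 * g x).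
  by congr Cinf; apply/funext => x; rewrite !mul1r.
by apply: Cinf_algP; apply: Cinf_alg_add; apply: Cinf_alg_mul => //; exact: Cinf_cst.
Qed.

Lemma CinfX f n : Cinf f -> Cinf (fun x => f x ^+ n).
Proof.
move=> Cf; elim: n => [|n IH].
  have -> : (fun x => f x ^+ 0) = (fun=> 1) by apply/funext => x; rewrite expr0.
  exact: Cinf_cst.
have -> : (fun x => f x ^+ n.+1) = (fun x => f x * f x ^+ n).
  by apply/funext => x; rewrite exprS.
exact: CinfM.
Qed.

Lemma Cinf_affine f (c d : R) : Cinf f -> Cinf (fun x => f (c * x + d)).
Proof.
move=> Cf.
apply: (@Cinf_coind (fun h => exists e g, Cinf g /\ h = fun x => e * g (c * x + d))).
  move=> _ [e [g [Cg ->]]].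
  exists (fun x => (e * c) * (derive1 g) (c * x + d)).
    by exists (e * c), (derive1 g); split => //; exact: Cinf_derive1.
  move=> x.
  have h1 : is_derive x 1 (fun x : R => c * x + d) c.
    have -> : (fun x : R => c * x + d) = (c \*: (@id R)) + cst d by [].
    by apply: is_derive_eq; rewrite addr0 /GRing.scale/= mulr1.
  have h2 := @is_derive1_comp _ g _ x _ _ (Cinf_is_derive (c * x + d) Cg) h1.
  have h3 : is_derive x 1 (e \*: (g \o (fun x : R => c * x + d))) (e * ((derive1 g) (c * x + d) * c)).
    exact: is_deriveZ.
  by rewrite -mulrA (mulrC c).
by exists 1, f; split => //; apply/funext => x; rewrite mul1r.
Qed.

(** The function x^-k exp(-1/x), extended by 0 to x <= 0. Negative powers are included because
    differentiating exp(-1/x) produces them; [flat 0] is the classical building block of bump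
    functions. *)
Definition flat k (x : R) : R := if 0 < x then x^-1 ^+ k * expR (- x^-1) else 0.

Lemma flat_le0 k x : x <= 0 -> flat k x = 0.
Proof. by rewrite /flat; case: ltP. Qed.

Lemma flat_ge0 k x : 0 <= flat k x.
Proof.
by rewrite /flat; case: ltP => // x0; rewrite mulr_ge0 ?expR_ge0 ?exprn_ge0 ?invr_ge0// ltW.
Qed.

Lemma flat0_le1 x : flat 0 x <= 1.
Proof.
rewrite /flat; case: ltP => // x0; rewrite expr0 mul1r -expR0 ler_expR.
by rewrite oppr_le0 invr_ge0 ltW.
Qed.

Lemma flat0_gt0 x : 0 < x -> 0 < flat 0 x.
Proof. by move=> x0; rewrite /flat x0 expr0 mul1r expR_gt0. Qed.

(** From 1 + t <= exp t one gets (y/k)^k <= exp(y/k)^k = exp y. The bound does not depend on y,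
    which makes every [flat k] bounded up to 0. *)
Lemma powexp_bound k (y : R) : 0 < y -> y ^+ k * expR (- y) <= k%:R ^+ k.
Proof.
move=> y0; case: k => [|k].
  by rewrite !expr0 mul1r -expR0 ler_expR oppr_le0 ltW.
rewrite expRN ler_pdivrMr ?expR_gt0//.
have -> : y = k.+1%:R * (y / k.+1%:R) by rewrite mulrC divfK// pnatr_eq0.
rewrite exprMn expRM_natl ler_wpM2l ?exprn_ge0//.
have yk : 0 <= y / k.+1%:R by rewrite divr_ge0// ltW.
rewrite lerXn2r ?nnegrE ?expR_ge0//.
by apply: le_trans (expR_ge1Dx _); rewrite lerDr.
Qed.

Lemma flat_bound k x : flat k x <= k%:R ^+ k.
Proof.
rewrite /flat; case: ltP => [x0|_]; last by rewrite exprn_ge0.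
by apply: powexp_bound; rewrite invr_gt0.
Qed.

(** Two more negative powers are traded for a factor x^2; one of its two factors is still there
    after the division by x in the difference quotient at 0. *)
Lemma flat_sqr k x : 0 < x -> flat k x = x ^+ 2 * flat k.+2 x.
Proof.
move=> x0; rewrite /flat x0 !exprS; have : x != 0 by rewrite gt_eqF.
by move=> ?; rewrite !mulrA expr0 mulr1 mulfK// mulfV// mul1r.
Qed.

Lemma flat_derive k x :
  is_derive x 1 (flat k) (- k%:R * flat k.+1 x + flat k.+2 x).
Proof.
have [x0|x0|->] := ltgtP x 0.
- apply: (@near_eq_is_derive _ _ _ (fun=> 0)).
    near=> y; rewrite flat_le0//; apply: ltW.
    by near: y; exact: lt_nbhsl.
  rewrite !flat_le0 ?ltW// mulr0 addr0; exact: is_derive_cst.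
- apply: (@near_eq_is_derive _ _ _ (fun y => y^-1 ^+ k * expR (- y^-1))).
    near=> y; rewrite /flat; case: ltP => // y0.
    have : 0 < y by near: y; exact: lt_nbhsr.
    by rewrite ltNge y0.
  have xn0 : x != 0 by rewrite gt_eqF.
  have h1 : is_derive x 1 (fun y : R => y^-1) (- x ^- 2).
    by apply: is_derive_eq; [exact: (is_deriveV xn0)|rewrite /GRing.scale/= mulr1].
  have h2 : is_derive x 1 (fun y : R => - y^-1) (x ^- 2).
    by rewrite -[x ^- 2]opprK; exact: is_deriveN.
  have h3 : is_derive x 1 (fun y : R => expR (- y^-1)) (expR (- x^-1) * x ^- 2).
    exact: (@is_derive1_comp _ expR _ x _ _ (is_derive_expR _) h2).
  have h4 : is_derive x 1 (fun y : R => y^-1 ^+ k) (k%:R * x^-1 ^+ k.-1 * (- x ^- 2)).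
    have := @is_deriveX _ _ (fun y : R => y^-1) k x 1 _ h1.
    by rewrite exprfctE /GRing.scale/=.
  apply: (is_derive_eq (is_deriveM h4 h3)).
  rewrite /flat x0 /GRing.scale/=; case: k {h4} => [|k].
    by rewrite mul0r mul0r mulr0 addr0 oppr0 mul0r add0r expr0 mul1r exprVn mulrC.
  rewrite /= !exprVn !exprS expr0; field.
  by rewrite expf_neq0.
rewrite !flat_le0// mulr0 addr0.
(* At 0 the difference quotient is y [flat k.+2] y for y > 0, hence at most y (k+2)^(k+2), and it is
   0 for y < 0. *)
have key : (fun h : R => h^-1 *: (flat k (h *: 1 + 0) - flat k 0)) @ 0^' --> (0 : R).
  apply/cvgr0Pnorm_le => e e0; near=> y.
  rewrite (flat_le0 k (lexx 0)) subr0 addr0 /GRing.scale/= mulr1.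
  have y0 : y != 0 by near: y; exact: nbhs_dnbhs_neq.
  have [yp|yn] := ltP 0 y; last by rewrite flat_le0// mulr0 normr0 ltW.
  rewrite flat_sqr// expr2 !mulrA mulVf// mul1r ger0_norm ?mulr_ge0 ?flat_ge0 ?(ltW yp)//.
  apply: (@le_trans _ _ (y * (k.+2%:R ^+ k.+2))); first by rewrite ler_wpM2l ?flat_bound// ltW.
  rewrite -ler_pdivlMr ?exprn_gt0//.
  rewrite -(gtr0_norm yp); near: y; apply: dnbhs0_le; rewrite divr_gt0 ?exprn_gt0//.
split; first by apply/cvg_ex; exists 0; exact: key.
exact/cvg_lim/key.
Unshelve. all: by end_near. Qed.

(** The linear span of the [flat k]: by [flat_derive] it is stable under differentiation, as
    coinduction requires. *)
Inductive flat_alg : (R -> R) -> Prop :=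
| flat_alg_flat k : flat_alg (flat k)
| flat_alg_scale (c : R) f : flat_alg f -> flat_alg (fun x => c * f x)
| flat_alg_add f g : flat_alg f -> flat_alg g -> flat_alg (fun x => f x + g x).

Lemma Cinf_flat k : Cinf (flat k).
Proof.
apply: (@Cinf_coind flat_alg); last exact: flat_alg_flat.
move=> f; elim=> {f} [m|c f _ [f' Sf' df]|f g _ [f' Sf' df] _ [g' Sg' dg]].
- exists (fun x => - m%:R * flat m.+1 x + flat m.+2 x).
    apply: flat_alg_add; last exact: flat_alg_flat.
    by apply: flat_alg_scale; exact: flat_alg_flat.
  exact: flat_derive.
- exists (fun x => c * f' x); first exact: flat_alg_scale.
  by move=> x; exact: (@is_deriveZ _ _ _ _ c).
- exists (fun x => f' x + g' x); first exact: flat_alg_add.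
  by move=> x; exact: is_deriveD.
Qed.

Definition bump k (s t x : R) : R :=
  flat 0 (k.+1%:R * (x - s)) * flat 0 (k.+1%:R * (t - x)).

Lemma Cinf_bump k s t : Cinf (bump k s t).
Proof.
apply: CinfM.
- have -> : (fun x => flat 0 (k.+1%:R * (x - s))) =
    (fun x => flat 0 (k.+1%:R * x + - (k.+1%:R * s))).
    by apply/funext => x; congr flat; ring.
  by apply: Cinf_affine; exact: Cinf_flat.
- have -> : (fun x => flat 0 (k.+1%:R * (t - x))) =
    (fun x => flat 0 (- k.+1%:R * x + k.+1%:R * t)).
    by apply/funext => x; congr flat; ring.
  by apply: Cinf_affine; exact: Cinf_flat.
Qed.

Lemma bump_ge0 k s t x : 0 <= bump k s t x.
Proof. by rewrite mulr_ge0 ?flat_ge0. Qed.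

Lemma bump_le1 k s t x : `|bump k s t x| <= 1.
Proof.
by rewrite ger0_norm ?bump_ge0// mulr_ile1 ?flat_ge0 ?flat0_le1.
Qed.

Lemma bump_out k s t x : ~ (s < x < t) -> bump k s t x = 0.
Proof.
move=> /negP; rewrite negb_and -!leNgt => /orP[h|h]; rewrite /bump.
- by rewrite flat_le0 ?mul0r// mulr_ge0_le0// subr_le0.
- by rewrite [X in _ * X]flat_le0 ?mulr0// mulr_ge0_le0// subr_le0.
Qed.

Lemma bump_gt0 k s t x : s < x < t -> 0 < bump k s t x.
Proof. by move=> /andP[sx xt]; rewrite mulr_gt0// flat0_gt0// mulr_gt0// subr_gt0. Qed.

Lemma bump_cvg s t x : s < x < t -> bump k s t x @[k --> \oo] --> (1 : R).
Proof.
have h (u : R) : 0 < u -> flat 0 (k.+1%:R * u) @[k --> \oo] --> (1 : R).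
  move=> u0; have -> : (fun k => flat 0 (k.+1%:R * u)) =
      (fun k => expR (- (u^-1 * (@harmonic R k)))).
    apply/funext => k; rewrite /flat mulr_gt0// expr0 mul1r invfM /harmonic/=.
    by rewrite mulrC.
  rewrite -expR0 -oppr0 -[X in - X](mulr0 u^-1).
  apply: (continuous_cvg _ (@continuous_expR R _)).
  by apply: cvgN; apply: cvgM; [exact: cvg_cst|exact: cvg_harmonic].
move=> /andP[sx xt]; rewrite -[1]mulr1.
by apply: cvgM; apply: h; rewrite subr_gt0.
Qed.

(** Dominated convergence with majorant |f|. This is the passage from smooth test functions to
    indicators of intervals. *)
Lemma bump_approx (al be s t : R) f : mu.-integrable `]al, be[ (EFin \o f) ->
  al <= s -> t <= be ->
  \int[mu]_(x in `]al, be[) (f x * bump k s t x) @[k --> \oo] -->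
  \int[mu]_(x in `]s, t[) f x.
Proof.
move=> fi als tbe; have mf := measurable_int_fun fi.
have -> : \int[mu]_(x in `]s, t[) f x = \int[mu]_(x in `]al, be[) (f x * \1_`]s, t[ x).
  rewrite [LHS]Rintegral_mkcond [RHS]Rintegral_mkcond; congr Rintegral.
  apply/funext => x; rewrite !patchE indicE !mem_setE.
  case: ifPn => [/(subset_oo als tbe) h|]; last by rewrite mulr0; case: ifP.
  by rewrite (_ : x \in `]al, be[) ?mulr1.
have mb k : measurable_fun `]al, be[ (bump k s t) by apply: Cinf_measurable => //; exact: Cinf_bump.
have fbi k : mu.-integrable `]al, be[ (EFin \o (fun x => f x * bump k s t x)).
  apply: (@integrable_mulbnd _ _ R mu _ _ f (bump k s t) 1) => //; first exact: mb.
  by move=> x _; exact: bump_le1.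
have f1i : mu.-integrable `]al, be[ (EFin \o (fun x => f x * \1_`]s, t[ x)).
  apply: (@integrable_mulbnd _ _ R mu _ _ f _ 1) => // x _.
  by rewrite indicE; case: (_ \in _); rewrite ?normr1 ?normr0.
apply: fine_cvg; rewrite fineK; last exact: integrable_fin_num.
have [] := @dominated_convergence _ _ R mu `]al, be[ _ (fun k x => (f x * bump k s t x)%:E)
  (fun x => (f x * \1_`]s, t[ x)%:E) (fun x => (`|f x|)%:E) => //.
- by move=> k; exact: measurable_int (fbi k).
- exact: measurable_int f1i.
- apply: ae_all => x _; apply: cvg_EFin; first by near=> k.
  apply: cvgM; first exact: cvg_cst.
  rewrite indicE mem_setE; have [xst|xst] := boolP (x \in `]s, t[).
    by apply: bump_cvg; move: xst; rewrite in_itv.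
  rewrite (_ : (fun k => _) = fun=> 0); first exact: cvg_cst.
  by apply/funext => k; rewrite bump_out//; apply/negP; move: xst; rewrite in_itv.
- exact: integrable_norm.
- apply: ae_all => x k _; rewrite lee_fin normrM ler_piMr// bump_le1.
Unshelve. all: by end_near. Qed.


(** The support is given by an explicit segment rather than a compact set, so that hulls of supports
    and base points of primitives can be named. *)
Definition test_itv (al be : R) f := Cinf f /\
  exists s t, [/\ al < s, s < t, t < be & forall x, ~ (s <= x <= t) -> f x = 0].

Lemma test_itv_derive (al be : R) f : test_itv al be f -> test_itv al be (derive1 f).
Proof.
move=> [Cf [s [t [als st tbe f0]]]]; split; first exact: Cinf_derive1.
exists s, t; split => // x /negP; rewrite negb_and -!ltNge => xst.
rewrite derive1E (@near_eq_derive _ _ _ _ (cst 0)) ?derive_cst//.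
case/orP : xst => h; near=> y; apply: f0; apply/negP; rewrite negb_and -!ltNge.
- by apply/orP; left; near: y; exact: lt_nbhsl.
- by apply/orP; right; near: y; exact: lt_nbhsr.
Unshelve. all: by end_near. Qed.

Lemma test_itv_bump (al be s t : R) k : al < s -> s < t -> t < be ->
  test_itv al be (bump k s t).
Proof.
move=> als st tbe; split; first exact: Cinf_bump.
exists s, t; split => // x h; apply: bump_out => /andP[sx xt]; apply: h.
by rewrite !ltW.
Qed.

Lemma test_itv_bounded (al be : R) f : test_itv al be f ->
  exists M, forall x, `|f x| <= M.
Proof.
move=> [Cf [s [t [als st tbe f0]]]].
have cf : {within `[s, t], continuous (fun x => `|f x|)}.
  apply: continuous_subspaceT => x; apply: continuous_comp; first exact: Cinf_continuous.
  exact: norm_continuous.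
have [c cst' cmax] := EVT_max (ltW st) cf.
exists `|f c| => x; have [xst|/negP xst] := boolP (s <= x <= t).
  by apply: cmax; rewrite in_itv.
by rewrite f0// normr0.
Qed.

Lemma test_itv_out (al be : R) f x : test_itv al be f -> ~ (al < x < be) -> f x = 0.
Proof.
move=> [Cf [s [t [als st tbe f0]]]] h; apply: f0 => /andP[sx xt]; apply: h.
by rewrite (lt_le_trans als sx) (le_lt_trans xt tbe).
Qed.

Lemma test_itv_integrable (al be : R) f : test_itv al be f ->
  mu.-integrable `]al, be[ (EFin \o f).
Proof.
move=> [Cf _]; apply: integrable_continuous_oo; apply: continuous_subspaceT.
exact: Cinf_continuous.
Qed.

Lemma test_itv_tail (al be : R) f s : test_itv al be f -> al < s < be ->
  f s = 0 - \int[mu]_(r in `]s, be[) derive1 f r.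
Proof.
move=> tf /andP[als sbe]; have [Cf _] := tf.
have cf : {within `[s, be], continuous f}.
  by apply: continuous_subspaceT; exact: Cinf_continuous.
have cf' : {within `[s, be], continuous (derive1 f)}.
  by apply: continuous_subspaceT; apply: Cinf_continuous; exact: Cinf_derive1.
rewrite (FTC_oo (ltW sbe) cf (fun t _ => Cinf_is_derive t Cf) cf').
by rewrite (test_itv_out tf (x := be)) ?ltxx ?andbF//; ring.
Qed.

(** With total integral zero, the primitive returns to 0 beyond t and so has compact support again.
    The base point m lies strictly to the left of s so that every point of the support, s included,
    is interior to an interval of integration. *)
Lemma Cinf_primitive (al be m s t : R) f : Cinf f -> al < m < s -> s < t -> t < be ->
  (forall x, ~ (s <= x <= t) -> f x = 0) -> \int[mu]_(x in `]m, t[) f x = 0 ->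
  let F x := \int[mu]_(u in `]m, x[) f u in
  test_itv al be F /\ derive1 F = f.
Proof.
move=> Cf /andP[alm ms] st tbe f0 If F.
have fi x y : mu.-integrable `]x, y[ (EFin \o f).
  by apply: integrable_continuous_oo; apply: continuous_subspaceT; exact: Cinf_continuous.
have F0 x : x < s -> F x = 0.
  move=> xs; rewrite /F (@eq_Rintegral _ _ _ mu _ (fun=> 0)) /Rintegral ?integral0//.
  move=> u; rewrite inE/= in_itv/= => /andP[_ ux]; apply: f0 => /andP[su _].
  by move: (le_lt_trans su (lt_trans ux xs)); rewrite ltxx.
have dF x : is_derive x 1 F (f x).
  have [xs|sx] := ltP x s.
    rewrite f0; last by rewrite leNgt xs.
    apply: (@near_eq_is_derive _ _ _ (fun=> 0 : R)).
    by near=> y; rewrite F0//; near: y; exact: lt_nbhsl.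
  apply: (@is_derive_int _ m (x + 1)) => //; first by rewrite (lt_le_trans ms sx) ltrDl ltr01.
  exact: Cinf_continuous.
have F' : derive1 F = f by apply/funext => x; rewrite derive1E derive_val.
have Ft x : t < x -> F x = 0.
  move=> tx; rewrite /F (@Rint_oo_split _ m t x) ?If ?add0r ?(ltW tx) ?(ltW (lt_trans ms st))//.
  rewrite (@eq_Rintegral _ _ _ mu _ (fun=> 0)) /Rintegral ?integral0//.
  move=> u; rewrite inE/= in_itv/= => /andP[tu _]; apply: f0 => /andP[_ ut].
  by move: (lt_le_trans tu ut); rewrite ltxx.
split => //; split.
  split => n x; case: n => [|n]; first exact: ex_derive.
  by rewrite derive1Sn F'; exact: Cinf_der.
exists s, t; split => //; first exact: lt_trans ms.
by move=> x /negP; rewrite negb_and -!ltNge => /orP[/F0|/Ft].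
Unshelve. all: by end_near. Qed.

Let divr_mulCA (A B I : R) : B / I * A = A / I * B.
Proof. by rewrite mulrAC [RHS]mulrAC (mulrC A). Qed.

(** Adding to h the primitive G of g turns the hypothesis into orthogonality of h + G to all
    derivatives of test functions, that is, to all test functions of integral zero. Hence h + G
    pairs with bumps as a constant c does, and letting the bumps tend to indicators of intervals
    gives equality almost everywhere. *)
Lemma duBoisReymond (al be : R) h g : al < be ->
  mu.-integrable `]al, be[ (EFin \o h) -> mu.-integrable `]al, be[ (EFin \o g) ->
  (forall th, test_itv al be th ->
    \int[mu]_(x in `]al, be[) (h x * derive1 th x) =
    \int[mu]_(x in `]al, be[) (g x * th x)) ->
  exists c, {ae mu, forall x, al < x < be ->
    h x = c - \int[mu]_(u in `]al, x[) g u}.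
Proof.
move=> albe hi gi hg.
pose G x := \int[mu]_(u in `]al, x[) g u; pose W x := h x + G x.
have cG : {within `[al, be], continuous G} by apply: continuous_int => //; exact: ltW.
have Gi : mu.-integrable `]al, be[ (EFin \o G) by exact: integrable_continuous_oo.
have Wi : mu.-integrable `]al, be[ (EFin \o W) by exact: integrableDE.
have mulb f k (M : R) : mu.-integrable `]al, be[ (EFin \o f) -> Cinf k ->
    (forall x, `|k x| <= M) -> mu.-integrable `]al, be[ (EFin \o (fun x => f x * k x)).
  move=> fi Ck kM; apply: (@integrable_mulbnd _ _ R mu _ _ f _ M) => //.
  exact: Cinf_measurable.
have W0 th : test_itv al be th -> \int[mu]_(x in `]al, be[) (W x * derive1 th x) = 0.
  move=> tth; have [Cth _] := tth; have tth' := test_itv_derive tth.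
  have [M thM] := test_itv_bounded tth; have [M' thM'] := test_itv_bounded tth'.
  have Cth' := Cinf_derive1 Cth.
  transitivity (\int[mu]_(x in `]al, be[) (h x * derive1 th x + G x * derive1 th x)).
    by apply: eq_Rintegral => x _; rewrite /W mulrDl.
  rewrite RintegralD//; [|exact: mulb thM'|exact: mulb thM'].
  rewrite hg// (IBP_int (W := 0) (k := derive1 th) gi); first last.
  - exact: mulb thM.
  - by move=> s als; exact: (test_itv_tail tth als).
  - exact: test_itv_integrable.
  rewrite mul0r sub0r [X in - X](_ : _ = \int[mu]_(x in `]al, be[) (G x * derive1 th x)) ?addNr//.
  by apply: eq_Rintegral => x _; rewrite mulrC.
(* A reference bump on the middle third; its integral is nonzero and normalises c. *)
pose s0 := al + (be - al) / 3; pose t0 := al + (be - al) / 3 * 2.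
have als0 : al < s0 by rewrite /s0; lra.
have s0t0 : s0 < t0 by rewrite /s0 /t0; lra.
have t0be : t0 < be by rewrite /t0; lra.
pose e0 := bump 0 s0 t0; pose I0 := \int[mu]_(x in `]al, be[) e0 x.
have e0i : mu.-integrable `]al, be[ (EFin \o e0).
  by apply: test_itv_integrable; exact: test_itv_bump.
have I0gt0 : 0 < I0.
  rewrite lt_neqAle Rintegral_ge0 ?andbT; last by move=> x _; exact: bump_ge0.
  apply/eqP => I00.
  have hae : ae_eq mu [set` `]al, be[] (EFin \o e0) (cst 0%E).
    apply: ge0_integral_eq0_ae => //.
    - exact: measurable_int e0i.
    - by move=> x _; rewrite lee_fin bump_ge0.
    - by rewrite integral_Rintegral// -/I0 -I00.
  have [N [mN N0 sN]] := hae.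
  have : (mu [set` `]s0, t0[] <= mu N)%E.
    apply: le_measure; rewrite ?inE//.
    move=> x /= xst; apply: sN => /= h0; move: (xst); rewrite in_itv/= => /(bump_gt0 0).
    have [] := h0 (subset_oo (ltW als0) (ltW t0be) xst).
    by rewrite -/e0 => ->; rewrite ltxx.
  rewrite N0 lebesgue_measure_itv/= lte_fin s0t0 -EFinD lee_fin leNgt subr_gt0.
  by rewrite s0t0.
pose c := (\int[mu]_(x in `]al, be[) (W x * e0 x)) / I0.
have key s t k : al < s -> s < t -> t < be ->
    \int[mu]_(x in `]al, be[) (W x * bump k s t x) =
    c * \int[mu]_(x in `]al, be[) (1 * bump k s t x).
  move=> als st tbe.
  (* Subtracting q times [e0] produces integral zero, so that the difference is the derivative of a
     test function. Below, [s1] and [t1] bound the union of the two supports. *)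
  pose q := \int[mu]_(x in `]al, be[) (1 * bump k s t x) / I0.
  pose f x := bump k s t x + (- q) * e0 x.
  have Cf : Cinf f by apply: CinfD; [exact: Cinf_bump|apply: CinfZ; exact: Cinf_bump].
  pose s1 := Num.min s s0; pose t1 := Num.max t t0.
  have als1 : al < s1 by rewrite lt_min als.
  have t1be : t1 < be by rewrite gt_max tbe.
  have s1t1 : s1 < t1 by rewrite lt_max !gt_min st.
  pose m := (al + s1) / 2.
  have alm : al < m by rewrite /m; lra.
  have ms1 : m < s1 by rewrite /m; lra.
  have bi : mu.-integrable `]al, be[ (EFin \o bump k s t).
    by apply: test_itv_integrable; exact: test_itv_bump.
  have fi : mu.-integrable `]al, be[ (EFin \o f).
    by apply: integrableDE => //; exact: integrableZE.
  have f0 x : ~ (s1 <= x <= t1) -> f x = 0.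
    move=> hx; rewrite /f /e0 !bump_out ?mulr0 ?addr0// => /andP[sx xt]; apply: hx.
    - by rewrite ge_min le_max (ltW sx) (ltW xt) !orbT.
    - by rewrite ge_min le_max (ltW sx) (ltW xt).
  have If : \int[mu]_(x in `]al, be[) f x = 0.
    rewrite RintegralD//; last exact: integrableZE.
    rewrite RintegralZl// -/I0 /q mulNr divfK ?gt_eqF//.
    by under [X in _ - X]eq_Rintegral do rewrite mul1r; rewrite subrr.
  have Ift : \int[mu]_(x in `]m, t1[) f x = 0.
    rewrite -If (@Rint_oo_split _ al m be) ?(ltW alm) ?(ltW (lt_trans ms1 (lt_trans s1t1 t1be)))//.
    rewrite (@Rint_oo_split _ m t1 be) ?(ltW t1be) ?(ltW (lt_trans ms1 s1t1))//; last first.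
      exact: integrable_sub_oo (ltW alm) (lexx be) fi.
    rewrite (@eq_Rintegral _ _ _ mu `]al, m[ (fun=> 0)); last first.
      move=> u; rewrite inE/= in_itv/= => /andP[_ um]; apply: f0 => /andP[su _].
      by move: (le_lt_trans su (lt_trans um ms1)); rewrite ltxx.
    rewrite (@eq_Rintegral _ _ _ mu `]t1, be[ (fun=> 0)); last first.
      move=> u; rewrite inE/= in_itv/= => /andP[tu _]; apply: f0 => /andP[_ ut].
      by move: (lt_le_trans tu ut); rewrite ltxx.
    by rewrite !Rintegral0 add0r addr0.
  have [tF F'] := Cinf_primitive Cf (introT andP (conj alm ms1)) s1t1 t1be f0 Ift.
  have := W0 _ tF; rewrite F' => W00.
  have : \int[mu]_(x in `]al, be[) (W x * bump k s t x + (- q) * (W x * e0 x)) = 0.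
    by rewrite -W00; apply: eq_Rintegral => x _; rewrite /f; ring.
  rewrite RintegralD//; last 2 first.
  - by exact: (mulb W (bump k s t) 1 Wi (Cinf_bump k s t) (bump_le1 k s t)).
  - by apply: integrableZE => //; exact: (mulb W e0 1 Wi (Cinf_bump 0 s0 t0) (bump_le1 0 s0 t0)).
  rewrite (@RintegralZl _ _ R mu _ (fun x => W x * e0 x) (- q))//; last by exact: (mulb W e0 1 Wi (Cinf_bump 0 s0 t0) (bump_le1 0 s0 t0)).
  rewrite mulNr => /eqP; rewrite subr_eq0 => /eqP ->.
  exact: divr_mulCA.
exists c.
have ci : mu.-integrable `]al, be[ (EFin \o (fun=> c : R)).
  by apply: integrable_continuous_oo; apply: continuous_subspaceT => x; exact: cvg_cst.
have oi : mu.-integrable `]al, be[ (EFin \o (fun=> 1 : R)).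
  by apply: integrable_continuous_oo; apply: continuous_subspaceT => x; exact: cvg_cst.
have : {ae mu, forall x, al < x < be -> W x - c = 0}.
  apply: ae0_of_intervals; first exact: integrableBE.
  move=> s t als st tbe.
  have sub f : mu.-integrable `]al, be[ (EFin \o f) -> mu.-integrable `]s, t[ (EFin \o f).
    by apply: integrable_sub_oo; exact: ltW.
  rewrite RintegralB//; [|exact: sub..].
  have l1 := bump_approx Wi (ltW als) (ltW tbe).
  have l2 := bump_approx oi (ltW als) (ltW tbe).
  have l3 : c * \int[mu]_(x in `]al, be[) (1 * bump k s t x) @[k --> \oo] -->
      c * \int[mu]_(x in `]s, t[) 1.
    by apply: cvgM l2; exact: cvg_cst.
  have E : \int[mu]_(x in `]s, t[) W x = c * \int[mu]_(x in `]s, t[) 1.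
    have E1 : (fun k => \int[mu]_(x in `]al, be[) (W x * bump k s t x)) =
        (fun k => c * \int[mu]_(x in `]al, be[) (1 * bump k s t x)).
      by apply/funext => k; exact: key.
    rewrite E1 in l1.
    by rewrite -(cvg_lim (@Rhausdorff R) l1) -(cvg_lim (@Rhausdorff R) l3).
  rewrite E -RintegralZl//; last exact: sub.
  by under eq_Rintegral do rewrite mulr1; rewrite subrr.
apply: ae_imp => x + xab => /(_ xab) /eqP; rewrite subr_eq0 /W => /eqP <-.
by rewrite addrK.
Unshelve. all: by end_near. Qed.

End smooth1.

(** * Smooth functions of two variables and test functions on the rectangle *)

Section plane.
Context {R : realType}.
Notation mu := (@lebesgue_measure R).

Lemma cvg_pairl (x y : R) : (fun r : R => (r, y)) @ x --> (x, y).
Proof.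
apply: (@cvg_pair _ _ _ _ (nbhs x) (nbhs y) _ _ _ id (fun=> y)); first exact: cvg_id.
exact: cvg_cst.
Qed.

Lemma cvg_pairr (x y : R) : (fun z : R => (x, z)) @ y --> (x, y).
Proof.
apply: (@cvg_pair _ _ _ _ (nbhs x) (nbhs y) _ _ _ (fun=> x) id); last exact: cvg_id.
exact: cvg_cst.
Qed.

(** Measurability for the product sigma-algebra: rounding the first coordinate down to a multiple of
    1/(n+1) makes f a countable patchwork of functions of the second coordinate, and f is the
    pointwise limit of these. *)
Lemma continuous_measurable_fun2 (f : R * R -> R) : continuous f ->
  measurable_fun setT f.
Proof.
move=> cf.
pose q n (x : R) : R := (Num.floor (n.+1%:R * x))%:~R / n.+1%:R.
have qcvg x : q n x @[n --> \oo] --> x.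
  apply/cvgrPdist_le => e e0; near=> n.
  have n0 : 0 < n.+1%:R :> R by [].
  have -> : x - q n x = (n.+1%:R * x - (Num.floor (n.+1%:R * x))%:~R) / n.+1%:R.
    by rewrite /q; field.
  have := floor_itv (n.+1%:R * x) => /andP[h1 h2].
  rewrite ger0_norm ?divr_ge0 ?subr_ge0//.
  apply: (@le_trans _ _ (n.+1%:R^-1)).
    rewrite -[leRHS]mul1r ler_pM2r ?invr_gt0// lerBlDl ltW//.
    by move: h2; rewrite intrD.
  by apply: ltW; near: n; exact: (near_infty_natSinv_lt (PosNum e0)).
apply: (@measurable_fun_cvg _ _ _ setT (fun n p => f (q n p.1, p.2))).
- move=> n _ B mB; rewrite setTI.
  have -> : (fun p => f (q n p.1, p.2)) @^-1` B = \bigcup_(k : int)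
     ([set x | Num.floor (n.+1%:R * x) = k] `*` [set y | B (f (k%:~R / n.+1%:R, y))]).
    apply/seteqP; split => [[x y] /= Bf|[x y] [k _ [/= <-]]//].
    by exists (Num.floor (n.+1%:R * x)).
  apply: countable_bigcupT_measurable => [|k]; first exact: countableP.
  apply: measurableX.
    have -> : [set x : R | Num.floor (n.+1%:R * x) = k] =
        [set x : R | k%:~R / n.+1%:R <= x < (k + 1)%:~R / n.+1%:R].
      apply/seteqP; split => x /=.
        move=> <-; rewrite ler_pdivrMr// ltr_pdivlMr// mulrC; exact: floor_itv.
      rewrite ler_pdivrMr// ltr_pdivlMr// mulrC => h.
      exact: floor_def.
    have -> : [set x : R | k%:~R / n.+1%:R <= x < (k + 1)%:~R / n.+1%:R] =
        `[(k%:~R / n.+1%:R : R), ((k + 1)%:~R / n.+1%:R)[%classic.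
      by apply/seteqP; split => x /=; rewrite in_itv.
    exact: measurable_itv.
  have cy : continuous (fun y : R => f (k%:~R / n.+1%:R, y)).
    by move=> y; apply: (continuous_comp (@cvg_pairr _ y)); exact: cf.
  rewrite -[X in measurable X]setTI.
  exact: (continuous_measurable_fun cy).
- move=> [x y] _ /=.
  apply: (@continuous_cvg _ _ _ _ _ (fun n => (q n x, y)) f (x, y)); first exact: cf.
  by apply: (@cvg_pair _ _ _ _ (nbhs x) (nbhs y)); [exact: qcvg|exact: cvg_cst].
Unshelve. all: by end_near. Qed.

Lemma pdr_prod (A B : R -> R) : Cinf A ->
  pdr (fun p : R * R => A p.1 * B p.2) = (fun p => derive1 A p.1 * B p.2).
Proof.
move=> CA; apply/funext => p; rewrite /pdr /=.
rewrite (_ : (fun r => A r * B p.2) = (fun r => B p.2 * A r)); last first.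
  by apply/funext => r; rewrite mulrC.
have h := Cinf_is_derive p.1 CA.
have [_ E] := @is_deriveZ _ _ _ A (B p.2) _ _ _ h.
by rewrite derive1E; etransitivity; [exact: E|rewrite mulrC].
Qed.

Lemma pdz_prod (A B : R -> R) : Cinf B ->
  pdz (fun p : R * R => A p.1 * B p.2) = (fun p => A p.1 * derive1 B p.2).
Proof.
move=> CB; apply/funext => p; rewrite /pdz /=.
have h := Cinf_is_derive p.2 CB.
have [_ E] := @is_deriveZ _ _ _ B (A p.1) _ _ _ h.
by rewrite derive1E; exact: E.
Qed.

Lemma pds_prod s (A B : R -> R) : Cinf A -> Cinf B ->
  exists A' B', [/\ Cinf A', Cinf B' &
    pds s (fun p : R * R => A p.1 * B p.2) = (fun p => A' p.1 * B' p.2)].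
Proof.
move=> CA CB; elim: s => [|b s [A' [B' [CA' CB' E]]]]; first by exists A, B.
case: b => /=; rewrite E.
- by exists (derive1 A'), B'; split => //; [exact: Cinf_derive1|exact: pdr_prod].
- by exists A', (derive1 B'); split => //; [exact: Cinf_derive1|exact: pdz_prod].
Qed.

Lemma smooth_prod (A B : R -> R) : Cinf A -> Cinf B ->
  smooth (fun p : R * R => A p.1 * B p.2).
Proof.
move=> CA CB s; have [A' [B' [CA' CB' ->]]] := pds_prod s CA CB; split.
- move=> p; apply: cvgM.
  + apply: (@continuous_comp _ _ _ fst A'); first exact: cvg_fst.
    exact: Cinf_continuous.
  + apply: (@continuous_comp _ _ _ snd B'); first exact: cvg_snd.
    exact: Cinf_continuous.
- move=> p /=; split.
  + rewrite (_ : (fun r => A' r * B' p.2) = (fun r => B' p.2 * A' r)); last first.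
      by apply/funext => r; rewrite mulrC.
    have h := CinfZ (B' p.2) CA'; case: h => h; exact: (h 0 p.1).
  + have h := CinfZ (A' p.1) CB'; case: h => h; exact: (h 0 p.2).
Qed.

Lemma test_fun_prod (rho a : R) (A B : R -> R) :
  test_itv 0 rho A -> test_itv (- a) a B ->
  test_fun rho a (fun p : R * R => A p.1 * B p.2).
Proof.
move=> [CA [s [t [s0 st trho A0]]]] [CB [u [v [ua uv va B0]]]].
split; first exact: smooth_prod.
exists (`[s, t] `*` `[u, v]); split.
- by apply: compact_setX; exact: segment_compact.
- move=> [x y] /= [] /=; rewrite !in_itv/= => /andP[sx xt] /andP[uy yv].
  by rewrite /Omega/= (lt_le_trans s0 sx) (le_lt_trans xt trho) (lt_le_trans ua uy) (le_lt_trans yv va).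
- move=> [x y] /= /not_andP[h|h].
  + by rewrite A0 ?mul0r// => hx; apply: h; rewrite /= in_itv.
  + by rewrite B0 ?mulr0// => hx; apply: h; rewrite /= in_itv.
Qed.

Lemma compact_in_oo (al be : R) (K : set R) : al < be -> compact K -> K `<=` `]al, be[ ->
  exists s t, [/\ al < s, s < t, t < be & forall x, K x -> s <= x <= t].
Proof.
move=> albe cK Kab; have [K0|K0] := pselect (K !=set0); last first.
  exists (al + (be - al) / 3), (al + (be - al) / 3 * 2); split; [lra|lra|lra|].
  by move=> x Kx; exfalso; apply: K0; exists x.
have cid : {within K, continuous (id : R -> R)} by apply: continuous_subspaceT => x; exact: cvg_id.
have [s /set_mem Ks smin] := compact_EVT_min K0 cK cid.
have [t /set_mem Kt tmax] := compact_EVT_max K0 cK cid.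
have := Kab _ Ks; rewrite /= in_itv/= => /andP[als sbe].
have := Kab _ Kt; rewrite /= in_itv/= => /andP[alt tbe].
have st : s <= t by apply: tmax; exact/mem_set.
(* Moving halfway towards the ends keeps the segment nondegenerate even when K is a single point. *)
exists ((al + s) / 2), ((be + t) / 2); split; [lra|lra|lra|].
move=> x /mem_set Kx; have /= := smin _ Kx; have /= := tmax _ Kx.
by move=> xt sx; apply/andP; split; lra.
Qed.

Lemma test_fun1_itv (rho : R) phi : 0 < rho -> test_fun1 rho phi -> test_itv 0 rho phi.
Proof.
move=> rho0 [dphi [K [cK Krho phi0]]]; split; first by split.
have [s [t [s0 st trho Kst]]] := compact_in_oo rho0 cK Krho.
exists s, t; split => // x h; apply: phi0 => /Kst; exact: h.
Qed.

Lemma compact_in_Omega (rho a : R) (K : set (R * R)) : 0 < rho -> 0 < a ->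
  compact K -> K `<=` Omega rho a ->
  exists s t u v, [/\ 0 < s, s < t, t < rho, [/\ - a < u, u < v & v < a] &
    forall p, K p -> (s <= p.1 <= t) && (u <= p.2 <= v)].
Proof.
move=> rho0 a0 cK KO.
have c1 : compact (fst @` K).
  by apply: continuous_compact => //; apply: continuous_subspaceT => x; exact: cvg_fst.
have c2 : compact (snd @` K).
  by apply: continuous_compact => //; apply: continuous_subspaceT => x; exact: cvg_snd.
have s1 : fst @` K `<=` `]0, rho[.
  by move=> _ [p Kp <-] /=; rewrite in_itv/=; case: (KO _ Kp).
have s2 : snd @` K `<=` `](- a), a[.
  by move=> _ [p Kp <-] /=; rewrite in_itv/=; case: (KO _ Kp).
have aa : - a < a by lra.
have [s [t [h1 h2 h3 h4]]] := compact_in_oo rho0 c1 s1.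
have [u [v [k1 k2 k3 k4]]] := compact_in_oo aa c2 s2.
exists s, t, u, v; split => // p Kp; apply/andP; split.
- by apply: h4; exists p.
- by apply: k4; exists p.
Qed.

Lemma smooth_pd (b : bool) (f : R * R -> R) : smooth f -> smooth (if b then pdr f else pdz f).
Proof.
move=> sf s; have -> : pds s (if b then pdr f else pdz f) = pds (rcons s b) f.
  by rewrite /pds foldr_rcons.
exact: sf.
Qed.

Lemma smooth_continuous (f : R * R -> R) : smooth f -> continuous f.
Proof. by move=> /(_ [::])[]. Qed.

Lemma smooth_measurable (D : set (R * R)) (f : R * R -> R) : smooth f -> measurable_fun D f.
Proof.
by move=> sf; apply: measurable_funTS; apply: continuous_measurable_fun2; exact: smooth_continuous.
Qed.

Lemma smooth_is_derive_r (f : R * R -> R) (r z : R) : smooth f ->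
  is_derive r 1 (fun r => f (r, z)) (pdr f (r, z)).
Proof. by move=> /(_ [::])[_ /(_ (r, z))[/= h _]]; split => //; rewrite -derive1E. Qed.

Lemma smooth_is_derive_z (f : R * R -> R) (r z : R) : smooth f ->
  is_derive z 1 (fun z => f (r, z)) (pdz f (r, z)).
Proof. by move=> /(_ [::])[_ /(_ (r, z))[/= _ h]]; split => //; rewrite -derive1E. Qed.

Lemma smooth_continuous_r (f : R * R -> R) (z : R) : smooth f -> continuous (fun r => f (r, z)).
Proof.
by move=> sf r; apply: (continuous_comp (@cvg_pairl r z)); exact: smooth_continuous.
Qed.

Lemma smooth_continuous_z (f : R * R -> R) (r : R) : smooth f -> continuous (fun z => f (r, z)).
Proof.
by move=> sf z; apply: (continuous_comp (@cvg_pairr r z)); exact: smooth_continuous.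
Qed.

Section test_functions.
Variables (rho a : R).
Hypotheses (rho0 : 0 < rho) (a0 : 0 < a).

(** A compact K is closed, so off K the function vanishes on a neighbourhood and its derivatives
    vanish too: the same K serves as support. *)
Lemma test_fun_pd (b : bool) phi : test_fun rho a phi ->
  test_fun rho a (if b then pdr phi else pdz phi).
Proof.
move=> [sphi [K [cK KO phi0]]]; split; first exact: smooth_pd.
exists K; split => // p Kp.
have oK : open (~` K).
  apply: closed_openC; apply: compact_closed => //; exact: Rhausdorff2.
have nK : \forall q \near p, ~ K q by apply: (open_nbhs_nbhs _); split.
case: b; rewrite /pdr /pdz derive1E (@near_eq_derive _ _ _ _ (cst 0)) ?derive_cst//.
- have h : (fun r : R => (r, p.2)) @ p.1 --> p.
    by case: (p) => x y; exact: cvg_pairl.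
  by near=> r; rewrite phi0//; near: r; exact: (h _ nK).
- have h : (fun z : R => (p.1, z)) @ p.2 --> p.
    by case: (p) => x y; exact: cvg_pairr.
  by near=> r; rewrite phi0//; near: r; exact: (h _ nK).
Unshelve. all: by end_near. Qed.

Lemma test_fun_box phi : test_fun rho a phi ->
  exists s t u v, [/\ 0 < s, s < t, t < rho, [/\ - a < u, u < v & v < a] &
    forall p, ~~ ((s <= p.1 <= t) && (u <= p.2 <= v)) -> phi p = 0].
Proof.
move=> [sphi [K [cK KO phi0]]].
have [s [t [u [v [h1 h2 h3 h4 h5]]]]] := compact_in_Omega rho0 a0 cK KO.
by exists s, t, u, v; split => // p /negP hp; apply: phi0 => /h5.
Qed.

Lemma test_fun_bounded phi : test_fun rho a phi -> exists M, forall p, `|phi p| <= M.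
Proof.
move=> [sphi [K [cK KO phi0]]]; have [K0|K0] := pselect (K !=set0); last first.
  exists 0 => p; rewrite phi0 ?normr0// => Kp; apply: K0; by exists p.
have cf : {within K, continuous (fun p => `|phi p|)}.
  apply: continuous_subspaceT => x; apply: continuous_comp; first exact: smooth_continuous.
  exact: norm_continuous.
have [c _ cmax] := compact_EVT_max K0 cK cf.
exists `|phi c| => p; have [Kp|Kp] := pselect (K p); first by apply: cmax; exact/mem_set.
by rewrite phi0// normr0.
Qed.

End test_functions.
End plane.

(** * Bessel and Riesz-Fischer *)

Section hilbert.
Context {d : measure_display} {T : measurableType d} {R : realType}.
Variable mu : {measure set T -> \bar R}.
Variable D : set T.
Hypothesis mD : measurable D.
Implicit Types f g : T -> R.

Lemma L2_B f g : L2 mu D f -> L2 mu D g -> L2 mu D (fun x => f x - g x).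
Proof.
move=> Lf Lg; have := L2D mD Lf (L2Z mD (- 1) Lg).
by congr L2; apply/funext => x; rewrite mulN1r.
Qed.

Lemma Rint_sqrD f g : L2 mu D f -> L2 mu D g ->
  \int[mu]_(x in D) ((f x + g x) ^+ 2) =
  \int[mu]_(x in D) (f x ^+ 2) + 2 * \int[mu]_(x in D) (f x * g x) +
  \int[mu]_(x in D) (g x ^+ 2).
Proof.
move=> Lf Lg; have fg := L2_mul mD Lf Lg; have [_ fi] := Lf; have [_ gi] := Lg.
rewrite -RintegralZl// -!RintegralD//; first last.
- exact: integrableZE.
- by apply: integrableDE => //; exact: integrableZE.
by apply: eq_Rintegral => x _; ring.
Qed.

Lemma Rint_sqr_le2 f g : L2 mu D f -> L2 mu D g ->
  \int[mu]_(x in D) ((f x + g x) ^+ 2) <=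
  2 * \int[mu]_(x in D) (f x ^+ 2) + 2 * \int[mu]_(x in D) (g x ^+ 2).
Proof.
move=> Lf Lg; have [_ fi] := Lf; have [_ gi] := Lg; have [_ fgi] := L2D mD Lf Lg.
rewrite -!RintegralZl// -!RintegralD//; [|exact: integrableZE..].
apply: le_Rintegral => //; first by apply: integrableDE => //; exact: integrableZE.
by move=> x _; have := sqr_ge0 (f x - g x); nra.
Qed.

Section orthogonal.
Variables (X : nat -> T -> R).
Hypothesis LX : forall n, L2 mu D (X n).
Hypothesis oX : forall n m, n != m -> \int[mu]_(x in D) (X n x * X m x) = 0.

Lemma orth_sum_mul N m : \int[mu]_(x in D) ((\sum_(n < N) X n x) * X m x) =
  if (m < N)%N then \int[mu]_(x in D) (X m x ^+ 2) else 0.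
Proof.
transitivity (\sum_(n < N) \int[mu]_(x in D) (X n x * X m x)).
  rewrite -(Rintegral_sum mD (F := fun n x => X n x * X m x)); last by move=> n _; exact: L2_mul.
  by apply: eq_Rintegral => x _; rewrite mulr_suml.
case: ifPn => mN.
  rewrite (bigD1 (Ordinal mN))//= big1 ?addr0; last by move=> i im; apply: oX.
  by apply: eq_Rintegral => x _; rewrite expr2.
rewrite big1// => i _; apply: oX; apply: contraNneq mN => <-; exact: ltn_ord.
Qed.

Lemma orth_sum_sqr N : \int[mu]_(x in D) ((\sum_(n < N) X n x) ^+ 2) =
  \sum_(n < N) \int[mu]_(x in D) (X n x ^+ 2).
Proof.
elim: N => [|N IH].
  rewrite big_ord0; under eq_Rintegral do rewrite big_ord0 expr0n.
  exact: Rintegral0.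
under eq_Rintegral do rewrite big_ord_recr/=.
rewrite Rint_sqrD//; last exact: L2_sum.
by rewrite IH orth_sum_mul ltnn mulr0 addr0 big_ord_recr.
Qed.

End orthogonal.

(** Expansion of the integral of (g - sum of c_n E_n)^2 >= 0. The minus sign is absorbed in [Y], so
    that the lemmas on orthogonal sums apply verbatim. *)
Lemma bessel (E : nat -> T -> R) g N : (forall n, L2 mu D (E n)) ->
  (forall n m, \int[mu]_(x in D) (E n x * E m x) = (n == m)%:R) -> L2 mu D g ->
  \sum_(n < N) (\int[mu]_(x in D) (g x * E n x)) ^+ 2 <= \int[mu]_(x in D) (g x ^+ 2).
Proof.
move=> LE oE Lg; pose c n := \int[mu]_(x in D) (g x * E n x).
pose Y n x := - c n * E n x.
have LY n : L2 mu D (Y n) by exact: L2Z.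
have oY n m : n != m -> \int[mu]_(x in D) (Y n x * Y m x) = 0.
  move=> nm; transitivity (c n * c m * \int[mu]_(x in D) (E n x * E m x)).
    by rewrite -RintegralZl//; [apply: eq_Rintegral => x _; rewrite /Y; ring|exact: L2_mul].
  by rewrite oE (negbTE nm) mulr0.
have Y2 n : \int[mu]_(x in D) (Y n x ^+ 2) = c n ^+ 2.
  transitivity (c n ^+ 2 * \int[mu]_(x in D) (E n x * E n x)).
    by rewrite -RintegralZl//; [apply: eq_Rintegral => x _; rewrite /Y; ring|exact: L2_mul].
  by rewrite oE eqxx mulr1.
have gY : \int[mu]_(x in D) (g x * \sum_(n < N) Y n x) = - \sum_(n < N) c n ^+ 2.
  transitivity (\sum_(n < N) \int[mu]_(x in D) (g x * Y n x)).
    rewrite -(Rintegral_sum mD (F := fun n x => g x * Y n x)); last by move=> n _; exact: L2_mul.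
    by apply: eq_Rintegral => x _; rewrite mulr_sumr.
  rewrite -sumrN; apply: eq_bigr => i _.
  transitivity (- c i * \int[mu]_(x in D) (g x * E i x)).
    by rewrite -RintegralZl//; [apply: eq_Rintegral => x _; rewrite /Y; ring|exact: L2_mul].
  by rewrite -/(c i); ring.
have LS : L2 mu D (fun x => \sum_(n < N) Y n x) by apply: L2_sum.
have : 0 <= \int[mu]_(x in D) ((g x + \sum_(n < N) Y n x) ^+ 2).
  by apply: Rintegral_ge0 => x _; rewrite sqr_ge0.
rewrite Rint_sqrD// gY (orth_sum_sqr LY oY).
have -> : \sum_(n < N) \int[mu]_(x in D) (Y n x ^+ 2) = \sum_(n < N) c n ^+ 2.
  by apply: eq_bigr => i _; exact: Y2.
by rewrite -/c; set A := \sum_(n < N) c n ^+ 2; rewrite -/A; lra.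
Qed.

(** The sum of 4^k g_k^2 has integral at most the sum of M 4^-k, so it is finite almost everywhere;
    there |g_k| is bounded by a multiple of 2^-k and the series converges absolutely. *)
Lemma ae_conv (g : nat -> T -> R) (M : R) : (forall k, L2 mu D (g k)) ->
  (forall k, \int[mu]_(x in D) (g k x ^+ 2) <= M * 16^-1 ^+ k) ->
  {ae mu, forall x, D x -> cvgn (series (fun k => g k x))}.
Proof.
move=> Lg gM.
have mg k : measurable_fun D (fun x => (4 ^+ k * g k x ^+ 2)%:E).
  by apply/measurable_EFinP; apply: measurable_funM => //; apply: measurable_funX; exact: (Lg k).1.
have g0 k x : D x -> (0 <= (4 ^+ k * g k x ^+ 2)%:E)%E.
  by move=> _; rewrite lee_fin mulr_ge0 ?sqr_ge0 ?exprn_ge0.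
have hk k : (\int[mu]_(x in D) (4 ^+ k * g k x ^+ 2)%:E <= (M * 4^-1 ^+ k)%:E)%E.
  have [_ gi] := Lg k.
  rewrite integral_Rintegral//; last exact: integrableZE.
  rewrite lee_fin RintegralZl//.
  apply: le_trans (ler_wpM2l _ (gM k)) _; first by rewrite exprn_ge0.
  rewrite mulrCA le_eqVlt; apply/orP; left; apply/eqP; congr (_ * _).
  by rewrite -exprMn; congr (_ ^+ _); field.
have sfin : (\sum_(0 <= k <oo) \int[mu]_(x in D) (4 ^+ k * g k x ^+ 2)%:E < +oo)%E.
  apply: le_lt_trans (lee_nneseries _ (fun k _ => hk k)) _.
    by move=> k _ _; apply: integral_ge0 => x; exact: g0.
  have c4 : cvgn (series (fun k => M * 4^-1 ^+ k)).
    by apply: is_cvg_geometric_series; rewrite ger0_norm; lra.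
  have -> : (\sum_(0 <= k <oo) (M * 4^-1 ^+ k)%:E =
      (limn (series (fun k => M * 4^-1 ^+ k)))%:E)%E.
    rewrite -EFin_lim//; congr (limn _); apply/funext => n /=.
    by rewrite sumEFin.
  by rewrite ltry.
rewrite -integral_nneseries// in sfin.
have mS : measurable_fun D (fun x => \sum_(0 <= k <oo) (4 ^+ k * g k x ^+ 2)%:E)%E.
  by apply: ge0_emeasurable_sum => // k x Dx _; exact: g0.
have Si : mu.-integrable D (fun x => \sum_(0 <= k <oo) (4 ^+ k * g k x ^+ 2)%:E)%E.
  apply/integrableP; split => //; apply: le_lt_trans sfin.
  rewrite le_eqVlt; apply/orP; left; apply/eqP; apply: eq_integral => x /set_mem Dx.
  by rewrite gee0_abs//; apply: nneseries_ge0 => k _ _; exact: g0.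
have := integrable_ae mD Si; apply: filterS => x /[swap] Dx /(_ Dx) xfin.
set S := (\sum_(0 <= k <oo) _)%E in xfin.
pose s := fine S.
(* From 4^k g_k^2 <= s <= (1 + s)^2; using 1 + s avoids a square root. *)
have gk k : `|g k x| <= (1 + s) * 2^-1 ^+ k.
  have S0 : (0 <= S)%E by apply: nneseries_ge0 => j _ _; exact: g0.
  have s0 : 0 <= s by exact: fine_ge0.
  have : ((4 ^+ k * g k x ^+ 2)%:E <= S)%E.
    rewrite /S (nneseriesD1 (n := k) (fun j _ => g0 j x Dx))//.
    by rewrite leeDl//; apply: nneseries_ge0 => j _ _; exact: g0.
  rewrite -(fineK xfin) lee_fin -/s => h.
  have h2 : (2 ^+ k * `|g k x|) ^+ 2 <= (1 + s) ^+ 2.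
    rewrite exprMn real_normK ?num_real// -exprM mulnC exprM.
    have -> : (2 ^+ 2 : R) = 4 by ring.
    by apply: le_trans h _; nra.
  have h3 : 2 ^+ k * `|g k x| <= 1 + s.
    by rewrite -(ler_pXn2r (n := 2)) ?nnegrE ?mulr_ge0 ?exprn_ge0 ?addr_ge0.
  by rewrite exprVn ler_pdivlMr ?exprn_gt0// mulrC.
apply: normed_cvg; apply: (@series_le_cvg _ _ (fun k => (1 + s) * 2^-1 ^+ k)).
- by move=> k /=.
- by move=> k /=; apply: le_trans (gk k).
- by move=> k /=; exact: gk.
- by apply: is_cvg_geometric_series; rewrite ger0_norm; lra.
Qed.

(** Fatou's lemma for the squares: a uniform L2 bound passes to an almost everywhere limit, with F
    equal to the limit only almost everywhere. *)
Lemma fatou_L2 (G : nat -> T -> R) (F : T -> R) (C : R) : (forall k, measurable_fun D (G k)) ->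
  measurable_fun D F -> {ae mu, forall x, D x -> G k x @[k --> \oo] --> F x} ->
  (forall k, (\int[mu]_(x in D) (G k x ^+ 2)%:E <= C%:E)%E) ->
  (\int[mu]_(x in D) (F x ^+ 2)%:E <= C%:E)%E.
Proof.
move=> mG mF GF GC.
have mG2 k : measurable_fun D (fun x => (G k x ^+ 2)%:E).
  by apply/measurable_EFinP; exact: measurable_funX.
have mL : measurable_fun D (fun x => limn_einf (fun k => (G k x ^+ 2)%:E)).
  have -> : (fun x => limn_einf (fun k => (G k x ^+ 2)%:E)) =
      (fun x => - limn_esup (fun k => - (G k x ^+ 2)%:E))%E.
    by apply/funext => x; rewrite -[LHS]oppeK -limn_esupN.
  apply: measurableT_comp => //.
  by apply: measurable_fun_limn_esup => k; exact: measurableT_comp.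
have -> : (\int[mu]_(x in D) (F x ^+ 2)%:E =
    \int[mu]_(x in D) limn_einf (fun k => (G k x ^+ 2)%:E))%E.
  apply: ae_eq_integral => //.
  - by apply/measurable_EFinP; exact: measurable_funX.
  apply: filterS GF => x + Dx => /(_ Dx) h.
  have h2 : (G k x ^+ 2)%:E @[k --> \oo] --> (F x ^+ 2)%:E.
    apply: cvg_EFin; first by near=> k.
    by rewrite expr2; exact: (cvgM h h).
  by rewrite (cvg_limn_einf_sup h2).1.
apply: le_trans (fatou _ mD mG2 _) _ => //.
  by move=> k x _; rewrite lee_fin sqr_ge0.
rewrite limn_einf_lim; apply: lime_le; first exact: is_cvg_einfs.
near=> n; apply: le_trans (GC n); apply: ereal_inf_lbound.
by exists n => /=.
Unshelve. all: by end_near. Qed.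

Section riesz_fischer.
Variables (X : nat -> T -> R) (M : R).
Hypothesis LX : forall n, L2 mu D (X n).
Hypothesis oX : forall n m, n != m -> \int[mu]_(x in D) (X n x * X m x) = 0.
Hypothesis sM : forall N, \sum_(n < N) \int[mu]_(x in D) (X n x ^+ 2) <= M.

Let S N x := \sum_(n < N) X n x.
Let s N := \sum_(n < N) \int[mu]_(x in D) (X n x ^+ 2).

Let LS N : L2 mu D (S N). Proof. by apply: L2_sum. Qed.

Let nd_s : nondecreasing_seq s.
Proof.
apply/nondecreasing_seqP => n; rewrite /s big_ord_recr/= lerDl.
by apply: Rintegral_ge0 => x _; rewrite sqr_ge0.
Qed.

Let cvg_s : cvgn s.
Proof. by apply: nondecreasing_is_cvgn => //; exists M => _ [n _ <-]; exact: sM. Qed.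

Let s_le N : s N <= limn s.
Proof. exact: nondecreasing_cvgn_le. Qed.

Let S_mul N K : (K <= N)%N -> \int[mu]_(x in D) (S N x * S K x) = s K.
Proof.
elim: K => [_|K IH KN].
  rewrite /s big_ord0 -[RHS](Rintegral0 mu D).
  by apply: eq_Rintegral => x _; rewrite /S big_ord0 mulr0.
transitivity (\int[mu]_(x in D) (S N x * S K x + S N x * X K x)).
  by apply: eq_Rintegral => x _; rewrite {2}/S big_ord_recr/= mulrDr.
rewrite RintegralD//; [|exact: L2_mul..].
by rewrite IH ?(ltnW KN)// (orth_sum_mul LX oX) KN /s big_ord_recr.
Qed.

Let S_diff N K : \int[mu]_(x in D) ((S N x - S K x) ^+ 2) = `|s N - s K|.
Proof.
wlog KN : N K / (K <= N)%N.
  move=> h; have [KN|NK] := leqP K N; first exact: h.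
  rewrite distrC -(h K N) ?(ltnW NK)//.
  by apply: eq_Rintegral => x _; ring.
rewrite ger0_norm ?subr_ge0 ?nd_s//.
transitivity (\int[mu]_(x in D) ((S N x + (- 1) * S K x) ^+ 2)).
  by apply: eq_Rintegral => x _; ring.
rewrite Rint_sqrD//; last exact: L2Z.
have -> : \int[mu]_(x in D) (S N x * (- 1 * S K x)) = - s K.
  transitivity (- 1 * \int[mu]_(x in D) (S N x * S K x)); last by rewrite S_mul// mulN1r.
  rewrite -RintegralZl//; last exact: L2_mul.
  by apply: eq_Rintegral => x _; ring.
have -> : \int[mu]_(x in D) ((- 1 * S K x) ^+ 2) = s K.
  transitivity (\int[mu]_(x in D) (S K x ^+ 2)); last exact: (orth_sum_sqr LX oX).
  by apply: eq_Rintegral => x _; ring.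
by rewrite (orth_sum_sqr LX oX) -/(s N); ring.
Qed.

(** Fatou's lemma bounds both F and its distance to the partial sums. The conclusion concerns
    pairings, along the whole sequence, because it is used to identify distributions. *)
Lemma riesz_fischer : exists F, [/\ L2 mu D F,
  \int[mu]_(x in D) (F x ^+ 2) <= M &
  forall phi, L2 mu D phi ->
    \int[mu]_(x in D) (S N x * phi x) @[N --> \oo] --> \int[mu]_(x in D) (F x * phi x)].
Proof.
(* Partial sums along Nk have geometrically small increments, hence converge almost everywhere. *)
have /choice[Nk HN] : forall k, exists N, limn s - s N <= 16^-1 ^+ k.
  move=> k; have e0 : 0 < 16^-1 ^+ k :> R by rewrite exprn_gt0// invr_gt0.
  have /cvgrPdist_le /(_ _ e0)[N _ /(_ N (leqnn N))/=] : s @ \oo --> limn s := cvg_s.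
  by rewrite ger0_norm ?subr_ge0 ?s_le// => h; exists N.
have dist k j N : (k <= j)%N -> limn s - s N <= 16^-1 ^+ j -> `|s N - s (Nk k)| <= 16^-1 ^+ k.
  move=> kj hN; have := HN k; have := s_le N; have := s_le (Nk k).
  have : 16^-1 ^+ j <= 16^-1 ^+ k :> R by rewrite ler_wiXn2l// ?invr_ge0//; lra.
  by move=> *; rewrite ler_norml; apply/andP; split; lra.
pose g k x := S (Nk k.+1) x - S (Nk k) x.
have Lg k : L2 mu D (g k) by exact: L2_B.
have gM k : \int[mu]_(x in D) (g k x ^+ 2) <= 1 * 16^-1 ^+ k.
  by rewrite mul1r S_diff; apply: dist (leqnSn k) (HN k.+1).
have Scv : {ae mu, forall x, D x -> exists l : R, S (Nk k) x @[k --> \oo] --> l}.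
  apply: filterS (ae_conv Lg gM) => x + Dx => /(_ Dx) /cvg_ex[l hl].
  exists (S (Nk 0) x + l).
  rewrite (_ : (fun k => _) = (fun k => S (Nk 0) x + series (fun k => g k x) k)).
    by apply: cvgD; [exact: cvg_cst|exact: hl].
  apply/funext => k; rewrite /series/= (telescope_sumr (fun k => S (Nk k) x))// addrC subrK//.
(* The upper limit is measurable without further argument and coincides with the limit wherever
   there is one. *)
pose F x := fine (limn_esup (fun k => (S (Nk k) x)%:E)).
have mF : measurable_fun D F.
  apply: (@measurableT_comp _ _ _ _ _ _ fine); first exact: fine_measurable.
  apply: measurable_fun_limn_esup => k; apply/measurable_EFinP; exact: (LS (Nk k)).1.
have FS : {ae mu, forall x, D x -> S (Nk k) x @[k --> \oo] --> F x}.
  apply: filterS Scv => x + Dx => /(_ Dx) [l hl].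
  have h2 : (S (Nk k) x)%:E @[k --> \oo] --> l%:E by apply: cvg_EFin; [near=> k|].
  by rewrite /F (cvg_limn_einf_sup h2).2.
have LF : (\int[mu]_(x in D) (F x ^+ 2)%:E <= M%:E)%E.
  apply: (fatou_L2 (G := fun k => S (Nk k))) => //; first by move=> k; exact: (LS _).1.
  move=> k; rewrite integral_Rintegral//; last exact: (LS _).2.
  by rewrite lee_fin (orth_sum_sqr LX oX); exact: sM.
have L2F : L2 mu D F by apply: L2P => //; apply: le_lt_trans LF _; rewrite ltry.
have Fk k : \int[mu]_(x in D) ((F x - S (Nk k) x) ^+ 2) <= 16^-1 ^+ k.
  rewrite -lee_fin -integral_Rintegral//; last by apply: (L2_B L2F (LS _)).2.
  apply: (fatou_L2 (G := fun j x => S (Nk (k + j)%N) x - S (Nk k) x)).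
  - by move=> j; exact: (L2_B (LS _) (LS _)).1.
  - exact: (L2_B L2F (LS _)).1.
  - apply: filterS FS => x + Dx => /(_ Dx) h.
    apply: cvgB; last exact: cvg_cst.
    rewrite (_ : (fun j => _) = (fun j => S (Nk (j + k)%N) x)); last first.
      by apply/funext => j; rewrite addnC.
    by rewrite (cvg_shiftn k (fun j => S (Nk j) x)).
  - move=> j; rewrite integral_Rintegral//; last by exact: (L2_B (LS _) (LS _)).2.
    by rewrite lee_fin S_diff; apply: dist (leq_addr j k) (HN _).
exists F; split => //.
  by rewrite -lee_fin -integral_Rintegral//; exact: L2F.2.
move=> phi Lphi; have [_ phi2] := Lphi.
set C := \int[mu]_(x in D) (phi x ^+ 2).
have C0 : 0 <= C by apply: Rintegral_ge0 => x _; rewrite sqr_ge0.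
have diffE N : \int[mu]_(x in D) (F x * phi x) - \int[mu]_(x in D) (S N x * phi x) =
    \int[mu]_(x in D) ((F x - S N x) * phi x).
  rewrite -RintegralB//; [|exact: L2_mul..].
  by apply: eq_Rintegral => x _; rewrite mulrBl.
apply/cvgrPdist_le => e e0.
have [k hk] : exists k, 4 * 16^-1 ^+ k * C <= e ^+ 2.
  have : (fun k => 4 * C * 16^-1 ^+ k) @ \oo --> (0 : R).
    have h : `|16^-1 : R| < 1 by rewrite ger0_norm; lra.
    exact: (cvg_geometric _ h).
  move=> /cvgrPdist_le /(_ (e ^+ 2)); rewrite exprn_gt0// => /(_ isT)[k _ /(_ k (leqnn k))/=].
  rewrite sub0r normrN => h; exists k; apply: le_trans h.
  by rewrite mulrAC ler_norm.
have e16 : 0 < 16^-1 ^+ k :> R by rewrite exprn_gt0// invr_gt0.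
have /cvgrPdist_le /(_ _ e16)[N0 _ HN0] : s @ \oo --> limn s := cvg_s.
exists N0 => // N /= N0N; rewrite diffE.
have hN : limn s - s N <= 16^-1 ^+ k.
  by have := HN0 N N0N; rewrite /= ger0_norm ?subr_ge0 ?s_le.
have LFN := L2_B L2F (LS N).
rewrite -(ler_pXn2r (n := 2)) ?nnegrE ?(ltW e0)// real_normK ?num_real//.
apply: le_trans (Rint_CS mD LFN Lphi) _; rewrite -/C.
apply: le_trans _ hk; apply: ler_wpM2r => //.
(* The detour through [S (Nk k)] gives two pieces of squared norm at most 16^-k each; with the
   factor 2 of (x + y)^2 <= 2 x^2 + 2 y^2 this makes 4 * 16^-k. *)
have -> : \int[mu]_(x in D) ((F x - S N x) ^+ 2) =
    \int[mu]_(x in D) (((F x - S (Nk k) x) + (S (Nk k) x - S N x)) ^+ 2).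
  by apply: eq_Rintegral => x _; ring.
apply: le_trans (Rint_sqr_le2 (L2_B L2F (LS _)) (L2_B (LS _) (LS _))) _.
rewrite S_diff distrC; have := Fk k; have := dist k k N (leqnn k) hN; lra.
Unshelve. all: by end_near. Qed.

End riesz_fischer.

End hilbert.

(** * The sine basis *)

Section sine_basis.
Context {R : realType}.
Notation mu := (@lebesgue_measure R).
Variable a : R.
Hypothesis a0 : 0 < a.

Let aa : - a <= a. Proof. by move: a0; lra. Qed.

Let contX (f : R -> R) j : continuous f -> continuous (fun z => f z ^+ j).
Proof. by move=> cf z; exact: (continuous_comp (cf z) (@exprn_continuous R j (f z))). Qed.

(** The frequencies for which the sine vanishes at both z = -a and z = a; the shift n + 1 excludes
    frequency 0. The cosines with the same frequencies, which carry the first z-derivatives, are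
    orthonormal too. *)
Definition lam n : R := n.+1%:R * pi / (2 * a).
Definition esin n (z : R) : R := (Num.sqrt a)^-1 * sin (lam n * (z + a)).
Definition ecos n (z : R) : R := (Num.sqrt a)^-1 * cos (lam n * (z + a)).

Let sa0 : Num.sqrt a != 0. Proof. by rewrite gt_eqF// sqrtr_gt0. Qed.
Let sa2 : (Num.sqrt a)^-1 * (Num.sqrt a)^-1 = a^-1.
Proof. by rewrite -invfM -expr2 sqr_sqrtr// ltW. Qed.

Lemma lam_gt0 n : 0 < lam n.
Proof. by rewrite /lam divr_gt0 ?mulr_gt0// pi_gt0. Qed.

Lemma lam2a n : lam n * (2 * a) = n.+1%:R * pi.
Proof. by rewrite /lam divfK// mulf_neq0 ?pnatr_eq0// gt_eqF. Qed.

Lemma sin_natpi n : sin (n%:R * pi) = 0 :> R.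
Proof. by rewrite mulr_natl -[_ *+ _]add0r (alternatingn (@sinDpi R)) sin0 mulr0. Qed.

Lemma is_derive_affine (f f' : R -> R) (c k b : R) (z : R) :
  (forall x : R, is_derive x 1 f (f' x)) ->
  is_derive z 1 (fun z => c * f (k * (z + b))) (c * (k * f' (k * (z + b)))).
Proof.
move=> df.
have h1 : is_derive z 1 (fun z : R => k * (z + b)) k.
  have h0 : is_derive z 1 (fun z : R => z + b) (1 + 0).
    by apply: is_deriveD.
  by have := @is_deriveZ _ _ _ (fun z : R => z + b) k _ _ _ h0; rewrite addr0 /GRing.scale/= mulr1.
have h2 := @is_derive1_comp _ f _ z _ _ (df (k * (z + b))) h1.
have h3 := @is_deriveZ _ _ _ (f \o (fun z : R => k * (z + b))) c _ _ _ h2.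
by move: h3; rewrite /GRing.scale/= (mulrC _ k).
Qed.

Lemma esin_derive n (z : R) : is_derive z 1 (esin n) (lam n * ecos n z).
Proof.
apply: (is_derive_eq (@is_derive_affine sin cos (Num.sqrt a)^-1 (lam n) a z (fun x => is_derive_sin x))).
by rewrite /ecos; ring.
Qed.

Lemma ecos_derive n (z : R) : is_derive z 1 (ecos n) (- lam n * esin n z).
Proof.
apply: (is_derive_eq (@is_derive_affine cos (fun x => - sin x) (Num.sqrt a)^-1 (lam n) a z
  (fun x => is_derive_cos x))).
by rewrite /esin; ring.
Qed.

Lemma esin_continuous n : continuous (esin n).
Proof. by move=> z; apply: differentiable_continuous; apply/derivable1_diffP; have [] := esin_derive n z. Qed.

Lemma ecos_continuous n : continuous (ecos n).
Proof. by move=> z; apply: differentiable_continuous; apply/derivable1_diffP; have [] := ecos_derive n z. Qed.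

Lemma esin_bound n z : `|esin n z| <= (Num.sqrt a)^-1.
Proof. by rewrite normrM ger0_norm ?invr_ge0// ler_piMr ?invr_ge0// sin_max. Qed.

Lemma ecos_bound n z : `|ecos n z| <= (Num.sqrt a)^-1.
Proof. by rewrite normrM ger0_norm ?invr_ge0// ler_piMr ?invr_ge0// cos_max. Qed.

Lemma esin_l n : esin n (- a) = 0.
Proof. by rewrite /esin addNr mulr0 sin0 mulr0. Qed.

Lemma esin_r n : esin n a = 0.
Proof.
by rewrite /esin (_ : a + a = 2 * a) ?lam2a ?sin_natpi ?mulr0//; ring.
Qed.

Let cos_int (k : R) : k != 0 -> sin (k * (2 * a)) = 0 ->
  \int[mu]_(z in `](- a), a[) cos (k * (z + a)) = 0.
Proof.
move=> k0 sk.
pose F (z : R) := k^-1 * sin (k * (z + a)).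
have dF (z : R) : is_derive z 1 F (cos (k * (z + a))).
  apply: (is_derive_eq (@is_derive_affine sin cos k^-1 k a z (fun x => is_derive_sin x))).
  by rewrite mulrA mulVf// mul1r.
have cF : {within `[- a, a], continuous F}.
  apply: continuous_subspaceT => z; apply: differentiable_continuous.
  by apply/derivable1_diffP; have [] := dF z.
have cc : {within `[- a, a], continuous (fun z => cos (k * (z + a)))}.
  apply: continuous_subspaceT => z; apply: differentiable_continuous.
  apply/derivable1_diffP.
  have [] := @is_derive_affine cos (fun x => - sin x) 1 k a z (fun x => is_derive_cos x).
  by rewrite (_ : (fun z => 1 * cos (k * (z + a))) = (fun z => cos (k * (z + a))))//; apply/funext => t; rewrite mul1r.
rewrite (FTC_oo aa cF (fun t _ => dF t) cc).
by rewrite /F addNr mulr0 sin0 (_ : a + a = 2 * a) ?sk ?mulr0 ?subrr//; ring.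
Qed.

Let lamB n m : sin ((lam n - lam m) * (2 * a)) = 0.
Proof.
by rewrite mulrBl !lam2a sinB !sin_natpi mul0r mulr0 subrr.
Qed.

Let lamD n m : sin ((lam n + lam m) * (2 * a)) = 0.
Proof.
by rewrite mulrDl !lam2a sinD !sin_natpi mul0r mulr0 addr0.
Qed.

Let cosi (k : R) : mu.-integrable `](- a), a[ (EFin \o (fun z => cos (k * (z + a)))).
Proof.
apply: integrable_continuous_oo; apply: continuous_subspaceT => z.
apply: differentiable_continuous; apply/derivable1_diffP.
have [] := @is_derive_affine cos (fun x => - sin x) 1 k a z (fun x => is_derive_cos x).
by rewrite (_ : (fun z => 1 * cos (k * (z + a))) = (fun z => cos (k * (z + a))))//; apply/funext => t; rewrite mul1r.
Qed.

Let lam_inj n m : n != m -> lam n - lam m != 0.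
Proof.
move=> nm; rewrite subr_eq0; apply: contra nm => /eqP h.
have : lam n * (2 * a) = lam m * (2 * a) by rewrite h.
by rewrite !lam2a => /(mulIf (lt0r_neq0 (@pi_gt0 R)))/eqP; rewrite eqr_nat eqSS.
Qed.

Let cosBi n m : \int[mu]_(z in `](- a), a[) cos ((lam n - lam m) * (z + a)) =
  2 * a * (n == m)%:R.
Proof.
have [->|nm] := eqVneq n m; last by rewrite cos_int ?lam_inj// mulr0.
under eq_Rintegral do rewrite subrr mul0r cos0.
rewrite Rint_cst_oo// (_ : true%:R = 1 :> R)//; ring.
Qed.

Let cosDi n m : \int[mu]_(z in `](- a), a[) cos ((lam n + lam m) * (z + a)) = 0.
Proof. by rewrite cos_int// gt_eqF// addr_gt0 ?lam_gt0. Qed.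

Let cosBE n m z : cos ((lam n - lam m) * (z + a)) =
  cos (lam n * (z + a)) * cos (lam m * (z + a)) + sin (lam n * (z + a)) * sin (lam m * (z + a)).
Proof. by rewrite mulrBl cosB. Qed.

Let cosDE n m z : cos ((lam n + lam m) * (z + a)) =
  cos (lam n * (z + a)) * cos (lam m * (z + a)) - sin (lam n * (z + a)) * sin (lam m * (z + a)).
Proof. by rewrite mulrDl cosD. Qed.

(** Product-to-sum formulas: the cosine of frequency lam n + lam m, or of lam n - lam m when n and m
    differ, has integral zero, since its primitive vanishes at both ends. *)
Lemma esin_orth n m : \int[mu]_(z in `](- a), a[) (esin n z * esin m z) = (n == m)%:R.
Proof.
transitivity (\int[mu]_(z in `](- a), a[) ((2 * a)^-1 * (cos ((lam n - lam m) * (z + a)) -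
   cos ((lam n + lam m) * (z + a))))).
  apply: eq_Rintegral => z _; rewrite /esin mulrACA sa2 cosBE cosDE; field.
  by rewrite gt_eqF.
rewrite RintegralZl//; last by apply: integrableBE.
by rewrite RintegralB// cosBi cosDi subr0 mulKf// mulf_neq0 ?pnatr_eq0// gt_eqF.
Qed.

Lemma ecos_orth n m : \int[mu]_(z in `](- a), a[) (ecos n z * ecos m z) = (n == m)%:R.
Proof.
transitivity (\int[mu]_(z in `](- a), a[) ((2 * a)^-1 * (cos ((lam n - lam m) * (z + a)) +
   cos ((lam n + lam m) * (z + a))))).
  apply: eq_Rintegral => z _; rewrite /ecos mulrACA sa2 cosBE cosDE; field.
  by rewrite gt_eqF.
rewrite RintegralZl//; last by apply: integrableDE.
by rewrite RintegralD// cosBi cosDi addr0 mulKf// mulf_neq0 ?pnatr_eq0// gt_eqF.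
Qed.

Lemma esin_measurable (D : set R) n : measurable_fun D (esin n).
Proof. by apply: measurable_funTS; apply: continuous_measurable_fun; exact: esin_continuous. Qed.

Lemma ecos_measurable (D : set R) n : measurable_fun D (ecos n).
Proof. by apply: measurable_funTS; apply: continuous_measurable_fun; exact: ecos_continuous. Qed.

(** * Completeness of the sines among integrable functions *)

Section completeness.

Let th (z : R) : R := pi / (2 * a) * (z + a).
(** Increasing from 0 to 1 along the interval and affine in cos(th z): a polynomial in y is a
    polynomial in the cosine, and comparing z with z0 amounts to comparing y z with y z0. *)
Let y (z : R) : R := (1 - cos (th z)) / 2.

Let th_range z : - a < z < a -> 0 < th z < pi.
Proof.
move=> /andP[az za]; have pi0 := @pi_gt0 R; apply/andP; split.
  by rewrite /th mulr_gt0 ?divr_gt0 ?mulr_gt0//; lra.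
have a2 : 2 * a != 0 by rewrite mulf_neq0 ?pnatr_eq0// gt_eqF.
have piE : pi / (2 * a) * (a + a) = pi by rewrite (_ : a + a = 2 * a) ?divfK//; ring.
by rewrite -[ltRHS]piE /th ltr_pM2l ?divr_gt0 ?mulr_gt0// ltrD2r.
Qed.

Let th_mono s t : s < t -> th s < th t.
Proof. by move=> st; rewrite /th ltr_pM2l ?divr_gt0 ?mulr_gt0 ?pi_gt0// ltrD2r. Qed.

Let y_mono s t : - a < s -> s < t -> t < a -> y s < y t.
Proof.
move=> as_ st ta.
have /andP[s0 spi] : 0 < th s < pi by apply: th_range; rewrite as_ (lt_trans st ta).
have /andP[t0 tpi] : 0 < th t < pi by apply: th_range; rewrite ta (lt_trans as_ st).
have : cos (th t) < cos (th s) by rewrite ltr_cos ?in_itv/= ?(ltW s0) ?(ltW t0) ?(ltW spi) ?(ltW tpi)// th_mono.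
by rewrite /y; lra.
Qed.

Let y_range z : - a < z < a -> 0 < y z < 1.
Proof.
move=> zr; have /andP[t0 tpi] := th_range zr.
have pi0 := @pi_gt0 R.
have h1 : cos (th z) < cos 0 by rewrite ltr_cos ?in_itv/= ?lexx ?(ltW t0) ?(ltW tpi) ?(ltW pi0).
have h2 : cos pi < cos (th z) by rewrite ltr_cos ?in_itv/= ?lexx ?(ltW t0) ?(ltW tpi) ?(ltW pi0).
by rewrite cos0 in h1; rewrite cospi in h2; rewrite /y; apply/andP; split; lra.
Qed.

Let th_continuous : continuous th.
Proof.
move=> z; apply: cvgM; first exact: cvg_cst.
by apply: cvgD; [exact: cvg_id|exact: cvg_cst].
Qed.

Let costh_continuous : continuous (fun z => cos (th z)).
Proof. by move=> z; apply: (continuous_comp (@th_continuous z)); exact: continuous_cos. Qed.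

Let sinth_continuous (k : R) : continuous (fun z => sin (k * th z)).
Proof.
move=> z; apply: (@continuous_comp _ _ _ (fun z => k * th z)); last exact: continuous_sin.
by apply: cvgM; [exact: cvg_cst|exact: th_continuous].
Qed.

Let bnd n m (x : R) : 0 <= x <= 1 -> 0 <= (1 - x ^+ n) ^+ m <= 1.
Proof.
move=> /andP[x0 x1].
have h0 : 0 <= x ^+ n by exact: exprn_ge0.
have h1 : x ^+ n <= 1 by exact: exprn_ile1.
by rewrite exprn_ge0 ?exprn_ile1//; lra.
Qed.

Let bernoulli_lo (t : R) m : 0 <= t <= 1 -> 1 - m%:R * t <= (1 - t) ^+ m.
Proof.
move=> /andP[t0 t1]; elim: m => [|m IH]; first by rewrite mul0r subr0 expr0.
rewrite exprS -[m.+1%:R]natr1.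
have h : (1 - t) * (1 - m%:R * t) <= (1 - t) * (1 - t) ^+ m by rewrite ler_wpM2l// subr_ge0.
apply: le_trans h; have : 0 <= m%:R * t ^+ 2 by rewrite mulr_ge0 ?sqr_ge0.
by nra.
Qed.

Let bernoulli_hi (t : R) m : 0 <= t <= 1 -> (1 - t) ^+ m <= (1 + m%:R * t)^-1.
Proof.
move=> /andP[t0 t1].
have mt : 0 <= m%:R * t by rewrite mulr_ge0.
rewrite -[leRHS]mul1r ler_pdivlMr; last by lra.
have h : 1 + m%:R * t <= (1 + t) ^+ m.
  elim: m {mt} => [|m IH]; first by rewrite mul0r addr0 expr0.
  rewrite exprS -[m.+1%:R]natr1.
  have h : (1 + t) * (1 + m%:R * t) <= (1 + t) * (1 + t) ^+ m by rewrite ler_wpM2l//; lra.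
  apply: le_trans h; have : 0 <= m%:R * t ^+ 2 by rewrite mulr_ge0 ?sqr_ge0.
  by nra.
have h1 : 0 <= (1 - t) ^+ m by rewrite exprn_ge0// subr_ge0.
apply: le_trans (ler_wpM2l h1 h) _.
rewrite -exprMn exprn_ile1//; nra.
Qed.

(* For [0 < c < 1], [(1 - x^n)^(c^-n)] tends to 1 when [x < c] and to 0 when
   [x > c], boundedly: this approximates indicators by polynomials. *)
Let step n (c x : R) : R := (1 - x ^+ n) ^+ (Num.truncn (c^-1 ^+ n)).

(** Bernoulli's inequality: with m the truncation of c^-n, (1 - x^n)^m >= 1 - m x^n >= 1 -
    (x/c)^n. *)
Let step_lt (c x : R) : 0 < c < 1 -> 0 <= x < c -> step n c x @[n --> \oo] --> (1 : R).
Proof.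
move=> /andP[c0 c1] /andP[x0 xc].
have q0 : 0 <= x / c by rewrite divr_ge0// ltW.
have q1 : x / c < 1 by rewrite ltr_pdivrMr// mul1r.
have lo n : 1 - (x / c) ^+ n <= step n c x <= 1.
  have xr : 0 <= x ^+ n <= 1 by rewrite exprn_ge0 ?exprn_ile1//; lra.
  have /andP[_ h1] := @bnd n (Num.truncn (c^-1 ^+ n)) x (introT andP (conj x0 (ltW (lt_trans xc c1)))).
  rewrite /step h1 andbT; apply: le_trans (bernoulli_lo _ xr).
  rewrite lerD2l lerN2 exprMn mulrC ler_wpM2l//; first by case/andP : xr.
  by rewrite truncn_le// exprn_ge0 ?invr_ge0// ltW.
apply: (@squeeze_cvgr _ _ _ _ (fun n => 1 - (x / c) ^+ n) (fun=> 1)).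
- by near=> n; exact: lo.
- rewrite -[X in _ --> X]subr0; apply: cvgB; first exact: cvg_cst.
  by apply: cvg_expr; rewrite ger0_norm.
- exact: cvg_cst.
Unshelve. all: by end_near. Qed.

(** With m the truncation of c^-n, the power is at most 1 / (1 + m x^n), and 1 + m x^n >= (m + 1)
    x^n >= (x/c)^n because m + 1 exceeds c^-n. *)
Let step_gt (c x : R) : 0 < c < 1 -> c < x < 1 -> step n c x @[n --> \oo] --> (0 : R).
Proof.
move=> /andP[c0 c1] /andP[cx x1].
have x0 : 0 < x by exact: lt_trans cx.
have xc0 : 0 < c / x by rewrite divr_gt0.
have q1 : c / x < 1 by rewrite ltr_pdivrMr// mul1r.
have hi n : 0 <= step n c x <= (c / x) ^+ n.
  have xr : 0 <= x ^+ n <= 1 by rewrite exprn_ge0 ?exprn_ile1 ?ltW.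
  have /andP[h0 _] := @bnd n (Num.truncn (c^-1 ^+ n)) x (introT andP (conj (ltW x0) (ltW x1))).
  rewrite /step h0/=; apply: le_trans (bernoulli_hi _ xr) _.
  rewrite -[leRHS]invrK lef_pV2 ?posrE ?invr_gt0 ?exprn_gt0//; last first.
    by rewrite ltr_wpDr// mulr_ge0//; case/andP : xr.
  rewrite -exprVn invf_div exprMn mulrC.
  have : c^-1 ^+ n < (Num.truncn (c^-1 ^+ n)).+1%:R by exact: truncnS_gt.
  rewrite -natr1 => h.
  have /andP[xn0 xn1] := xr.
  apply: (@le_trans _ _ (((Num.truncn (c^-1 ^+ n))%:R + 1) * x ^+ n)).
    by rewrite ler_wpM2r// ltW.
  by rewrite mulrDl mul1r addrC lerD2r.
apply: (@squeeze_cvgr _ _ _ _ (fun=> 0) (fun n => (c / x) ^+ n)).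
- by near=> n; exact: hi.
- exact: cvg_cst.
- by apply: cvg_expr; rewrite ger0_norm ?ltW.
Unshelve. all: by end_near. Qed.

Variable g : R -> R.
Hypothesis gi : mu.-integrable `](- a), a[ (EFin \o g).
Hypothesis g0 : forall n, \int[mu]_(z in `](- a), a[) (g z * esin n z) = 0.

Let gmul (k : R -> R) : continuous k -> (exists M, forall z, - a < z < a -> `|k z| <= M) ->
  mu.-integrable `](- a), a[ (EFin \o (fun z => g z * k z)).
Proof.
move=> ck [M kM]; apply: (@integrable_mulbnd _ _ R mu _ _ g k M) => //.
by apply: measurable_funTS; exact: continuous_measurable_fun.
Qed.

Let sin_moment (k : nat) : \int[mu]_(z in `](- a), a[) (g z * sin (k%:R * th z)) = 0.
Proof.
case: k => [|k].
  by under eq_Rintegral do rewrite mul0r sin0 mulr0; exact: Rintegral0.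
have := g0 k.
have -> : \int[mu]_(z in `](- a), a[) (g z * esin k z) =
    (Num.sqrt a)^-1 * \int[mu]_(z in `](- a), a[) (g z * sin (k.+1%:R * th z)).
  rewrite -RintegralZl//; last first.
    apply: gmul; first exact: sinth_continuous.
    by exists 1 => z _; exact: sin_max.
  by apply: eq_Rintegral => z _; rewrite /esin /lam /th !mulrA; ring.
by move=> /eqP; rewrite mulf_eq0 invr_eq0 (negbTE sa0)/= => /eqP.
Qed.

Let sc_cont (k : R) j : continuous (fun z => sin (k * th z) * cos (th z) ^+ j).
Proof.
move=> z; apply: cvgM; first exact: sinth_continuous.
by apply: contX; exact: costh_continuous.
Qed.

Let sc_bnd (k : R) j : exists M, forall z, - a < z < a -> `|sin (k * th z) * cos (th z) ^+ j| <= M.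
Proof.
by exists 1 => z _; rewrite normrM mulr_ile1 ?sin_max// normrX exprn_ile1// cos_max.

Qed.

(** Each factor cos(th) is removed by 2 sin(k th) cos(th) = sin((k+1) th) + sin((k-1) th), so that
    only pure sine moments remain. *)
Let sincos_moment j (k : nat) :
  \int[mu]_(z in `](- a), a[) (g z * (sin (k%:R * th z) * cos (th z) ^+ j)) = 0.
Proof.
elim: j k => [|j IH] k.
  by rewrite -[RHS](sin_moment k); apply: eq_Rintegral => z _; rewrite expr0 mulr1.
case: k => [|k].
  by under eq_Rintegral do rewrite mul0r sin0 mul0r mulr0; exact: Rintegral0.
transitivity (\int[mu]_(z in `](- a), a[)
   (2^-1 * (g z * (sin (k.+2%:R * th z) * cos (th z) ^+ j)) +
    2^-1 * (g z * (sin (k%:R * th z) * cos (th z) ^+ j)))).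
  apply: eq_Rintegral => z _.
  rewrite (_ : k.+2%:R * th z = k.+1%:R * th z + th z); last by rewrite -natr1 mulrDl mul1r.
  rewrite (_ : k%:R * th z = k.+1%:R * th z - th z); last by rewrite -natr1 mulrDl mul1r addrK.
  by rewrite sinD sinB exprS; field.
have i1 l : mu.-integrable `](- a), a[ (EFin \o (fun z => g z * (sin (l * th z) * cos (th z) ^+ j))).
  by apply: gmul; [exact: sc_cont|exact: sc_bnd].
rewrite RintegralD//; [|exact: integrableZE..].
by rewrite !RintegralZl// !IH !mulr0 addr0.
Qed.

Let poly_moment (p : {poly R}) :
  \int[mu]_(z in `](- a), a[) (g z * (sin (th z) * p.[cos (th z)])) = 0.
Proof.
have i1 j : mu.-integrable `](- a), a[ (EFin \o (fun z => g z * (sin (1 * th z) * cos (th z) ^+ j))).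
  by apply: gmul; [exact: sc_cont|exact: sc_bnd].
transitivity (\int[mu]_(z in `](- a), a[) \sum_(j < size p)
  (p`_j * (g z * (sin (1 * th z) * cos (th z) ^+ j)))).
  apply: eq_Rintegral => z _; rewrite horner_coef mulr_sumr mulr_sumr.
  by apply: eq_bigr => j _; rewrite mul1r; ring.
have E := @Rintegral_sum _ _ R mu `](- a), a[ (measurable_itv _) (size p)
  (fun j z => p`_j * (g z * (sin (1 * th z) * cos (th z) ^+ j))).
rewrite E => [|j _]; last exact: integrableZE.
apply: big1 => j _; rewrite RintegralZl//.
by have := sincos_moment j 1; rewrite mulr1n => ->; rewrite mulr0.
Qed.

(** g sin(th) is orthogonal to every polynomial in cos(th), in particular to the polynomial steps
    with threshold c = y z0; these converge boundedly to the indicator of z < z0. *)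
Let moment_lt z0 : - a < z0 < a ->
  \int[mu]_(z in `](- a), z0[) (g z * sin (1 * th z)) = 0.
Proof.
move=> z0r; pose c := y z0; have c01 : 0 < c < 1 := y_range z0r.
have gsi : mu.-integrable `](- a), a[ (EFin \o (fun z => g z * sin (1 * th z))).
  by apply: gmul; [exact: sinth_continuous|exists 1 => z _; exact: sin_max].
have stepc n : continuous (fun z => step n c (y z)).
  have cy : continuous y.
    move=> z; apply: cvgM; last exact: cvg_cst.
    by apply: cvgB; [exact: cvg_cst|exact: costh_continuous].
  have c1 : continuous (fun z => y z ^+ n) by exact: contX.
  have c2 : continuous (fun z => 1 - y z ^+ n).
    by move=> z; apply: cvgB; [exact: cvg_cst|exact: c1].
  exact: (@contX _ (Num.truncn (c^-1 ^+ n)) c2).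
have stepb n z : - a < z < a -> `|step n c (y z)| <= 1.
  move=> /y_range/andP[y0 y1]; have /andP[h0 h1] := @bnd n (Num.truncn (c^-1 ^+ n)) (y z) (introT andP (conj (ltW y0) (ltW y1))).
  by rewrite ger0_norm.
have step0 n : \int[mu]_(z in `](- a), a[) (g z * sin (1 * th z) * step n c (y z)) = 0.
  rewrite -[RHS](poly_moment ((1 - (2^-1 *: (1 - 'X)) ^+ n) ^+ (Num.truncn (c^-1 ^+ n)))).
  apply: eq_Rintegral => z _; rewrite -mulrA; congr (_ * (_ * _)); first by rewrite mul1r.
  by rewrite /step /y !(hornerE, horner_exp) mulrC.
have mi : measurable_fun `](- a), a[ (fun z => g z * sin (1 * th z) * \1_(`](- a), z0[) z).
  by apply: measurable_funM => //; exact: measurable_int_fun gsi.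
transitivity (\int[mu]_(z in `](- a), a[) (g z * sin (1 * th z) * \1_(`](- a), z0[) z)).
  rewrite [LHS]Rintegral_mkcond [RHS]Rintegral_mkcond; congr Rintegral.
  apply/funext => z; rewrite !patchE indicE !mem_setE.
  have /andP[_ z0a] := z0r.
  case: ifPn => [/(subset_oo (lexx _) (ltW z0a)) h|]; last by rewrite mulr0; case: ifP.
  by rewrite (_ : z \in `](- a), a[) ?mulr1.
have [] := @dominated_convergence _ _ R mu `](- a), a[ _
  (fun n z => (g z * sin (1 * th z) * step n c (y z))%:E)
  (fun z => (g z * sin (1 * th z) * \1_(`](- a), z0[) z)%:E) (fun z => (`|g z * sin (1 * th z)|)%:E) => //.
- move=> n; apply/measurable_EFinP; apply: measurable_funM; first exact: measurable_int_fun gsi.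
  by apply: measurable_funTS; apply: continuous_measurable_fun; exact: stepc.
- exact/measurable_EFinP.
(* The steps need not converge at z0, where y z = c; that single point is the exceptional set. *)
- exists [set z0]; split; [exact: measurable_set1|exact: (lebesgue_measure_set1 z0)|].
  move=> z /= hz; apply: contrapT => zz0; apply: hz; rewrite in_itv/= => zr.
  apply: cvg_EFin; first by near=> n.
  apply: cvgM; first exact: cvg_cst.
  have /andP[az za] := zr; have /andP[az0 z0a] := z0r; have /andP[y0 y1] := y_range zr.
  rewrite indicE mem_setE in_itv/= az/=; have [zlt|zgt] := ltP z z0.
    by apply: step_lt => //; rewrite (ltW y0)/=; exact: y_mono.
  apply: step_gt => //; rewrite y1 andbT; apply: y_mono => //.
  by rewrite lt_neqAle zgt andbT; apply/eqP => h; apply: zz0.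
- exact: integrable_norm.
- apply: ae_all => z n /=; rewrite in_itv/= => zr.
  by rewrite lee_fin normrM ler_piMr// stepb.
move=> _ _ lim; rewrite /Rintegral.
have := cvg_lim (@ereal_hausdorff R) lim => <-.
rewrite (_ : [sequence _]_n = fun=> 0%E); first by rewrite lim_cst.
apply/funext => n /=.
have := step0 n; rewrite /Rintegral => /eqP; rewrite fine_eq0; first by move/eqP.
apply: integrable_fin_num => //.
apply: (@integrable_mulbnd _ _ R mu _ _ _ _ 1) => //.
- by apply: measurable_funTS; apply: continuous_measurable_fun; exact: stepc.
- by move=> z /=; rewrite in_itv/= => /stepb.
Unshelve. all: by end_near. Qed.

(** Differences of the integrals up to z0 show that g sin(th) has integral zero over every interval,
    so it vanishes almost everywhere; sin(th) is positive inside the interval. *)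
Lemma esin_complete : {ae mu, forall z, - a < z < a -> g z = 0}.
Proof.
have gsi : mu.-integrable `](- a), a[ (EFin \o (fun z => g z * sin (1 * th z))).
  by apply: gmul; [exact: sinth_continuous|exists 1 => z _; exact: sin_max].
have : {ae mu, forall z, - a < z < a -> g z * sin (1 * th z) = 0}.
  apply: ae0_of_intervals => // s t as_ st ta.
  have := moment_lt (introT andP (conj (lt_trans as_ st) ta)).
  rewrite (Rint_oo_split (ltW as_) (ltW st)); last first.
    exact: integrable_sub_oo (lexx _) (ltW ta) gsi.
  by rewrite moment_lt ?add0r// as_ (lt_trans st ta).
apply: ae_imp => z + zr => /(_ zr) /eqP; rewrite mulf_eq0 => /orP[/eqP//|].
by rewrite mul1r gt_eqF// sin_gt0_pi// th_range.
Qed.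

End completeness.
End sine_basis.

(** * Hardy's inequality *)

Section hardy.
Context {R : realType}.
Notation mu := (@lebesgue_measure R).
Implicit Types (f k : R -> R) (x y r s p q g : R).

Lemma eq_Rint_oo x y (f k : R -> R) : (forall t, x < t < y -> f t = k t) ->
  \int[mu]_(t in `]x, y[) f t = \int[mu]_(t in `]x, y[) k t.
Proof. by move=> fk; apply: eq_Rintegral => t; rewrite inE/= in_itv/=; exact: fk. Qed.

Lemma eq_integrable_oo x y (f k : R -> R) : (forall t, x < t < y -> f t = k t) ->
  mu.-integrable `]x, y[ (EFin \o f) -> mu.-integrable `]x, y[ (EFin \o k).
Proof.
by move=> fk; apply: eq_integrable => // t; rewrite inE/= in_itv/= => /fk ->.
Qed.

Lemma le_Rint_oo x y (f k : R -> R) : mu.-integrable `]x, y[ (EFin \o f) ->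
  mu.-integrable `]x, y[ (EFin \o k) -> (forall t, x < t < y -> f t <= k t) ->
  \int[mu]_(t in `]x, y[) f t <= \int[mu]_(t in `]x, y[) k t.
Proof.
by move=> fi ki fk; apply: le_Rintegral => // t; rewrite /= in_itv/=; exact: fk.
Qed.

Lemma integrable_dom_oo x y (f k : R -> R) : measurable_fun `]x, y[ f ->
  (forall t, x < t < y -> `|f t| <= k t) -> mu.-integrable `]x, y[ (EFin \o k) ->
  mu.-integrable `]x, y[ (EFin \o f).
Proof.
by move=> mf fk; apply: integrable_dom => // t; rewrite /= in_itv/=; exact: fk.
Qed.

Lemma integral_exhaust x y f (C : \bar R) : measurable_fun `]x, y[ f ->
  (forall t, x < t < y -> 0 <= f t) ->
  (forall d, x < d < y -> (\int[mu]_(t in `]d, y[) (f t)%:E <= C)%E) -> (0 <= C)%E ->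
  (\int[mu]_(t in `]x, y[) (f t)%:E <= C)%E.
Proof.
move=> mf f0 fC C0.
have sub i : `[x + i.+1%:R^-1, y[ `<=` (`]x, y[ : set R).
  move=> t /=; rewrite !in_itv/= => /andP[xt ->]; rewrite andbT (lt_le_trans _ xt)//.
  by rewrite ltrDl invr_gt0.
have nd : {homo (fun i : nat => `[x + i.+1%:R^-1, y[%classic) : n m / (n <= m)%N >-> (n <= m)%O}.
  move=> n m nm; rewrite subsetEset => t /=; rewrite !in_itv/= => /andP[xt ->]; rewrite andbT.
  by rewrite (le_trans _ xt)// lerD2l lef_pV2 ?posrE// ler_nat.
have cv := @ge0_nondecreasing_set_cvg_integral _ (measurableTypeR R) R
  (fun i : nat => `[x + i.+1%:R^-1, y[%classic) (EFin \o f) mu nd (fun i => measurable_itv _).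
rewrite itv_open_bnd_bigcup -(cvg_lim _ (cv _ _))//.
- apply: lime_le; last first.
    apply: nearW => i; have [yx|xy] := leP y (x + i.+1%:R^-1).
      by rewrite set_itv_ge ?integral_set0// bnd_simp -leNgt.
    rewrite integral_itv_bndoo; last first.
      apply/measurable_EFinP; apply: measurable_funS mf => //.
      apply: subset_trans (sub i); exact: subset_itv_oo_co.
    by apply: fC; rewrite xy ltrDl invr_gt0 ltr0n.
  apply/cvg_ex; eexists; apply: cv => //.
  + by move=> i; apply: measurable_funS (sub i) _ => //; exact/measurable_EFinP.
  + by move=> i t /sub; rewrite /= in_itv/= => xty; rewrite lee_fin f0.
- by move=> i; apply: measurable_funS (sub i) _ => //; exact/measurable_EFinP.
- by move=> i t /sub; rewrite /= in_itv/= => xty; rewrite lee_fin f0.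
Qed.

(** Nothing is assumed integrable up to x: a bound uniform in the cut-off d yields, by monotone
    convergence, integrability and the estimate together. Weights singular at 0 are treated in this
    way. *)
Lemma Rint_exhaust x y f (C : R) : measurable_fun `]x, y[ f ->
  (forall t, x < t < y -> 0 <= f t) -> 0 <= C ->
  (forall d, x < d < y -> mu.-integrable `]d, y[ (EFin \o f) /\
    \int[mu]_(t in `]d, y[) f t <= C) ->
  mu.-integrable `]x, y[ (EFin \o f) /\ \int[mu]_(t in `]x, y[) f t <= C.
Proof.
move=> mf f0 C0 fC.
have le : (\int[mu]_(t in `]x, y[) (f t)%:E <= C%:E)%E.
  apply: integral_exhaust => // d xdy; have [fi fle] := fC _ xdy.
  by rewrite integral_Rintegral// lee_fin.
have fi : mu.-integrable `]x, y[ (EFin \o f).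
  apply: ge0_integrable; [exact: mf| |exact: le_lt_trans le (ltry _)].
  by move=> t; rewrite /= in_itv/= => /f0.
by split => //; rewrite -lee_fin -integral_Rintegral.
Qed.

Lemma le_Rint_sub x y x' y' f : x <= x' -> y' <= y ->
  mu.-integrable `]x, y[ (EFin \o f) -> (forall t, x < t < y -> 0 <= f t) ->
  \int[mu]_(t in `]x', y'[) f t <= \int[mu]_(t in `]x, y[) f t.
Proof.
move=> xx yy fi f0; rewrite -lee_fin -!integral_Rintegral//; last exact: integrable_sub_oo fi.
apply: ge0_subset_integral => //.
- exact: (measurable_int _ fi).
- exact: subset_oo.
Qed.

Lemma powM r p q : 0 < r -> r `^ p * r `^ q = r `^ (p + q).
Proof. by move=> r0; rewrite powRD// (gt_eqF r0) implybT. Qed.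

Lemma powE r n : 0 < r -> r ^+ n = r `^ n%:R.
Proof. by move=> r0; rewrite powR_mulrn// ltW. Qed.

Lemma pow_sqr r p : 0 < r -> (r `^ (p / 2)) ^+ 2 = r `^ p.
Proof. by move=> r0; rewrite expr2 powM// -splitr. Qed.

Lemma pow_le p r s : 0 <= p -> 0 < r -> r <= s -> r `^ p <= s `^ p.
Proof. by move=> p0 r0 rs; rewrite ge0_ler_powR// nnegrE ltW// (lt_le_trans r0). Qed.

Lemma pow_anti p r s : p <= 0 -> 0 < r -> r <= s -> s `^ p <= r `^ p.
Proof.
move=> p0 r0 rs; rewrite -[p]opprK (powRN s (- p)) (powRN r (- p)).
by rewrite lef_pV2 ?posrE ?powR_gt0 ?(lt_le_trans r0)// pow_le// oppr_ge0.
Qed.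

Lemma pow_cont_at p r : 0 < r -> {for r, continuous (fun s : R => s `^ p)}.
Proof.
move=> r0; apply: differentiable_continuous; apply/derivable1_diffP.
by have := is_derive1_powR p r0; case.
Qed.

Lemma pow_continuous p x y : 0 < x -> {within `[x, y], continuous (fun s : R => s `^ p)}.
Proof.
move=> x0; apply: continuous_in_subspaceT => t; rewrite inE/= in_itv/= => /andP[xt _].
by apply: pow_cont_at; exact: lt_le_trans xt.
Qed.

Lemma pow_int p x y : p + 1 != 0 -> 0 < x -> x <= y ->
  \int[mu]_(s in `]x, y[) s `^ p = (y `^ (p + 1) - x `^ (p + 1)) / (p + 1).
Proof.
move=> p1 x0 xy.
have FT := @FTC_oo R x y (fun s => (p + 1)^-1 * s `^ (p + 1)) (fun s => s `^ p) xy.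
apply: etrans (FT _ _ _) _; last by rewrite mulrBl mulrC [X in _ - X]mulrC.
- apply: continuous_in_subspaceT => t; rewrite inE/= in_itv/= => /andP[xt _].
  by apply: cvgM; [exact: cvg_cst|apply: pow_cont_at; exact: lt_le_trans xt].
- move=> t /andP[xt _]; have t0 := lt_trans x0 xt.
  have h := is_derive1_powR (p + 1) t0.
  have := @is_deriveZ _ _ _ (fun s : R => s `^ (p + 1)) (p + 1)^-1 t 1 _ h.
  by rewrite /GRing.scale/= mulrA mulVf// mul1r addrK.
- exact: pow_continuous.
Qed.

Lemma pow_int0 p y : 0 < p + 1 -> 0 < y ->
  mu.-integrable `]0, y[ (EFin \o (fun s => s `^ p)) /\
  \int[mu]_(s in `]0, y[) s `^ p <= y `^ (p + 1) / (p + 1).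
Proof.
move=> p1 y0; apply: Rint_exhaust => //.
- by apply: measurable_funTS; exact: measurable_powR.
- by move=> t _; exact: powR_ge0.
- by rewrite divr_ge0 ?powR_ge0// ltW.
- move=> d /andP[d0 dy]; split.
    by apply: integrable_continuous_oo; exact: pow_continuous.
  rewrite pow_int ?gt_eqF ?(ltW dy)// ler_wpM2r ?invr_ge0 ?(ltW p1)//.
  by rewrite gerBl powR_ge0.
Qed.

(** The cut-off at d makes the weight w bounded, so the order of integration may be exchanged; the
    inner integral of r^e over ]s, rho[ is then at most s^(e+1) / -(e+1), a bound free of d. *)
Lemma int_pow_triangle rho e d (k : R -> R) : 0 < d < rho -> e + 1 < 0 ->
  (forall s, 0 <= k s) -> mu.-integrable `]0, rho[ (EFin \o k) ->
  mu.-integrable `]0, rho[ (EFin \o (fun s => k s * s `^ (e + 1))) ->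
  mu.-integrable `]d, rho[ (EFin \o (fun r => r `^ e * \int[mu]_(s in `]0, r[) k s)) /\
  \int[mu]_(r in `]d, rho[) (r `^ e * \int[mu]_(s in `]0, r[) k s) <=
  (- (e + 1))^-1 * \int[mu]_(s in `]0, rho[) (k s * s `^ (e + 1)).
Proof.
move=> /andP[d0 dr] e1 k0 ki kei.
have rho0 : 0 < rho by exact: lt_trans dr.
have [w wE] : exists w : R -> R, forall r, w r = if d < r then r `^ e else 0.
  by exists (fun r => if d < r then r `^ e else 0).
have mw : measurable_fun `]0, rho[ w.
  have -> : w = (fun r => r `^ e * \1_(`]d, +oo[%classic) r).
    by apply/funext => r; rewrite wE indicE mem_setE in_itv/= andbT; case: ifP; rewrite ?mulr1 ?mulr0.
  apply: measurable_funM; last exact: measurable_indic.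
  by apply: measurable_funTS; exact: measurable_powR.
have w0 s : 0 <= w s by rewrite wE; case: ifP => // _; exact: powR_ge0.
have wb r : 0 < r -> `|w r| <= d `^ e.
  move=> r0; rewrite wE; case: ifP => [dltr|]; last by rewrite normr0 powR_ge0.
  by rewrite ger0_norm ?powR_ge0// pow_anti ?(ltW dltr)//; lra.
have wi : mu.-integrable `]0, rho[ (EFin \o w).
  apply: (@integrable_dom _ _ R mu _ _ _ (cst (d `^ e)) mw) => //.
    by move=> r; rewrite /= in_itv/= => /andP[r0 _]; exact: wb.
  apply: integrable_continuous_oo; apply: continuous_subspaceT => t; exact: cvg_cst.
have T := triangle ki wi.
have wint s : 0 < s < rho -> \int[mu]_(r in `]s, rho[) w r <= (- (e + 1))^-1 * s `^ (e + 1).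
  move=> /andP[s0 sr].
  apply: (@le_trans _ _ (\int[mu]_(r in `]s, rho[) r `^ e)).
    apply: le_Rint_oo; first exact: integrable_sub_oo (ltW s0) (lexx _) wi.
      by apply: integrable_continuous_oo; exact: pow_continuous.
    by move=> r _; rewrite wE; case: ifP => // _; exact: powR_ge0.
  rewrite pow_int; [|by rewrite lt_eqF|exact: s0|exact: ltW].
  rewrite -mulrNN -invrN mulrC; apply: ler_wpM2l; first by rewrite invr_ge0; lra.
  by rewrite opprB gerBl powR_ge0.
have mk : measurable_fun `]0, rho[ k by exact: measurable_int_fun ki.
have mtail : measurable_fun `]0, rho[ (fun s => \int[mu]_(r in `]s, rho[) w r).
  have : measurable_fun `]0, rho[ (fun s => \int[mu]_(r in `]0, rho[) w r - \int[mu]_(r in `]0, s[) w r).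
    apply: measurable_funB; first exact: measurable_cst.
    apply: measurable_continuous_oo; exact: continuous_int (ltW rho0) wi.
  apply: eq_measurable_fun => s; rewrite inE/= in_itv/= => /andP[s0 sr].
  by rewrite (Rint_oo_split (ltW s0) (ltW sr) wi) addrC addKr.
have key : \int[mu]_(r in `]0, rho[) (w r * \int[mu]_(s in `]0, r[) k s) <=
    (- (e + 1))^-1 * \int[mu]_(s in `]0, rho[) (k s * s `^ (e + 1)).
  rewrite -T -RintegralZl//; apply: le_Rint_oo.
  - apply: (@integrable_mulbnd _ _ R mu _ _ k _ (\int[mu]_(r in `]0, rho[) w r)); [exact: measurable_itv|exact: ki|exact: mtail|].
    move=> s; rewrite /= in_itv/= => /andP[s0 sr].
    rewrite ger0_norm; last by apply: Rintegral_ge0 => ? _; exact: w0.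
    by apply: le_Rint_sub wi _; [exact: ltW|exact: lexx|move=> t _; exact: w0].
  - exact: integrableZE.
  - move=> s s0r.
    by rewrite mulrCA; apply: ler_wpM2l; [exact: k0|exact: wint].
have mI : measurable_fun `]0, rho[ (fun r => \int[mu]_(s in `]0, r[) k s).
  by apply: measurable_continuous_oo; exact: continuous_int (ltW rho0) ki.
have wki : mu.-integrable `]0, rho[ (EFin \o (fun r => w r * \int[mu]_(s in `]0, r[) k s)).
  apply: (@integrable_mulbnd _ _ R mu _ _ w _ (\int[mu]_(s in `]0, rho[) k s)); [exact: measurable_itv|exact: wi|exact: mI|].
  move=> r; rewrite /= in_itv/= => /andP[r0 rr].
  rewrite ger0_norm; last by apply: Rintegral_ge0 => ? _; exact: k0.
  by apply: le_Rint_sub ki _; [exact: lexx|exact: ltW|move=> t _; exact: k0].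
have E r : d < r < rho -> w r * \int[mu]_(s in `]0, r[) k s = r `^ e * \int[mu]_(s in `]0, r[) k s.
  by move=> /andP[dltr _]; rewrite wE dltr.
have wki' := integrable_sub_oo (ltW d0) (lexx _) wki.
split; first exact: eq_integrable_oo E wki'.
rewrite -(eq_Rint_oo E); apply: le_trans key; apply: (le_Rint_sub _ _ wki); [exact: ltW|exact: lexx|].
by move=> t _; apply: mulr_ge0; [exact: w0|apply: Rintegral_ge0 => ? _; exact: k0].
Qed.

Section hardy_ineq.
Variables (rho b : R) (f : R -> R).
Hypotheses (rho0 : 0 < rho) (b1 : b + 1 < 0).
Hypothesis mf : measurable_fun `]0, rho[ f.
Hypothesis fi : mu.-integrable `]0, rho[ (EFin \o (fun s => f s ^+ 2 * s `^ (b + 2))).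
Let A := \int[mu]_(s in `]0, rho[) (f s ^+ 2 * s `^ (b + 2)).
Let F r := \int[mu]_(s in `]0, r[) f s.

Let mpow p (D : set R) : measurable_fun D (fun s : R => s `^ p).
Proof. by apply: measurable_funTS; exact: measurable_powR. Qed.

Let sub0 r : r <= rho -> `]0, r[ `<=` (`]0, rho[ : set R).
Proof. by move=> rr; exact: subset_oo. Qed.

Let wL2 g r : b + 2 <= g -> r <= rho ->
  mu.-integrable `]0, r[ (EFin \o (fun s => f s ^+ 2 * s `^ g)) /\
  L2 mu `]0, r[ (fun s => f s * s `^ (g / 2)).
Proof.
move=> bg rr.
have mf' : measurable_fun `]0, r[ f by apply: measurable_funS mf => //; exact: sub0.
have gi : mu.-integrable `]0, r[ (EFin \o (fun s => f s ^+ 2 * s `^ g)).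
  have mfg : measurable_fun `]0, r[ (fun s => f s ^+ 2 * s `^ g).
    by apply: measurable_funM => //; exact: measurable_funX.
  apply: (@integrable_dom _ _ R mu _ _ _ (fun s => rho `^ (g - (b + 2)) * (f s ^+ 2 * s `^ (b + 2))) mfg) => //.
    move=> s; rewrite /= in_itv/= => /andP[s0 sr].
    rewrite ger0_norm; last by rewrite mulr_ge0 ?sqr_ge0 ?powR_ge0.
    rewrite [leRHS]mulrCA ler_wpM2l ?sqr_ge0//.
    have -> : s `^ g = s `^ (g - (b + 2)) * s `^ (b + 2) by rewrite powM// subrK.
    rewrite ler_wpM2r ?powR_ge0// pow_le ?subr_ge0//.
    by rewrite ltW// (lt_le_trans sr).
  by apply: integrableZE => //; exact: integrable_sub_oo fi.
have mfp : measurable_fun `]0, r[ (fun s => f s * s `^ (g / 2)) by apply: measurable_funM.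
split => //; split; first exact: mfp.
apply: eq_integrable gi => // s; rewrite inE/= in_itv/= => /andP[s0 _].
by rewrite exprMn pow_sqr.
Qed.

(** Cauchy-Schwarz for the product of f s^(g/2) and s^(-g/2). The exponent is left free: g = b + 2
    gives the pointwise bound on F, an intermediate g gives Hardy's inequality. *)
Let CS g r : b + 2 <= g -> g < 1 -> 0 < r -> r <= rho ->
  mu.-integrable `]0, r[ (EFin \o f) /\
  F r ^+ 2 <= r `^ (1 - g) / (1 - g) * \int[mu]_(s in `]0, r[) (f s ^+ 2 * s `^ g).
Proof.
move=> bg g1 r0 rr; have [_ Lf] := wL2 bg rr.
have [pi ple] : mu.-integrable `]0, r[ (EFin \o (fun s => s `^ (- g))) /\
    \int[mu]_(s in `]0, r[) s `^ (- g) <= r `^ (1 - g) / (1 - g).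
  by rewrite [1 - g]addrC; apply: pow_int0 => //; lra.
have Lp : L2 mu `]0, r[ (fun s => s `^ (- g / 2)).
  split; first exact: mpow.
  by apply: eq_integrable pi => // s; rewrite inE/= in_itv/= => /andP[s0 _]; rewrite pow_sqr.
have E s : 0 < s -> f s * s `^ (g / 2) * s `^ (- g / 2) = f s.
  by move=> s0; rewrite -mulrA powM// -mulrDl subrr mul0r powRr0 mulr1.
split.
  apply: eq_integrable (L2_mul _ Lf Lp) => // s.
  by rewrite inE/= in_itv/= => /andP[s0 _]; rewrite E.
have := Rint_CS _ Lf Lp => /(_ (measurable_itv _)).
under eq_Rintegral => s do [rewrite inE/= in_itv/= => /andP[s0 _]; rewrite E//].
rewrite [X in _ <= X * _ -> _](_ : _ = \int[mu]_(s in `]0, r[) (f s ^+ 2 * s `^ g)); last first.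
  by apply: eq_Rintegral => s; rewrite inE/= in_itv/= => /andP[s0 _]; rewrite exprMn pow_sqr.
rewrite [X in _ <= _ * X -> _](_ : _ = \int[mu]_(s in `]0, r[) s `^ (- g)); last first.
  by apply: eq_Rintegral => s; rewrite inE/= in_itv/= => /andP[s0 _]; rewrite pow_sqr.
move=> h; apply: (le_trans h); rewrite mulrC ler_wpM2r//.
by apply: Rintegral_ge0 => s _; rewrite mulr_ge0 ?sqr_ge0 ?powR_ge0.
Qed.

Lemma hardy_int : mu.-integrable `]0, rho[ (EFin \o f).
Proof. by have bb := b1; have [] := @CS (b + 2) rho (lexx _) ltac:(lra) rho0 (lexx _). Qed.

Lemma hardy_bound r : 0 < r <= rho -> F r ^+ 2 <= r `^ (- b - 1) / (- b - 1) * A.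
Proof.
have bb := b1; move=> /andP[r0 rr]; have [_] := @CS (b + 2) r (lexx _) ltac:(lra) r0 rr.
have -> : 1 - (b + 2) = - b - 1 by ring.
move=> h; apply: (le_trans h); rewrite ler_wpM2l ?divr_ge0 ?powR_ge0//; first by lra.
by apply: le_Rint_sub => // t _; rewrite mulr_ge0 ?sqr_ge0 ?powR_ge0.
Qed.

Lemma hardy_measurable : measurable_fun `]0, rho[ F.
Proof.
by apply: measurable_continuous_oo; apply: continuous_int (ltW rho0) hardy_int.
Qed.

Lemma hardy : mu.-integrable `]0, rho[ (EFin \o (fun r => F r ^+ 2 * r `^ b)) /\
  \int[mu]_(r in `]0, rho[) (F r ^+ 2 * r `^ b) <= 4 / (b + 1) ^+ 2 * A.
Proof.
have bb := b1; have mF := hardy_measurable.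
have A0 : 0 <= A by apply: Rintegral_ge0 => s _; rewrite mulr_ge0 ?sqr_ge0 ?powR_ge0.
have mFb : measurable_fun `]0, rho[ (fun r => F r ^+ 2 * r `^ b).
  by apply: measurable_funM => //; exact: measurable_funX.
(* g = (b + 3)/2 is the midpoint of b + 2 and 1. Both 1/(1 - g) and the constant of the exchanged
   integral then equal -2/(b + 1), and their product is the classical 4/(b + 1)^2. *)
have [g [g1 bg eE e1 ge]] : exists g, [/\ 1 - g = - (b + 1) / 2, b + 2 <= g,
    b + (1 - g) = (b - 1) / 2, (b - 1) / 2 + 1 < 0 & g + ((b - 1) / 2 + 1) = b + 2].
  by exists ((b + 3) / 2); split; [field|lra|field|lra|field].
have [ki _] := wL2 bg (lexx _).
have CSg r : 0 < r -> r <= rho -> F r ^+ 2 <= r `^ (1 - g) / (1 - g) * \int[mu]_(s in `]0, r[) (f s ^+ 2 * s `^ g).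
  by move=> r0 rr; have [] := CS bg ltac:(lra) r0 rr.
apply: Rint_exhaust; [exact: mFb| | |].
- by move=> t _; rewrite mulr_ge0 ?sqr_ge0 ?powR_ge0.
- by rewrite mulr_ge0// divr_ge0 ?sqr_ge0.
move=> d d0r; have /andP[d0 dr] := d0r.
have kE s : 0 < s < rho -> f s ^+ 2 * s `^ (b + 2) = f s ^+ 2 * s `^ g * s `^ ((b - 1) / 2 + 1).
  by move=> /andP[s0 _]; rewrite -mulrA powM// ge.
have [] := int_pow_triangle d0r e1 _ ki (eq_integrable_oo kE fi).
  by move=> s; rewrite mulr_ge0 ?sqr_ge0 ?powR_ge0.
rewrite -(eq_Rint_oo kE) -/A => Ti Tle.
have bnd r : d < r < rho -> F r ^+ 2 * r `^ b <=
    (1 - g)^-1 * (r `^ ((b - 1) / 2) * \int[mu]_(s in `]0, r[) (f s ^+ 2 * s `^ g)).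
  move=> /andP[dr' rr]; have r0 := lt_trans d0 dr'.
  apply: (le_trans (ler_wpM2r (powR_ge0 _ _) (CSg r r0 (ltW rr)))).
  rewrite -eE -powM// le_eqVlt; apply/orP; left; apply/eqP.
  by move: (\int[mu]_(s in _) _) => X; ring.
have mFb' : measurable_fun `]d, rho[ (fun r => F r ^+ 2 * r `^ b).
  by apply: measurable_funS mFb; [exact: measurable_itv|apply: subset_oo; [exact: ltW|exact: lexx]].
have Ti' := @integrableZE _ _ R mu _ (measurable_itv _) (1 - g)^-1 _ Ti.
have Fi : mu.-integrable `]d, rho[ (EFin \o (fun r => F r ^+ 2 * r `^ b)).
  apply: integrable_dom_oo mFb' _ Ti' => r drr.
  by rewrite ger0_norm ?bnd// mulr_ge0 ?sqr_ge0 ?powR_ge0.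
split; first exact: Fi.
apply: (le_trans (le_Rintegral _ Fi Ti' _)); [exact: measurable_itv| |].
  by move=> r; rewrite /= in_itv/=; exact: bnd.
rewrite RintegralZl//.
have g10 : 0 < (1 - g)^-1 by rewrite invr_gt0; lra.
apply: (le_trans (ler_wpM2l (ltW g10) Tle)).
rewrite g1 le_eqVlt; apply/orP; left; apply/eqP; field.
by lra.
Qed.

End hardy_ineq.
End hardy.

(** * The radial equation *)

Lemma Rint_oo_lin3 {R : realType} (x y a b c : R) (f k l : R -> R) :
  (@lebesgue_measure R).-integrable `]x, y[ (EFin \o f) ->
  (@lebesgue_measure R).-integrable `]x, y[ (EFin \o k) ->
  (@lebesgue_measure R).-integrable `]x, y[ (EFin \o l) ->
  \int[@lebesgue_measure R]_(t in `]x, y[) (a * f t + b * k t + c * l t) =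
  a * \int[@lebesgue_measure R]_(t in `]x, y[) f t +
  b * \int[@lebesgue_measure R]_(t in `]x, y[) k t +
  c * \int[@lebesgue_measure R]_(t in `]x, y[) l t.
Proof.
move=> fi ki li.
have fi' := @integrableZE _ _ R (@lebesgue_measure R) _ (measurable_itv _) a _ fi.
have ki' := @integrableZE _ _ R (@lebesgue_measure R) _ (measurable_itv _) b _ ki.
have li' := @integrableZE _ _ R (@lebesgue_measure R) _ (measurable_itv _) c _ li.
by rewrite RintegralD ?RintegralD ?RintegralZl//; exact: integrableDE.
Qed.

Section radial.
Context {R : realType}.
Notation mu := (@lebesgue_measure R).
Variables (rho m : R) (g : R -> R).
Hypotheses (rho0 : 0 < rho) (m0 : 0 < m) (m1 : m < 1).
Hypothesis mg : measurable_fun `]0, rho[ g.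
Hypothesis gi : mu.-integrable `]0, rho[ (EFin \o (fun s => g s ^+ 2 * s `^ (2 * m + 1))).

(* V = radV solves - V'' - (3/r) V' = g on ]0, rho[ with V(rho) = 0, and P = radP
   is V': the equation reads (r^3 V')' = - r^3 g. *)
Definition radPhi r : R := \int[mu]_(s in `]0, r[) (s ^+ 3 * g s).
Definition radP r : R := - (r ^- 3 * radPhi r).
Definition radQ r : R := \int[mu]_(s in `]0, r[) radP s.
Definition radV r : R := radQ r - radQ rho.

Let A := \int[mu]_(s in `]0, rho[) (g s ^+ 2 * s `^ (2 * m + 1)).

Let pow3 (s : R) (x : R) b : 0 < s -> (s ^+ 3 * x) ^+ 2 * s `^ b = x ^+ 2 * s `^ (b + 6).
Proof.
move=> s0; rewrite exprMn -exprM mulrC mulrA -mulrC; congr (_ * _).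
by rewrite (powE _ s0) powM//; congr (_ `^ _); rewrite addrC.
Qed.

(** The weight brought to the form b + 2 of Hardy's inequality with b = 2 m - 7 and function s^3 g.
    The second application takes b = 2 m - 3 and the function [radP]; the exponents stay
    unsimplified so that they match. *)
Let gE s : 0 < s < rho -> g s ^+ 2 * s `^ (2 * m + 1) = (s ^+ 3 * g s) ^+ 2 * s `^ (2 * m - 7 + 2).
Proof. by move=> /andP[s0 _]; rewrite pow3//; congr (_ * _ `^ _); ring. Qed.

Let mpow p (D : set R) : measurable_fun D (fun s : R => s `^ p).
Proof. by apply: measurable_funTS; exact: measurable_powR. Qed.

Let mX n (D : set R) : measurable_fun D (fun s : R => s ^+ n).
Proof. by apply: measurable_funTS; exact: exprn_measurable. Qed.

Let msg : measurable_fun `]0, rho[ (fun s => s ^+ 3 * g s).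
Proof. by apply: measurable_funM. Qed.

Let fi := eq_integrable_oo gE gi.

Let b7 : 2 * m - 7 + 1 < 0. Proof. have := m1; lra. Qed.
Let b3 : 2 * m - 3 + 1 < 0. Proof. have := m1; lra. Qed.

Lemma rad_s3g : mu.-integrable `]0, rho[ (EFin \o (fun s => s ^+ 3 * g s)).
Proof. exact: hardy_int rho0 b7 msg fi. Qed.

(** The pointwise Hardy bound with b = 2 m - 7 gives Phi^2 <= A r^(6 - 2m) / (6 - 2m). This decay is
    what removes the boundary term of the energy identity at the axis. *)
Lemma radPhi_bound : exists2 C, 0 <= C & forall r, 0 < r <= rho -> `|radPhi r| <= C * r `^ (3 - m).
Proof.
have AE : A = \int[mu]_(s in `]0, rho[) ((s ^+ 3 * g s) ^+ 2 * s `^ (2 * m - 7 + 2)).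
  exact: eq_Rint_oo gE.
have A0 : 0 <= A by apply: Rintegral_ge0 => s _; rewrite mulr_ge0 ?sqr_ge0 ?powR_ge0.
have mm := m1.
exists (Num.sqrt (A / (6 - 2 * m))); first exact: sqrtr_ge0.
move=> r r0r; have /andP[r0 _] := r0r.
rewrite -(@ler_pXn2r _ 2) ?nnegrE ?mulr_ge0 ?sqrtr_ge0 ?powR_ge0// exprMn sqr_sqrtr; last first.
  by rewrite divr_ge0//; lra.
rewrite real_normK ?num_real//.
apply: le_trans (hardy_bound b7 msg fi r0r) _.
rewrite -AE expr2 powM//.
rewrite (_ : 3 - m + (3 - m) = - (2 * m - 7) - 1); last by ring.
rewrite (_ : 6 - 2 * m = - (2 * m - 7) - 1); last by ring.
by rewrite le_eqVlt; apply/orP; left; apply/eqP; ring.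
Qed.

Lemma radPhi_continuous : {within `[0, rho], continuous radPhi}.
Proof. exact: continuous_int (ltW rho0) rad_s3g. Qed.

Lemma radP_continuous d : 0 < d -> {within `[d, rho], continuous radP}.
Proof.
move=> d0 x; apply: cvgN; apply: cvgM; last first.
  move: x; apply: continuous_subspaceW radPhi_continuous.
  by apply: subset_itvr; rewrite bnd_simp ltW.
move: x; apply: continuous_in_subspaceT => t; rewrite inE/= in_itv/= => /andP[dt _].
apply: cvgV; last exact: exprn_continuous.
by rewrite expf_neq0// gt_eqF// (lt_le_trans d0).
Qed.

Lemma radP_measurable : measurable_fun `]0, rho[ radP.
Proof.
apply: measurable_funN; apply: measurable_funM.
  apply: (eq_measurable_fun (fun s : R => s `^ (- 3%:R))); last exact: mpow.
  by move=> s; rewrite inE/= in_itv/= => /andP[s0 _]; rewrite powR_invn// ltW.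
exact: measurable_continuous_oo radPhi_continuous.
Qed.

Let PE s : 0 < s < rho -> radPhi s ^+ 2 * s `^ (2 * m - 7) = radP s ^+ 2 * s `^ (2 * m - 3 + 2).
Proof.
move=> /andP[s0 _].
have -> : radPhi s = s ^+ 3 * - radP s.
  by rewrite /radP opprK mulrA divff ?mul1r// expf_neq0// gt_eqF.
by rewrite pow3// sqrrN; congr (_ * _ `^ _); ring.
Qed.

Lemma radP_hardy :
  mu.-integrable `]0, rho[ (EFin \o (fun s => radP s ^+ 2 * s `^ (2 * m - 3 + 2))) /\
  \int[mu]_(s in `]0, rho[) (radP s ^+ 2 * s `^ (2 * m - 3 + 2)) <= 4 / (2 * m - 6) ^+ 2 * A.
Proof.
have [h1 h2] := hardy rho0 b7 msg fi; split; first exact: eq_integrable_oo PE h1.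
rewrite -(eq_Rint_oo PE) /A (eq_Rint_oo gE).
by rewrite (_ : 2 * m - 6 = 2 * m - 7 + 1)//; ring.
Qed.

Lemma radP_integrable : mu.-integrable `]0, rho[ (EFin \o radP).
Proof. by have [h _] := radP_hardy; exact: hardy_int rho0 b3 radP_measurable h. Qed.

Lemma radQ_hardy :
  mu.-integrable `]0, rho[ (EFin \o (fun s => radQ s ^+ 2 * s `^ (2 * m - 3))) /\
  \int[mu]_(s in `]0, rho[) (radQ s ^+ 2 * s `^ (2 * m - 3)) <=
    4 / (2 * m - 2) ^+ 2 * (4 / (2 * m - 6) ^+ 2 * A).
Proof.
have [h1 h2] := radP_hardy; have [h3 h4] := hardy rho0 b3 radP_measurable h1.
split; first exact: h3.
apply: (le_trans h4); rewrite (_ : 2 * m - 3 + 1 = 2 * m - 2); last by ring.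
apply: ler_wpM2l h2; first by rewrite divr_ge0 ?sqr_ge0.
Qed.

Lemma radV_continuous : {within `[0, rho], continuous radV}.
Proof.
move=> x; apply: cvgB; last exact: cvg_cst.
by move: x; exact: continuous_int (ltW rho0) radP_integrable.
Qed.

(** Written [0 - ...] to have the shape expected by [IBP_int], with boundary value 0 at rho. *)
Lemma radVE r : 0 <= r <= rho -> radV r = 0 - \int[mu]_(s in `]r, rho[) radP s.
Proof.
move=> /andP[r0 rr]; rewrite /radV /radQ.
by rewrite [X in _ - X](Rint_oo_split r0 rr radP_integrable) opprD addrA subrr.
Qed.

Lemma radV_measurable : measurable_fun `]0, rho[ radV.
Proof. exact: measurable_continuous_oo radV_continuous. Qed.

Lemma radV_bounded : exists2 C, 0 <= C & forall r, 0 <= r <= rho -> `|radV r| <= C.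
Proof.
exists (\int[mu]_(s in `]0, rho[) `|radP s|); first exact: Rintegral_ge0.
move=> r r0r; have /andP[r0 rr] := r0r; rewrite radVE// sub0r normrN.
apply: le_trans (le_normr_Rintegral _ _) _ => //.
  exact: integrable_sub_oo r0 (lexx _) radP_integrable.
apply: le_Rint_sub => //; exact: integrable_norm radP_integrable.
Qed.

Lemma radV_derive r : 0 < r < rho -> is_derive r 1 radV (radP r).
Proof.
move=> r0r; have /andP[r0 rr] := r0r.
have cP : {for r, continuous radP}.
  have h := @radP_continuous (r / 2) ltac:(by rewrite divr_gt0).
  apply: within_continuous_continuous h _; first by lra.
  by rewrite in_itv/=; apply/andP; split; lra.
have h1 := is_derive_int radP_integrable r0r cP.
have := @is_deriveB _ _ _ radQ (cst (radQ rho)) r 1 _ _ h1 (is_derive_cst _ _ _).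
by rewrite subr0.
Qed.


(** The energy balance as a single density. It is integrable on all of ]0,
    rho[, so its integral over ]d, rho[ converges as d tends to 0 and only boundary terms need
    control. *)
Let h r := r `^ (2 * m + 1) * (g r * radV r) - r `^ (2 * m + 1) * radP r ^+ 2
  - 2 * m * (1 - m) * (r `^ (2 * m - 1) * radV r ^+ 2).

Lemma rad_P2i : mu.-integrable `]0, rho[ (EFin \o (fun r => r `^ (2 * m + 1) * radP r ^+ 2)).
Proof.
have [h1 _] := radP_hardy; have mP := radP_measurable.
have bb : 2 * m - 3 + 2 <= 2 * m + 1 by lra.
apply: (integrable_dom_oo (k := fun r => rho `^ 2 * (radP r ^+ 2 * r `^ (2 * m - 3 + 2)))).
- by apply: measurable_funM => //; exact: measurable_funX.
- move=> t /andP[t0 tr]; rewrite ger0_norm; last by rewrite mulr_ge0 ?powR_ge0 ?sqr_ge0.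
  rewrite [leRHS]mulrCA [leLHS]mulrC; apply: ler_wpM2l; first exact: sqr_ge0.
  rewrite (_ : t `^ (2 * m + 1) = t `^ 2 * t `^ (2 * m - 3 + 2)); last first.
    by rewrite powM//; congr (_ `^ _); ring.
  by rewrite ler_wpM2r ?powR_ge0// pow_le// ltW.
- exact: integrableZE.
Qed.

Lemma rad_V2i : mu.-integrable `]0, rho[ (EFin \o (fun r => r `^ (2 * m - 1) * radV r ^+ 2)).
Proof.
have [C C0 VC] := radV_bounded; have mm := m0.
have [h1 _] := @pow_int0 R (2 * m - 1) rho ltac:(lra) rho0.
apply: (@integrable_mulbnd _ _ R mu _ _ _ _ (C ^+ 2)) h1 _ _ => //.
  by apply: measurable_funX; exact: radV_measurable.
move=> t; rewrite /= in_itv/= => /andP[t0 tr].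
by rewrite normrX lerXn2r ?nnegrE// VC// !ltW.
Qed.

Lemma rad_V2i' : mu.-integrable `]0, rho[ (EFin \o (fun r => r `^ (2 * m + 1) * radV r ^+ 2)).
Proof.
have [C C0 VC] := radV_bounded; have mm := m0.
have [h1 _] := @pow_int0 R (2 * m + 1) rho ltac:(lra) rho0.
apply: (@integrable_mulbnd _ _ R mu _ _ _ _ (C ^+ 2)) h1 _ _ => //.
  by apply: measurable_funX; exact: radV_measurable.
move=> t; rewrite /= in_itv/= => /andP[t0 tr].
by rewrite normrX lerXn2r ?nnegrE// VC// !ltW.
Qed.

Lemma rad_gVi : mu.-integrable `]0, rho[ (EFin \o (fun r => r `^ (2 * m + 1) * (g r * radV r))).
Proof.
have mV := radV_measurable.
have L1 : L2 mu `]0, rho[ (fun r => g r * r `^ ((2 * m + 1) / 2)).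
  have mf : measurable_fun `]0, rho[ (fun r => g r * r `^ ((2 * m + 1) / 2)) by apply: measurable_funM.
  split; first exact: mf.
  by apply: eq_integrable_oo gi => s /andP[s0 _]; rewrite exprMn pow_sqr.
have L3 : L2 mu `]0, rho[ (fun r => radV r * r `^ ((2 * m + 1) / 2)).
  have mf : measurable_fun `]0, rho[ (fun r => radV r * r `^ ((2 * m + 1) / 2)) by apply: measurable_funM.
  split; first exact: mf.
  by apply: eq_integrable_oo rad_V2i' => s /andP[s0 _]; rewrite exprMn pow_sqr// mulrC.
apply: eq_integrable_oo (L2_mul _ L1 L3) => // s /andP[s0 _].
by rewrite mulrACA -expr2 pow_sqr// mulrC.
Qed.

Let hi : mu.-integrable `]0, rho[ (EFin \o h).
Proof.
apply: integrableBE => //; last by apply: integrableZE => //; exact: rad_V2i.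
by apply: integrableBE => //; [exact: rad_gVi|exact: rad_P2i].
Qed.

Let pow3D (s p : R) : 0 < s -> s `^ (p + 3) = s ^+ 3 * s `^ p.
Proof. by move=> s0; rewrite (powE _ s0) powM// addrC. Qed.

Let pow3Da (s : R) : 0 < s -> s `^ (2 * m + 1) = s ^+ 3 * s `^ (2 * m - 2).
Proof. by move=> s0; rewrite -pow3D//; congr (_ `^ _); ring. Qed.

Let pow3Db (s : R) : 0 < s -> s `^ (2 * m) = s ^+ 3 * s `^ (2 * m - 3).
Proof. by move=> s0; rewrite -pow3D//; congr (_ `^ _); ring. Qed.

Let w_alg (s P V : R) : 0 < s ->
  s ^+ 3 * P * (s `^ (2 * m - 2) * P + (2 * m - 2) * s `^ (2 * m - 3) * V) =
  s `^ (2 * m + 1) * P ^+ 2 + (2 * m - 2) * (s `^ (2 * m) * (P * V)).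
Proof.
move=> s0; rewrite pow3Da// pow3Db//.
by move: (s `^ (2 * m - 2)) (s `^ (2 * m - 3)) => a b; ring.
Qed.

(** Integration by parts of s^3 g against w = s^(2m-2) V, which vanishes at rho and has derivative
    [k]. The primitive of s^3 g from d is - r^3 P - Phi(d), so k times it produces the P^2 term, a
    mixed term in P V and the boundary term with Phi(d). *)
Lemma rad_energy_delta d : 0 < d < rho ->
  \int[mu]_(r in `]d, rho[) h r =
  (1 - m) * d `^ (2 * m) * radV d ^+ 2 - radPhi d * (d `^ (2 * m - 2) * radV d).
Proof.
move=> d0r; have /andP[d0 dr] := d0r.
have cV : {within `[d, rho], continuous radV}.
  by apply: continuous_subspaceW radV_continuous; apply: subset_itvr; rewrite bnd_simp ltW.
have cP := radP_continuous d0.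
have cp p : {within `[d, rho], continuous (fun s : R => s `^ p)} by exact: pow_continuous.
have Vr : radV rho = 0 by rewrite /radV subrr.
pose k s := s `^ (2 * m - 2) * radP s + (2 * m - 2) * s `^ (2 * m - 3) * radV s.
have dW p s : d < s < rho -> is_derive s 1 (fun s => s `^ p * radV s) (s `^ p * radP s + p * s `^ (p - 1) * radV s).
  move=> /andP[ds sr]; have s0 := lt_trans d0 ds.
  have h1 := is_derive1_powR p s0; have h2 := @radV_derive s ltac:(by rewrite s0).
  apply: (is_derive_eq (is_deriveM h1 h2)).
  by rewrite /GRing.scale/=; ring.
have cW p : {within `[d, rho], continuous (fun s => s `^ p * radV s)}.
  by move=> x; apply: cvgM; [exact: cp|exact: cV].
have ck : {within `[d, rho], continuous k}.
  move=> x; apply: cvgD; first by apply: cvgM; [exact: cp|exact: cP].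
  apply: cvgM; last exact: cV.
  by apply: cvgM; [exact: cvg_cst|exact: cp].
have ki := integrable_continuous_oo ck.
have dWk t : d < t < rho -> is_derive t 1 (fun s => s `^ (2 * m - 2) * radV s) (k t).
  move=> tr; apply: (is_derive_eq (dW _ _ tr)).
  by rewrite /k; congr (_ + _ * _ `^ _ * _); ring.
have wE s : d < s < rho -> s `^ (2 * m - 2) * radV s = 0 - \int[mu]_(r in `]s, rho[) k r.
  move=> /andP[ds sr].
  have sub : `[s, rho] `<=` (`[d, rho] : set R) by apply: subset_itvr; rewrite bnd_simp ltW.
  have dk t : s < t < rho -> is_derive t 1 (fun s => s `^ (2 * m - 2) * radV s) (k t).
    by move=> /andP[st tr]; apply: dWk; rewrite (lt_trans ds).
  rewrite (FTC_oo (ltW sr) (continuous_subspaceW sub (cW _)) dk (continuous_subspaceW sub ck)).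
  by rewrite Vr mulr0 !sub0r opprK.
have sgi := integrable_sub_oo (ltW d0) (lexx rho) rad_s3g.
have gVE s : d < s < rho -> s `^ (2 * m + 1) * (g s * radV s) = s ^+ 3 * g s * (s `^ (2 * m - 2) * radV s).
  move=> /andP[ds _]; have s0 := lt_trans d0 ds.
  by rewrite pow3Da//; move: (s `^ (2 * m - 2)) => a; ring.
have gVi := integrable_sub_oo (ltW d0) (lexx rho) rad_gVi.
have gwi := eq_integrable_oo gVE gVi.
have I1 := IBP_int sgi ki wE gwi.
have Pi := integrable_sub_oo (ltW d0) (lexx rho) rad_P2i.
have V2i := integrable_sub_oo (ltW d0) (lexx rho) rad_V2i.
have PVi : mu.-integrable `]d, rho[ (EFin \o (fun s => s `^ (2 * m) * (radP s * radV s))).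
  by apply: integrable_continuous_oo => x; apply: cvgM; [exact: cp|apply: cvgM; [exact: cP|exact: cV]].
have I2 : \int[mu]_(r in `]d, rho[) (k r * \int[mu]_(s in `]d, r[) (s ^+ 3 * g s)) =
    - 1 * \int[mu]_(r in `]d, rho[) (r `^ (2 * m + 1) * radP r ^+ 2) +
    - (2 * m - 2) * \int[mu]_(r in `]d, rho[) (r `^ (2 * m) * (radP r * radV r)) +
    - radPhi d * \int[mu]_(r in `]d, rho[) k r.
  rewrite -Rint_oo_lin3//.
  apply: eq_Rint_oo => r /andP[dr' rr]; have r0 := lt_trans d0 dr'.
  have -> : \int[mu]_(s in `]d, r[) (s ^+ 3 * g s) = - (r ^+ 3 * radP r) - radPhi d.
    apply/eqP; rewrite eq_sym subr_eq addrC -Rint_oo_split ?(ltW d0) ?(ltW dr')//; last first.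
      exact: integrable_sub_oo (lexx _) (ltW rr) rad_s3g.
    by rewrite /radP mulrN opprK mulrA divff ?mul1r// expf_neq0// gt_eqF.
  have := w_alg (radP r) (radV r) r0; rewrite -/(k r).
  move: (k r) (r `^ _ * _) (r `^ _ * (_ * _)) => K a b E.
  transitivity (- (r ^+ 3 * radP r * K) - radPhi d * K); first by ring.
  by rewrite E; ring.
(* The mixed term is removed by integrating the derivative of s^(2m) V^2; multiplied by -(1 - m),
   this yields the V^2 term of [h] and the boundary term in V(d)^2. *)
have I3 : 2 * m * \int[mu]_(r in `]d, rho[) (r `^ (2 * m - 1) * radV r ^+ 2) +
    2 * \int[mu]_(r in `]d, rho[) (r `^ (2 * m) * (radP r * radV r)) = - (d `^ (2 * m) * radV d ^+ 2).
  rewrite -!RintegralZl// -RintegralD//; [|exact: integrableZE..].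
  have dVV t : d < t < rho -> is_derive t 1 (fun s => s `^ (2 * m) * radV s * radV s)
      (2 * m * (t `^ (2 * m - 1) * radV t ^+ 2) + 2 * (t `^ (2 * m) * (radP t * radV t))).
    move=> tr; have h1 := dW (2 * m) t tr; have /andP[dt tr'] := tr.
    have h2 := @radV_derive t ltac:(by rewrite (lt_trans d0 dt)).
    apply: (is_derive_eq (is_deriveM h1 h2)); rewrite /GRing.scale/=.
    by move: (t `^ (2 * m)) (t `^ (2 * m - 1)) => a b; ring.
  have cVV : {within `[d, rho], continuous (fun s => s `^ (2 * m) * radV s * radV s)}.
    by move=> x; apply: cvgM; [exact: cW|exact: cV].
  rewrite (FTC_oo (ltW dr) cVV dVV).
    by rewrite Vr !mulr0 sub0r -mulrA.
  move=> x; apply: cvgD; (apply: cvgM; first exact: cvg_cst); apply: cvgM; try exact: cp.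
    by apply: cvgM; exact: cV.
  by apply: cvgM; [exact: cP|exact: cV].
have kE : \int[mu]_(r in `]d, rho[) k r = - (d `^ (2 * m - 2) * radV d).
  by rewrite (FTC_oo (ltW dr) (cW _) dWk ck) Vr mulr0 sub0r.
have -> : \int[mu]_(r in `]d, rho[) h r = \int[mu]_(r in `]d, rho[) (r `^ (2 * m + 1) * (g r * radV r)) -
   \int[mu]_(r in `]d, rho[) (r `^ (2 * m + 1) * radP r ^+ 2) -
   2 * m * (1 - m) * \int[mu]_(r in `]d, rho[) (r `^ (2 * m - 1) * radV r ^+ 2).
  rewrite -!RintegralZl// -!RintegralB//; [exact: integrableBE|exact: integrableZE].
rewrite (eq_Rint_oo gVE) I1 I2 kE mul0r.
move: I3; move: (\int[mu]_(r in `]d, rho[) (r `^ (2 * m - 1) * radV r ^+ 2)) => X.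
move: (\int[mu]_(r in `]d, rho[) (r `^ (2 * m) * (radP r * radV r))) => Y.
move: (\int[mu]_(r in `]d, rho[) (r `^ (2 * m + 1) * radP r ^+ 2)) => Z.
move: (d `^ (2 * m)) (d `^ (2 * m - 2)) (radV d) (radPhi d) => a b V Ph I3.
rewrite [RHS](_ : _ = (1 - m) * - (- (a * V ^+ 2)) - Ph * (b * V)); last by ring.
by rewrite -I3; ring.
Qed.


(* The equation is tested with r^(2m-2) V, so that the weights become r^(2m+1). *)
Lemma rad_energy :
  \int[mu]_(r in `]0, rho[) (r `^ (2 * m + 1) * radP r ^+ 2) +
  2 * m * (1 - m) * \int[mu]_(r in `]0, rho[) (r `^ (2 * m - 1) * radV r ^+ 2) <=
  \int[mu]_(r in `]0, rho[) (r `^ (2 * m + 1) * (g r * radV r)).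
Proof.
have mm := m1; have mm0 := m0.
rewrite -subr_ge0.
suff : 0 <= \int[mu]_(r in `]0, rho[) h r.
  rewrite (eq_Rint_oo (k := fun r => 1 * (r `^ (2 * m + 1) * (g r * radV r)) +
    -1 * (r `^ (2 * m + 1) * radP r ^+ 2) + - (2 * m * (1 - m)) * (r `^ (2 * m - 1) * radV r ^+ 2))); last first.
    by move=> t _; rewrite /h mul1r mulN1r mulNr.
  rewrite Rint_oo_lin3; [|exact: rad_gVi|exact: rad_P2i|exact: rad_V2i].
  by rewrite mul1r mulN1r mulNr opprD addrA.
have [C C0 PhiC] := radPhi_bound; have [D D0 VD] := radV_bounded.
have ch := continuous_int (ltW rho0) hi.
have [_ h0 _] := (continuous_within_itvP _ rho0).1 ch.
have p0 := @powR_cvg0 R (1 + m) ltac:(lra).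
have : \int[mu]_(u in `]0, d[) h u + (- (C * D)) * d `^ (1 + m) @[d --> 0^'+] -->
    \int[mu]_(u in `]0, 0[) h u + (- (C * D)) * 0.
  by apply: cvgD; [exact: h0|apply: cvgM; [exact: cvg_cst|exact: p0]].
rewrite Rint_oo0 mulr0 addr0 => /cvgr_to_le; apply.
near=> d.
have d0 : 0 < d by [].
have dr : d < rho by near: d; exact: nbhs_right_lt.
have d0r : 0 < d < rho by rewrite d0.
rewrite (Rint_oo_split (ltW d0) (ltW dr) hi) lerD2l rad_energy_delta// mulNr.
(* The boundary term in V(d)^2 is nonnegative and dropped; the other is at most C d^(3-m) d^(2m-2) D
   = C D d^(1+m). *)
apply: (@le_trans _ _ (- (radPhi d * (d `^ (2 * m - 2) * radV d)))); last first.
  by rewrite lerDr mulr_ge0 ?sqr_ge0// mulr_ge0 ?powR_ge0//; lra.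
rewrite lerN2.
have dle : 0 < d <= rho by rewrite d0 ltW.
have dle' : 0 <= d <= rho by rewrite !ltW.
have bound_alg (x y z C' D' b : R) : 0 <= y -> 0 <= C' * b -> `|x| <= C' * b -> `|z| <= D' ->
    x * (y * z) <= C' * D' * (b * y).
  move=> y0 Cb0 xC zD; apply: (le_trans (ler_norm _)); rewrite !normrM (ger0_norm y0).
  rewrite [leRHS](_ : _ = C' * b * (y * D')); last by ring.
  by rewrite ler_pM ?mulr_ge0// ler_wpM2l.
rewrite (_ : 1 + m = (3 - m) + (2 * m - 2)); last by ring.
rewrite -(powM (3 - m) (2 * m - 2) d0); apply: bound_alg; [exact: powR_ge0|by rewrite mulr_ge0 ?powR_ge0|exact: PhiC|exact: VD].
Unshelve. all: by end_near. Qed.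

End radial.

Section oo_linear.
Context {R : realType}.
Notation mu := (@lebesgue_measure R).

Lemma integrableZ_oo (x y k : R) (f : R -> R) : mu.-integrable `]x, y[ (EFin \o f) ->
  mu.-integrable `]x, y[ (EFin \o (fun t => k * f t)).
Proof. exact: integrableZE. Qed.

Lemma integrableD_oo (x y : R) (f g : R -> R) : mu.-integrable `]x, y[ (EFin \o f) ->
  mu.-integrable `]x, y[ (EFin \o g) -> mu.-integrable `]x, y[ (EFin \o (fun t => f t + g t)).
Proof. exact: integrableDE. Qed.

Lemma integrableB_oo (x y : R) (f g : R -> R) : mu.-integrable `]x, y[ (EFin \o f) ->
  mu.-integrable `]x, y[ (EFin \o g) -> mu.-integrable `]x, y[ (EFin \o (fun t => f t - g t)).
Proof. exact: integrableBE. Qed.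

Lemma integrable_cst_oo (x y c : R) : mu.-integrable `]x, y[ (EFin \o (fun=> c)).
Proof.
by apply: integrable_continuous_oo; apply: continuous_subspaceT => t; exact: cvg_cst.
Qed.

Lemma ae_oo (x y : R) (Q : R -> Prop) : {ae mu, forall t, x < t < y -> Q t} ->
  {ae mu, forall t, [set` `]x, y[] t -> Q t}.
Proof. by apply: ae_imp => t h; rewrite /= in_itv/=. Qed.

Lemma ae_eq_integrable_oo (x y : R) (f g : R -> R) : measurable_fun `]x, y[ g ->
  {ae mu, forall t, x < t < y -> f t = g t} ->
  mu.-integrable `]x, y[ (EFin \o f) -> mu.-integrable `]x, y[ (EFin \o g).
Proof. by move=> mg /ae_oo; exact: ae_eq_integrable. Qed.

Lemma ae_eq_Rint_oo (x y : R) (f g : R -> R) : measurable_fun `]x, y[ f ->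
  measurable_fun `]x, y[ g -> {ae mu, forall t, x < t < y -> f t = g t} ->
  \int[mu]_(t in `]x, y[) f t = \int[mu]_(t in `]x, y[) g t.
Proof. by move=> mf mg /ae_oo; exact: ae_eq_Rintegral. Qed.

Lemma ae_alln (Q : nat -> R -> Prop) : (forall n, {ae mu, forall x, Q n x}) ->
  {ae mu, forall x, forall n, Q n x}.
Proof. by move=> Qn; apply/ae_foralln. Qed.

End oo_linear.

(** * A single sine mode: identification with the explicit radial solution, and its estimate *)

Section mode.
Context {R : realType}.
Notation mu := (@lebesgue_measure R).
Variables (rho m lam : R) (v p f : R -> R).
Hypotheses (rho0 : 0 < rho) (m0 : 0 < m) (m1 : m < 1) (lam0 : 0 < lam).
Hypotheses (mv : measurable_fun `]0, rho[ v) (mp : measurable_fun `]0, rho[ p)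
  (mf : measurable_fun `]0, rho[ f).
Hypothesis vi : mu.-integrable `]0, rho[ (EFin \o (fun r => v r ^+ 2 * r)).
Hypothesis pi : mu.-integrable `]0, rho[ (EFin \o (fun r => p r ^+ 2 * r)).
Hypothesis fi : mu.-integrable `]0, rho[ (EFin \o (fun r => f r ^+ 2 * r `^ (2 * m + 1))).
Hypothesis weak_eq : forall xi, test_itv 0 rho xi ->
  \int[mu]_(r in `]0, rho[) (r ^+ 3 * p r * derive1 xi r) +
  lam ^+ 2 * \int[mu]_(r in `]0, rho[) (r ^+ 3 * v r * xi r) =
  \int[mu]_(r in `]0, rho[) (r ^+ 3 * f r * xi r).
(** Combines v' = p with v(rho) = 0: it is integration by parts against r - d, which vanishes at d,
    with no contribution from rho. *)
Hypothesis weak_der : forall d, 0 < d < rho ->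
  \int[mu]_(r in `]d, rho[) (p r * (r - d)) = - \int[mu]_(r in `]d, rho[) v r.

(** The term lam^2 v is counted among the data, so that the explicit solution without zero-order
    term applies; v is admissible as data because r^(2m+1) <= rho^(2m) r. *)
Definition mode_rhs r := f r - lam ^+ 2 * v r.

Let g := mode_rhs.
Let P := radP g.
Let V := radV rho g.

Let mpow q (D : set R) : measurable_fun D (fun s : R => s `^ q).
Proof. by apply: measurable_funTS; exact: measurable_powR. Qed.

Let mX n (D : set R) : measurable_fun D (fun s : R => s ^+ n).
Proof. by apply: measurable_funTS; exact: exprn_measurable. Qed.

Lemma mode_rhs_measurable : measurable_fun `]0, rho[ g.
Proof. by apply: measurable_funB => //; exact: measurable_funM. Qed.

Let vwi : mu.-integrable `]0, rho[ (EFin \o (fun r => v r ^+ 2 * r `^ (2 * m + 1))).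
Proof.
apply: (integrable_dom_oo (k := fun r => rho `^ (2 * m) * (v r ^+ 2 * r))).
- by apply: measurable_funM => //; exact: measurable_funX.
- move=> t /andP[t0 tr]; rewrite ger0_norm; last by rewrite mulr_ge0 ?powR_ge0 ?sqr_ge0.
  rewrite [leRHS]mulrCA; apply: ler_wpM2l; first exact: sqr_ge0.
  have -> : t `^ (2 * m + 1) = t `^ (2 * m) * t by rewrite -powM// powRr1// ltW.
  apply: ler_wpM2r; first exact: ltW.
  by apply: pow_le => //; [rewrite mulr_ge0// ltW|exact: ltW].
- exact: integrableZE.
Qed.

Lemma mode_rhs_integrable : mu.-integrable `]0, rho[ (EFin \o (fun r => g r ^+ 2 * r `^ (2 * m + 1))).
Proof.
have mg := mode_rhs_measurable.
apply: (integrable_dom_oo (k := fun r => 2 * (f r ^+ 2 * r `^ (2 * m + 1)) +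
   2 * lam ^+ 4 * (v r ^+ 2 * r `^ (2 * m + 1)))).
- by apply: measurable_funM => //; exact: measurable_funX.
- move=> t _; rewrite ger0_norm; last by rewrite mulr_ge0 ?powR_ge0 ?sqr_ge0.
  rewrite -subr_ge0 /g /mode_rhs.
  rewrite (_ : _ - _ = (f t + lam ^+ 2 * v t) ^+ 2 * t `^ (2 * m + 1)).
    by rewrite mulr_ge0 ?powR_ge0 ?sqr_ge0.
  by move: (t `^ _) => b; ring.
- by apply: integrableDE => //; exact: integrableZE.
Qed.

Let mg := mode_rhs_measurable.
Let gi := mode_rhs_integrable.

(** From (r^2 - |u|)^2 r >= 0 one gets r^3 |u| <= r^5 + u^2 r: the factor r^3 makes every function
    square integrable for r dr integrable. *)
Let r3i (u : R -> R) : measurable_fun `]0, rho[ u -> mu.-integrable `]0, rho[ (EFin \o (fun r => u r ^+ 2 * r)) ->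
  mu.-integrable `]0, rho[ (EFin \o (fun r => r ^+ 3 * u r)).
Proof.
move=> mu' ui.
have c1 := integrable_cst_oo 0 rho 1.
apply: (integrable_dom_oo (k := fun r => rho ^+ 5 * 1 + u r ^+ 2 * r)).
- by apply: measurable_funM.
- move=> t /andP[t0 tr]; rewrite mulr1.
  have t5 : t ^+ 5 <= rho ^+ 5 by rewrite lerXn2r ?nnegrE ?ltW// (lt_trans t0).
  rewrite normrM (ger0_norm (exprn_ge0 _ (ltW t0))) -[u t ^+ 2]real_normK ?num_real//.
  have : 0 <= (t ^+ 2 - `|u t|) ^+ 2 * t by rewrite mulr_ge0 ?sqr_ge0// ltW.
  have : 0 <= t ^+ 3 * `|u t| by rewrite mulr_ge0// exprn_ge0// ltW.
  rewrite (_ : (t ^+ 2 - `|u t|) ^+ 2 * t = t ^+ 5 + `|u t| ^+ 2 * t - 2 * (t ^+ 3 * `|u t|)); last by ring.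
  lra.
- by apply: integrableDE => //; exact: integrableZE.
Qed.

Let r3p := r3i mp pi.
Let r3v := r3i mv vi.
Let r3g : mu.-integrable `]0, rho[ (EFin \o (fun r => r ^+ 3 * g r)).
Proof. exact: rad_s3g rho0 m1 mg gi. Qed.
Let r3f : mu.-integrable `]0, rho[ (EFin \o (fun r => r ^+ 3 * f r)).
Proof.
have h := integrableD_oo r3g (integrableZ_oo (lam ^+ 2) r3v).
by apply: eq_integrable_oo h => t _; rewrite /g /mode_rhs; ring.
Qed.

(** Du Bois-Reymond gives r^3 p = c - Phi, that is p - P = c r^-3. Both p and P are square
    integrable for r dr, the latter by Hardy's inequality and m < 1, so c^2 r^-5 is integrable near
    0, which forces c = 0. *)
Lemma mode_p : {ae mu, forall r, 0 < r < rho -> p r = P r}.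
Proof.
have [c pE] : exists c, {ae mu, forall x, 0 < x < rho -> x ^+ 3 * p x = c - \int[mu]_(s in `]0, x[) (s ^+ 3 * g s)}.
  apply: duBoisReymond r3p r3g _ => // xi txi.
  have [M xiM] := test_itv_bounded txi.
  have mxi : measurable_fun `]0, rho[ xi by apply: Cinf_measurable => //; case: txi.
  have bi u : mu.-integrable `]0, rho[ (EFin \o u) -> mu.-integrable `]0, rho[ (EFin \o (fun r => u r * xi r)).
    by move=> ui; apply: (@integrable_mulbnd _ _ R mu _ _ u xi M).
  rewrite (canRL (addrK _) (weak_eq txi)).
  rewrite -RintegralZl//; last exact: bi.
  rewrite -RintegralB//; [|exact: bi|by apply: integrableZE => //; exact: bi].
  by apply: eq_Rint_oo => t _; rewrite /g /mode_rhs; ring.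
have mP : measurable_fun `]0, rho[ P := radP_measurable rho0 m1 mg gi.
have [h1 _] := radP_hardy rho0 m1 mg gi.
suff c0 : c = 0.
  apply: ae_imp pE => r /[swap] /[dup] r0r /andP[r0 _] /(_ r0r).
  rewrite c0 sub0r -/(radPhi g r) => E.
  by rewrite /P /radP -mulrN -E mulrA mulVf ?mul1r// expf_neq0// gt_eqF.
have Pi : mu.-integrable `]0, rho[ (EFin \o (fun r => P r ^+ 2 * r)).
  have mm := m1.
  apply: (integrable_dom_oo (k := fun r => rho `^ (2 - 2 * m) * (P r ^+ 2 * r `^ (2 * m - 3 + 2)))).
  - by apply: measurable_funM => //; exact: measurable_funX.
  - move=> t /andP[t0 tr]; rewrite ger0_norm; last by rewrite mulr_ge0 ?sqr_ge0// ltW.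
    rewrite [leRHS]mulrCA; apply: ler_wpM2l; first exact: sqr_ge0.
    have tE : t = t `^ (2 - 2 * m) * t `^ (2 * m - 3 + 2).
      have e1 : 2 - 2 * m + (2 * m - 3 + 2) = 1 by ring.
      by rewrite powM// e1 powRr1// ltW.
    rewrite [leLHS]tE; apply: ler_wpM2r; first exact: powR_ge0.
    by apply: pow_le => //; [lra|exact: ltW].
  - exact: integrableZE.
have ci : mu.-integrable `]0, rho[ (EFin \o (fun r => c ^+ 2 * r `^ (- 5%:R))).
  have pPi : mu.-integrable `]0, rho[ (EFin \o (fun r => (p r - P r) ^+ 2 * r)).
    apply: (integrable_dom_oo (k := fun r => 2 * (p r ^+ 2 * r) + 2 * (P r ^+ 2 * r))).
    - by apply: measurable_funM => //; apply: measurable_funX; exact: measurable_funB.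
    - move=> t /andP[t0 _]; rewrite ger0_norm; last by rewrite mulr_ge0 ?sqr_ge0// ltW.
      have : 0 <= (p t + P t) ^+ 2 * t by rewrite mulr_ge0 ?sqr_ge0// ltW.
      move=> h0; rewrite -subr_ge0 (_ : _ - _ = (p t + P t) ^+ 2 * t)//; ring.
    - by apply: integrableDE => //; exact: integrableZE.
  have mc : measurable_fun `]0, rho[ (fun r => c ^+ 2 * r `^ (- 5%:R)) by exact: measurable_funM.
  apply: (ae_eq_integrable_oo mc _ pPi); apply: ae_imp pE => r + r0r.
  have /andP[r0 rr] := r0r; move=> /(_ r0r); rewrite -/(radPhi g r) => E.
  have rn0 : r != 0 by rewrite gt_eqF.
  have pE' : p r = r ^- 3 * (c - radPhi g r) by rewrite -E mulrA mulVf ?mul1r// expf_neq0.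
  rewrite (_ : p r - P r = c * r ^- 3); last by rewrite pE' /P /radP; ring.
  by rewrite powR_invn ?ltW//; field.
have [//|c2] := eqVneq c 0.
have : 0 < c ^+ 2 by rewrite exprn_even_gt0.
pose I := \int[mu]_(r in `]0, rho[) (c ^+ 2 * r `^ (- 5%:R)).
have p4 := @powR_cvg0 R 4%:R ltac:(by rewrite ltr0n).
have : (32 * I) * d `^ 4%:R @[d --> 0^'+] --> (32 * I) * 0 by apply: cvgM; [exact: cvg_cst|exact: p4].
rewrite mulr0 => /cvgr_to_ge h; rewrite ltNge => /negP[]; apply: h.
near=> d.
have d0 : 0 < d by [].
have dr : d < rho / 2 by near: d; apply: nbhs_right_lt; rewrite divr_gt0.
have d2 : 2 * d <= rho by lra.
(* On ]d, 2d[ the integral is at least c^2 (2d)^-5 d = c^2 / (32 d^4), hence c^2 <= 32 I d^4 for all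
   small d. *)
have : \int[mu]_(r in `]d, (2 * d)[) (c ^+ 2 * (2 * d) `^ (- 5%:R)) <= I.
  apply: (@le_trans _ _ (\int[mu]_(r in `]d, (2 * d)[) (c ^+ 2 * r `^ (- 5%:R)))).
    apply: le_Rint_oo.
    - exact: integrable_cst_oo.
    - exact: integrable_sub_oo (ltW d0) d2 ci.
    - move=> t /andP[dt t2]; apply: ler_wpM2l; first exact: sqr_ge0.
      by apply: pow_anti; [rewrite oppr_le0|exact: lt_trans dt|exact: ltW].
  apply: le_Rint_sub ci _; [exact: ltW|exact: d2|].
  by move=> t _; rewrite mulr_ge0 ?sqr_ge0 ?powR_ge0.
rewrite Rint_cst_oo; last by lra.
have dd : 0 <= 2 * d by lra.
rewrite (powR_invn _ dd) (powR_mulrn _ (ltW d0)).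
have K0 : 0 < 32 * d ^+ 4 by rewrite mulr_gt0 ?exprn_gt0.
rewrite -(ler_pM2l K0) => h'; rewrite [leRHS](_ : _ = 32 * d ^+ 4 * I); last by ring.
apply: le_trans h'.
rewrite le_eqVlt; apply/orP; left; apply/eqP; field.
by rewrite !gt_eqF.
Unshelve. all: by end_near. Qed.


Let Pi := radP_integrable rho0 m1 mg gi.
Let Vc := radV_continuous rho0 m1 mg gi.

Let v_int d : 0 < d < rho -> mu.-integrable `]d, rho[ (EFin \o v).
Proof.
move=> /andP[d0 dr].
apply: (integrable_dom_oo (k := fun r => v r ^+ 2 * r + d^-1)).
- by apply: measurable_funS mv => //; apply: subset_oo => //; exact: ltW.
- move=> t /andP[dt tr]; have t0 := lt_trans d0 dt.
  apply: (@le_trans _ _ (v t ^+ 2 * t + t^-1)); last by rewrite lerD2l lef_pV2 ?posrE// ltW.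
  have : 0 <= (`|v t| * t - 1) ^+ 2 / t by rewrite mulr_ge0 ?sqr_ge0// invr_ge0 ltW.
  have -> : (`|v t| * t - 1) ^+ 2 / t = `|v t| ^+ 2 * t + t^-1 - 2 * `|v t|.
    by field; rewrite gt_eqF.
  rewrite real_normK ?num_real// subr_ge0; apply: le_trans.
  by rewrite ler_peMl// ler1n.
- apply: integrableD_oo; last exact: integrable_cst_oo.
  exact: integrable_sub_oo (ltW d0) (lexx _) vi.
Qed.

(** Integrals of p = P against r - d show that v and V have the same integral over every ]d, rho[,
    hence over every interval away from 0. As v is known to be integrable only away from the axis,
    the conclusion is drawn on ]1/(n+1), rho[ for each n. *)
Lemma mode_v : {ae mu, forall r, 0 < r < rho -> v r = V r}.
Proof.
have mP : measurable_fun `]0, rho[ P := radP_measurable rho0 m1 mg gi.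
have VE d : 0 < d < rho -> \int[mu]_(r in `]d, rho[) v r = \int[mu]_(r in `]d, rho[) V r.
  move=> d0r; have /andP[d0 dr] := d0r.
  apply: oppr_inj; rewrite -weak_der//.
  have sub : `]d, rho[ `<=` (`]0, rho[ : set R) by apply: subset_oo => //; exact: ltW.
  have mrd : measurable_fun `]d, rho[ (fun r : R => r - d).
    by apply: measurable_funB => //; exact: measurable_id.
  have -> : \int[mu]_(r in `]d, rho[) (p r * (r - d)) = \int[mu]_(r in `]d, rho[) (P r * (r - d)).
    apply: ae_eq_Rintegral => //.
    - by apply: measurable_funM => //; exact: measurable_funS sub mp.
    - by apply: measurable_funM => //; exact: measurable_funS sub mP.
    - by apply: ae_imp mode_p => r + /sub; rewrite /= in_itv/= => /[apply] ->.
  have := @triangle R d rho (fun=> 1) P (integrable_cst_oo _ _ _) (integrable_sub_oo (ltW d0) (lexx _) Pi).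
  rewrite [X in _ = X -> _](_ : _ = \int[mu]_(r in `]d, rho[) (P r * (r - d))); last first.
    by apply: eq_Rint_oo => r /andP[dr' _]; rewrite Rint_cst_oo ?mul1r// ltW.
  move=> <-; rewrite -mulN1r -RintegralZl//; last first.
    apply: integrable_continuous_oo; apply: continuous_subspaceW Vc.
    by apply: subset_itvr; rewrite bnd_simp ltW.
  apply: eq_Rint_oo => r /andP[dr' rr].
  by rewrite /V (radVE rho0 m1 mg gi) ?sub0r ?mulN1r ?opprK ?mul1r// !ltW// (lt_trans d0).
have ae_n (n : nat) : {ae mu, forall r, n.+1%:R^-1 < r < rho -> v r - V r = 0}.
  pose d : R := n.+1%:R^-1.
  have d0 : 0 < d by rewrite invr_gt0 ltr0n.
  have [rd|dr] := leP rho d.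
    by apply: ae_all => r /andP[dr' rr]; move: (lt_le_trans (lt_trans dr' rr) rd); rewrite ltxx.
  have vid := v_int (introT andP (conj d0 dr)).
  have Vid : mu.-integrable `]d, rho[ (EFin \o V).
    apply: integrable_continuous_oo; apply: continuous_subspaceW Vc.
    by apply: subset_itvr; rewrite bnd_simp ltW.
  apply: ae0_of_intervals; first exact: integrableB_oo.
  have z0 x : d < x < rho -> \int[mu]_(r in `]x, rho[) (v r - V r) = 0.
    move=> /andP[dx xr].
    rewrite RintegralB//; [|exact: integrable_sub_oo (ltW dx) (lexx _) vid|exact: integrable_sub_oo (ltW dx) (lexx _) Vid].
    by rewrite VE ?subrr// (lt_trans d0 dx).
  move=> x y dx xy yr; have xr := lt_trans xy yr.
  have := Rint_oo_split (ltW xy) (ltW yr) (integrable_sub_oo (ltW dx) (lexx _) (integrableB_oo vid Vid)).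
  by rewrite !z0 ?addr0 ?dx ?xr ?yr ?(lt_trans dx xy).
apply: ae_imp (ae_alln ae_n) => r h /andP[r0 rr].
have [n nr] : exists n : nat, n.+1%:R^-1 < r.
  by have := near_infty_natSinv_lt (PosNum r0) => -[n _ /(_ n)] /= /(_ (leqnn n)); exists n.
by apply/eqP; rewrite -subr_eq0 (h n)// nr.
Qed.

(** The energy inequality multiplied by 2 lam^2, with data f - lam^2 V: the bound 2 lam^2 (f - lam^2
    V) V <= f^2 - lam^4 V^2 holds because the difference is (f - lam^2 V)^2. *)
Lemma mode_est :
  lam ^+ 4 * \int[mu]_(r in `]0, rho[) (r `^ (2 * m + 1) * V r ^+ 2) +
  2 * lam ^+ 2 * \int[mu]_(r in `]0, rho[) (r `^ (2 * m + 1) * P r ^+ 2) +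
  4 * m * (1 - m) * lam ^+ 2 * \int[mu]_(r in `]0, rho[) (r `^ (2 * m - 1) * V r ^+ 2) <=
  \int[mu]_(r in `]0, rho[) (f r ^+ 2 * r `^ (2 * m + 1)).
Proof.
have E := rad_energy rho0 m0 m1 mg gi.
have gVi := rad_gVi rho0 m0 m1 mg gi.
have V2i := rad_V2i' rho0 m0 m1 mg gi.
have key : 2 * lam ^+ 2 * \int[mu]_(r in `]0, rho[) (r `^ (2 * m + 1) * (g r * V r)) <=
    \int[mu]_(r in `]0, rho[) (f r ^+ 2 * r `^ (2 * m + 1)) -
    lam ^+ 4 * \int[mu]_(r in `]0, rho[) (r `^ (2 * m + 1) * V r ^+ 2).
  have aeE : {ae mu, forall r, 0 < r < rho -> r `^ (2 * m + 1) * (g r * V r) =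
      r `^ (2 * m + 1) * ((f r - lam ^+ 2 * V r) * V r)}.
    by apply: ae_imp mode_v => r + r0r; move=> /(_ r0r) vV; rewrite /g /mode_rhs vV.
  have mV : measurable_fun `]0, rho[ V := radV_measurable rho0 m1 mg gi.
  have m2 : measurable_fun `]0, rho[ (fun r => r `^ (2 * m + 1) * ((f r - lam ^+ 2 * V r) * V r)).
    apply: measurable_funM => //; apply: measurable_funM => //; apply: measurable_funB => //.
    exact: measurable_funM.
  have i2 := ae_eq_integrable_oo m2 aeE gVi.
  rewrite (ae_eq_Rint_oo _ _ aeE)//; last exact: measurable_int_fun gVi.
  rewrite -!RintegralZl// -RintegralB//; last exact: integrableZ_oo.
  apply: le_Rint_oo.
  - exact: integrableZ_oo.
  - by apply: integrableB_oo => //; exact: integrableZ_oo.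
  - move=> r _; rewrite -subr_ge0.
    rewrite (_ : _ - _ = (f r - lam ^+ 2 * V r) ^+ 2 * r `^ (2 * m + 1)).
      by rewrite mulr_ge0 ?sqr_ge0 ?powR_ge0.
    by move: (r `^ _) (V r) => b c; ring.
have l2 : 0 <= 2 * lam ^+ 2 by rewrite mulr_ge0 ?sqr_ge0.
have := le_trans (ler_wpM2l l2 E) key.
rewrite -/P -/V.
move: (\int[mu]_(r in _) (r `^ (2 * m - 1) * _)) => X.
move: (\int[mu]_(r in _) (r `^ (2 * m + 1) * V r ^+ 2)) => Y.
move: (\int[mu]_(r in _) (r `^ (2 * m + 1) * P r ^+ 2)) => Z.
move: (\int[mu]_(r in _) _) => F.
rewrite lerBrDr; apply: le_trans; rewrite le_eqVlt; apply/orP; left; apply/eqP; ring.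
Qed.

End mode.

(** * Weighted sections and sine coefficients *)

Section Omega_fubini.
Context {R : realType}.
Notation mu := (@lebesgue_measure R).
Variables (rho a : R).
Hypotheses (rho0 : 0 < rho) (a0 : 0 < a).
Notation Om := (Omega rho a).
Implicit Types (H F f : R * R -> R) (k e : R -> R).

Lemma measurable_Omega : measurable Om.
Proof. by rewrite OmegaE; exact: measurable_rect. Qed.

Lemma Omega_finite : (leb2 Om < +oo)%E.
Proof.
rewrite OmegaE /leb2 product_measure1E//= !lebesgue_measure_itv/= !lte_fin.
rewrite rho0 ifT; first by rewrite -!EFinB -EFinM ltry.
by rewrite (lt_trans _ a0)// oppr_lt0.
Qed.

Lemma measurable_Omega1 k : measurable_fun `]0, rho[ k -> measurable_fun Om (fun p => k p.1).
Proof.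
move=> mk; apply: (@measurable_comp _ _ _ _ _ _ `]0, rho[%classic k) => //.
  by move=> _ [p [p1 _] <-] /=; rewrite in_itv.
by apply: measurable_funTS; exact: measurable_fst.
Qed.

Lemma measurable_Omega2 e : measurable_fun `](- a), a[ e -> measurable_fun Om (fun p => e p.2).
Proof.
move=> mk; apply: (@measurable_comp _ _ _ _ _ _ `](- a), a[%classic e) => //.
  by move=> _ [p [_ p2] <-] /=; rewrite in_itv.
by apply: measurable_funTS; exact: measurable_snd.
Qed.

Lemma integrable_Omega_bnd H F (M : R) : leb2.-integrable Om (EFin \o H) ->
  measurable_fun Om F -> (forall p, Om p -> `|F p| <= M) ->
  leb2.-integrable Om (EFin \o (fun p => H p * F p)).
Proof.
exact: (@integrable_mulbnd _ _ R leb2 _ measurable_Omega H F M).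
Qed.

Lemma integrable_Omega_bnd1 k H (M : R) : leb2.-integrable Om (EFin \o H) ->
  measurable_fun `]0, rho[ k -> (forall r, 0 < r < rho -> `|k r| <= M) ->
  leb2.-integrable Om (EFin \o (fun p => k p.1 * H p)).
Proof.
move=> Hi mk kM.
have -> : (fun p => k p.1 * H p) = (fun p => H p * k p.1) by apply/funext => p; rewrite mulrC.
apply: integrable_Omega_bnd Hi (measurable_Omega1 mk) _ => p [p1 _]; exact: kM.
Qed.

Lemma integrable_Omega_bnd2 e H (M : R) : leb2.-integrable Om (EFin \o H) ->
  measurable_fun `](- a), a[ e -> (forall z, - a < z < a -> `|e z| <= M) ->
  leb2.-integrable Om (EFin \o (fun p => e p.2 * H p)).
Proof.
move=> Hi mk kM.
have -> : (fun p => e p.2 * H p) = (fun p => H p * e p.2) by apply/funext => p; rewrite mulrC.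
apply: integrable_Omega_bnd Hi (measurable_Omega2 mk) _ => p [_ p2]; exact: kM.
Qed.

Lemma Omega_int1 H : leb2.-integrable Om (EFin \o H) ->
  mu.-integrable `]0, rho[ (EFin \o (fun r => \int[mu]_(z in `](- a), a[) H (r, z))).
Proof.
by move=> Hi; apply: fubini_integrable1 => //; rewrite -OmegaE.
Qed.

Lemma Omega_int2 H : leb2.-integrable Om (EFin \o H) ->
  mu.-integrable `](- a), a[ (EFin \o (fun z => \int[mu]_(r in `]0, rho[) H (r, z))).
Proof.
by move=> Hi; apply: fubini_integrable2 => //; rewrite -OmegaE.
Qed.

Lemma Omega_ae1 H : leb2.-integrable Om (EFin \o H) ->
  {ae mu, forall r, 0 < r < rho -> mu.-integrable `](- a), a[ (EFin \o (fun z => H (r, z)))}.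
Proof.
move=> Hi; have := @fubini_ae1 R `]0, rho[%classic `](- a), a[%classic _ _ H.
rewrite -OmegaE => /(_ _ _ Hi) h; apply: ae_imp (h _ _) => // r + r0r; apply.
Qed.

Lemma Omega_ae2 H : leb2.-integrable Om (EFin \o H) ->
  {ae mu, forall z, - a < z < a -> mu.-integrable `]0, rho[ (EFin \o (fun r => H (r, z)))}.
Proof.
move=> Hi; have := @fubini_ae2 R `]0, rho[%classic `](- a), a[%classic _ _ H.
rewrite -OmegaE => /(_ _ _ Hi) h; apply: ae_imp (h _ _) => // r + r0r; apply.
Qed.

Lemma Omega_fub1 H : leb2.-integrable Om (EFin \o H) ->
  \int[leb2]_(p in Om) H p = \int[mu]_(r in `]0, rho[) \int[mu]_(z in `](- a), a[) H (r, z).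
Proof. by rewrite OmegaE => Hi; exact: fubini_rect1. Qed.

Lemma Omega_fub2 H : leb2.-integrable Om (EFin \o H) ->
  \int[leb2]_(p in Om) H p = \int[mu]_(z in `](- a), a[) \int[mu]_(r in `]0, rho[) H (r, z).
Proof. by rewrite OmegaE => Hi; exact: fubini_rect2. Qed.

Lemma Omega_coef1 k H (M : R) : leb2.-integrable Om (EFin \o H) ->
  measurable_fun `]0, rho[ k -> (forall r, 0 < r < rho -> `|k r| <= M) ->
  \int[leb2]_(p in Om) (k p.1 * H p) =
  \int[mu]_(r in `]0, rho[) (k r * \int[mu]_(z in `](- a), a[) H (r, z)).
Proof.
move=> Hi mk kM; have kHi := integrable_Omega_bnd1 Hi mk kM.
rewrite Omega_fub1//; apply: ae_eq_Rint_oo.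
- exact: measurable_int_fun (Omega_int1 kHi).
- by apply: measurable_funM => //; exact: measurable_int_fun (Omega_int1 Hi).
- by apply: ae_imp (Omega_ae1 Hi) => r h r0r /=; rewrite RintegralZl//; exact: h.
Qed.

Lemma Omega_coef2 e H (M : R) : leb2.-integrable Om (EFin \o H) ->
  measurable_fun `](- a), a[ e -> (forall z, - a < z < a -> `|e z| <= M) ->
  \int[leb2]_(p in Om) (e p.2 * H p) =
  \int[mu]_(z in `](- a), a[) (e z * \int[mu]_(r in `]0, rho[) H (r, z)).
Proof.
move=> Hi mk kM; have kHi := integrable_Omega_bnd2 Hi mk kM.
rewrite Omega_fub2//; apply: ae_eq_Rint_oo.
- exact: measurable_int_fun (Omega_int2 kHi).
- by apply: measurable_funM => //; exact: measurable_int_fun (Omega_int2 Hi).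
- by apply: ae_imp (Omega_ae2 Hi) => r h r0r /=; rewrite RintegralZl//; exact: h.
Qed.

Lemma Rint_oo_tail d k : 0 <= d ->
  \int[mu]_(r in `]d, rho[) k r = \int[mu]_(r in `]0, rho[) (\1_(`]d, +oo[%classic) r * k r).
Proof.
move=> d0; rewrite [LHS]Rintegral_mkcond [RHS]Rintegral_mkcond; congr Rintegral.
apply/funext => r; rewrite !patchE indicE !mem_setE !in_itv/= andbT.
case: (ltP d r) => dr /=; last by rewrite mul0r; case: ifP.
by rewrite mul1r (le_lt_trans d0 dr).
Qed.

(** Moves half of the weight r^q into the function, so that weighted spaces become the plain L2
    space of dr dz. For the exponent m of [L2w], q = 2 m + 1 includes the Jacobian r. *)
Definition wt (q : R) f (p : R * R) : R := f p * p.1 `^ (q / 2).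

Lemma wt_measurable q f : measurable_fun Om f -> measurable_fun Om (wt q f).
Proof.
move=> mf; apply: measurable_funM => //; apply: (@measurable_Omega1 (fun r => r `^ (q / 2))).
by apply: measurable_funTS; exact: measurable_powR.
Qed.

Lemma wt_sqr q f p : Om p -> wt q f p ^+ 2 = f p ^+ 2 * p.1 `^ q.
Proof. by move=> [/andP[p0 _] _]; rewrite exprMn pow_sqr. Qed.

Lemma L2w_sqE m f : L2w_sq rho a m f = (\int[leb2]_(p in Om) (wt (2 * m + 1) f p ^+ 2)%:E)%E.
Proof.
apply: eq_integral => p; rewrite inE => Omp; congr EFin; rewrite wt_sqr//.
have [/andP[p0 _] _] := Omp.
by rewrite real_normK ?num_real// -powM// powRr1 ?ltW// mulrA.
Qed.

Lemma L2w_L2 m f : L2w rho a m f -> L2 leb2 Om (wt (2 * m + 1) f).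
Proof.
move=> [mf fi]; apply: (@L2P _ _ R leb2); first exact: wt_measurable.
by rewrite -L2w_sqE.
Qed.

Lemma L2_Omega_int F : L2 leb2 Om F -> leb2.-integrable Om (EFin \o F).
Proof. exact: (@L2_cst_fin _ _ R leb2 _ measurable_Omega F Omega_finite). Qed.

(* For r > 0 this is the coefficient of f(r, .) along e; the weight stays inside
   the integral because only [wt q f] is known to be square integrable. *)
Definition zc q f e r : R := r `^ (- (q / 2)) * \int[mu]_(z in `](- a), a[) (wt q f (r, z) * e z).

Section zcoef.
Variables (q : R) (f : R * R -> R) (e : R -> R) (M : R).
Hypotheses (Lf : L2 leb2 Om (wt q f)) (me : measurable_fun `](- a), a[ e)
  (eM : forall z, - a < z < a -> `|e z| <= M).

Lemma wte_int : leb2.-integrable Om (EFin \o (fun p => wt q f p * e p.2)).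
Proof.
by apply: integrable_Omega_bnd (L2_Omega_int Lf) (measurable_Omega2 me) _ => p [_ /eM]; exact.
Qed.

Lemma zc_measurable : measurable_fun `]0, rho[ (zc q f e).
Proof.
apply: measurable_funM; first by apply: measurable_funTS; exact: measurable_powR.
exact: measurable_int_fun (Omega_int1 wte_int).
Qed.

(** A radial factor k may be paired with f as soon as it compensates the weight, that is, k r^(-q/2)
    is bounded; Fubini then applies to the weighted function, which is integrable. *)
Lemma zc_int k (C : R) : measurable_fun `]0, rho[ k ->
  (forall r, 0 < r < rho -> `|k r * r `^ (- (q / 2))| <= C) ->
  leb2.-integrable Om (EFin \o (fun p => k p.1 * (f p * e p.2))) /\
  \int[leb2]_(p in Om) (k p.1 * (f p * e p.2)) = \int[mu]_(r in `]0, rho[) (k r * zc q f e r).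
Proof.
move=> mk kC.
have mk' : measurable_fun `]0, rho[ (fun r => k r * r `^ (- (q / 2))).
  by apply: measurable_funM => //; apply: measurable_funTS; exact: measurable_powR.
have E p : Om p -> k p.1 * (f p * e p.2) = k p.1 * p.1 `^ (- (q / 2)) * (wt q f p * e p.2).
  move=> [/andP[p0 _] _].
  have : p.1 `^ (- (q / 2)) * p.1 `^ (q / 2) = 1 by rewrite powM// addNr powRr0.
  rewrite /wt; move: (p.1 `^ _) (p.1 `^ _) => b c bc.
  by rewrite -[LHS]mul1r -bc; ring.
have h1 := integrable_Omega_bnd1 wte_int mk' kC.
have h2 := Omega_coef1 wte_int mk' kC.
split.
  by apply: eq_integrable h1 => [|p]; [exact: measurable_Omega|rewrite inE => /E /= ->].
transitivity (\int[leb2]_(p in Om) (k p.1 * p.1 `^ (- (q / 2)) * (wt q f p * e p.2))).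
  by apply: eq_Rintegral => p; rewrite inE => /E.
by rewrite h2; apply: eq_Rint_oo => r _; rewrite /zc mulrA.
Qed.

Lemma zc_sqr r : 0 < r -> zc q f e r ^+ 2 * r `^ q = (\int[mu]_(z in `](- a), a[) (wt q f (r, z) * e z)) ^+ 2.
Proof.
move=> r0; rewrite /zc exprMn mulrAC -mulNr pow_sqr// powM// addNr powRr0 mul1r//.
Qed.

End zcoef.
End Omega_fubini.

(** * Zero traces *)

Lemma integral_Rint_oo {R : realType} (x y : R) (f : R -> R) :
  (@lebesgue_measure R).-integrable `]x, y[ (EFin \o f) ->
  (\int[@lebesgue_measure R]_(t in `]x, y[) (f t)%:E =
   (\int[@lebesgue_measure R]_(t in `]x, y[) f t)%:E)%E.
Proof. exact: integral_Rintegral. Qed.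

Lemma cvgn_of_sub0 {R : realType} (x : nat -> R) (l : R) :
  x n - l @[n --> \oo] --> 0 -> x n @[n --> \oo] --> l.
Proof.
move=> x0; have -> : x = (fun n => x n - l + l) by apply/funext => n; rewrite subrK.
by rewrite -[X in _ --> X]add0r; apply: cvgD; [exact: x0|exact: cvg_cst].
Qed.

Lemma cvgn_uniq {R : realType} (x : nat -> R) (l l' : R) :
  x n @[n --> \oo] --> l -> x n @[n --> \oo] --> l' -> l = l'.
Proof. by move=> h h'; rewrite -(cvg_lim (@norm_hausdorff _ R) h); exact: cvg_lim. Qed.

Section traces.
Context {R : realType}.
Notation mu := (@lebesgue_measure R).
Variables (rho a : R).
Hypotheses (rho0 : 0 < rho) (a0 : 0 < a).
Notation Om := (Omega rho a).
Implicit Types (f u : R * R -> R) (k e : R -> R).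

Lemma ereal_cvg0_lt (u : nat -> \bar R) (d : R) : u n @[n --> \oo] --> 0%E -> 0 < d ->
  \forall n \near \oo, (u n < d%:E)%E.
Proof.
move=> u0 d0; have := u0 [set x : \bar R | (x < d%:E)%E]; apply.
apply: open_nbhs_nbhs; split; last by rewrite /= lte_fin.
exact: open_ereal_lt_ereal.
Qed.

(** The bound is required only where u n is finite: the approximations may be at infinite distance
    from the limit for finitely many n. *)
Lemma cvg0_of_sqr (C : R) (x : nat -> R) (u : nat -> \bar R) :
  (forall n, (0 <= u n)%E) ->
  (forall n, (u n < +oo)%E -> ((x n ^+ 2)%:E <= C%:E * u n)%E) ->
  u n @[n --> \oo] --> 0%E -> x n @[n --> \oo] --> 0.
Proof.
move=> un0 xu u0; apply/cvgr0Pnorm_le => eps eps0.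
pose D := `|C| + 1; have D0 : 0 < D by rewrite ltr_wpDl.
have d0 : 0 < eps ^+ 2 / D by rewrite divr_gt0 ?exprn_gt0.
have := ereal_cvg0_lt u0 d0; apply: filterS => n un.
have h := xu n (lt_trans un (ltry _)).
 rewrite -(@ler_pXn2r _ 2) ?nnegrE ?(ltW eps0)// real_normK ?num_real//.
rewrite -lee_fin; apply: (le_trans h).
apply: (@le_trans _ _ (D%:E * u n)%E).
  by apply: lee_wpmul2r => //; rewrite lee_fin /D ler_wpDr// ler_norm.
apply: (@le_trans _ _ (D%:E * (eps ^+ 2 / D)%:E)%E).
  by apply: lee_wpmul2l; [rewrite lee_fin ltW|exact: ltW].
by rewrite -EFinM lee_fin mulrC divfK// gt_eqF.
Qed.

Lemma smooth_bounded f : smooth f ->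
  exists M, forall p, 0 <= p.1 <= rho -> - a <= p.2 <= a -> `|f p| <= M.
Proof.
move=> sf; pose K : set (R * R) := `[0, rho] `*` `[- a, a].
have cK : compact K by apply: compact_setX; exact: segment_compact.
have K0 : K !=set0.
  by exists (0, a); split; rewrite /= in_itv/= ?lexx ?(ltW rho0)//= ge0_cp// ltW.
have cf : {within K, continuous (fun p => `|f p|)}.
  apply: continuous_subspaceT => x; apply: continuous_comp; first exact: smooth_continuous.
  exact: norm_continuous.
have [c _ cmax] := compact_EVT_max K0 cK cf.
exists `|f c| => p p1 p2; apply: cmax; apply/mem_set; split; by rewrite /= in_itv.
Qed.

Lemma integrable_Omega_cst (c : R) : leb2.-integrable Om (EFin \o (fun=> c)).
Proof.
have := integrable_prod (measurable_itv _) (measurable_itv _)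
  (integrable_cst_oo 0 rho c) (integrable_cst_oo (- a) a 1).
rewrite -OmegaE; apply: eq_integrable; first exact: measurable_Omega.
by move=> p _; rewrite /= mulr1.
Qed.

Lemma integrable_Omega_bounded f (M : R) : measurable_fun Om f ->
  (forall p, Om p -> `|f p| <= M) -> leb2.-integrable Om (EFin \o f).
Proof.
move=> mf fM; have := integrable_Omega_bnd (integrable_Omega_cst 1) mf fM.
by apply: eq_integrable; [exact: measurable_Omega|move=> p _; rewrite /= mul1r].
Qed.

Lemma L2_Omega_bounded f (M : R) : measurable_fun Om f ->
  (forall p, Om p -> `|f p| <= M) -> L2 leb2 Om f.
Proof.
move=> mf fM; split => //; apply: (@integrable_Omega_bounded _ (M ^+ 2)).
  exact: measurable_funX.
move=> p Op; have M0 : 0 <= M by exact: le_trans (fM p Op).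
by rewrite normrX lerXn2r ?nnegrE// fM.
Qed.

Lemma smooth_integrable f : smooth f -> leb2.-integrable Om (EFin \o f).
Proof.
move=> sf; have [M fM] := smooth_bounded sf.
apply: (@integrable_Omega_bounded f M); first exact: smooth_measurable.
by move=> p [/andP[p0 pr] /andP[pa pb]]; apply: fM; apply/andP; split; exact: ltW.
Qed.

Lemma L2w_sq_ge0 m f : (0 <= L2w_sq rho a m f)%E.
Proof.
by apply: integral_ge0 => p [/andP[p0 _] _]; rewrite lee_fin !mulr_ge0 ?sqr_ge0 ?powR_ge0// ltW.
Qed.

Lemma integral_Rint_Omega f : leb2.-integrable Om (EFin \o f) ->
  (\int[leb2]_(p in Om) (f p)%:E = (\int[leb2]_(p in Om) f p)%:E)%E.
Proof. exact: (@integral_Rintegral _ _ R leb2 Om (measurable_Omega rho a) f). Qed.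

Lemma L2_mul_Omega f g : L2 leb2 Om f -> L2 leb2 Om g ->
  leb2.-integrable Om (EFin \o (fun p => f p * g p)).
Proof. exact: (@L2_mul _ _ R leb2 Om (measurable_Omega rho a) f g). Qed.

Lemma CS_Omega f g : L2 leb2 Om f -> L2 leb2 Om g ->
  (\int[leb2]_(p in Om) (f p * g p)) ^+ 2 <=
  (\int[leb2]_(p in Om) (f p ^+ 2)) * (\int[leb2]_(p in Om) (g p ^+ 2)).
Proof. exact: (@Rint_CS _ _ R leb2 Om (measurable_Omega rho a) f g). Qed.

(** Cauchy-Schwarz against a bounded function. The exponent stays [2 * 0 + 1] because it is the
    instance at 0 of the general 2 m + 1. *)
Lemma wt_pair_limit (g : nat -> R * R -> R) u (phi : R * R -> R) (M : R) :
  measurable_fun Om phi -> (forall p, Om p -> `|phi p| <= M) ->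
  (forall n, measurable_fun Om (g n)) ->
  (forall n, leb2.-integrable Om (EFin \o (fun p => phi p * wt (2 * 0 + 1) (g n) p))) ->
  L2w rho a 0 u -> L2w_sq rho a 0 (g n \- u) @[n --> \oo] --> 0%E ->
  \int[leb2]_(p in Om) (phi p * wt (2 * 0 + 1) (g n) p) @[n --> \oo] -->
  \int[leb2]_(p in Om) (phi p * wt (2 * 0 + 1) u p).
Proof.
move=> mphi phiM mg gi Lu gu; have Lu2 := L2w_L2 Lu.
have Lphi := L2_Omega_bounded mphi phiM.
have ui := L2_mul_Omega Lphi Lu2.
have mu : measurable_fun Om u by case: Lu.
have diff n : (L2w_sq rho a 0 (g n \- u)%R < +oo)%E ->
    (((\int[leb2]_(p in Om) (phi p * wt (2 * 0 + 1) (g n) p) -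
     \int[leb2]_(p in Om) (phi p * wt (2 * 0 + 1) u p)) ^+ 2)%:E <=
    (\int[leb2]_(p in Om) (phi p ^+ 2))%:E * L2w_sq rho a 0 (g n \- u)%R)%E.
  move=> fin.
  have Ld : L2 leb2 Om (wt (2 * 0 + 1) (g n \- u)).
    by apply: L2w_L2; split => //; exact: measurable_funB.
  rewrite -RintegralB//; last exact: measurable_Omega.
  have -> : \int[leb2]_(p in Om) (phi p * wt (2 * 0 + 1) (g n) p - phi p * wt (2 * 0 + 1) u p) =
     \int[leb2]_(p in Om) (phi p * wt (2 * 0 + 1) (g n \- u) p).
    by apply: eq_Rintegral => p _; rewrite /wt/=; ring.
  rewrite L2w_sqE (integral_Rint_Omega Ld.2) -EFinM lee_fin.
  exact: CS_Omega.
have c := cvg0_of_sqr (fun n => L2w_sq_ge0 _ _) diff gu.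
exact: cvgn_of_sub0 c.
Qed.


Lemma trace_limit (g : nat -> R * R -> R) u k e (C M : R) :
  (forall n, smooth (g n)) -> L2w rho a 0 u ->
  L2w_sq rho a 0 (g n \- u) @[n --> \oo] --> 0%E ->
  measurable_fun `]0, rho[ k -> (forall r, 0 < r < rho -> `|k r * r `^ (- (1 / 2))| <= C) ->
  measurable_fun `](- a), a[ e -> (forall z, - a < z < a -> `|e z| <= M) ->
  \int[leb2]_(p in Om) (k p.1 * (g n p * e p.2)) @[n --> \oo] -->
  \int[leb2]_(p in Om) (k p.1 * (u p * e p.2)).
Proof.
move=> sg Lu gu mk kC me eM.
pose phi (p : R * R) := k p.1 * p.1 `^ (- (1 / 2)) * e p.2.
have mphi : measurable_fun Om phi.
  apply: measurable_funM; last exact: measurable_Omega2.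
  apply: (@measurable_Omega1 R rho a (fun r => k r * r `^ (- (1 / 2)))).
  by apply: measurable_funM => //; apply: measurable_funTS; exact: measurable_powR.
have phiM p : Om p -> `|phi p| <= C * M.
  by move=> [p1 p2]; rewrite normrM ler_pM// ?kC// eM.
have phiE f p : Om p -> phi p * wt (2 * 0 + 1) f p = k p.1 * (f p * e p.2).
  move=> [/andP[p0 _] _].
  have : p.1 `^ (- (1 / 2)) * p.1 `^ (1 / 2) = 1 by rewrite powM// addNr powRr0.
  rewrite /phi /wt mulr0 add0r; move: (p.1 `^ _) (p.1 `^ _) => b c bc.
  by rewrite -[RHS]mul1r -bc; ring.
have gE n : \int[leb2]_(p in Om) (k p.1 * (g n p * e p.2)) =
    \int[leb2]_(p in Om) (phi p * wt (2 * 0 + 1) (g n) p).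
  by apply: eq_Rintegral => p; rewrite inE => /phiE ->.
have -> : \int[leb2]_(p in Om) (k p.1 * (u p * e p.2)) =
    \int[leb2]_(p in Om) (phi p * wt (2 * 0 + 1) u p).
  by apply: eq_Rintegral => p; rewrite inE => /phiE ->.
under eq_fun do rewrite gE.
apply: (wt_pair_limit mphi phiM _ _ Lu gu) => n; first exact: smooth_measurable.
have [B gB] := smooth_bounded (sg n).
apply: (@integrable_Omega_bounded _ (C * M * (B * rho `^ (1 / 2)))).
  have mw : measurable_fun Om (wt (2 * 0 + 1) (g n)) by apply: wt_measurable; exact: smooth_measurable.
  by apply: measurable_funM; [exact: mphi|exact: mw].
move=> p Op; rewrite normrM; apply: ler_pM => //; first exact: phiM.
have [/andP[p0 pr] /andP[pa pb]] := Op.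
rewrite /wt mulr0 add0r normrM (ger0_norm (powR_ge0 _ _)).
apply: ler_pM => //; first exact: powR_ge0.
  by apply: gB; apply/andP; split; exact: ltW.
by apply: pow_le; [rewrite divr_ge0|exact: p0|exact: ltW].
Qed.


Lemma smooth_L2_z f (r : R) : smooth f -> L2 mu `](- a), a[ (fun z => f (r, z)).
Proof.
move=> sf; have cf := @smooth_continuous_z R f r sf.
split; first by apply: measurable_continuous_oo; exact: continuous_subspaceT.
by apply: integrable_continuous_oo; apply: continuous_subspaceT => z; apply: cvgM; exact: cf.
Qed.

Lemma smooth_L2_r f (z : R) : smooth f -> L2 mu `]0, rho[ (fun r => f (r, z) * r `^ (1 / 2)).
Proof.
move=> sf; have cf := @smooth_continuous_r R f z sf.
have mfr : measurable_fun `]0, rho[ (fun r => f (r, z) * r `^ (1 / 2)).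
  apply: measurable_funM; first by apply: measurable_continuous_oo; exact: continuous_subspaceT.
  by apply: measurable_funTS; exact: measurable_powR.
split; first exact: mfr.
apply: (eq_integrable_oo (f := fun r => f (r, z) ^+ 2 * r)).
  by move=> r /andP[r0 _]; rewrite exprMn pow_sqr// powRr1// ltW.
by apply: integrable_continuous_oo; apply: continuous_subspaceT => t; apply: cvgM; [apply: cvgM; exact: cf|exact: cvg_id].
Qed.

Let S1 f := \int[mu]_(z in `](- a), a[) (f (rho, z) ^+ 2 * rho).
Let S2 f := \int[mu]_(r in `]0, rho[) ((f (r, a) ^+ 2 + f (r, - a) ^+ 2) * r).

Lemma L2S_sqE f : smooth f -> L2S_sq rho a f = (S1 f + S2 f)%:E /\ 0 <= S1 f /\ 0 <= S2 f.
Proof.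
move=> sf; have [_ i1] := smooth_L2_z rho sf.
have i2 z : mu.-integrable `]0, rho[ (EFin \o (fun r => f (r, z) ^+ 2 * r)).
  apply: eq_integrable_oo (smooth_L2_r z sf).2 => r /andP[r0 _].
  by rewrite exprMn pow_sqr// powRr1// ltW.
split; last first.
  split; first by apply: Rintegral_ge0 => z _; rewrite mulr_ge0 ?sqr_ge0// ltW.
  apply: Rintegral_ge0 => r; rewrite /= in_itv/= => /andP[r0 _].
  by rewrite mulr_ge0 ?addr_ge0 ?sqr_ge0// ltW.
have i1' : mu.-integrable `](- a), a[ (EFin \o (fun z => f (rho, z) ^+ 2 * rho)).
  by apply: eq_integrable_oo (integrableZ_oo rho i1) => z _; rewrite mulrC.
have i2' : mu.-integrable `]0, rho[ (EFin \o (fun r => (f (r, a) ^+ 2 + f (r, - a) ^+ 2) * r)).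
  by apply: eq_integrable_oo (integrableD_oo (i2 a) (i2 (- a))) => r _; rewrite mulrDl.
rewrite EFinD -(integral_Rint_oo i1') -(integral_Rint_oo i2').
by congr (_ + _)%E; apply: eq_integral => t _; rewrite !real_normK ?num_real.
Qed.

Lemma L2S_sq_ge0 f : smooth f -> (0 <= L2S_sq rho a f)%E.
Proof. by move=> sf; have [-> [h1 h2]] := L2S_sqE sf; rewrite lee_fin addr_ge0. Qed.

Lemma lateral_limit (g : nat -> R * R -> R) e : (forall n, smooth (g n)) ->
  L2S_sq rho a (g n) @[n --> \oo] --> 0%E -> L2 mu `](- a), a[ e ->
  \int[mu]_(z in `](- a), a[) (g n (rho, z) * e z) @[n --> \oo] --> 0.
Proof.
move=> sg gS Le.
apply: (@cvg0_of_sqr (\int[mu]_(z in `](- a), a[) (e z ^+ 2) / rho) _ _ _ _ gS).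
  by move=> n; exact: L2S_sq_ge0.
move=> n _; have [-> [h1 h2]] := L2S_sqE (sg n); rewrite -EFinM lee_fin.
apply: (le_trans (Rint_CS _ (smooth_L2_z rho (sg n)) Le)) => //.
rewrite mulrC -mulrA; apply: ler_wpM2l; first by apply: Rintegral_ge0 => ? _; exact: sqr_ge0.
rewrite mulrC ler_pdivlMr//; apply: (@le_trans _ _ (S1 (g n))); last by rewrite lerDl.
by rewrite /S1 RintegralZr//; have [_] := smooth_L2_z rho (sg n).
Qed.

Lemma base_limit (g : nat -> R * R -> R) k z : (forall n, smooth (g n)) ->
  z = a \/ z = - a ->
  L2S_sq rho a (g n) @[n --> \oo] --> 0%E -> L2 mu `]0, rho[ (fun r => k r * r `^ (- (1 / 2))) ->
  \int[mu]_(r in `]0, rho[) (k r * g n (r, z)) @[n --> \oo] --> 0.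
Proof.
move=> sg za gS Lk.
apply: (@cvg0_of_sqr (\int[mu]_(r in `]0, rho[) ((k r * r `^ (- (1 / 2))) ^+ 2)) _ _ _ _ gS).
  by move=> n; exact: L2S_sq_ge0.
move=> n _; have [-> [h1 h2]] := L2S_sqE (sg n); rewrite -EFinM lee_fin.
have -> : \int[mu]_(r in `]0, rho[) (k r * g n (r, z)) =
    \int[mu]_(r in `]0, rho[) (k r * r `^ (- (1 / 2)) * (g n (r, z) * r `^ (1 / 2))).
  apply: eq_Rint_oo => r /andP[r0 _].
  have : r `^ (- (1 / 2)) * r `^ (1 / 2) = 1 by rewrite powM// addNr powRr0.
  by move: (r `^ _) (r `^ _) => b c bc; rewrite -[LHS]mul1r -bc; ring.
have Lg w := smooth_L2_r w (sg n).
apply: (le_trans (Rint_CS _ Lk (Lg z))) => //.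
apply: ler_wpM2l; first by apply: Rintegral_ge0 => ? _; exact: sqr_ge0.
apply: (@le_trans _ _ (S2 (g n))); last by rewrite lerDr.
have i2 w : mu.-integrable `]0, rho[ (EFin \o (fun r => g n (r, w) ^+ 2 * r)).
  apply: eq_integrable_oo (Lg w).2 => r /andP[r0 _].
  by rewrite exprMn pow_sqr// powRr1// ltW.
apply: le_Rint_oo; first exact: (Lg z).2.
  by apply: eq_integrable_oo (integrableD_oo (i2 a) (i2 (- a))) => r _; rewrite mulrDl.
move=> r /andP[r0 _]; rewrite exprMn pow_sqr// (powRr1 (ltW r0)) mulrDl.
have r0' := ltW r0; by case: za => ->; rewrite ?lerDl ?lerDr mulr_ge0 ?sqr_ge0.
Qed.


Lemma smooth_cut_int k e f (C M : R) : smooth f ->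
  measurable_fun `]0, rho[ k -> (forall r, 0 < r < rho -> `|k r| <= C) ->
  measurable_fun `](- a), a[ e -> (forall z, - a < z < a -> `|e z| <= M) ->
  leb2.-integrable Om (EFin \o (fun p => k p.1 * (f p * e p.2))).
Proof.
move=> sf mk kC me eM; have h := integrable_Omega_bnd2 (smooth_integrable sf) me eM.
have h2 := integrable_Omega_bnd1 h mk kC.
apply: eq_integrable h2; first exact: measurable_Omega.
by move=> p _; rewrite /= [e _ * _]mulrC.
Qed.

(** The multiplier r - d vanishes at the cut d, so the only boundary term is the one on the lateral
    surface; staying at r > d keeps the pairings continuous in the norm weighted by r. *)
Lemma smooth_radial_ibp f e d (M : R) : smooth f -> 0 < d < rho ->
  measurable_fun `](- a), a[ e -> (forall z, - a < z < a -> `|e z| <= M) ->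
  \int[leb2]_(p in Om) (\1_(`]d, +oo[%classic) p.1 * (p.1 - d) * (pdr f p * e p.2)) +
  \int[leb2]_(p in Om) (\1_(`]d, +oo[%classic) p.1 * (f p * e p.2)) =
  (rho - d) * \int[mu]_(z in `](- a), a[) (f (rho, z) * e z).
Proof.
move=> sf /andP[d0 dr] me eM; have sf' : smooth (pdr f) := smooth_pd true sf.
have m1 : measurable_fun `]0, rho[ (\1_(`]d, +oo[%classic) : R -> R) by exact: measurable_indic.
have m2 : measurable_fun `]0, rho[ (fun r : R => \1_(`]d, +oo[%classic) r * (r - d)).
  by apply: measurable_funM => //; apply: measurable_funB => //; exact: measurable_id.
have b1 (r : R) : 0 < r < rho -> `|\1_(`]d, +oo[%classic) r : R| <= 1.
  by move=> _; rewrite indicE; case: (_ \in _); rewrite ?normr1 ?normr0.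
have b2 (r : R) : 0 < r < rho -> `|\1_(`]d, +oo[%classic) r * (r - d)| <= rho + d.
  move=> r0r; have /andP[r0 rr] := r0r; rewrite normrM -[leRHS]mul1r ler_pM ?b1//.
  by apply: (le_trans (ler_normB _ _)); rewrite !ger0_norm ?(ltW r0) ?(ltW d0)// lerD2r ltW.
have i1 := smooth_cut_int sf' m2 b2 me eM.
have i2 := smooth_cut_int sf m1 b1 me eM.
rewrite !Omega_fub2// -RintegralD//; [|exact: Omega_int2 i1|exact: Omega_int2 i2].
rewrite -RintegralZl//; last first.
  have ci : mu.-integrable `](- a), a[ (EFin \o (fun z => f (rho, z))).
    apply: integrable_continuous_oo; apply: continuous_subspaceT; exact: smooth_continuous_z.
  by apply: (@integrable_mulbnd _ _ R mu _ (measurable_itv _) (fun z => f (rho, z)) e M).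
apply: eq_Rint_oo => z _ /=.
have cz := @smooth_continuous_r R f z sf; have cz' := @smooth_continuous_r R _ z sf'.
have [T1 T2] : \int[mu]_(r in `]0, rho[) (\1_(`]d, +oo[%classic) r * (r - d) * (pdr f (r, z) * e z)) =
      \int[mu]_(r in `]d, rho[) ((r - d) * (pdr f (r, z) * e z)) /\
    \int[mu]_(r in `]0, rho[) (\1_(`]d, +oo[%classic) r * (f (r, z) * e z)) =
      \int[mu]_(r in `]d, rho[) (f (r, z) * e z).
  by split; rewrite Rint_oo_tail ?(ltW d0)//; apply: eq_Rint_oo => r _; rewrite ?mulrA.
rewrite T1 T2.
have c1 : continuous (fun r : R => (r - d) * (pdr f (r, z) * e z)).
  move=> r; apply: cvgM; first by apply: cvgB; [exact: cvg_id|exact: cvg_cst].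
  by apply: cvgM; [exact: cz'|exact: cvg_cst].
have c2 : continuous (fun r : R => f (r, z) * e z).
  by move=> r; apply: cvgM; [exact: cz|exact: cvg_cst].
rewrite -RintegralD//; [|by apply: integrable_continuous_oo; exact: continuous_subspaceT..].
have dF t : d < t < rho -> is_derive t 1 (fun r : R => (r - d) * f (r, z) * e z)
    ((t - d) * (pdr f (t, z) * e z) + f (t, z) * e z).
  move=> _; have h1 := @smooth_is_derive_r R f t z sf.
  have h2 : is_derive t 1 (fun r : R => r - d) 1.
    have := @is_deriveB _ _ _ id (cst d) t 1 _ _ (is_derive_id _ _) (is_derive_cst _ _ _).
    by rewrite subr0.
  have h3 := is_deriveM (is_deriveM h2 h1) (is_derive_cst (e z) t 1).
  apply: (is_derive_eq h3); rewrite /GRing.scale/=; ring.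
rewrite (FTC_oo (ltW dr) _ dF); first by ring.
  apply: continuous_subspaceT => r; apply: cvgM; last exact: cvg_cst.
  by apply: cvgM; [apply: cvgB; [exact: cvg_id|exact: cvg_cst]|exact: cz].
by apply: continuous_subspaceT => r; apply: cvgD; [exact: c1|exact: c2].
Qed.

(** The derivative of f ecos is f_z ecos - lam f esin. Since the cosine does not vanish on the
    bases, the boundary terms there have to be removed by the trace. *)
Lemma smooth_axial_ibp f k n (C : R) : smooth f ->
  measurable_fun `]0, rho[ k -> (forall r, 0 < r < rho -> `|k r| <= C) ->
  \int[leb2]_(p in Om) (k p.1 * (pdz f p * ecos a n p.2)) -
  lam a n * \int[leb2]_(p in Om) (k p.1 * (f p * esin a n p.2)) =
  ecos a n a * \int[mu]_(r in `]0, rho[) (k r * f (r, a)) -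
  ecos a n (- a) * \int[mu]_(r in `]0, rho[) (k r * f (r, - a)).
Proof.
move=> sf mk kC; have sf' : smooth (pdz f) := smooth_pd false sf.
have ec z : - a < z < a -> `|ecos a n z| <= (Num.sqrt a)^-1 by move=> _; exact: ecos_bound.
have es z : - a < z < a -> `|esin a n z| <= (Num.sqrt a)^-1 by move=> _; exact: esin_bound.
have i1 := smooth_cut_int sf' mk kC (ecos_measurable _ _) ec.
have i2 := smooth_cut_int sf mk kC (esin_measurable _ _) es.
have one z : - a < z < a -> `|1 : R| <= 1 by rewrite normr1.
have bi (g : R -> R) : continuous g -> mu.-integrable `]0, rho[ (EFin \o (fun r => k r * g r)).
  move=> cg; have gi : mu.-integrable `]0, rho[ (EFin \o g).
    by apply: integrable_continuous_oo; exact: continuous_subspaceT.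
  have := @integrable_mulbnd _ _ R mu _ (measurable_itv _) g k C gi mk.
  move=> h; apply: (eq_integrable_oo (f := fun r => g r * k r)); first by move=> t _; rewrite mulrC.
  by apply: h => r; rewrite /= in_itv/=; exact: kC.
have bz z := bi _ (@smooth_continuous_r R f z sf).
rewrite !Omega_fub1// -!RintegralZl//; [|exact: Omega_int1 i2].
rewrite -!RintegralB//; [|exact: integrableZ_oo|exact: integrableZ_oo|exact: Omega_int1 i1|by apply: integrableZ_oo; exact: Omega_int1 i2].
apply: eq_Rint_oo => r _ /=.
have cz := @smooth_continuous_z R f r sf; have cz' := @smooth_continuous_z R _ r sf'.
have c1 : continuous (fun z : R => k r * (pdz f (r, z) * ecos a n z)).
  by move=> z; apply: cvgM; [exact: cvg_cst|apply: cvgM; [exact: cz'|exact: ecos_continuous]].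
have c2 : continuous (fun z : R => k r * (f (r, z) * esin a n z)).
  by move=> z; apply: cvgM; [exact: cvg_cst|apply: cvgM; [exact: cz|exact: esin_continuous]].
have j1 := integrable_continuous_oo (continuous_subspaceT c1 : {within `[- a, a], continuous _}).
have j2 := integrable_continuous_oo (continuous_subspaceT c2 : {within `[- a, a], continuous _}).
rewrite -RintegralZl// -RintegralB//; last exact: integrableZ_oo.
have dF t : - a < t < a -> is_derive t 1 (fun z : R => k r * (f (r, z) * ecos a n z))
    (k r * (pdz f (r, t) * ecos a n t) - lam a n * (k r * (f (r, t) * esin a n t))).
  move=> _; have h1 := @smooth_is_derive_z R f r t sf.
  have h3 := is_deriveM (is_derive_cst (k r) t 1) (is_deriveM h1 (ecos_derive a n t)).
  apply: (is_derive_eq h3); rewrite /GRing.scale/=; ring.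
have aa : - a <= a by rewrite ge0_cp// ltW.
rewrite (FTC_oo aa _ dF); first by ring.
  apply: continuous_subspaceT => z; apply: cvgM; first exact: cvg_cst.
  by apply: cvgM; [exact: cz|exact: ecos_continuous].
apply: continuous_subspaceT => z; apply: cvgB; first exact: c1.
by apply: cvgM; [exact: cvg_cst|exact: c2].
Qed.


(** Limit of the identity for the smooth approximations: both volume terms converge in the weighted
    L2 norm, and the lateral term tends to 0 with the boundary values. Nothing is needed on the
    axis. *)
Lemma zero_trace_radial u ur uz e d (M : R) : L2w rho a 0 u -> L2w rho a 0 ur ->
  zero_trace rho a u ur uz -> 0 < d < rho ->
  measurable_fun `](- a), a[ e -> (forall z, - a < z < a -> `|e z| <= M) ->
  \int[leb2]_(p in Om) (\1_(`]d, +oo[%classic) p.1 * (p.1 - d) * (ur p * e p.2)) =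
  - \int[leb2]_(p in Om) (\1_(`]d, +oo[%classic) p.1 * (u p * e p.2)).
Proof.
move=> Lu Lur [g [sg g0 g1 _ gS]] d0r me eM; have /andP[d0 dr] := d0r.
have m1 : measurable_fun `]0, rho[ (\1_(`]d, +oo[%classic) : R -> R) by exact: measurable_indic.
have m2 : measurable_fun `]0, rho[ (fun r : R => \1_(`]d, +oo[%classic) r * (r - d)).
  by apply: measurable_funM => //; apply: measurable_funB => //; exact: measurable_id.
have b1 (r : R) : 0 < r < rho -> `|\1_(`]d, +oo[%classic) r * r `^ (- (1 / 2))| <= d `^ (- (1 / 2)).
  move=> _; rewrite indicE mem_setE in_itv/= andbT; case: (ltP d r) => dr'; last by rewrite mul0r normr0 powR_ge0.
  by rewrite [true%:R * _]mul1r ger0_norm ?powR_ge0// pow_anti// ?(ltW dr')// oppr_le0 divr_ge0.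
have b2 (r : R) : 0 < r < rho -> `|\1_(`]d, +oo[%classic) r * (r - d) * r `^ (- (1 / 2))| <= (rho + d) * d `^ (- (1 / 2)).
  move=> r0r; have /andP[r0 rr] := r0r; rewrite mulrAC mulrC normrM ler_pM ?b1//.
  by apply: (le_trans (ler_normB _ _)); rewrite !ger0_norm ?(ltW r0) ?(ltW d0)// lerD2r ltW.
have l1 := trace_limit (fun n => smooth_pd true (sg n)) Lur g1 m2 b2 me eM.
have l2 := trace_limit sg Lu g0 m1 b1 me eM.
have Le : L2 mu `](- a), a[ e.
  split => //; apply: (integrable_dom_oo (k := fun=> M ^+ 2)); [exact: measurable_funX| |exact: integrable_cst_oo].
  move=> z zr; have M0 : 0 <= M by exact: le_trans (eM z zr).
  by rewrite normrX lerXn2r ?nnegrE// eM.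
have l3 := lateral_limit sg gS Le.
have l4 : (rho - d) * \int[mu]_(z in `](- a), a[) (g n (rho, z) * e z) @[n --> \oo] --> (rho - d) * 0.
  by apply: cvgM; [exact: cvg_cst|exact: l3].
have l12 : \int[leb2]_(p in Om) (\1_(`]d, +oo[%classic) p.1 * (p.1 - d) * (pdr (g n) p * e p.2)) +
    \int[leb2]_(p in Om) (\1_(`]d, +oo[%classic) p.1 * (g n p * e p.2)) @[n --> \oo] -->
    \int[leb2]_(p in Om) (\1_(`]d, +oo[%classic) p.1 * (p.1 - d) * (ur p * e p.2)) +
    \int[leb2]_(p in Om) (\1_(`]d, +oo[%classic) p.1 * (u p * e p.2)).
  by apply: cvgD; [exact: l1|exact: l2].
apply/eqP; rewrite -addr_eq0; apply/eqP; apply: (cvgn_uniq l12).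
rewrite -[X in _ --> X](mulr0 (rho - d)).
under eq_fun => n do rewrite (smooth_radial_ibp (sg n) d0r me eM).
exact: l4.
Qed.

(** The condition on the bases becomes a relation between cosine coefficients of u_z and sine
    coefficients of u; boundedness of k r^(-1/2) makes volume and boundary pairings converge. *)
Lemma zero_trace_axial u ur uz k n (C : R) : L2w rho a 0 u -> L2w rho a 0 uz ->
  zero_trace rho a u ur uz ->
  measurable_fun `]0, rho[ k -> (forall r, 0 < r < rho -> `|k r * r `^ (- (1 / 2))| <= C) ->
  \int[leb2]_(p in Om) (k p.1 * (uz p * ecos a n p.2)) =
  lam a n * \int[leb2]_(p in Om) (k p.1 * (u p * esin a n p.2)).
Proof.
move=> Lu Luz [g [sg g0 _ g2 gS]] mk kC.
have kC' r : 0 < r < rho -> `|k r| <= C * rho `^ (1 / 2).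
  move=> /andP[r0 rr].
  have -> : k r = k r * r `^ (- (1 / 2)) * r `^ (1 / 2) by rewrite -mulrA powM// addNr powRr0 mulr1.
  rewrite normrM ler_pM ?kC ?r0//.
  by rewrite ger0_norm ?powR_ge0// pow_le// ?(ltW rr)// divr_ge0.
have ec z : - a < z < a -> `|ecos a n z| <= (Num.sqrt a)^-1 by move=> _; exact: ecos_bound.
have es z : - a < z < a -> `|esin a n z| <= (Num.sqrt a)^-1 by move=> _; exact: esin_bound.
have l1 := trace_limit (fun n => smooth_pd false (sg n)) Luz g2 mk kC (ecos_measurable _ _) ec.
have l2 := trace_limit sg Lu g0 mk kC (esin_measurable _ _) es.
have Lk : L2 mu `]0, rho[ (fun r => k r * r `^ (- (1 / 2))).
  have mk' : measurable_fun `]0, rho[ (fun r => k r * r `^ (- (1 / 2))).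
    by apply: measurable_funM => //; apply: measurable_funTS; exact: measurable_powR.
  split; first exact: mk'.
  apply: (integrable_dom_oo (k := fun=> C ^+ 2)); [exact: measurable_funX| |exact: integrable_cst_oo].
  move=> r r0r; have C0 : 0 <= C by exact: le_trans (kC r r0r).
  by rewrite normrX lerXn2r ?nnegrE// kC.
have l3 := base_limit sg (or_introl erefl) gS Lk.
have l4 := base_limit sg (or_intror erefl) gS Lk.
have l5 : ecos a n a * \int[mu]_(r in `]0, rho[) (k r * g m (r, a)) -
    ecos a n (- a) * \int[mu]_(r in `]0, rho[) (k r * g m (r, - a)) @[m --> \oo] -->
    ecos a n a * 0 - ecos a n (- a) * 0.
  by apply: cvgB; (apply: cvgM; first exact: cvg_cst); [exact: l3|exact: l4].
have l12 : \int[leb2]_(p in Om) (k p.1 * (pdz (g m) p * ecos a n p.2)) -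
   lam a n * \int[leb2]_(p in Om) (k p.1 * (g m p * esin a n p.2)) @[m --> \oo] -->
   \int[leb2]_(p in Om) (k p.1 * (uz p * ecos a n p.2)) -
   lam a n * \int[leb2]_(p in Om) (k p.1 * (u p * esin a n p.2)).
  by apply: cvgB; [exact: l1|apply: cvgM; [exact: cvg_cst|exact: l2]].
apply/eqP; rewrite -subr_eq0; apply/eqP; apply: (cvgn_uniq l12).
rewrite [X in _ --> X](_ : 0 = ecos a n a * 0 - ecos a n (- a) * 0); last by rewrite !mulr0 subrr.
by under eq_fun => m do rewrite (smooth_axial_ibp n (sg m) mk kC').
Qed.

End traces.

(** * The equations of the modes *)

Section Omega_linear.
Context {R : realType}.
Variables (rho a : R).
Notation Om := (Omega rho a).
Implicit Types H F : R * R -> R.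

Lemma integrableZ_Omega k H : leb2.-integrable Om (EFin \o H) ->
  leb2.-integrable Om (EFin \o (fun p => k * H p)).
Proof. exact: (@integrableZE _ _ R leb2 Om (measurable_Omega rho a)). Qed.

Lemma integrableD_Omega H F : leb2.-integrable Om (EFin \o H) ->
  leb2.-integrable Om (EFin \o F) -> leb2.-integrable Om (EFin \o (fun p => H p + F p)).
Proof. exact: (@integrableDE _ _ R leb2 Om (measurable_Omega rho a)). Qed.

Lemma integrableB_Omega H F : leb2.-integrable Om (EFin \o H) ->
  leb2.-integrable Om (EFin \o F) -> leb2.-integrable Om (EFin \o (fun p => H p - F p)).
Proof. exact: (@integrableBE _ _ R leb2 Om (measurable_Omega rho a)). Qed.

Lemma Omega_Zl k H : leb2.-integrable Om (EFin \o H) ->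
  \int[leb2]_(p in Om) (k * H p) = k * \int[leb2]_(p in Om) H p.
Proof. by move=> Hi; apply: RintegralZl Hi; exact: measurable_Omega. Qed.

Lemma Omega_D H F : leb2.-integrable Om (EFin \o H) -> leb2.-integrable Om (EFin \o F) ->
  \int[leb2]_(p in Om) (H p + F p) = \int[leb2]_(p in Om) H p + \int[leb2]_(p in Om) F p.
Proof. by move=> Hi Fi; apply: (RintegralD _ Hi Fi); exact: measurable_Omega. Qed.

Lemma Omega_B H F : leb2.-integrable Om (EFin \o H) -> leb2.-integrable Om (EFin \o F) ->
  \int[leb2]_(p in Om) (H p - F p) = \int[leb2]_(p in Om) H p - \int[leb2]_(p in Om) F p.
Proof. by move=> Hi Fi; apply: (RintegralB _ Hi Fi); exact: measurable_Omega. Qed.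

End Omega_linear.

Section weak_modes.
Context {R : realType}.
Notation mu := (@lebesgue_measure R).
Variables (rho a m : R).
Hypotheses (rho0 : 0 < rho) (a0 : 0 < a) (m0 : 0 < m) (m1 : m < 1).
Notation Om := (Omega rho a).

Lemma pow_bound j (q : R) (xi : R -> R) M : q / 2 <= j%:R -> (forall r, `|xi r| <= M) ->
  forall r, 0 < r < rho -> `|r ^+ j * xi r * r `^ (- (q / 2))| <= rho `^ (j%:R - q / 2) * M.
Proof.
move=> qj xiM r /andP[r0 rr].
have -> : r ^+ j * xi r * r `^ (- (q / 2)) = r `^ (j%:R - q / 2) * xi r.
  by rewrite powE// mulrAC powM.
rewrite normrM ger0_norm ?powR_ge0// ler_pM ?powR_ge0// pow_le ?subr_ge0//.
exact: ltW.
Qed.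

Lemma wt_mul_int (q : R) (f : R * R -> R) (k : R -> R) (C : R) : L2 leb2 Om (wt q f) -> measurable_fun `]0, rho[ k ->
  (forall r, 0 < r < rho -> `|k r * r `^ (- (q / 2))| <= C) ->
  leb2.-integrable Om (EFin \o (fun p => k p.1 * f p)).
Proof.
move=> Lf mk kC.
have one z : - a < z < a -> `|1 : R| <= 1 by rewrite normr1.
have [h _] := @zc_int R rho a rho0 a0 q f (fun=> 1) 1 Lf (measurable_cst _) one k C mk kC.
by apply: eq_integrable h => [|p _]; [exact: measurable_Omega|rewrite /= mulr1].
Qed.

Variables (omega psi psir psiz : R * R -> R).
Hypotheses (Lom : L2w rho a m omega) (Lpsi : L2w rho a 0 psi)
  (Lpsir : L2w rho a 0 psir) (Lpsiz : L2w rho a 0 psiz).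
Hypothesis drpsi : forall phi, test_fun rho a phi ->
  Dr (distr rho a psi) phi = distr rho a psir phi.
Hypothesis dzpsi : forall phi, test_fun rho a phi ->
  Dz (distr rho a psi) phi = distr rho a psiz phi.
Hypothesis tr0 : zero_trace rho a psi psir psiz.
Hypothesis weq : forall phi, test_fun rho a phi ->
  - Lap (distr rho a psi) phi - 2 * divr (Dr (distr rho a psi)) phi = distr rho a omega phi.

(** The 1/r of the Laplacian and the 2/r of the problem add up to 3/r. The product by 1/r acts on
    the test function, so phi / r must be admissible as well. *)
Lemma weak_form phi : test_fun rho a phi -> test_fun rho a (fun p => p.1^-1 * phi p) ->
  distr rho a psir (pdr phi) - 3 * distr rho a psir (fun p => p.1^-1 * phi p) +
  distr rho a psiz (pdz phi) = distr rho a omega phi.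
Proof.
move=> tp tp'; rewrite -weq// /Lap /divr.
have e1 : Dr (Dr (distr rho a psi)) phi = - distr rho a psir (pdr phi).
  by rewrite -drpsi//; exact: (test_fun_pd true tp).
have e3 : Dz (Dz (distr rho a psi)) phi = - distr rho a psiz (pdz phi).
  by rewrite -dzpsi//; exact: (test_fun_pd false tp).
rewrite e1 e3 drpsi//.
by move: (distr _ _ _ _) (distr _ _ _ _) (distr _ _ _ _) => x y z; ring.
Qed.

Lemma test_itv_pow j xi : test_itv 0 rho xi -> test_itv 0 rho (fun r => r ^+ j * xi r).
Proof.
move=> [Cxi [s [t [s0 st tr xi0]]]]; split.
  by apply: CinfM => //; apply: CinfX; exact: Cinf_id.
by exists s, t; split => // x h; rewrite xi0 ?mulr0.
Qed.

Let q0 : R := 2 * 0 + 1.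
Let q0E : q0 = 1. Proof. by rewrite /q0 mulr0 add0r. Qed.
Let qm : R := 2 * m + 1.

Let three : q0 / 2 <= 3. Proof. rewrite q0E; lra. Qed.
Let two : q0 / 2 <= 2. Proof. rewrite q0E; lra. Qed.
Let three' : qm / 2 <= 3. Proof. have := m1; rewrite /qm; lra. Qed.

Section with_xi.
Variable xi : R -> R.
Hypothesis txi : test_itv 0 rho xi.

Let mxi : measurable_fun `]0, rho[ xi.
Proof. by apply: Cinf_measurable => //; case: txi. Qed.
Let mxi' : measurable_fun `]0, rho[ (derive1 xi).
Proof. by apply: Cinf_measurable => //; case: (test_itv_derive txi). Qed.
Let mXf j k : measurable_fun `]0, rho[ k -> measurable_fun `]0, rho[ (fun r : R => r ^+ j * k r).
Proof. by move=> mk; apply: measurable_funM => //; apply: measurable_funTS; exact: exprn_measurable. Qed.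

Lemma int_r_xi j f (q : R) : q / 2 <= j%:R -> L2 leb2 Om (wt q f) ->
  leb2.-integrable Om (EFin \o (fun p => p.1 ^+ j * xi p.1 * f p)).
Proof.
move=> qj Lf; have [M xiM] := test_itv_bounded txi.
exact: (@wt_mul_int q f (fun r => r ^+ j * xi r) _ Lf (mXf j mxi) (pow_bound qj xiM)).
Qed.

Lemma int_r_dxi j f (q : R) : q / 2 <= j%:R -> L2 leb2 Om (wt q f) ->
  leb2.-integrable Om (EFin \o (fun p => p.1 ^+ j * derive1 xi p.1 * f p)).
Proof.
move=> qj Lf; have [M xiM] := test_itv_bounded (test_itv_derive txi).
exact: (@wt_mul_int q f (fun r => r ^+ j * derive1 xi r) _ Lf (mXf j mxi') (pow_bound qj xiM)).
Qed.

Lemma derive1_X3 r : derive1 (fun r => r ^+ 3 * xi r) r = r ^+ 3 * derive1 xi r + 3 * (r ^+ 2 * xi r).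
Proof.
have [Cxi _] := txi; rewrite derive1E.
have h1 := Cinf_is_derive r Cxi.
have h2 : is_derive r 1 (fun r : R => r ^+ 3) (3 * r ^+ 2).
  have h := is_deriveM (is_derive_id r (1 : R)) (is_deriveM (is_derive_id r (1 : R)) (is_derive_id r (1 : R))).
  by apply: (is_derive_eq h); rewrite /GRing.scale/= mulrfctE/=; ring.
have [_ ->] := is_deriveM h2 h1.
rewrite /GRing.scale/=; ring.
Qed.


(** The test function is r^3 xi(r) th(z): in (r^3 xi)' = r^3 xi' + 3 r^2 xi the second term cancels
    the one with 3/r, leaving the divergence form with weight r^3. *)
Lemma weak_prod th : test_itv (- a) a th ->
  \int[leb2]_(p in Om) (th p.2 * (p.1 ^+ 3 * derive1 xi p.1 * psir p)) +
  \int[leb2]_(p in Om) (derive1 th p.2 * (p.1 ^+ 3 * xi p.1 * psiz p)) =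
  \int[leb2]_(p in Om) (th p.2 * (p.1 ^+ 3 * xi p.1 * omega p)).
Proof.
move=> tth; have [Cth _] := tth; have [M thM] := test_itv_bounded tth.
have mth : measurable_fun `](- a), a[ th by apply: Cinf_measurable.
have t3 := test_itv_pow 3 txi; have t2 := test_itv_pow 2 txi.
have [C3 _] := t3.
have tf := test_fun_prod t3 tth; have tf2 := test_fun_prod t2 tth.
have E : (fun p : R * R => p.1^-1 * (p.1 ^+ 3 * xi p.1 * th p.2)) = (fun p => p.1 ^+ 2 * xi p.1 * th p.2).
  apply/funext => p; have [->|p0] := eqVneq p.1 0; first by rewrite !expr0n/= !mul0r mulr0.
  by rewrite [p.1 ^+ 3]exprS !mulrA mulVf// mul1r.
have W := weak_form tf; rewrite E in W; move/(_ tf2) : W; rewrite /distr.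
rewrite (@pdr_prod R (fun r => r ^+ 3 * xi r) th C3) (@pdz_prod R (fun r => r ^+ 3 * xi r) th Cth).
have i1 := integrable_Omega_bnd2 (int_r_dxi three (L2w_L2 Lpsir)) mth (fun z _ => thM z).
have i2 := integrable_Omega_bnd2 (int_r_xi two (L2w_L2 Lpsir)) mth (fun z _ => thM z).
have -> : \int[leb2]_(p in Om) (psir p * (derive1 (fun r => r ^+ 3 * xi r) p.1 * th p.2)) =
    \int[leb2]_(p in Om) (th p.2 * (p.1 ^+ 3 * derive1 xi p.1 * psir p)) +
    3 * \int[leb2]_(p in Om) (th p.2 * (p.1 ^+ 2 * xi p.1 * psir p)).
  rewrite -(Omega_Zl _ i2) -(Omega_D i1 (integrableZ_Omega _ i2)).
  by apply: eq_Rintegral => p _; rewrite derive1_X3; ring.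
have -> : \int[leb2]_(p in Om) (psir p * (p.1 ^+ 2 * xi p.1 * th p.2)) =
    \int[leb2]_(p in Om) (th p.2 * (p.1 ^+ 2 * xi p.1 * psir p)).
  by apply: eq_Rintegral => p _; ring.
have -> : \int[leb2]_(p in Om) (psiz p * (p.1 ^+ 3 * xi p.1 * derive1 th p.2)) =
    \int[leb2]_(p in Om) (derive1 th p.2 * (p.1 ^+ 3 * xi p.1 * psiz p)).
  by apply: eq_Rintegral => p _; ring.
have -> : \int[leb2]_(p in Om) (omega p * (p.1 ^+ 3 * xi p.1 * th p.2)) =
    \int[leb2]_(p in Om) (th p.2 * (p.1 ^+ 3 * xi p.1 * omega p)).
  by apply: eq_Rintegral => p _; ring.
by move=> <-; ring.
Qed.


Let PZ (p : R * R) := p.1 ^+ 3 * xi p.1 * psiz p.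
Let PG (p : R * R) := p.1 ^+ 3 * xi p.1 * omega p - p.1 ^+ 3 * derive1 xi p.1 * psir p.

Let PZi : leb2.-integrable Om (EFin \o PZ).
Proof. exact: int_r_xi three (L2w_L2 Lpsiz). Qed.
Let PGi : leb2.-integrable Om (EFin \o PG).
Proof.
apply: integrableB_Omega.
  exact: int_r_xi three' (L2w_L2 Lom).
exact: int_r_dxi three (L2w_L2 Lpsir).
Qed.

(** A sine is not compactly supported in ]-a, a[ and cannot play the part of th. Instead, du
    Bois-Reymond in z shows that h, the radial integral of [PZ], is a constant minus a primitive of
    g, the radial integral of [PG]; integration by parts against the sine then uses only its zeros
    at the ends. *)
Lemma weak_sine n :
  lam a n * \int[leb2]_(p in Om) (ecos a n p.2 * PZ p) = \int[leb2]_(p in Om) (esin a n p.2 * PG p).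
Proof.
pose h z := \int[mu]_(r in `]0, rho[) PZ (r, z).
pose g z := \int[mu]_(r in `]0, rho[) PG (r, z).
have hi : mu.-integrable `](- a), a[ (EFin \o h) by exact: Omega_int2 PZi.
have gi : mu.-integrable `](- a), a[ (EFin \o g) by exact: Omega_int2 PGi.
have aa : - a < a by rewrite gtrN.
have [c hE] : exists c, {ae mu, forall z, - a < z < a -> h z = c - \int[mu]_(s in `](- a), z[) g s}.
  apply: duBoisReymond => // th tth.
  have [Cth _] := tth; have [M thM] := test_itv_bounded tth.
  have [Cth' _] := test_itv_derive tth; have [M' thM'] := test_itv_bounded (test_itv_derive tth).
  have mth : measurable_fun `](- a), a[ th by apply: Cinf_measurable.
  have mth' : measurable_fun `](- a), a[ (derive1 th) by apply: Cinf_measurable.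
  rewrite (eq_Rint_oo (k := fun z => derive1 th z * h z)); last by move=> z _; rewrite mulrC.
  rewrite [RHS](eq_Rint_oo (k := fun z => th z * g z)); last by move=> z _; rewrite mulrC.
  rewrite -(Omega_coef2 PZi mth' (fun z _ => thM' z)) -(Omega_coef2 PGi mth (fun z _ => thM z)).
  have i1 := integrable_Omega_bnd2 (int_r_dxi three (L2w_L2 Lpsir)) mth (fun z _ => thM z).
  have i2 := integrable_Omega_bnd2 (int_r_xi three' (L2w_L2 Lom)) mth (fun z _ => thM z).
  rewrite (_ : \int[leb2]_(p in Om) (th p.2 * PG p) =
    \int[leb2]_(p in Om) (th p.2 * (p.1 ^+ 3 * xi p.1 * omega p)) -
    \int[leb2]_(p in Om) (th p.2 * (p.1 ^+ 3 * derive1 xi p.1 * psir p))); last first.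
    rewrite -(Omega_B i2 i1).
    by apply: eq_Rintegral => p _; rewrite /PG; ring.
  by rewrite -(weak_prod tth) addrAC subrr add0r.
have ec z : - a < z < a -> `|ecos a n z| <= (Num.sqrt a)^-1 by move=> _; exact: ecos_bound.
have es z : - a < z < a -> `|esin a n z| <= (Num.sqrt a)^-1 by move=> _; exact: esin_bound.
rewrite (Omega_coef2 PZi (ecos_measurable _ _) ec) (Omega_coef2 PGi (esin_measurable _ _) es).
rewrite -/h -/g.
have ci : mu.-integrable `](- a), a[ (EFin \o ecos a n).
  by apply: integrable_continuous_oo; apply: continuous_subspaceT; exact: ecos_continuous.
have ki := integrableZ_oo (lam a n) ci.
have FE s : - a <= s -> s <= a -> \int[mu]_(r in `]s, a[) (lam a n * ecos a n r) = esin a n a - esin a n s.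
  move=> as_ sa; apply: FTC_oo => //.
  - by apply: continuous_subspaceT; exact: esin_continuous.
  - by move=> t _; exact: esin_derive.
  - apply: continuous_subspaceT => t; apply: cvgM; [exact: cvg_cst|exact: ecos_continuous].
have wE s : - a < s < a -> esin a n s = 0 - \int[mu]_(r in `]s, a[) (lam a n * ecos a n r).
  by move=> /andP[as_ sa]; rewrite FE ?ltW// esin_r// !sub0r opprK.
have gsi : mu.-integrable `](- a), a[ (EFin \o (fun s => g s * esin a n s)).
  apply: (@integrable_mulbnd _ _ R mu _ (measurable_itv _) g (esin a n) (Num.sqrt a)^-1) => //.
  exact: esin_measurable.
have := IBP_int gi ki wE gsi.
rewrite mul0r sub0r => I1.
rewrite [RHS](eq_Rint_oo (k := fun z => g z * esin a n z)); last by move=> z _; rewrite mulrC.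
rewrite I1.
have mI : measurable_fun `](- a), a[ (fun z => \int[mu]_(s in `](- a), z[) g s).
  by apply: measurable_continuous_oo; apply: continuous_int => //; exact: ltW.
have mec : measurable_fun `](- a), a[ (ecos a n) by exact: ecos_measurable.
have mh := measurable_int_fun hi.
have J : \int[mu]_(z in `](- a), a[) (lam a n * (ecos a n z * h z)) =
   \int[mu]_(z in `](- a), a[) (c * (lam a n * ecos a n z) - lam a n * ecos a n z * \int[mu]_(s in `](- a), z[) g s).
  apply: ae_eq_Rint_oo.
  - by apply: measurable_funM => //; apply: measurable_funM.
  - by apply: measurable_funB; apply: measurable_funM => //; apply: measurable_funM.
  - by apply: ae_imp hE => z E zr; rewrite E//; ring.
have echi : mu.-integrable `](- a), a[ (EFin \o (fun z => ecos a n z * h z)).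
  have := @integrable_mulbnd _ _ R mu _ (measurable_itv _) h (ecos a n) (Num.sqrt a)^-1 hi mec.
  move=> H; apply: (eq_integrable_oo (f := fun z => h z * ecos a n z)); first by move=> z _; rewrite mulrC.
  by apply: H => z _; exact: ecos_bound.
rewrite -RintegralZl// J RintegralB//.
(* The unknown constant c contributes c (esin(a) - esin(-a)) = 0. *)
- by rewrite RintegralZl// FE ?lexx ?ltW// esin_r// esin_l// subrr mulr0 sub0r.
- exact: integrableZ_oo.
- have B z : - a < z < a -> `|\int[mu]_(s in `](- a), z[) g s| <= \int[mu]_(s in `](- a), a[) `|g s|.
    move=> /andP[az za]; apply: le_trans (le_normr_Rintegral _ _) _ => //.
      exact: integrable_sub_oo (lexx _) (ltW za) gi.
    by apply: le_Rint_sub => //; [exact: ltW|exact: integrable_norm gi].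
  apply: (@integrable_mulbnd _ _ R mu _ (measurable_itv _) (fun z => lam a n * ecos a n z) _ _ ki mI).
  by move=> z; rewrite /= in_itv/=; exact: B.
Qed.

End with_xi.

Definition vcoef n := zc a q0 psi (esin a n).
Definition pcoef n := zc a q0 psir (esin a n).
Definition fcoef n := zc a qm omega (esin a n).

Let esb n z : - a < z < a -> `|esin a n z| <= (Num.sqrt a)^-1.
Proof. by move=> _; exact: esin_bound. Qed.
Let ms n : measurable_fun `](- a), a[ (esin a n). Proof. exact: esin_measurable. Qed.


(** One factor lam comes from integrating the equation by parts against the sine, the other from the
    trace on the bases, which converts the cosine coefficient of psi_z into lam times the sine
    coefficient of psi. *)
Lemma vcoef_weak n xi : test_itv 0 rho xi ->
  \int[mu]_(r in `]0, rho[) (r ^+ 3 * pcoef n r * derive1 xi r) +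
  lam a n ^+ 2 * \int[mu]_(r in `]0, rho[) (r ^+ 3 * vcoef n r * xi r) =
  \int[mu]_(r in `]0, rho[) (r ^+ 3 * fcoef n r * xi r).
Proof.
move=> txi; have [M xiM] := test_itv_bounded txi.
have [M' xiM'] := test_itv_bounded (test_itv_derive txi).
have mxi : measurable_fun `]0, rho[ xi by apply: Cinf_measurable => //; case: txi.
have mxi' : measurable_fun `]0, rho[ (derive1 xi).
  by apply: Cinf_measurable => //; case: (test_itv_derive txi).
have mX3 k : measurable_fun `]0, rho[ k -> measurable_fun `]0, rho[ (fun r : R => r ^+ 3 * k r).
  by move=> mk; apply: measurable_funM => //; apply: measurable_funTS; exact: exprn_measurable.
have [ip Ep] := zc_int rho0 a0 (L2w_L2 Lpsir) (ms n) (@esb n) (mX3 _ mxi') (pow_bound three xiM').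
have [iv Ev] := zc_int rho0 a0 (L2w_L2 Lpsi) (ms n) (@esb n) (mX3 _ mxi) (pow_bound three xiM).
have [io Eo] := zc_int rho0 a0 (L2w_L2 Lom) (ms n) (@esb n) (mX3 _ mxi) (pow_bound three' xiM).
rewrite (eq_Rint_oo (k := fun r => r ^+ 3 * derive1 xi r * pcoef n r)); last by move=> r _; rewrite mulrAC.
rewrite (eq_Rint_oo (f := fun r => r ^+ 3 * vcoef n r * xi r) (k := fun r => r ^+ 3 * xi r * vcoef n r)); last by move=> r _; rewrite mulrAC.
rewrite [RHS](eq_Rint_oo (k := fun r => r ^+ 3 * xi r * fcoef n r)); last by move=> r _; rewrite mulrAC.
rewrite -Ep -Ev -Eo.
have kb := pow_bound three xiM; rewrite q0E in kb.
have A := zero_trace_axial rho0 a0 n Lpsi Lpsiz tr0 (mX3 _ mxi) kb.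
rewrite expr2 -mulrA -A.
have W := weak_sine txi n.
rewrite [X in lam a n * X](_ : _ = \int[leb2]_(p in Om) (ecos a n p.2 * (p.1 ^+ 3 * xi p.1 * psiz p))); last first.
  by apply: eq_Rintegral => p _; ring.
rewrite W.
rewrite (_ : \int[leb2]_(p in Om) (esin a n p.2 * _) =
  \int[leb2]_(p in Om) (p.1 ^+ 3 * xi p.1 * (omega p * esin a n p.2)) -
  \int[leb2]_(p in Om) (p.1 ^+ 3 * derive1 xi p.1 * (psir p * esin a n p.2))).
  by ring.
by rewrite -(Omega_B io ip); apply: eq_Rintegral => p _; ring.
Qed.

Lemma vcoef_der n d : 0 < d < rho ->
  \int[mu]_(r in `]d, rho[) (pcoef n r * (r - d)) = - \int[mu]_(r in `]d, rho[) vcoef n r.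
Proof.
move=> d0r; have /andP[d0 dr] := d0r.
have Z := zero_trace_radial rho0 a0 Lpsi Lpsir tr0 d0r (ms n) (@esb n).
have m1' : measurable_fun `]0, rho[ (\1_(`]d, +oo[%classic) : R -> R) by exact: measurable_indic.
have m2 : measurable_fun `]0, rho[ (fun r : R => \1_(`]d, +oo[%classic) r * (r - d)).
  by apply: measurable_funM => //; apply: measurable_funB => //; exact: measurable_id.
have b1 (r : R) : 0 < r < rho -> `|\1_(`]d, +oo[%classic) r * r `^ (- (q0 / 2))| <= d `^ (- (q0 / 2)).
  move=> _; rewrite indicE mem_setE in_itv/= andbT; case: (ltP d r) => dr'; last by rewrite mul0r normr0 powR_ge0.
  by rewrite [true%:R * _]mul1r ger0_norm ?powR_ge0// pow_anti// ?(ltW dr')// oppr_le0 q0E divr_ge0.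
have b2 (r : R) : 0 < r < rho -> `|\1_(`]d, +oo[%classic) r * (r - d) * r `^ (- (q0 / 2))| <= (rho + d) * d `^ (- (q0 / 2)).
  move=> r0r; have /andP[r0 rr] := r0r; rewrite mulrAC mulrC normrM ler_pM ?b1//.
  by apply: (le_trans (ler_normB _ _)); rewrite !ger0_norm ?(ltW r0) ?(ltW d0)// lerD2r ltW.
have [_ Ep] := zc_int rho0 a0 (L2w_L2 Lpsir) (ms n) (@esb n) m2 b2.
have [_ Ev] := zc_int rho0 a0 (L2w_L2 Lpsi) (ms n) (@esb n) m1' b1.
have T k := @Rint_oo_tail R rho d k (ltW d0).
rewrite (T (fun r => pcoef n r * (r - d))) (T (vcoef n)).
rewrite (eq_Rint_oo (k := fun r => \1_(`]d, +oo[%classic) r * (r - d) * pcoef n r)); last by move=> r _; ring.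
by rewrite -Ep -Ev.
Qed.

End weak_modes.

(** * Synthesis from the modes *)

Section ae_dom.
Context {R : realType}.
Notation mu := (@lebesgue_measure R).
Implicit Types (f k : R -> R) (x y : R).

(** The majorant is replaced by max(k, |f|), which dominates everywhere and equals k almost
    everywhere. *)
Lemma integrable_ae_dom_oo x y f k : measurable_fun `]x, y[ f ->
  {ae mu, forall t, x < t < y -> `|f t| <= k t} -> mu.-integrable `]x, y[ (EFin \o k) ->
  mu.-integrable `]x, y[ (EFin \o f).
Proof.
move=> mf fk ki; have mk := measurable_int_fun ki.
apply: (integrable_dom_oo (k := fun t => Num.max (k t) `|f t|)) => //.
  by move=> t _; rewrite le_max lexx orbT.
apply: ae_eq_integrable_oo ki.
  by apply: measurable_maxr => //; exact: measurableT_comp.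
by apply: ae_imp fk => t h /h ht; rewrite max_l.
Qed.

Lemma le_Rint_ae_oo x y f k : mu.-integrable `]x, y[ (EFin \o f) ->
  mu.-integrable `]x, y[ (EFin \o k) -> {ae mu, forall t, x < t < y -> f t <= k t} ->
  \int[mu]_(t in `]x, y[) f t <= \int[mu]_(t in `]x, y[) k t.
Proof.
move=> fi ki fk; have mf := measurable_int_fun fi; have mk := measurable_int_fun ki.
have mmax : measurable_fun `]x, y[ (fun t => Num.max (k t) (f t)) by exact: measurable_maxr.
have E : {ae mu, forall t, x < t < y -> k t = Num.max (k t) (f t)}.
  by apply: ae_imp fk => t h /h ht; rewrite max_l.
rewrite (ae_eq_Rint_oo mk mmax E); apply: le_Rint_oo => //.
  exact: ae_eq_integrable_oo mmax E ki.
by move=> t _; rewrite le_max lexx orbT.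
Qed.

Lemma L2_integrable_oo x y f : L2 mu `]x, y[ f -> mu.-integrable `]x, y[ (EFin \o f).
Proof.
move=> [mf fi]; apply: (integrable_dom_oo (k := fun t => 1 + f t ^+ 2)) => //.
  move=> t _; have := sqr_ge0 (`|f t| - 1); rewrite sqrrB1 real_normK ?num_real//.
  by have := normr_ge0 (f t); move: `|f t| => b; rewrite mulr2n; lra.
by apply: integrableD_oo => //; exact: integrable_cst_oo.
Qed.

End ae_dom.

Lemma eq_Rint_Omega {R : realType} (rho a : R) (H F : R * R -> R) :
  (forall p, Omega rho a p -> H p = F p) ->
  \int[leb2]_(p in Omega rho a) H p = \int[leb2]_(p in Omega rho a) F p.
Proof. by move=> HF; apply: eq_Rintegral => p; rewrite inE => /HF. Qed.

(** * Orthonormal expansions in z with coefficients depending on r *)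

Section expansion.
Context {R : realType}.
Notation mu := (@lebesgue_measure R).
Variables (rho a q : R).
Hypotheses (rho0 : 0 < rho) (a0 : 0 < a).
Notation Om := (Omega rho a).
Variables (E : nat -> R -> R) (M : R).
Hypotheses (mE : forall n, measurable_fun `](- a), a[ (E n))
  (EM : forall n z, `|E n z| <= M)
  (oE : forall n m, \int[mu]_(z in `](- a), a[) (E n z * E m z) = (n == m)%:R).

Let EM' n z : - a < z < a -> `|E n z| <= M. Proof. by move=> _; exact: EM. Qed.

Let LE n : L2 mu `](- a), a[ (E n).
Proof.
split; first exact: mE.
apply: (integrable_dom_oo (k := fun=> M ^+ 2)); [exact: measurable_funX| |exact: integrable_cst_oo].
move=> z zr; have M0 : 0 <= M by exact: le_trans (EM n z).
by rewrite normrX lerXn2r ?nnegrE.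
Qed.

Section bessel.
Variable f : R * R -> R.
Hypothesis Lf : L2 leb2 Om (wt q f).

Lemma wt_section_L2 : {ae mu, forall r, 0 < r < rho -> L2 mu `](- a), a[ (fun z => wt q f (r, z))}.
Proof.
have [mw wi] := Lf.
apply: ae_imp (Omega_ae1 wi) => r h r0r; split; last exact: h.
rewrite OmegaE in mw; by apply: measurable_sectionF mw _.
Qed.

Let cs n r := zc a q f (E n) r ^+ 2 * r `^ q.

Let cs_bessel N : {ae mu, forall r, 0 < r < rho ->
  \sum_(n < N) cs n r <= \int[mu]_(z in `](- a), a[) (wt q f (r, z) ^+ 2)}.
Proof.
apply: ae_imp wt_section_L2 => r h r0r; have Lr := h r0r; have /andP[r0 _] := r0r.
have := @bessel _ _ R mu `](- a), a[%classic (measurable_itv _) E (fun z => wt q f (r, z)) N LE oE Lr.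
by apply: le_trans; apply: ler_sum => n _; rewrite /cs zc_sqr.
Qed.

Let mcs n : measurable_fun `]0, rho[ (cs n).
Proof.
apply: measurable_funM; last by apply: measurable_funTS; exact: measurable_powR.
by apply: measurable_funX; exact: zc_measurable Lf (mE n) (@EM' n).
Qed.

Let wi1 : mu.-integrable `]0, rho[ (EFin \o (fun r => \int[mu]_(z in `](- a), a[) (wt q f (r, z) ^+ 2))).
Proof. by have [_ wi] := Lf; exact: Omega_int1 wi. Qed.

Let cs0 n r : 0 <= cs n r. Proof. by rewrite mulr_ge0 ?sqr_ge0 ?powR_ge0. Qed.

Lemma zc_sqr_integrable n :
  mu.-integrable `]0, rho[ (EFin \o (fun r => zc a q f (E n) r ^+ 2 * r `^ q)).
Proof.
apply: integrable_ae_dom_oo (mcs n) _ wi1.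
apply: ae_imp (cs_bessel n.+1) => r h /h; apply: le_trans.
by rewrite big_ord_recr/= ger0_norm ?cs0// lerDr sumr_ge0.
Qed.

(** Bessel's inequality for the weighted function on almost every section, integrated in r. *)
Lemma zc_bessel N : \sum_(n < N) \int[mu]_(r in `]0, rho[) (zc a q f (E n) r ^+ 2 * r `^ q) <=
  \int[leb2]_(p in Om) (wt q f p ^+ 2).
Proof.
have [_ wi] := Lf.
rewrite (Omega_fub1 wi) -(@Rintegral_sum _ _ R mu _ (measurable_itv _) N cs); last first.
  by move=> n _; exact: zc_sqr_integrable.
apply: le_Rint_ae_oo (cs_bessel N); last exact: wi1.
by apply: integrable_sumE => // n _; exact: zc_sqr_integrable.
Qed.

End bessel.

Section synthesis.
Variables (c : nat -> R -> R) (B : R).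
Hypotheses (mc : forall n, measurable_fun `]0, rho[ (c n))
  (ci : forall n, mu.-integrable `]0, rho[ (EFin \o (fun r => c n r ^+ 2 * r `^ q)))
  (cB : forall N, \sum_(n < N) \int[mu]_(r in `]0, rho[) (c n r ^+ 2 * r `^ q) <= B).

Let X n (p : R * R) := c n p.1 * p.1 `^ (q / 2) * E n p.2.

Lemma Omega_prod (k e : R -> R) : mu.-integrable `]0, rho[ (EFin \o k) ->
  mu.-integrable `](- a), a[ (EFin \o e) ->
  leb2.-integrable Om (EFin \o (fun p => k p.1 * e p.2)) /\
  \int[leb2]_(p in Om) (k p.1 * e p.2) =
  (\int[mu]_(r in `]0, rho[) k r) * \int[mu]_(z in `](- a), a[) e z.
Proof.
move=> ki ei; have pi : leb2.-integrable Om (EFin \o (fun p => k p.1 * e p.2)).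
  by rewrite OmegaE; exact: integrable_prod.
split; first exact: pi.
rewrite (Omega_fub1 pi) -RintegralZr//; apply: eq_Rint_oo => r _ /=.
by rewrite RintegralZl.
Qed.

Let wc n : L2 mu `]0, rho[ (fun r => c n r * r `^ (q / 2)).
Proof.
have mw : measurable_fun `]0, rho[ (fun r => c n r * r `^ (q / 2)).
  by apply: measurable_funM => //; apply: measurable_funTS; exact: measurable_powR.
split; first exact: mw.
by apply: eq_integrable_oo (ci n) => r /andP[r0 _]; rewrite exprMn pow_sqr.
Qed.

Let mX n : measurable_fun Om (X n).
Proof.
apply: measurable_funM; last exact: measurable_Omega2.
by apply: (@measurable_Omega1 R rho a (fun r => c n r * r `^ (q / 2))); case: (wc n).
Qed.

Let XX n k : leb2.-integrable Om (EFin \o (fun p => X n p * X k p)) /\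
  \int[leb2]_(p in Om) (X n p * X k p) =
  (\int[mu]_(r in `]0, rho[) (c n r * r `^ (q / 2) * (c k r * r `^ (q / 2)))) * (n == k)%:R.
Proof.
rewrite -oE; have [h1 h2] := Omega_prod (@L2_mul _ _ R mu _ (measurable_itv _) _ _ (wc n) (wc k)) (@L2_mul _ _ R mu _ (measurable_itv _) _ _ (LE n) (LE k)).
have EX p : c n p.1 * p.1 `^ (q / 2) * (c k p.1 * p.1 `^ (q / 2)) * (E n p.2 * E k p.2) = X n p * X k p.
  by rewrite /X; move: (p.1 `^ _) => b; ring.
split; last by rewrite -h2; apply: eq_Rintegral => p _; rewrite EX.
by apply: eq_integrable h1 => [|p _]; [exact: measurable_Omega|rewrite /= EX].
Qed.

Let LX n : L2 leb2 Om (X n).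
Proof. by split; [exact: mX|have [h _] := XX n n]. Qed.

Let oX n k : n != k -> \int[leb2]_(p in Om) (X n p * X k p) = 0.
Proof. by move=> /negbTE nk; have [_ ->] := XX n k; rewrite nk mulr0. Qed.

Let nX n : \int[leb2]_(p in Om) (X n p ^+ 2) = \int[mu]_(r in `]0, rho[) (c n r ^+ 2 * r `^ q).
Proof.
have [_ h] := XX n n; rewrite (eq_Rint_Omega (F := fun p => X n p * X n p))// h eqxx mulr1.
by apply: eq_Rint_oo => r /andP[r0 _]; rewrite mulrACA -!expr2 pow_sqr.
Qed.

(** With the weight included, the terms [X n] are orthogonal on the rectangle whatever their radial
    factors, so Riesz-Fischer yields G, and F is G divided by the weight. The coefficients of F are
    identified by pairing G with interval indicators in r times [E n] in z. *)
Lemma synthesis : exists F, [/\ L2 leb2 Om (wt q F),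
  \int[leb2]_(p in Om) (wt q F p ^+ 2) <= B,
  forall phi, L2 leb2 Om (fun p => phi p * p.1 `^ (- (q / 2))) ->
    \int[leb2]_(p in Om) ((\sum_(n < N) c n p.1 * E n p.2) * phi p) @[N --> \oo] -->
    \int[leb2]_(p in Om) (F p * phi p) &
  forall n, {ae mu, forall r, 0 < r < rho -> zc a q F (E n) r = c n r}].
Proof.
have sB N : \sum_(n < N) \int[leb2]_(p in Om) (X n p ^+ 2) <= B.
  by apply: le_trans (cB N); apply: ler_sum => n _; rewrite nX.
have [G [LG GB Gw]] := @riesz_fischer _ _ R leb2 Om (measurable_Omega rho a) X B LX oX sB.
pose F (p : R * R) := G p * p.1 `^ (- (q / 2)).
have inv r : 0 < r -> r `^ (- (q / 2)) * r `^ (q / 2) = 1 by move=> r0; rewrite powM// addNr powRr0.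
have wF p : Om p -> wt q F p = G p.
  by move=> [/andP[p0 _] _]; rewrite /wt /F -mulrA inv// mulr1.
have mF : measurable_fun Om (wt q F).
  by case: LG => mG _; apply: eq_measurable_fun mG => p; rewrite inE => /wF.
exists F; split.
- split; first exact: mF.
  by case: LG => _; apply: eq_integrable => [|p]; [exact: measurable_Omega|rewrite inE => /wF /= ->].
- by rewrite (eq_Rint_Omega (F := fun p => G p ^+ 2))// => p /wF ->.
- move=> phi Lphi; have := Gw _ Lphi.
  rewrite (_ : \int[leb2]_(p in Om) (G p * (phi p * p.1 `^ (- (q / 2)))) = \int[leb2]_(p in Om) (F p * phi p)); last first.
    by apply: eq_Rintegral => p _; rewrite /F; move: (p.1 `^ _) => b; ring.
  have EN N : \int[leb2]_(p in Om) ((\sum_(n < N) X n p) * (phi p * p.1 `^ (- (q / 2)))) =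
      \int[leb2]_(p in Om) ((\sum_(n < N) c n p.1 * E n p.2) * phi p).
    apply: eq_Rintegral => p; rewrite inE => -[/andP[p0 _] _].
    rewrite mulrCA mulrC; congr (_ * _); rewrite mulr_suml; apply: eq_bigr => n _.
    by have := inv _ p0; rewrite /X; move: (p.1 `^ _) (p.1 `^ _) => b b' bb; rewrite -[RHS]mul1r -bb; ring.
  by under eq_fun do rewrite EN.
- move=> n; have Wi := @wte_int R rho a rho0 a0 q F (E n) M.
  have LF : L2 leb2 Om (wt q F).
    split; first exact: mF.
    by case: LG => _; apply: eq_integrable => [|p]; [exact: measurable_Omega|rewrite inE => /wF /= ->].
  have {}Wi := Wi LF (mE n) (@EM' n).
  have cin : mu.-integrable `]0, rho[ (EFin \o (fun r => c n r * r `^ (q / 2))).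
    exact: L2_integrable_oo (wc n).
  have Ii := Omega_int1 Wi.
  have : {ae mu, forall r, 0 < r < rho -> \int[mu]_(z in `](- a), a[) (wt q F (r, z) * E n z) - c n r * r `^ (q / 2) = 0}.
    apply: ae0_of_intervals; first exact: integrableB_oo.
    move=> s t s0 st tr.
    have st' : `]s, t[ `<=` (`]0, rho[ : set R) by apply: subset_oo; exact: ltW.
    pose chi (r : R) := \1_(`]s, t[%classic) r : R.
    have mchi : measurable_fun `]0, rho[ chi by exact: measurable_indic.
    have chib r : `|chi r| <= 1 by rewrite /chi indicE; case: (_ \in _); rewrite ?normr1 ?normr0.
    have cut k : \int[mu]_(r in `]s, t[) k r = \int[mu]_(r in `]0, rho[) (chi r * k r).
      rewrite [LHS]Rintegral_mkcond [RHS]Rintegral_mkcond; congr Rintegral.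
      apply/funext => r; rewrite !patchE /chi indicE !mem_setE.
      case: ifPn => [/st' h|_]; last by rewrite mul0r; case: ifP.
      by rewrite ifT ?mul1r.
    rewrite RintegralB//; [|exact: integrable_sub_oo (ltW s0) (ltW tr) Ii|exact: integrable_sub_oo (ltW s0) (ltW tr) cin].
    apply/eqP; rewrite subr_eq0; apply/eqP; rewrite !cut.
    have Lchi : L2 leb2 Om (fun p => chi p.1 * E n p.2).
      apply: (L2_Omega_bounded (M := 1 * M)).
        by apply: measurable_funM; [exact: measurable_Omega1|exact: measurable_Omega2].
      by move=> p _; rewrite normrM ler_pM.
    have := Gw _ Lchi.
    have -> : \int[leb2]_(p in Om) (G p * (chi p.1 * E n p.2)) =
        \int[mu]_(r in `]0, rho[) (chi r * \int[mu]_(z in `](- a), a[) (wt q F (r, z) * E n z)).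
      rewrite -(Omega_coef1 Wi mchi (fun r _ => chib r)).
      by apply: eq_Rintegral => p; rewrite inE => /wF ->; ring.
    have chici k : mu.-integrable `]0, rho[ (EFin \o (fun r => c k r * r `^ (q / 2) * chi r)).
      have ck : mu.-integrable `]0, rho[ (EFin \o (fun r => c k r * r `^ (q / 2))).
        exact: L2_integrable_oo (wc k).
      exact: (@integrable_mulbnd _ _ R mu _ (measurable_itv _) _ chi 1 ck mchi (fun r _ => chib r)).
    have P k := Omega_prod (chici k) (@L2_mul _ _ R mu _ (measurable_itv _) _ _ (LE k) (LE n)).
    have EP k p : X k p * (chi p.1 * E n p.2) = c k p.1 * p.1 `^ (q / 2) * chi p.1 * (E k p.2 * E n p.2).
      by rewrite /X; move: (p.1 `^ _) => b; ring.
    (* Once N > n, orthonormality leaves a single term of the partial sum, so the sequence of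
       pairings is eventually constant. *)
    have EN N : (n < N)%N -> \int[leb2]_(p in Om) ((\sum_(k < N) X k p) * (chi p.1 * E n p.2)) =
        \int[mu]_(r in `]0, rho[) (c n r * r `^ (q / 2) * chi r).
      move=> nN; rewrite (eq_Rint_Omega (F := fun p => \sum_(k < N) c k p.1 * p.1 `^ (q / 2) * chi p.1 * (E k p.2 * E n p.2))); last first.
        by move=> p _; rewrite mulr_suml; apply: eq_bigr => k _; rewrite EP.
      rewrite (@Rintegral_sum _ _ R leb2 Om (measurable_Omega rho a) N (fun k p => c k p.1 * p.1 `^ (q / 2) * chi p.1 * (E k p.2 * E n p.2))); last first.
        by move=> k _; have [] := P k.
      rewrite (bigD1 (Ordinal nN))//= big1 ?addr0; last first.
        move=> k kn; have [_ ->] := P k; rewrite oE.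
        have -> : (k == n :> nat) = false by apply/negbTE; exact: kn.
        by rewrite mulr0.
      by have [_ ->] := P n; rewrite oE eqxx mulr1.
    move=> cv; have := cvgn_uniq cv; apply.
    rewrite (eq_Rint_oo (f := fun r => chi r * _) (k := fun r => c n r * r `^ (q / 2) * chi r)); last by move=> r _; rewrite mulrC.
    by apply: cvg_near_cst; exists n.+1 => // N /= nN; rewrite EN.
  apply: ae_imp => r h /[dup] r0r /andP[r0 _]; have /eqP := h r0r; rewrite subr_eq0 => /eqP {}h.
  by rewrite /zc h mulrCA inv// mulr1.
Qed.

End synthesis.
End expansion.

Lemma eq_Rint_oppr {R : realType} (x y : R) (f k : R -> R) :
  (@lebesgue_measure R).-integrable `]x, y[ (EFin \o k) ->
  (forall t, x < t < y -> f t = - k t) ->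
  \int[@lebesgue_measure R]_(t in `]x, y[) f t = - \int[@lebesgue_measure R]_(t in `]x, y[) k t.
Proof.
move=> ki fk; rewrite -mulN1r -RintegralZl//.
by apply: eq_Rint_oo => t /fk ->; rewrite mulN1r.
Qed.

(** * Termwise integration by parts against test functions *)

Section test_ibp.
Context {R : realType}.
Notation mu := (@lebesgue_measure R).
Variables (rho a : R).
Hypotheses (rho0 : 0 < rho) (a0 : 0 < a).
Notation Om := (Omega rho a).
Variable phi : R * R -> R.
Hypothesis tphi : test_fun rho a phi.

Let sphi : smooth phi. Proof. by case: tphi. Qed.

Let phi0r r z : r <= 0 \/ rho <= r -> phi (r, z) = 0.
Proof.
have [s [t [u [v [s0 st tr [au uv va] h]]]]] := test_fun_box rho0 a0 tphi.
by move=> hr; apply: h; apply/negP => /= /andP[/andP[h1 h2] _]; case: hr => hr; lra.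
Qed.

Let phi0z r z : z <= - a \/ a <= z -> phi (r, z) = 0.
Proof.
have [s [t [u [v [s0 st tr [au uv va] h]]]]] := test_fun_box rho0 a0 tphi.
by move=> hr; apply: h; apply/negP => /= /andP[_ /andP[h1 h2]]; case: hr => hr; lra.
Qed.

Lemma test_mul_int (H : R * R -> R) : leb2.-integrable Om (EFin \o H) ->
  leb2.-integrable Om (EFin \o (fun p => H p * phi p)).
Proof.
move=> Hi; have [M phiM] := test_fun_bounded tphi.
by apply: (integrable_Omega_bnd Hi _ (M := M)) => //; exact: smooth_measurable.
Qed.

(** The support stays in s <= r <= t with s > 0, where any power of r lies below s^x + t^x, whatever
    the sign of x. *)
Lemma test_wt_L2 (x : R) : L2 leb2 Om (fun p => phi p * p.1 `^ x).
Proof.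
have [M phiM] := test_fun_bounded tphi.
have [s [t [u [v [s0 st tr [au uv va] h]]]]] := test_fun_box rho0 a0 tphi.
apply: (L2_Omega_bounded (M := M * (s `^ x + t `^ x))).
  apply: measurable_funM; first exact: smooth_measurable.
  by apply: (@measurable_Omega1 R rho a (fun r => r `^ x)); apply: measurable_funTS; exact: measurable_powR.
move=> p _; have M0 : 0 <= M by exact: le_trans (phiM p).
have [/andP[/andP[sp pt] _]|hp] := boolP ((s <= p.1 <= t) && (u <= p.2 <= v)); last first.
  by rewrite h// mul0r normr0 mulr_ge0 ?addr_ge0 ?powR_ge0.
have p0 : 0 < p.1 by exact: lt_le_trans sp.
rewrite normrM (ger0_norm (powR_ge0 _ _)) ler_pM ?powR_ge0//.
have [x0|x0] := leP 0 x.
  by apply: (le_trans (pow_le x0 p0 pt)); rewrite lerDr powR_ge0.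
by apply: (le_trans (pow_anti (ltW x0) s0 sp)); rewrite lerDl powR_ge0.
Qed.

Lemma test_ibp_z (k e e' : R -> R) : mu.-integrable `]0, rho[ (EFin \o k) ->
  (forall z : R, is_derive z 1 e (e' z)) -> continuous e' ->
  leb2.-integrable Om (EFin \o (fun p => k p.1 * e p.2)) ->
  leb2.-integrable Om (EFin \o (fun p => k p.1 * e' p.2)) ->
  \int[leb2]_(p in Om) (k p.1 * e p.2 * pdz phi p) = - \int[leb2]_(p in Om) (k p.1 * e' p.2 * phi p).
Proof.
move=> ki de ce' i1 i2; have sphi' : smooth (pdz phi) := smooth_pd false sphi.
have ce : continuous e.
  by move=> z; apply: differentiable_continuous; apply/derivable1_diffP; case: (de z).
have j1 : leb2.-integrable Om (EFin \o (fun p => k p.1 * e p.2 * pdz phi p)).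
  have t' : test_fun rho a (pdz phi) := test_fun_pd false tphi.
  have [M phiM] := test_fun_bounded t'.
  by apply: (integrable_Omega_bnd i1 _ (M := M)) => //; exact: smooth_measurable.
have j2 := test_mul_int i2.
apply/eqP; rewrite -addr_eq0 -(Omega_D j1 j2); apply/eqP.
rewrite (Omega_fub1 (integrableD_Omega j1 j2)).
rewrite (eq_Rint_oo (k := fun=> 0)) ?Rintegral0// => r _ /=.
have cz := @smooth_continuous_z R phi r sphi; have cz' := @smooth_continuous_z R _ r sphi'.
have dF t : - a < t < a -> is_derive t 1 (fun z : R => k r * (e z * phi (r, z)))
    (k r * e t * pdz phi (r, t) + k r * e' t * phi (r, t)).
  move=> _; have h1 := @smooth_is_derive_z R phi r t sphi.
  have h3 := is_deriveM (is_derive_cst (k r) t 1) (is_deriveM (de t) h1).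
  apply: (is_derive_eq h3); rewrite /GRing.scale/=; ring.
have aa : - a <= a by rewrite ge0_cp// ltW.
rewrite (FTC_oo aa _ dF).
- by rewrite !phi0z ?lexx ?mulr0 ?subrr//; [left|right].
- apply: continuous_subspaceT => z; apply: cvgM; first exact: cvg_cst.
  by apply: cvgM; [exact: ce|exact: cz].
- apply: continuous_subspaceT => z; apply: cvgD.
    by apply: cvgM; [apply: cvgM; [exact: cvg_cst|exact: ce]|exact: cz'].
  by apply: cvgM; [apply: cvgM; [exact: cvg_cst|exact: ce']|exact: cz].
Qed.

(** V is only a primitive of an integrable P, so on each horizontal line the integration by parts
    goes through [IBP_int], with the derivative of the test function as the integrable factor. *)
Lemma test_ibp_r (V P e : R -> R) (C M : R) : measurable_fun `]0, rho[ V ->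
  (forall r, 0 < r < rho -> `|V r| <= C) -> mu.-integrable `]0, rho[ (EFin \o P) ->
  (forall r, 0 < r < rho -> V r = 0 - \int[mu]_(s in `]r, rho[) P s) ->
  measurable_fun `](- a), a[ e -> (forall z, - a < z < a -> `|e z| <= M) ->
  \int[leb2]_(p in Om) (V p.1 * e p.2 * pdr phi p) = - \int[leb2]_(p in Om) (P p.1 * e p.2 * phi p).
Proof.
move=> mV VC Pi VE me eM; have sphi' : smooth (pdr phi) := smooth_pd true sphi.
have [B phiB] := smooth_bounded rho0 a0 sphi'.
have ei : mu.-integrable `](- a), a[ (EFin \o e).
  by apply: (integrable_dom_oo (k := fun=> M)) => //; exact: integrable_cst_oo.
have [i2 _] := Omega_prod Pi ei.
have Vi : mu.-integrable `]0, rho[ (EFin \o V).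
  by apply: (integrable_dom_oo (k := fun=> C)) => //; exact: integrable_cst_oo.
have [i1 _] := Omega_prod Vi ei.
have j1 : leb2.-integrable Om (EFin \o (fun p => V p.1 * e p.2 * pdr phi p)).
  have t' : test_fun rho a (pdr phi) := test_fun_pd true tphi.
  have [M' phiM] := test_fun_bounded t'.
  by apply: (integrable_Omega_bnd i1 _ (M := M')) => //; exact: smooth_measurable.
have j2 := test_mul_int i2.
have K2 := Omega_int2 j2.
rewrite (Omega_fub2 j1) (Omega_fub2 j2).
apply: (eq_Rint_oppr K2) => z zr /=.
have cz := @smooth_continuous_r R phi z sphi; have cz' := @smooth_continuous_r R _ z sphi'.
have gi : mu.-integrable `]0, rho[ (EFin \o (fun r => pdr phi (r, z))).
  by apply: integrable_continuous_oo; exact: continuous_subspaceT.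
have gVi : mu.-integrable `]0, rho[ (EFin \o (fun r => pdr phi (r, z) * V r)).
  exact: (@integrable_mulbnd _ _ R mu _ (measurable_itv _) _ V C gi mV (fun r => VC r)).
have PhiE r : 0 < r < rho -> \int[mu]_(s in `]0, r[) pdr phi (s, z) = phi (r, z).
  move=> /andP[r0 rr].
  rewrite (@FTC_oo _ _ _ (fun s => phi (s, z)) _ (ltW r0) _ (fun s _ => @smooth_is_derive_r R phi s z sphi)).
  - by rewrite (@phi0r 0) ?subr0//; left.
  - exact: continuous_subspaceT.
  - exact: continuous_subspaceT.
have I := IBP_int gi Pi VE gVi.
have E1 : \int[mu]_(r in `]0, rho[) (V r * e z * pdr phi (r, z)) = e z * \int[mu]_(r in `]0, rho[) (pdr phi (r, z) * V r).
  by rewrite -RintegralZl//; apply: eq_Rint_oo => r _; ring.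
have Pphi : mu.-integrable `]0, rho[ (EFin \o (fun r => P r * phi (r, z))).
  have [M' phiM] := test_fun_bounded tphi.
  have mphi : measurable_fun `]0, rho[ (fun r => phi (r, z)).
    by apply: measurable_continuous_oo; exact: continuous_subspaceT.
  exact: (@integrable_mulbnd _ _ R mu _ (measurable_itv _) P _ M' Pi mphi (fun r _ => phiM _)).
have E2 : \int[mu]_(r in `]0, rho[) (P r * e z * phi (r, z)) = e z * \int[mu]_(r in `]0, rho[) (P r * phi (r, z)).
  by rewrite -RintegralZl//; apply: eq_Rint_oo => r _; ring.
rewrite E1 E2 I mul0r sub0r (eq_Rint_oo (k := fun r => P r * phi (r, z))); first by rewrite mulrN.
by move=> r r0r; rewrite PhiE.
Qed.

End test_ibp.

(** * Local integrability from weighted square integrability *)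

Section local_integrability.
Context {R : realType}.
Variables (rho a : R).
Hypotheses (rho0 : 0 < rho) (a0 : 0 < a).
Notation Om := (Omega rho a).

(* K need not be measurable for the product sigma-algebra of the library. *)
Lemma integrable_subset (B K : set (R * R)) (f : R * R -> R) : measurable B ->
  K `<=` B -> leb2.-integrable B (EFin \o f) -> leb2.-integrable K (EFin \o f).
Proof.
move=> mB KB /integrableP[mf fi]; apply/integrableP; split.
  by move=> mK; apply: (measurable_funS mB KB mf).
apply: le_lt_trans fi; rewrite !ge0_integralE//; apply: ereal_sup_le => _ [h hK <-].
exists h => // x; apply: (le_trans (hK x)); rewrite !patchE.
case: ifPn => [xK|_]; first by rewrite (mem_set (KB _ (set_mem xK))).
by case: ifP => // _; exact: abse_ge0.
Qed.

(** A compact subset of the open rectangle stays at r >= s > 0, where the weight is harmless; the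
    cut at s/2 leaves room for a measurable rectangle containing it. *)
Lemma wt_loc_int (q : R) f : L2 leb2 Om (wt q f) -> loc_int rho a f.
Proof.
move=> Lf; have [mw wi] := Lf.
have inv r : 0 < r -> r `^ (q / 2) * r `^ (- (q / 2)) = 1 by move=> r0; rewrite powM// subrr powRr0.
have mf : measurable_fun Om f.
  have : measurable_fun Om (fun p => wt q f p * p.1 `^ (- (q / 2))).
    apply: measurable_funM => //.
    by apply: (@measurable_Omega1 R rho a (fun r => r `^ (- (q / 2)))); apply: measurable_funTS; exact: measurable_powR.
  apply: eq_measurable_fun => p; rewrite inE => -[/andP[p0 _] _].
  by rewrite /wt -mulrA inv// mulr1.
split; first exact: mf.
move=> K cK KO.
have [s [t [u [v [s0 st tr [au uv va] Kb]]]]] := compact_in_Omega rho0 a0 cK KO.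
pose chi (r : R) := \1_(`]s / 2, +oo[%classic) r : R.
have mchi : measurable_fun `]0, rho[ (fun r => chi r * r `^ (- (q / 2))).
  by apply: measurable_funM; [exact: measurable_indic|apply: measurable_funTS; exact: measurable_powR].
have s20 : 0 < s / 2 by rewrite divr_gt0.
have chib r : 0 < r < rho -> `|chi r * r `^ (- (q / 2))| <= (s / 2) `^ (- (q / 2)) + rho `^ (- (q / 2)).
  move=> /andP[r0 rr]; rewrite /chi indicE mem_setE in_itv/= andbT; case: ltP => sr; last first.
    by rewrite mul0r normr0 addr_ge0 ?powR_ge0.
  rewrite [true%:R * _]mul1r ger0_norm ?powR_ge0//.
  have [x0|x0] := leP 0 (- (q / 2)).
    by apply: (le_trans (pow_le x0 r0 (ltW rr))); rewrite lerDr powR_ge0.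
  by apply: (le_trans (pow_anti (ltW x0) s20 (ltW sr))); rewrite lerDl powR_ge0.
have hi := integrable_Omega_bnd1 (L2_Omega_int rho0 a0 Lf) mchi chib.
have sB : `]s / 2, rho[ `*` `](- a), a[ `<=` Om.
  by move=> [x y] [/=]; rewrite /Omega/= !in_itv/= => /andP[x1 ->] ->; rewrite (lt_trans s20 x1).
have mB : measurable (`]s / 2, rho[ `*` `](- a), a[ : set (R * R)) by exact: measurable_rect.
have hB := @integrableS _ _ R leb2 _ _ _ (measurable_Omega rho a) mB sB hi.
apply: (integrable_subset mB).
  move=> p Kp; have [_ p2] := KO p Kp; have /andP[/andP[p1 p1'] _] := Kb p Kp.
  by split; rewrite /= in_itv/= ?p2//; apply/andP; split; lra.
apply: eq_integrable hB => // p; rewrite inE => -[]; rewrite /= in_itv/= => /andP[sp pr] _.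
have p0 := lt_trans s20 sp.
rewrite /chi indicE mem_setE in_itv/= sp [true%:R * _]mul1r; congr EFin.
by have := inv _ p0; rewrite /wt; move: (p.1 `^ _) (p.1 `^ _) => b b' bb; rewrite -[RHS]mulr1 -bb; ring.
Qed.

End local_integrability.

Section test_sum.
Context {R : realType}.
Notation mu := (@lebesgue_measure R).
Variables (rho a : R).
Hypotheses (rho0 : 0 < rho) (a0 : 0 < a).
Notation Om := (Omega rho a).

Lemma sum_test (k e : nat -> R -> R) phi N : test_fun rho a phi ->
  (forall n, leb2.-integrable Om (EFin \o (fun p => k n p.1 * e n p.2))) ->
  \int[leb2]_(p in Om) ((\sum_(n < N) k n p.1 * e n p.2) * phi p) =
  \sum_(n < N) \int[leb2]_(p in Om) (k n p.1 * e n p.2 * phi p).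
Proof.
move=> tphi ki.
rewrite (eq_Rint_Omega (F := fun p => \sum_(n < N) k n p.1 * e n p.2 * phi p)); last by move=> p _; rewrite mulr_suml.
apply: (@Rintegral_sum _ _ R leb2 Om (measurable_Omega rho a) N (fun n p => k n p.1 * e n p.2 * phi p)).
by move=> n _; exact: (test_mul_int tphi (ki n)).
Qed.

(** The partial sums of both series satisfy the identity exactly, so their limits do. Convergence
    against test functions is enough to differentiate the series as distributions. *)
Lemma limit_ibp (k e k' e' : nat -> R -> R) phi phi' x y : test_fun rho a phi -> test_fun rho a phi' ->
  (forall n, leb2.-integrable Om (EFin \o (fun p => k n p.1 * e n p.2))) ->
  (forall n, leb2.-integrable Om (EFin \o (fun p => k' n p.1 * e' n p.2))) ->
  (forall n, \int[leb2]_(p in Om) (k n p.1 * e n p.2 * phi p) = - \int[leb2]_(p in Om) (k' n p.1 * e' n p.2 * phi' p)) ->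
  \int[leb2]_(p in Om) ((\sum_(n < N) k n p.1 * e n p.2) * phi p) @[N --> \oo] --> x ->
  \int[leb2]_(p in Om) ((\sum_(n < N) k' n p.1 * e' n p.2) * phi' p) @[N --> \oo] --> y ->
  x = - y.
Proof.
move=> t t' ki ki' E cx cy; apply: (cvgn_uniq cx).
rewrite [X in X @ _ --> _](_ : _ = fun N => - \int[leb2]_(p in Om) ((\sum_(n < N) k' n p.1 * e' n p.2) * phi' p)).
  exact: cvgN.
by apply/funext => N; rewrite !sum_test// -sumrN; apply: eq_bigr => n _.
Qed.

End test_sum.

(** Completeness of the sines on almost every section gives equality there, and Tonelli turns it
    into equality almost everywhere in the plane. *)
Lemma sine_sections_inj {R : realType} (rho a : R) (F H : R * R -> R) : 0 < a ->
  measurable_fun (Omega rho a) F -> measurable_fun (Omega rho a) H ->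
  {ae @lebesgue_measure R, forall r, 0 < r < rho ->
    [/\ (@lebesgue_measure R).-integrable `](- a), a[ (EFin \o (fun z => F (r, z))),
        (@lebesgue_measure R).-integrable `](- a), a[ (EFin \o (fun z => H (r, z))) &
        forall n, \int[@lebesgue_measure R]_(z in `](- a), a[) (F (r, z) * esin a n z) =
                  \int[@lebesgue_measure R]_(z in `](- a), a[) (H (r, z) * esin a n z)]} ->
  {ae leb2, forall p, Omega rho a p -> F p = H p}.
Proof.
move=> a0 mF mH FH; rewrite OmegaE in mF mH *.
apply: (rect_ae_eq (measurable_itv _) (measurable_itv _) mF mH).
apply: ae_imp FH => r h; rewrite /= in_itv/= => /h[Fi Hi E].
have Bi := integrableB_oo Fi Hi.
have se (f : R -> R) n : (@lebesgue_measure R).-integrable `](- a), a[ (EFin \o f) ->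
    (@lebesgue_measure R).-integrable `](- a), a[ (EFin \o (fun z => f z * esin a n z)).
  move=> fi; apply: (@integrable_mulbnd _ _ R (@lebesgue_measure R) _ (measurable_itv _) f (esin a n) (Num.sqrt a)^-1) => //.
    exact: esin_measurable.
  by move=> z _; exact: esin_bound.
suff C : {ae @lebesgue_measure R, forall z, - a < z < a -> F (r, z) - H (r, z) = 0}.
  by apply: ae_imp C => z h2; rewrite /= in_itv/= => /h2/eqP; rewrite subr_eq0 => /eqP.
apply: (esin_complete a0 Bi) => n.
rewrite (eq_Rint_oo (k := fun z => F (r, z) * esin a n z - H (r, z) * esin a n z)); last by move=> z _; rewrite mulrBl.
by rewrite RintegralB ?E ?subrr//; exact: se.
Qed.

(** * Summation of the modes and the weak derivatives of psi *)

Section assembly.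
Context {R : realType}.
Notation mu := (@lebesgue_measure R).
Variables (rho a m : R).
Hypotheses (rho0 : 0 < rho) (a0 : 0 < a) (m0 : 0 < m) (m1 : m < 1).
Notation Om := (Omega rho a).
Variables (omega psi psir psiz : R * R -> R).
Hypotheses (Lom : L2w rho a m omega) (Lpsi : L2w rho a 0 psi)
  (Lpsir : L2w rho a 0 psir) (Lpsiz : L2w rho a 0 psiz).
Hypothesis drpsi : forall phi, test_fun rho a phi ->
  Dr (distr rho a psi) phi = distr rho a psir phi.
Hypothesis dzpsi : forall phi, test_fun rho a phi ->
  Dz (distr rho a psi) phi = distr rho a psiz phi.
Hypothesis tr0 : zero_trace rho a psi psir psiz.
Hypothesis weq : forall phi, test_fun rho a phi ->
  - Lap (distr rho a psi) phi - 2 * divr (Dr (distr rho a psi)) phi = distr rho a omega phi.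

Let q0 : R := 2 * 0 + 1.
Let qm : R := 2 * m + 1.
Let qz : R := 2 * (m - 1) + 1.
Let lm n : R := lam a n.
Let v n := vcoef a psi n.
Let pc n := pcoef a psir n.
Let f n := fcoef a m omega n.
Definition gmode n : R -> R := mode_rhs (lm n) (v n) (f n).
Definition Vmode n : R -> R := radV rho (gmode n).
Let P n : R -> R := radP (gmode n).
Let V := Vmode.
Let B : R := \int[leb2]_(p in Om) (wt qm omega p ^+ 2).

Let ms n : measurable_fun `](- a), a[ (esin a n). Proof. exact: esin_measurable. Qed.
Let mc n : measurable_fun `](- a), a[ (ecos a n). Proof. exact: ecos_measurable. Qed.
Let sb n z : `|esin a n z| <= (Num.sqrt a)^-1. Proof. exact: esin_bound. Qed.
Let cb n z : `|ecos a n z| <= (Num.sqrt a)^-1. Proof. exact: ecos_bound. Qed.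
Let so n k := @esin_orth R a a0 n k.
Let co n k := @ecos_orth R a a0 n k.
Let l0 n : 0 < lm n. Proof. exact: lam_gt0. Qed.

Let mv n : measurable_fun `]0, rho[ (v n).
Proof. exact: (zc_measurable rho0 a0 (L2w_L2 Lpsi) (ms n) (fun z _ => sb n z)). Qed.
Let mp n : measurable_fun `]0, rho[ (pc n).
Proof. exact: (zc_measurable rho0 a0 (L2w_L2 Lpsir) (ms n) (fun z _ => sb n z)). Qed.
Let mf n : measurable_fun `]0, rho[ (f n).
Proof. exact: (zc_measurable rho0 a0 (L2w_L2 Lom) (ms n) (fun z _ => sb n z)). Qed.

Let q01 (r : R) : 0 < r -> r `^ q0 = r. Proof. by move=> r0; rewrite /q0 mulr0 add0r powRr1// ltW. Qed.

Let zci q (F : R * R -> R) (LF : L2 leb2 Om (wt q F)) n := zc_sqr_integrable rho0 a0 ms sb so LF n.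

Let vi n : mu.-integrable `]0, rho[ (EFin \o (fun r => v n r ^+ 2 * r)).
Proof.
apply: (eq_integrable_oo (f := fun r => v n r ^+ 2 * r `^ q0)) => [r /andP[r0 _]|]; first by rewrite q01.
exact: (zci (L2w_L2 Lpsi) n).
Qed.
Let pi n : mu.-integrable `]0, rho[ (EFin \o (fun r => pc n r ^+ 2 * r)).
Proof.
apply: (eq_integrable_oo (f := fun r => pc n r ^+ 2 * r `^ q0)) => [r /andP[r0 _]|]; first by rewrite q01.
exact: (zci (L2w_L2 Lpsir) n).
Qed.
Let fi n : mu.-integrable `]0, rho[ (EFin \o (fun r => f n r ^+ 2 * r `^ (2 * m + 1))).
Proof. exact: (zci (L2w_L2 Lom) n). Qed.

Let weak n := @vcoef_weak R rho a m rho0 a0 m1 omega psi psir psiz Lom Lpsi Lpsir Lpsiz drpsi dzpsi tr0 weq n.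
Let der n := @vcoef_der R rho a rho0 a0 psi psir psiz Lpsi Lpsir tr0 n.

Lemma gmode_measurable n : measurable_fun `]0, rho[ (gmode n).
Proof. exact: mode_rhs_measurable (mv n) (mf n). Qed.
Lemma gmode_integrable n : mu.-integrable `]0, rho[ (EFin \o (fun r => gmode n r ^+ 2 * r `^ (2 * m + 1))).
Proof. exact: (@mode_rhs_integrable R rho m (lm n) (v n) (f n) m0 (mv n) (mf n) (vi n) (fi n)). Qed.

Lemma vcoef_mode n : {ae mu, forall r, 0 < r < rho -> v n r = V n r}.
Proof. exact: (@mode_v R rho m (lm n) (v n) (pc n) (f n) rho0 m0 m1 (mv n) (mp n) (mf n) (vi n) (pi n) (fi n) (@weak n) (@der n)). Qed.

Let est n := @mode_est R rho m (lm n) (v n) (pc n) (f n) rho0 m0 m1 (mv n) (mp n) (mf n) (vi n) (pi n) (fi n) (@weak n) (@der n).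

Let mg := gmode_measurable.
Let gi := gmode_integrable.
Let mV n : measurable_fun `]0, rho[ (V n). Proof. exact: radV_measurable rho0 m1 (mg n) (gi n). Qed.
Let mP n : measurable_fun `]0, rho[ (P n). Proof. exact: radP_measurable rho0 m1 (mg n) (gi n). Qed.

Let qzE : qz = 2 * m - 1. Proof. rewrite /qz; ring. Qed.

Let Iv n := \int[mu]_(r in `]0, rho[) (r `^ (2 * m + 1) * V n r ^+ 2).
Let Ip n := \int[mu]_(r in `]0, rho[) (r `^ (2 * m + 1) * P n r ^+ 2).
Let Iz n := \int[mu]_(r in `]0, rho[) (r `^ (2 * m - 1) * V n r ^+ 2).
Let If n := \int[mu]_(r in `]0, rho[) (f n r ^+ 2 * r `^ qm).

Let IvE n : \int[mu]_(r in `]0, rho[) ((- (lm n ^+ 2) * V n r) ^+ 2 * r `^ qm) = lm n ^+ 4 * Iv n.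
Proof.
rewrite -RintegralZl//; last exact: rad_V2i' rho0 m0 m1 (mg n) (gi n).
by apply: eq_Rint_oo => r _; rewrite -/qm; move: (r `^ qm) => b; ring.
Qed.
Let IpE n : \int[mu]_(r in `]0, rho[) ((lm n * P n r) ^+ 2 * r `^ qm) = lm n ^+ 2 * Ip n.
Proof.
rewrite -RintegralZl//; last exact: rad_P2i rho0 m1 (mg n) (gi n).
by apply: eq_Rint_oo => r _; rewrite -/qm; move: (r `^ qm) => b; ring.
Qed.
Let IzE n : \int[mu]_(r in `]0, rho[) ((lm n * V n r) ^+ 2 * r `^ qz) = lm n ^+ 2 * Iz n.
Proof.
rewrite -RintegralZl//; last exact: rad_V2i rho0 m0 m1 (mg n) (gi n).
by apply: eq_Rint_oo => r _; rewrite qzE; move: (r `^ _) => b; ring.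
Qed.

Let Iv0 n : 0 <= Iv n. Proof. by apply: Rintegral_ge0 => r _; rewrite mulr_ge0 ?powR_ge0 ?sqr_ge0. Qed.
Let Ip0 n : 0 <= Ip n. Proof. by apply: Rintegral_ge0 => r _; rewrite mulr_ge0 ?powR_ge0 ?sqr_ge0. Qed.
Let Iz0 n : 0 <= Iz n. Proof. by apply: Rintegral_ge0 => r _; rewrite mulr_ge0 ?powR_ge0 ?sqr_ge0. Qed.

Let IfB N : \sum_(n < N) If n <= B.
Proof. exact: (zc_bessel rho0 a0 ms sb so (L2w_L2 Lom) N). Qed.

Let sumB (F : nat -> R) (k : R) N : 0 < k -> (forall n, k * F n <= If n) -> \sum_(n < N) F n <= B / k.
Proof.
move=> k0 Fk; rewrite ler_pdivlMr// mulrC mulr_sumr; apply: le_trans (IfB N).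
by apply: ler_sum => n _.
Qed.

Let mm : 0 < 4 * m * (1 - m). Proof. by rewrite mulr_gt0 ?mulr_gt0 ?subr_gt0. Qed.

Let split3 n : 0 <= lm n ^+ 4 * Iv n /\ 0 <= 2 * lm n ^+ 2 * Ip n /\ 0 <= 4 * m * (1 - m) * lm n ^+ 2 * Iz n.
Proof.
have l2 : 0 <= lm n ^+ 2 by exact: sqr_ge0.
split; first by rewrite mulr_ge0// exprn_ge0// ltW.
by split; rewrite mulr_ge0// mulr_ge0// ltW.
Qed.

(** [mode_est] bounds a sum of three nonnegative terms, so each is controlled separately: lam^4 [Iv]
    with constant 1, lam^2 [Ip] with 1/2, lam^2 [Iz] with 1/(4 m (1 - m)). Bessel's inequality for
    omega then bounds the three sums. *)
Let bv N : \sum_(n < N) \int[mu]_(r in `]0, rho[) ((- (lm n ^+ 2) * V n r) ^+ 2 * r `^ qm) <= B.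
Proof.
under eq_bigr do rewrite IvE.
rewrite -[leRHS]divr1; apply: (sumB (F := fun n => lm n ^+ 4 * Iv n)) => // n; rewrite mul1r.
by have [h1 [h2 h3]] := split3 n; have := est n; rewrite -/(Iv n) -/(Ip n) -/(Iz n) -/(If n); lra.
Qed.
Let bp N : \sum_(n < N) \int[mu]_(r in `]0, rho[) ((lm n * P n r) ^+ 2 * r `^ qm) <= B / 2.
Proof.
under eq_bigr do rewrite IpE.
apply: (sumB (F := fun n => lm n ^+ 2 * Ip n)) => // n; rewrite [leLHS]mulrA.
by have [h1 [h2 h3]] := split3 n; have := est n; rewrite -/(Iv n) -/(Ip n) -/(Iz n) -/(If n); lra.
Qed.
Let bz N : \sum_(n < N) \int[mu]_(r in `]0, rho[) ((lm n * V n r) ^+ 2 * r `^ qz) <= B / (4 * m * (1 - m)).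
Proof.
under eq_bigr do rewrite IzE.
apply: (sumB (F := fun n => lm n ^+ 2 * Iz n)) => // n; rewrite [leLHS]mulrA.
by have [h1 [h2 h3]] := split3 n; have := est n; rewrite -/(Iv n) -/(Ip n) -/(Iz n) -/(If n); lra.
Qed.

Let iv n : mu.-integrable `]0, rho[ (EFin \o (fun r => (- (lm n ^+ 2) * V n r) ^+ 2 * r `^ qm)).
Proof.
have h := integrableZ_oo (lm n ^+ 4) (rad_V2i' rho0 m0 m1 (mg n) (gi n)).
by apply: eq_integrable_oo h => r _; rewrite -/qm; move: (r `^ qm) => b; rewrite /V /Vmode; ring.
Qed.
Let ip n : mu.-integrable `]0, rho[ (EFin \o (fun r => (lm n * P n r) ^+ 2 * r `^ qm)).
Proof.
have h := integrableZ_oo (lm n ^+ 2) (rad_P2i rho0 m1 (mg n) (gi n)).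
by apply: eq_integrable_oo h => r _; rewrite -/qm; move: (r `^ qm) => b; rewrite /P; ring.
Qed.
Let iz n : mu.-integrable `]0, rho[ (EFin \o (fun r => (lm n * V n r) ^+ 2 * r `^ qz)).
Proof.
have h := integrableZ_oo (lm n ^+ 2) (rad_V2i rho0 m0 m1 (mg n) (gi n)).
by apply: eq_integrable_oo h => r _; rewrite qzE; move: (r `^ _) => b; rewrite /V /Vmode; ring.
Qed.

Let mX (k : R) (F : R -> R) : measurable_fun `]0, rho[ F -> measurable_fun `]0, rho[ (fun r => k * F r).
Proof. by move=> mF; apply: measurable_funM. Qed.

(** Only for this series are the coefficients of the sum recorded: they are needed to recognise
    omega + psi_zz as the data of the radial problem. *)
Lemma zz_synthesis : exists F, [/\ L2 leb2 Om (wt qm F), \int[leb2]_(p in Om) (wt qm F p ^+ 2) <= B,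
  forall phi, test_fun rho a phi ->
    \int[leb2]_(p in Om) ((\sum_(n < N) (- (lm n ^+ 2) * V n p.1) * esin a n p.2) * phi p) @[N --> \oo] -->
    \int[leb2]_(p in Om) (F p * phi p) &
  forall n, {ae mu, forall r, 0 < r < rho -> zc a qm F (esin a n) r = - (lm n ^+ 2) * V n r}].
Proof.
have [F [h1 h2 h3 h4]] := synthesis rho0 a0 ms sb so (fun n => mX (- (lm n ^+ 2)) (mV n)) iv bv.
by exists F; split => // phi tphi; apply: h3; exact: test_wt_L2.
Qed.

Lemma zr_synthesis : exists F, [/\ L2 leb2 Om (wt qm F), \int[leb2]_(p in Om) (wt qm F p ^+ 2) <= B / 2 &
  forall phi, test_fun rho a phi ->
    \int[leb2]_(p in Om) ((\sum_(n < N) (lm n * P n p.1) * ecos a n p.2) * phi p) @[N --> \oo] -->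
    \int[leb2]_(p in Om) (F p * phi p)].
Proof.
have [F [h1 h2 h3 h4]] := synthesis rho0 a0 mc cb co (fun n => mX (lm n) (mP n)) ip bp.
by exists F; split => // phi tphi; apply: h3; exact: test_wt_L2.
Qed.

Lemma z_synthesis : exists F, [/\ L2 leb2 Om (wt qz F), \int[leb2]_(p in Om) (wt qz F p ^+ 2) <= B / (4 * m * (1 - m)) &
  forall phi, test_fun rho a phi ->
    \int[leb2]_(p in Om) ((\sum_(n < N) (lm n * V n p.1) * ecos a n p.2) * phi p) @[N --> \oo] -->
    \int[leb2]_(p in Om) (F p * phi p)].
Proof.
have [F [h1 h2 h3 h4]] := synthesis rho0 a0 mc cb co (fun n => mX (lm n) (mV n)) iz bz.
by exists F; split => // phi tphi; apply: h3; exact: test_wt_L2.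
Qed.

Let LLpsi := L2w_L2 Lpsi.

Let iV n : mu.-integrable `]0, rho[ (EFin \o (fun r => V n r ^+ 2 * r `^ q0)).
Proof.
apply: (@ae_eq_integrable_oo _ _ _ (fun r => v n r ^+ 2 * r `^ q0)).
- apply: measurable_funM; first by exact: measurable_funX.
  by apply: measurable_funTS; exact: measurable_powR.
- by apply: ae_imp (vcoef_mode n) => r h /h ->.
- exact: (zci (L2w_L2 Lpsi) n).
Qed.

Let bV N : \sum_(n < N) \int[mu]_(r in `]0, rho[) (V n r ^+ 2 * r `^ q0) <= \int[leb2]_(p in Om) (wt q0 psi p ^+ 2).
Proof.
apply: le_trans (zc_bessel rho0 a0 ms sb so (L2w_L2 Lpsi) N).
rewrite le_eqVlt; apply/orP; left; apply/eqP; apply: eq_bigr => n _.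
apply: ae_eq_Rint_oo.
- exact: measurable_int_fun (iV n).
- exact: measurable_int_fun (zci (L2w_L2 Lpsi) n).
- by apply: ae_imp (vcoef_mode n) => r h /h <-.
Qed.

(** Synthesis yields some F with coefficients [V n], which are almost everywhere those of psi;
    completeness of the sines on sections identifies F with psi. *)
Lemma psi_expansion phi : test_fun rho a phi ->
  \int[leb2]_(p in Om) ((\sum_(n < N) V n p.1 * esin a n p.2) * phi p) @[N --> \oo] -->
  \int[leb2]_(p in Om) (psi p * phi p).
Proof.
move=> tphi; have [F [LF _ h3 h4]] := synthesis rho0 a0 ms sb so mV iV bV.
have E : {ae leb2, forall p, Om p -> wt q0 F p = wt q0 psi p}.
  have [mF _] := LF; have [mpsi _] := LLpsi.
  apply: sine_sections_inj => //.
  have coefs : {ae mu, forall r, forall n, 0 < r < rho -> zc a q0 F (esin a n) r = zc a q0 psi (esin a n) r}.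
    apply: ae_alln => n; apply: ae_imp2 (h4 n) (vcoef_mode n) => r e1 e2 r0r.
    by rewrite e1// -e2.
  have LL : {ae mu, forall r, 0 < r < rho -> L2 mu `](- a), a[ (fun z => wt q0 F (r, z)) /\
      L2 mu `](- a), a[ (fun z => wt q0 psi (r, z))}.
    by apply: ae_imp2 (wt_section_L2 LF) (wt_section_L2 LLpsi) => r h1 h2 r0r; split; [exact: h1|exact: h2].
  apply: ae_imp2 coefs LL => r coefs' h r0r.
  have [s1 s2] := h r0r.
  split; [exact: L2_integrable_oo s1|exact: L2_integrable_oo s2|].
  move=> n; have /andP[r0 _] := r0r; have := coefs' n r0r; rewrite /zc => /mulfI; apply.
  by rewrite gt_eqF// powR_gt0.
have := h3 _ (test_wt_L2 rho0 a0 tphi _).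
have [mF _] := wt_loc_int rho0 a0 LF; have [mpsi _] := wt_loc_int rho0 a0 LLpsi.
have mphi : measurable_fun Om phi by case: tphi => sphi _; exact: smooth_measurable.
rewrite (@ae_eq_Rintegral _ _ R leb2 Om (measurable_Omega rho a) (fun p => F p * phi p) (fun p => psi p * phi p))//.
- exact: measurable_funM.
- exact: measurable_funM.
apply: ae_imp_leb2 E => p E Op; have := E Op; rewrite /wt => /mulIf ->//.
by have [/andP[p0 _] _] := Op; rewrite gt_eqF// powR_gt0.
Qed.

(** The formal derivatives of the series of psi are differentiated term by term against test
    functions. The first z-derivative is identified first; both second derivatives start from its
    cosine series. *)
Lemma weak_derivatives_exist : exists Fz Fzr Fzz : R * R -> R,
  [/\ L2 leb2 Om (wt qz Fz) /\ \int[leb2]_(p in Om) (wt qz Fz p ^+ 2) <= B / (4 * m * (1 - m)),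
      L2 leb2 Om (wt qm Fzr) /\ \int[leb2]_(p in Om) (wt qm Fzr p ^+ 2) <= B / 2,
      L2 leb2 Om (wt qm Fzz) /\ \int[leb2]_(p in Om) (wt qm Fzz p ^+ 2) <= B,
      forall n, {ae mu, forall r, 0 < r < rho -> zc a qm Fzz (esin a n) r = - (lm n ^+ 2) * V n r} &
      forall phi, test_fun rho a phi -> [/\ Dz (distr rho a psi) phi = distr rho a Fz phi,
        Dr (Dz (distr rho a psi)) phi = distr rho a Fzr phi &
        Dz (Dz (distr rho a psi)) phi = distr rho a Fzz phi]].
Proof.
have [Fzz [zz1 zz2 zz3 zz4]] := zz_synthesis.
have [Fzr [zr1 zr2 zr3]] := zr_synthesis.
have [Fz [z1 z2 z3]] := z_synthesis.
exists Fz, Fzr, Fzz; split => //.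
have Vi n : mu.-integrable `]0, rho[ (EFin \o V n).
  by apply: integrable_continuous_oo; exact: radV_continuous rho0 m1 (mg n) (gi n).
have Pi n : mu.-integrable `]0, rho[ (EFin \o P n) by exact: radP_integrable rho0 m1 (mg n) (gi n).
have ei n : mu.-integrable `](- a), a[ (EFin \o esin a n).
  by apply: integrable_continuous_oo; apply: continuous_subspaceT; exact: esin_continuous.
have ci n : mu.-integrable `](- a), a[ (EFin \o ecos a n).
  by apply: integrable_continuous_oo; apply: continuous_subspaceT; exact: ecos_continuous.
have Ve n := (Omega_prod (Vi n) (ei n)).1.
have lVc n := (Omega_prod (integrableZ_oo (lm n) (Vi n)) (ci n)).1.
have lPc n := (Omega_prod (integrableZ_oo (lm n) (Pi n)) (ci n)).1.
have llVe n := (Omega_prod (integrableZ_oo (- (lm n ^+ 2)) (Vi n)) (ei n)).1.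
have dz phi : test_fun rho a phi -> Dz (distr rho a psi) phi = distr rho a Fz phi.
  move=> t; have t' : test_fun rho a (pdz phi) := test_fun_pd false t.
  rewrite /Dz /distr; apply/eqP; rewrite eqr_oppLR; apply/eqP.
  apply: (limit_ibp (k' := fun n r => lm n * V n r) t' t Ve lVc _ (psi_expansion t') (z3 _ t)) => n.
  have cl : continuous (fun z => lm n * ecos a n z) by move=> z; apply: cvgM; [exact: cvg_cst|exact: ecos_continuous].
  have i2 : leb2.-integrable Om (EFin \o (fun p => V n p.1 * (lm n * ecos a n p.2))).
    by apply: eq_integrable (lVc n) => [|p _]; [exact: measurable_Omega|rewrite /=; congr EFin; ring].
  rewrite (test_ibp_z rho0 a0 t (Vi n) (fun z => esin_derive a n z) cl (Ve n) i2).
  by congr (- _); apply: eq_Rintegral => p _; rewrite mulrCA !mulrA.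
move=> phi t; split; first exact: dz.
- have t' : test_fun rho a (pdr phi) := test_fun_pd true t.
  rewrite /Dr dz// /distr; apply/eqP; rewrite eqr_oppLR; apply/eqP.
  apply: (limit_ibp (k := fun n r => lm n * V n r) (k' := fun n r => lm n * P n r) t' t lVc lPc _ (z3 _ t') (zr3 _ t)) => n.
  have [C C0 VC] := radV_bounded rho0 m1 (mg n) (gi n).
  have lVb r : 0 < r < rho -> `|lm n * V n r| <= lm n * C.
    move=> /andP[r0 rr]; rewrite normrM (gtr0_norm (l0 n)) ler_wpM2l// ?(ltW (l0 n))//.
    by apply: VC; rewrite !ltW.
  have VE r : 0 < r < rho -> lm n * V n r = 0 - \int[mu]_(s in `]r, rho[) (lm n * P n s).
    move=> /andP[r0 rr]; rewrite /V /Vmode (radVE rho0 m1 (mg n) (gi n)) ?(ltW r0) ?(ltW rr)//.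
    rewrite RintegralZl//; first by rewrite !sub0r mulrN.
    exact: integrable_sub_oo (ltW r0) (lexx _) (Pi n).
  exact: (test_ibp_r rho0 a0 t (mX (lm n) (mV n)) lVb (integrableZ_oo (lm n) (Pi n)) VE (mc n) (fun z _ => cb n z)).
- have t' : test_fun rho a (pdz phi) := test_fun_pd false t.
  rewrite /Dz -/(Dz _ _) dz// /distr; apply/eqP; rewrite eqr_oppLR; apply/eqP.
  apply: (limit_ibp (k := fun n r => lm n * V n r) (k' := fun n r => - (lm n ^+ 2) * V n r) t' t lVc llVe _ (z3 _ t') (zz3 _ t)) => n.
  have cl : continuous (fun z => - lm n * esin a n z) by move=> z; apply: cvgM; [exact: cvg_cst|exact: esin_continuous].
  have i2 : leb2.-integrable Om (EFin \o (fun p => lm n * V n p.1 * (- lm n * esin a n p.2))).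
    by apply: eq_integrable (llVe n) => [|p _]; [exact: measurable_Omega|rewrite /=; congr EFin; ring].
  rewrite (test_ibp_z rho0 a0 t (integrableZ_oo (lm n) (Vi n)) (fun z => ecos_derive a n z) cl (lVc n) i2).
  by congr (- _); apply: eq_Rintegral => p _; rewrite /lm; ring.
Qed.

End assembly.

(** * Radial integration of sections *)

(** The variable upper bound is encoded by a function of three variables cut at t < r; the Tonelli
    measurability theorem applies to its positive and negative parts. No integrability is involved,
    since the real integral is [fine] of their difference. *)
Lemma measurable_primitive {R : realType} (rho a : R) (k : R * R -> R) :
  measurable_fun (Omega rho a) k ->
  measurable_fun (Omega rho a) (fun p => \int[@lebesgue_measure R]_(t in `]0, p.1[) k (t, p.2)).
Proof.
move=> mk; have mOm := @measurable_Omega R rho a.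
have mk' : measurable_fun setT (k \_ (Omega rho a)) := (measurable_restrictT k mOm).1 mk.
pose H (x : (R * R) * R) : \bar R := (if x.2 < x.1.1 then (k \_ (Omega rho a)) (x.2, x.1.2) else 0)%:E.
have mH : measurable_fun setT H.
  apply/measurable_EFinP; apply: measurable_fun_ifT.
  - apply: measurable_fun_ltr; first exact: measurable_snd.
    by apply: measurableT_comp; [exact: measurable_fst|exact: measurable_fst].
  - apply: (measurableT_comp mk'); apply: measurable_fun_pair; first exact: measurable_snd.
    by apply: measurableT_comp; [exact: measurable_snd|exact: measurable_fst].
  - exact: measurable_cst.
have M1 := @measurable_fun_fubini_tonelli_F _ _ _ _ R (@lebesgue_measure R) (H^\+)%E (measurable_funepos mH) (fun x => funepos_ge0 H x).
have M2 := @measurable_fun_fubini_tonelli_F _ _ _ _ R (@lebesgue_measure R) (H^\-)%E (measurable_funeneg mH) (fun x => funeneg_ge0 H x).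
have M : measurable_fun setT (fun p => fine (fubini_F (@lebesgue_measure R) (H^\+)%E p - fubini_F (@lebesgue_measure R) (H^\-)%E p)%E).
  by apply: measurableT_comp; [exact: fine_measurable|exact: emeasurable_funB].
apply: eq_measurable_fun (measurable_funTS M) => p; rewrite inE => -[/andP[p0 pr] pz].
rewrite /Rintegral; congr fine; rewrite integral_mkcond integralE /fubini_F.
have HE t : H (p, t) = ((fun x => (k (x, p.2))%:E) \_ `]0%R, p.1[) t.
  rewrite /H /= !patchE/= mem_setE in_itv/=.
  case: (ltP t p.1) => tp; last by rewrite andbF.
  case: (ltP 0 t) => t0 /=; first by rewrite mem_set//; split => //=; rewrite t0 (lt_trans tp).
  by rewrite memNset// => -[/=]; rewrite ltNge t0.
by congr (_ - _)%E; apply: eq_integral => t _; rewrite ?funeposE ?funenegE HE.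
Qed.

Lemma measurable_Rint_section {R : realType} (rho a : R) (k : R * R -> R) :
  measurable_fun (Omega rho a) k ->
  measurable_fun `](- a), a[ (fun z => \int[@lebesgue_measure R]_(t in `]0, rho[) k (t, z)).
Proof.
rewrite OmegaE => /measurable_EFinP mk.
have M1 := @measurable_tonelli_rect2 R `]0, rho[%classic `](- a), a[%classic (measurable_itv _) (measurable_itv _) _ (measurable_funepos mk) (fun p _ => funepos_ge0 _ p).
have M2 := @measurable_tonelli_rect2 R `]0, rho[%classic `](- a), a[%classic (measurable_itv _) (measurable_itv _) _ (measurable_funeneg mk) (fun p _ => funeneg_ge0 _ p).
have M := measurableT_comp (@fine_measurable R setT measurableT) (emeasurable_funB M1 M2).
apply: eq_measurable_fun M => z _ /=.
rewrite /Rintegral; congr fine; rewrite [RHS]integralE.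
by congr (_ - _)%E; apply: eq_integral => t _; rewrite ?funeposE ?funenegE.
Qed.

Lemma Rint_oo_head {R : realType} (rho r : R) (k : R -> R) : r <= rho ->
  \int[@lebesgue_measure R]_(s in `]0, r[) k s = \int[@lebesgue_measure R]_(s in `]0, rho[) (\1_(`]-oo, r[%classic) s * k s).
Proof.
move=> rr; rewrite [LHS]Rintegral_mkcond [RHS]Rintegral_mkcond; congr Rintegral.
apply/funext => s; rewrite !patchE indicE !mem_setE !in_itv/=.
case: (ltP s r) => sr /=; last by rewrite mul0r andbF; case: ifP.
by rewrite mul1r andbT (lt_le_trans sr rr) andbT.
Qed.

Section regularize.
Context {R : realType}.
Notation mu := (@lebesgue_measure R).
Variables (rho a q : R).
Hypotheses (rho0 : 0 < rho) (a0 : 0 < a).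
Notation Om := (Omega rho a).

(* G is F set to zero on a null set of heights z; coefficients do not see the change. *)
Lemma regularize (F : R * R -> R) : measurable_fun Om F -> L2 leb2 Om (wt q F) ->
  exists G, [/\ measurable_fun Om G, L2 leb2 Om (wt q G),
    \int[leb2]_(p in Om) (wt q G p ^+ 2) <= \int[leb2]_(p in Om) (wt q F p ^+ 2),
    forall z, - a < z < a -> mu.-integrable `]0, rho[ (EFin \o (fun r => G (r, z) ^+ 2 * r `^ q)) &
    forall n r, 0 < r < rho -> zc a q G (esin a n) r = zc a q F (esin a n) r].
Proof.
move=> mF LF; have [mw wi] := LF.
have [N [mN N0 PN]] := Omega_ae2 wi.
pose chi z : R := \1_(~` N) z.
have mchi (D : set R) : measurable_fun D chi by apply: measurable_indic; exact: measurableC.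
have chib z : `|chi z| <= 1 by rewrite /chi indicE; case: (_ \in _); rewrite ?normr1 ?normr0.
have mG : measurable_fun Om (fun p => chi p.2 * F p).
  by apply: measurable_funM => //; exact: measurable_Omega2.
have wG p : wt q (fun p => chi p.2 * F p) p = chi p.2 * wt q F p by rewrite /wt mulrA.
have LG : L2 leb2 Om (wt q (fun p => chi p.2 * F p)).
  apply: (@L2_dom _ _ R leb2 _ (measurable_Omega rho a) _ (wt q F)) => //; first exact: wt_measurable.
  by move=> p _; rewrite wG normrM ler_piMl.
exists (fun p => chi p.2 * F p); split => //.
- have [_ gi] := LG; apply: (@le_Rintegral _ _ R leb2 _ _ _ (measurable_Omega rho a) gi wi) => p _.
  rewrite wG exprMn ler_piMl ?sqr_ge0// -real_normK ?num_real// expr_le1//.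
- move=> z zr; have [zN|zN] := pselect (N z).
    apply: (eq_integrable_oo (f := fun=> 0)); last exact: integrable_cst_oo.
    by move=> r _; rewrite /chi indicE memNset ?mul0r ?expr0n ?mul0r//=; exact.
  have h : - a < z < a -> mu.-integrable `]0, rho[ (EFin \o (fun r => wt q F (r, z) ^+ 2)).
    by apply: contrapT => nh; apply: zN; exact: PN.
  apply: eq_integrable_oo (h zr) => r r0r; rewrite (@wt_sqr R rho a)//.
  by rewrite /chi indicE mem_set//= mul1r.
- move=> n r r0r; rewrite /zc; congr (_ * _).
  have ms : measurable_fun `](- a), a[ (esin a n) by exact: esin_measurable.
  have msec (H : R * R -> R) : measurable_fun Om H -> measurable_fun `](- a), a[ (fun z => wt q H (r, z)).
    by move=> mH; have := wt_measurable q mH; rewrite OmegaE => mH'; apply: measurable_sectionF mH' _; rewrite /= ?in_itv.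
  apply: ae_eq_Rint_oo.
  + by apply: measurable_funM => //; exact: msec.
  + by apply: measurable_funM => //; exact: msec.
  exists N; split => // z /= h; apply: contrapT => zN; apply: h => zr.
  by rewrite wG /chi indicE mem_set//= mul1r.
Qed.

End regularize.

Section radial_sections.
Context {R : realType}.
Notation mu := (@lebesgue_measure R).
Variables (rho a m : R) (G : R * R -> R).
Hypotheses (rho0 : 0 < rho) (a0 : 0 < a) (m0 : 0 < m) (m1 : m < 1).
Notation Om := (Omega rho a).
Hypotheses (mG : measurable_fun Om G) (LG : L2 leb2 Om (wt (2 * m + 1) G)).
Hypothesis Gi : forall z, - a < z < a ->
  mu.-integrable `]0, rho[ (EFin \o (fun r => G (r, z) ^+ 2 * r `^ (2 * m + 1))).

Let gz z s := G (s, z).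

Definition secP p : R := radP (gz p.2) p.1.
Definition secQ p : R := radQ (gz p.2) p.1.
Definition secV p : R := radV rho (gz p.2) p.1.

Let mgz z : - a < z < a -> measurable_fun `]0, rho[ (gz z).
Proof.
move=> zr; have := mG; rewrite OmegaE => mG'.
by apply: measurable_sectionG mG' _; rewrite /= ?in_itv.
Qed.

Lemma secP_measurable : measurable_fun Om secP.
Proof.
have mk : measurable_fun Om (fun p => p.1 ^+ 3 * G p).
  apply: measurable_funM => //; apply: (@measurable_Omega1 R rho a (fun r => r ^+ 3)).
  by apply: measurable_funTS; exact: exprn_measurable.
apply: measurable_funN; apply: measurable_funM; last exact: measurable_primitive mk.
apply: (@measurable_Omega1 R rho a (fun r => r ^- 3)).
apply: (eq_measurable_fun (fun s : R => s `^ (- 3%:R))).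
  by move=> s; rewrite inE/= in_itv/= => /andP[s0 _]; rewrite powR_invn// ltW.
by apply: measurable_funTS; exact: measurable_powR.
Qed.

Lemma secQ_measurable : measurable_fun Om secQ.
Proof. exact: measurable_primitive secP_measurable. Qed.

Let K z := \int[mu]_(r in `]0, rho[) `|r ^+ 3 * G (r, z)|.

Let rG_int : leb2.-integrable Om (EFin \o (fun p => p.1 ^+ 3 * G p)).
Proof.
have b (r : R) : 0 < r < rho -> `|r ^+ 3 * 1 * r `^ (- ((2 * m + 1) / 2))| <= rho `^ (3%:R - (2 * m + 1) / 2) * 1.
  move=> r0r; apply: (@pow_bound R rho 3 (2 * m + 1) (fun=> 1) 1) => //; first by have := m1; lra.
  by move=> _; rewrite normr1.
have mk : measurable_fun `]0, rho[ (fun r : R => r ^+ 3 * 1).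
  by apply: measurable_funM => //; apply: measurable_funTS; exact: exprn_measurable.
have := wt_mul_int rho0 a0 LG mk b.
by apply: eq_integrable => [|p _]; [exact: measurable_Omega|rewrite /= mulr1].
Qed.

Let K_int : mu.-integrable `](- a), a[ (EFin \o K).
Proof. by apply: (Omega_int2 (rho := rho) (H := fun p => `|p.1 ^+ 3 * G p|)); exact: (integrable_norm rG_int). Qed.

Let s3g z : - a < z < a -> mu.-integrable `]0, rho[ (EFin \o (fun s => s ^+ 3 * gz z s)).
Proof. by move=> zr; exact: rad_s3g rho0 m1 (mgz zr) (Gi zr). Qed.

(** To the right of a fixed r > 0 the function P is dominated by r^-3 K(z) with K integrable in z.
    This makes Fubini available for P away from the axis. *)
Let Pb r s z : 0 < r -> r <= s -> s < rho -> - a < z < a -> `|secP (s, z)| <= r ^- 3 * K z.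
Proof.
move=> r0 rs sr zr; have s0 := lt_le_trans r0 rs.
rewrite /secP /radP normrN normrM ger0_norm ?invr_ge0 ?exprn_ge0 ?(ltW s0)//.
apply: ler_pM => //; first by rewrite invr_ge0 exprn_ge0// ltW.
  by rewrite lef_pV2 ?posrE ?exprn_gt0// lerXn2r ?nnegrE// ltW.
apply: le_trans (le_normr_Rintegral _ _) _ => //.
  exact: integrable_sub_oo (lexx _) (ltW sr) (s3g zr).
apply: le_Rint_sub => //; [exact: ltW|exact: (integrable_norm (s3g zr))].
Qed.

Section coefficients.
Variables (e : R -> R) (M : R).
Hypotheses (me : measurable_fun `](- a), a[ e) (eM : forall z, `|e z| <= M).
Let g := zc a (2 * m + 1) G e.
Hypothesis gi : mu.-integrable `]0, rho[ (EFin \o (fun r => g r ^+ 2 * r `^ (2 * m + 1))).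

Let eM' z : - a < z < a -> `|e z| <= M. Proof. by move=> _; exact: eM. Qed.
Let mg : measurable_fun `]0, rho[ g.
Proof. exact: (@zc_measurable R rho a rho0 a0 (2 * m + 1) G e M LG me eM'). Qed.

(** Fubini: the coefficient of a radial integral is the radial integral of the coefficient. The
    upper limit r is turned into an indicator so that the integrand lives on the whole rectangle. *)
Lemma secP_coef r : 0 < r < rho -> \int[mu]_(z in `](- a), a[) (secP (r, z) * e z) = radP g r.
Proof.
move=> /andP[r0 rr].
pose chi (s : R) : R := \1_(`]-oo, r[%classic) s.
have chib s : `|chi s| <= 1 by rewrite /chi indicE; case: (_ \in _); rewrite ?normr1 ?normr0.
have mchi : measurable_fun `]0, rho[ chi by exact: measurable_indic.
have mk : measurable_fun `]0, rho[ (fun s : R => s ^+ 3 * chi s).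
  by apply: measurable_funM => //; apply: measurable_funTS; exact: exprn_measurable.
have b (s : R) : 0 < s < rho -> `|s ^+ 3 * chi s * s `^ (- ((2 * m + 1) / 2))| <= rho `^ (3%:R - (2 * m + 1) / 2) * 1.
  by move=> r0r; apply: (@pow_bound R rho 3 (2 * m + 1) chi 1) => //; have := m1; lra.
have [_ E] := zc_int rho0 a0 LG me eM' mk b.
have cG : leb2.-integrable Om (EFin \o (fun p => chi p.1 * (p.1 ^+ 3 * G p))).
  exact: integrable_Omega_bnd1 rG_int mchi (fun s _ => chib s).
have E2 := Omega_coef2 cG me eM'.
rewrite (eq_Rint_oo (k := fun z => - r ^- 3 * (e z * \int[mu]_(s in `]0, rho[) (chi s * (s ^+ 3 * G (s, z)))))); last first.
  by move=> z _; rewrite /secP /radP /radPhi (Rint_oo_head _ (ltW rr)) -/chi; ring.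
rewrite RintegralZl//; last first.
  have h := Omega_int2 (integrable_Omega_bnd2 cG me eM').
  apply: ae_eq_integrable_oo h.
    apply: measurable_funM => //; exact: measurable_int_fun (Omega_int2 cG).
  by apply: ae_imp (Omega_ae2 cG) => z h zr /=; rewrite RintegralZl//; exact: h.
rewrite -E2 /radP /radPhi (Rint_oo_head _ (ltW rr)) -/chi mulNr; congr (- (_ * _)).
rewrite (eq_Rint_oo (f := fun s => chi s * (s ^+ 3 * g s)) (k := fun s => s ^+ 3 * chi s * g s)); last by move=> s _; ring.
by rewrite -E; apply: eq_Rintegral => p _; ring.
Qed.

(** V(r) involves P only on ]r, rho[, where P has an integrable majorant, so coefficients may be
    taken under the radial integral; together with [secP_coef] this says that coefficients commute
    with solving the radial equation. *)
Lemma secV_coef r : 0 < r < rho -> \int[mu]_(z in `](- a), a[) (secV (r, z) * e z) = radV rho g r.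
Proof.
move=> r0r; have /andP[r0 rr] := r0r.
have rr0 : 0 <= r <= rho by rewrite !ltW.
pose chi (s : R) : R := \1_(`]r, +oo[%classic) s.
have mchi : measurable_fun `]0, rho[ chi by exact: measurable_indic.
have mH : measurable_fun Om (fun p => chi p.1 * secP p).
  by apply: measurable_funM; [exact: measurable_Omega1|exact: secP_measurable].
have Kb : leb2.-integrable Om (EFin \o (fun p => r ^- 3 * K p.2)).
  exact: (Omega_prod (integrable_cst_oo 0 rho (r ^- 3)) K_int).1.
have K0 z : 0 <= K z by apply: Rintegral_ge0.
have Hi : leb2.-integrable Om (EFin \o (fun p => chi p.1 * secP p)).
  apply: (@integrable_dom _ _ R leb2 _ (measurable_Omega rho a) _ (fun p => r ^- 3 * K p.2) mH) => // -[s z] [/= /andP[s0 sr] zr].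
  rewrite /chi indicE mem_setE in_itv/= andbT; case: ltP => rs.
    by rewrite [true%:R * _]mul1r; apply: Pb => //; exact: ltW.
  by rewrite mul0r normr0 mulr_ge0// invr_ge0 exprn_ge0// ltW.
rewrite (eq_Rint_oo (k := fun z => -1 * (e z * \int[mu]_(s in `]0, rho[) (chi s * secP (s, z))))); last first.
  move=> z zr; rewrite /secV (radVE rho0 m1 (mgz zr) (Gi zr) rr0) -(Rint_oo_tail _ _ (ltW r0)).
  by rewrite /secP/=; ring.
have h := Omega_int2 (integrable_Omega_bnd2 Hi me eM').
rewrite RintegralZl//; last first.
  apply: ae_eq_integrable_oo h.
    apply: measurable_funM => //; exact: measurable_int_fun (Omega_int2 Hi).
  by apply: ae_imp (Omega_ae2 Hi) => z h zr /=; rewrite RintegralZl//; exact: h.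
rewrite -(Omega_coef2 Hi me eM') (Omega_fub1 (integrable_Omega_bnd2 Hi me eM')).
rewrite (radVE rho0 m1 mg gi rr0) sub0r mulN1r; congr (- _).
rewrite (Rint_oo_tail _ _ (ltW r0)); apply: ae_eq_Rint_oo.
- exact: measurable_int_fun (Omega_int1 (integrable_Omega_bnd2 Hi me eM')).
- by apply: measurable_funM => //; exact: radP_measurable rho0 m1 mg gi.
apply: ae_all => s s0r; rewrite -secP_coef// /chi indicE mem_setE in_itv/= andbT; case: ltP => rs.
  by rewrite [RHS]mul1r; apply: eq_Rint_oo => z _; rewrite [true%:R * _]mul1r mulrC.
rewrite [RHS]mul0r (eq_Rint_oo (k := fun=> 0)) ?Rintegral0// => z _.
by rewrite [false%:R * _]mul0r mulr0.
Qed.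

End coefficients.

Lemma secV_measurable : measurable_fun Om secV.
Proof.
apply: measurable_funB; first exact: secQ_measurable.
exact: (measurable_Omega2 (e := fun z => \int[mu]_(t in `]0, rho[) secP (t, z)) (measurable_Rint_section secP_measurable)).
Qed.

Lemma secV_section_int r : 0 < r < rho -> mu.-integrable `](- a), a[ (EFin \o (fun z => secV (r, z))).
Proof.
move=> r0r; have /andP[r0 rr] := r0r.
apply: (integrable_dom_oo (k := fun z => rho * (r ^- 3) * K z)); last exact: integrableZ_oo.
  by have := secV_measurable; rewrite OmegaE => mV; apply: measurable_sectionF mV _; rewrite /= ?in_itv.
move=> z zr; rewrite /secV (radVE rho0 m1 (mgz zr) (Gi zr)) ?(ltW r0) ?(ltW rr)// sub0r normrN.
have Pi := radP_integrable rho0 m1 (mgz zr) (Gi zr).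
have Pi' := integrable_sub_oo (ltW r0) (lexx rho) Pi.
apply: le_trans (le_normr_Rintegral _ _) _ => //.
have b t : r < t < rho -> `|radP (gz z) t| <= r ^- 3 * K z.
  by move=> /andP[rt tr]; exact: (@Pb r t z r0 (ltW rt) tr zr).
apply: (le_trans (le_Rint_oo (integrable_norm Pi') (integrable_cst_oo _ _ _) b)).
rewrite Rint_cst_oo ?(ltW rr)// mulrC -mulrA ler_wpM2r//; last by rewrite gerBl ltW.
by rewrite mulr_ge0 ?invr_ge0 ?exprn_ge0 ?(ltW r0)//; apply: Rintegral_ge0.
Qed.

End radial_sections.

(** * Weak derivatives in r of the explicit radial solution *)

Section radial_weak_derivatives.
Context {R : realType}.
Notation mu := (@lebesgue_measure R).

Lemma radV_ae (rho : R) (g g' : R -> R) r : measurable_fun `]0, rho[ g -> measurable_fun `]0, rho[ g' ->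
  {ae mu, forall s, 0 < s < rho -> g s = g' s} -> 0 <= r <= rho -> radV rho g r = radV rho g' r.
Proof.
move=> mg mg' E /andP[r0 rr].
have PE s : 0 < s < rho -> radP g s = radP g' s.
  move=> /andP[s0 sr]; rewrite /radP /radPhi; congr (- (_ * _)).
  have sub : `]0, s[ `<=` (`]0, rho[ : set R) by apply: subset_oo => //; exact: ltW.
  have mX : measurable_fun `]0, s[ (fun t : R => t ^+ 3).
    by apply: measurable_funTS; exact: exprn_measurable.
  apply: ae_eq_Rint_oo; [apply: measurable_funM => //; exact: measurable_funS sub mg
    |apply: measurable_funM => //; exact: measurable_funS sub mg'|].
  by apply: ae_imp E => t h /andP[t0 ts]; rewrite h// t0 (lt_trans ts).
have QE t : t <= rho -> radQ g t = radQ g' t.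
  by move=> tr; apply: eq_Rint_oo => s /andP[s0 st]; apply: PE; rewrite s0 (lt_le_trans st tr).
by rewrite /radV (QE r rr) (QE rho (lexx _)).
Qed.

(** The factor s^n matters only near 0, and compact subsets of the open interval stay away from 0.
    It serves for the second derivative, which is controlled only after multiplication by s^3. *)
Lemma locally_integrable_oo (rho : R) (f : R -> R) n : 0 < rho -> measurable_fun `]0, rho[ f ->
  mu.-integrable `]0, rho[ (EFin \o (fun s => s ^+ n * f s)) -> locally_integrable `]0, rho[ f.
Proof.
move=> rho0 mf fi; split; [exact: mf|exact: interval_open|].
move=> K K0 cK; have [d [t [d0 dt tr Kdt]]] := compact_in_oo rho0 cK K0.
have fd : mu.-integrable `]d / 2, rho[ (EFin \o f).
  have d2 : 0 < d / 2 by lra.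
  have sub : `]d / 2, rho[ `<=` (`]0, rho[ : set R) by apply: subset_oo => //; exact: ltW.
  apply: (integrable_dom_oo (k := fun s => (d / 2) ^- n * `|s ^+ n * f s|)).
  - exact: measurable_funS sub mf.
  - move=> s /andP[ds sr]; have s0 := lt_trans d2 ds.
    rewrite normrM ger0_norm ?exprn_ge0 ?(ltW s0)// mulrA ler_peMl// mulrC ler_pdivlMr ?exprn_gt0// mul1r.
    by rewrite lerXn2r ?nnegrE// ltW.
  - apply: (@integrableZ_oo R _ _ _ (fun s => `|s ^+ n * f s|)).
    exact: (integrable_norm (integrable_sub_oo (ltW d2) (lexx _) fi)).
have oI : open (`]d / 2, rho[%classic : set R) by exact: interval_open.
have [_ _ h] := open_integrable_locally oI fd.
by apply: h => // s Ks; have := Kdt s Ks; rewrite /= in_itv/= => /andP[? ?]; apply/andP; split; lra.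
Qed.

Variables (rho m : R) (g w : R -> R).
Hypotheses (rho0 : 0 < rho) (m1 : m < 1).
Hypothesis mg : measurable_fun `]0, rho[ g.
Hypothesis gi : mu.-integrable `]0, rho[ (EFin \o (fun s => g s ^+ 2 * s `^ (2 * m + 1))).
Hypotheses (mw : measurable_fun `]0, rho[ w)
  (wV : {ae mu, forall r, 0 < r < rho -> w r = radV rho g r}).

(** The double sign matches psi minus its axis value, which is - [radQ] at rho because [radQ]
    vanishes at 0. *)
Let u r := w r - - radQ g rho.

Let uQ : {ae mu, forall r, 0 < r < rho -> u r = radQ g r}.
Proof. by apply: ae_imp wV => r h /h; rewrite /u => ->; rewrite /radV opprK subrK. Qed.

Let mu' : measurable_fun `]0, rho[ u. Proof. exact: measurable_funB. Qed.
Let Pi := radP_integrable rho0 m1 mg gi.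
Let mP := radP_measurable rho0 m1 mg gi.
Let s3g := rad_s3g rho0 m1 mg gi.

Let cQ : {within `[0, rho], continuous (radQ g)}.
Proof. exact: continuous_int (ltW rho0) Pi. Qed.
Let Qi : mu.-integrable `]0, rho[ (EFin \o radQ g). Proof. exact: integrable_continuous_oo cQ. Qed.
Let mQ : measurable_fun `]0, rho[ (radQ g). Proof. exact: measurable_int_fun Qi. Qed.

(* The i-th derivative of V, up to the constant V(0) when i = 0. *)
Definition radD (i : nat) (r : R) : R :=
  if i is 0%N then radQ g r else if i is 1%N then radP g r else - g r - 3 * (radP g r / r).

Let ui : mu.-integrable `]0, rho[ (EFin \o u).
Proof. by apply: (ae_eq_integrable_oo mu' _ Qi); apply: ae_imp uQ => r h /h ->. Qed.

Let lu : locally_integrable `]0, rho[ u.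
Proof. by apply: open_integrable_locally => //; exact: interval_open. Qed.

Let inv_m : measurable_fun `]0, rho[ (fun r : R => r^-1).
Proof.
apply: (eq_measurable_fun (fun s : R => s `^ (- 1%:R))).
  by move=> s; rewrite inE/= in_itv/= => /andP[s0 _]; rewrite powR_invn ?expr1// ltW.
by apply: measurable_funTS; exact: measurable_powR.
Qed.

Lemma radD_measurable i : measurable_fun `]0, rho[ (radD i).
Proof.
case: i => [|[|i]] //=.
apply: measurable_funB; first exact: measurable_funN.
by apply: measurable_funM => //; exact: measurable_funM.
Qed.

Lemma radD_locint i : locally_integrable `]0, rho[ (radD i).
Proof.
case: i => [|[|i]].
- by apply: open_integrable_locally => //; exact: interval_open.
- by apply: open_integrable_locally => //; exact: interval_open.
apply: (@locally_integrable_oo rho _ 3) => //; first exact: (radD_measurable i.+2).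
have mX n : measurable_fun `]0, rho[ (fun r : R => r ^+ n).
  by apply: measurable_funTS; exact: exprn_measurable.
have h2 : mu.-integrable `]0, rho[ (EFin \o (fun r => radP g r * r ^+ 2)).
  apply: (@integrable_mulbnd _ _ R mu _ (measurable_itv _) (radP g) (fun r => r ^+ 2) (rho ^+ 2)) => //.
  move=> r; rewrite /= in_itv/= => /andP[r0 rr].
  by rewrite ger0_norm ?exprn_ge0 ?(ltW r0)// lerXn2r ?nnegrE ?(ltW rho0) ?(ltW r0)// ltW.
have h := integrableB_oo (integrableZ_oo (-1) s3g) (integrableZ_oo 3 h2).
by apply: eq_integrable_oo h => r /andP[r0 _] /=; field; rewrite gt_eqF.
Qed.

Section test.
Variable phi : R -> R.
Hypothesis tphi : test_itv 0 rho phi.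

Let Cphi : Cinf phi. Proof. by case: tphi. Qed.
Let mphi : measurable_fun `]0, rho[ phi. Proof. exact: Cinf_measurable. Qed.

Lemma radQ_weak : \int[mu]_(r in `]0, rho[) (radQ g r * derive1 phi r) =
  - \int[mu]_(r in `]0, rho[) (radP g r * phi r).
Proof.
have t' := test_itv_derive tphi; have [C' _] := t'.
have [M phiM] := test_itv_bounded tphi.
have [s [t [s0 st tr phi0]]] : exists s t, [/\ 0 < s, s < t, t < rho & forall x, ~ s <= x <= t -> phi x = 0] by case: tphi.
have ki : mu.-integrable `]0, rho[ (EFin \o derive1 phi).
  by apply: integrable_continuous_oo; apply: continuous_subspaceT; exact: Cinf_continuous C'.
have phiE x : 0 < x < rho -> phi x = 0 - \int[mu]_(y in `]x, rho[) derive1 phi y.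
  move=> /andP[x0 xr].
  have d y : x < y < rho -> is_derive y 1 phi (derive1 phi y) by move=> _; exact: Cinf_is_derive.
  rewrite (FTC_oo (ltW xr) _ d).
  - by rewrite [phi rho]phi0 ?sub0r ?opprK// => /andP[_]; lra.
  - by apply: continuous_subspaceT; exact: Cinf_continuous Cphi.
  - by apply: continuous_subspaceT; exact: Cinf_continuous C'.
have Pphi := @integrable_mulbnd _ _ R mu _ (measurable_itv _) (radP g) phi M Pi mphi (fun r _ => phiM r).
rewrite (IBP_int Pi ki phiE Pphi) mul0r sub0r opprK.
by apply: eq_Rint_oo => r _; rewrite mulrC.
Qed.

Let bnd (f : R -> R) p : test_itv 0 rho f -> exists C, forall r, 0 < r < rho -> `|r `^ p * f r| <= C.
Proof.
move=> tf; have [M fM] := test_itv_bounded tf; have [_ [s [t [s0 st tr f0]]]] := tf.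
have M0 : 0 <= M by exact: le_trans (fM 0).
exists ((s `^ p + t `^ p) * M) => r /andP[r0 rr].
have [/andP[sr rt]|hr] := boolP (s <= r <= t); last first.
  by rewrite f0 ?mulr0 ?normr0 ?mulr_ge0 ?addr_ge0 ?powR_ge0//; exact/negP.
rewrite normrM ger0_norm ?powR_ge0// ler_pM ?powR_ge0//.
have [p0|p0] := leP 0 p; first by apply: (le_trans (pow_le p0 r0 rt)); rewrite lerDr powR_ge0.
by apply: (le_trans (pow_anti (ltW p0) s0 sr)); rewrite lerDl powR_ge0.
Qed.

(** P is - r^-3 Phi with Phi a primitive of r^3 g, whence the derivative - g - 3 P / r. Integration
    by parts pairs r^3 g with r^-3 phi, which is harmless because phi vanishes near 0. *)
Lemma radP_weak : \int[mu]_(r in `]0, rho[) (radP g r * derive1 phi r) =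
  - \int[mu]_(r in `]0, rho[) (radD 2 r * phi r).
Proof.
have t' := test_itv_derive tphi; have [C' _] := t'.
have mphi' : measurable_fun `]0, rho[ (derive1 phi) by exact: Cinf_measurable.
have mp p : measurable_fun `]0, rho[ (fun r : R => r `^ p) by apply: measurable_funTS; exact: measurable_powR.
have [s [t [s0 st tr phi0]]] : exists s t, [/\ 0 < s, s < t, t < rho & forall x, ~ s <= x <= t -> phi x = 0] by case: tphi.
pose W r := r `^ (- 3%:R) * phi r.
(* The derivative of [W], so that k Phi consists of the terms - P phi' and 3 P phi / r. *)
pose k r := r `^ (- 3%:R) * derive1 phi r - 3 * (r `^ (- 3%:R - 1) * phi r).
have [M1 b1] := bnd (- 3%:R) tphi; have [M2 b2] := bnd (- 3%:R) t'; have [M3 b3] := bnd (- 3%:R - 1) tphi.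
have mk : measurable_fun `]0, rho[ k.
  by apply: measurable_funB; [exact: measurable_funM|apply: measurable_funM => //; exact: measurable_funM].
have ki : mu.-integrable `]0, rho[ (EFin \o k).
  apply: (integrable_dom_oo (k := fun=> M2 + 3 * M3)) => //; last exact: integrable_cst_oo.
  move=> r r0r; apply: (le_trans (ler_normB _ _)); rewrite lerD ?b2//.
  by rewrite normrM ger0_norm// ler_wpM2l// b3.
have dW (r : R) : 0 < r -> is_derive r 1 W (k r).
  move=> r0; apply: (is_derive_eq (is_deriveM (is_derive1_powR (- 3%:R) r0) (Cinf_is_derive r Cphi))).
  by rewrite /k /GRing.scale/=; move: (r `^ _) (r `^ _) => x y; ring.
have WE x : 0 < x < rho -> W x = 0 - \int[mu]_(y in `]x, rho[) k y.
  move=> /andP[x0 xr].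
  have d y : x < y < rho -> is_derive y 1 W (k y) by move=> /andP[xy _]; apply: dW; exact: lt_trans xy.
  have cp p : {within `[x, rho], continuous (fun r : R => r `^ p)} by exact: pow_continuous.
  have cphi : {within `[x, rho], continuous phi} by apply: continuous_subspaceT; exact: Cinf_continuous Cphi.
  have cphi' : {within `[x, rho], continuous (derive1 phi)} by apply: continuous_subspaceT; exact: Cinf_continuous C'.
  rewrite (FTC_oo (ltW xr) _ d).
  - by rewrite {2}/W [phi rho]phi0 ?mulr0 ?sub0r ?opprK// => /andP[_]; lra.
  - by move=> y; apply: cvgM; [exact: cp|exact: cphi].
  - move=> y; apply: cvgB; first by apply: cvgM; [exact: cp|exact: cphi'].
    by apply: cvgM; [exact: cvg_cst|apply: cvgM; [exact: cp|exact: cphi]].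
have mW : measurable_fun `]0, rho[ W by exact: measurable_funM.
have WM r : `]0, rho[%classic r -> `|W r| <= M1 by rewrite /= in_itv/=; exact: b1.
have gW := @integrable_mulbnd _ _ R mu _ (measurable_itv _) (fun r => r ^+ 3 * g r) W M1 s3g mW WM.
have I := IBP_int s3g ki WE gW.
have [M phiM] := test_itv_bounded tphi; have [M' phiM'] := test_itv_bounded t'.
have i1 := @integrable_mulbnd _ _ R mu _ (measurable_itv _) (radP g) _ M' Pi mphi' (fun r _ => phiM' r).
have [M4 b4] := bnd (- 1%:R) tphi.
have mq : measurable_fun `]0, rho[ (fun r => r `^ (- 1%:R) * phi r) by exact: measurable_funM.
have qM r : `]0, rho[%classic r -> `|r `^ (- 1%:R) * phi r| <= M4 by rewrite /= in_itv/=; exact: b4.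
have i2 := @integrable_mulbnd _ _ R mu _ (measurable_itv _) (radP g) _ M4 Pi mq qM.
have inv3 (r : R) : 0 < r -> r ^+ 3 * r `^ (- 3%:R) = 1 by move=> r0; rewrite powR_invn ?(ltW r0)// divff// expf_neq0// gt_eqF.
have E1 : \int[mu]_(r in `]0, rho[) (k r * \int[mu]_(y in `]0, r[) (y ^+ 3 * g y)) =
  \int[mu]_(r in `]0, rho[) (3 * (radP g r * (r `^ (- 1%:R) * phi r)) - radP g r * derive1 phi r).
  apply: eq_Rint_oo => r /andP[r0 rr]; rewrite -/(radPhi g r).
  have -> : radPhi g r = - (r ^+ 3 * radP g r).
    by rewrite /radP mulrN opprK mulrA divff ?mul1r// expf_neq0// gt_eqF.
  have e1 := inv3 r r0.
  have -> : r `^ (- 1%:R) = r ^+ 3 * r `^ (- 3%:R - 1) by rewrite (powE _ r0) powM//; congr (_ `^ _); ring.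
  rewrite /k; move: e1; move: (r `^ _) (r `^ _) (r ^+ 3) => x y z e1.
  transitivity (3 * (radP g r * (z * x * phi r)) - z * y * (radP g r * derive1 phi r)); first by ring.
  by rewrite e1 mul1r.
rewrite E1 mul0r sub0r RintegralB// in I; last exact: integrableZ_oo.
rewrite RintegralZl// in I.
have i0 : mu.-integrable `]0, rho[ (EFin \o (fun r => g r * phi r)).
  by apply: eq_integrable_oo gW => r /andP[r0 _]; rewrite /W mulrACA inv3// mul1r.
have e0 : \int[mu]_(r in `]0, rho[) (r ^+ 3 * g r * W r) = \int[mu]_(r in `]0, rho[) (g r * phi r).
  by apply: eq_Rint_oo => r /andP[r0 _]; rewrite /W mulrACA inv3// mul1r.
have -> : \int[mu]_(r in `]0, rho[) (radD 2 r * phi r) =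
    - 1 * \int[mu]_(r in `]0, rho[) (g r * phi r) + - 3 * \int[mu]_(r in `]0, rho[) (radP g r * (r `^ (- 1%:R) * phi r)).
  rewrite -!RintegralZl// -RintegralD//; [|exact: integrableZ_oo|exact: integrableZ_oo].
  by apply: eq_Rint_oo => r /andP[r0 _] /=; rewrite powR_invn ?(ltW r0)// expr1; ring.
rewrite e0 in I; rewrite I; ring.
Qed.

End test.

Lemma radial_wderiv i : (i <= 2)%N -> wderiv1 rho i u (radD i).
Proof.
move=> i2; split; [exact: lu|exact: radD_locint|move=> phi tphi1].
have tphi := test_fun1_itv rho0 tphi1.
have mt f : test_itv 0 rho f -> measurable_fun `]0, rho[ f by move=> [Cf _]; exact: Cinf_measurable.
have uE f : test_itv 0 rho f -> \int[mu]_(r in `]0, rho[) (u r * f r) = \int[mu]_(r in `]0, rho[) (radQ g r * f r).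
  move=> tf; have mf := mt f tf; apply: ae_eq_Rint_oo; [exact: measurable_funM|exact: measurable_funM|].
  by apply: ae_imp uQ => r h /h ->.
case: i i2 => [|[|[|//]]] _.
- by rewrite expr0 mul1r; exact: uE.
- rewrite expr1 mulN1r -(radQ_weak tphi); apply: uE; exact: test_itv_derive.
- rewrite sqrrN expr1n mul1r -[RHS]opprK -(radP_weak tphi) -(radQ_weak (test_itv_derive tphi)).
  by apply: uE; do 2 apply: test_itv_derive.
Qed.

End radial_weak_derivatives.

(** * The weighted norm of second order in r *)

Section radial_norm.
Context {R : realType}.
Notation mu := (@lebesgue_measure R).
Variables (rho m : R).
Hypotheses (rho0 : 0 < rho) (m1 : m < 1).

Let k0 : R := 4 / (2 * m - 2) ^+ 2.
Let k1 : R := 4 / (2 * m - 6) ^+ 2.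
(* k0 and k1 are Hardy constants for the exponents 2m - 3 and 2m - 7. *)
Definition Hk_cst : R := k0 * k1 + k1 + (2 + 18 * k1).

Lemma Hk_cst_ge0 : 0 <= Hk_cst.
Proof.
have k00 : 0 <= k0 by rewrite divr_ge0 ?sqr_ge0.
have k10 : 0 <= k1 by rewrite divr_ge0 ?sqr_ge0.
have k01 := mulr_ge0 k00 k10; rewrite /Hk_cst; lra.
Qed.

(** Two Hardy inequalities for V - V(0), one for V', and the equation V'' = - g - 3 V' / r for the
    last term; these are the three summands of [Hk_cst]. *)
Lemma radD_norm (g : R -> R) : measurable_fun `]0, rho[ g ->
  mu.-integrable `]0, rho[ (EFin \o (fun s => g s ^+ 2 * s `^ (2 * m + 1))) ->
  (Hk_sq rho 2 m (radD g) <=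
   (Hk_cst * \int[mu]_(s in `]0, rho[) (g s ^+ 2 * s `^ (2 * m + 1)))%:E)%E.
Proof.
move=> mg gi; have [P1 P2] := radP_hardy rho0 m1 mg gi; have [Q1 Q2] := radQ_hardy rho0 m1 mg gi.
set A := \int[mu]_(s in `]0, rho[) _.
have term (D : R -> R) (p q B : R) : p + 1 = q ->
    mu.-integrable `]0, rho[ (EFin \o (fun s => D s ^+ 2 * s `^ q)) ->
    \int[mu]_(s in `]0, rho[) (D s ^+ 2 * s `^ q) <= B ->
    (\int[mu]_(r in `]0%R, rho[) (`|D r| ^+ 2 * r `^ p * r)%:E <= B%:E)%E.
  move=> pq Di DB.
  have E (r : R) : 0 < r -> `|D r| ^+ 2 * r `^ p * r = D r ^+ 2 * r `^ q.
    by move=> r0; rewrite real_normK ?num_real// -mulrA -pq -powM// powRr1// ltW.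
  rewrite [X in (X <= _)%E](_ : _ = \int[mu]_(r in `]0%R, rho[) (D r ^+ 2 * r `^ q)%:E)%E; last first.
    by apply: eq_integral => r; rewrite inE/= in_itv/= => /andP[r0 _]; rewrite E.
  by rewrite integral_Rint_oo// lee_fin.
have mp q : measurable_fun `]0, rho[ (fun s : R => s `^ q).
  by apply: measurable_funTS; exact: measurable_powR.
have mD := radD_measurable rho0 m1 mg gi 2.
have gP : mu.-integrable `]0, rho[ (EFin \o (fun s => 2 * (g s ^+ 2 * s `^ (2 * m + 1)) + 18 * (radP g s ^+ 2 * s `^ (2 * m - 3 + 2)))).
  by apply: integrableD_oo; exact: integrableZ_oo.
have Dle s : 0 < s < rho -> radD g 2 s ^+ 2 * s `^ (2 * m + 1) <=
    2 * (g s ^+ 2 * s `^ (2 * m + 1)) + 18 * (radP g s ^+ 2 * s `^ (2 * m - 3 + 2)).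
  move=> /andP[s0 _] /=.
  have -> : s `^ (2 * m + 1) = s ^+ 2 * s `^ (2 * m - 3 + 2).
    by rewrite (powE _ s0) powM//; congr (_ `^ _); ring.
  have b0 : 0 <= s `^ (2 * m - 3 + 2) by exact: powR_ge0.
  move: (s `^ _) b0 => b b0; rewrite -subr_ge0.
  (* This is the square discarded in (s g + 3 P)^2 <= 2 (s g)^2 + 18 P^2, the source of the
     constants 2 and 18. *)
  rewrite (_ : _ - _ = (s * g s - 3 * radP g s) ^+ 2 * b); last by field; rewrite gt_eqF.
  by rewrite mulr_ge0// sqr_ge0.
have Di : mu.-integrable `]0, rho[ (EFin \o (fun s => radD g 2 s ^+ 2 * s `^ (2 * m + 1))).
  apply: (integrable_dom_oo _ _ gP).
    by apply: measurable_funM => //; exact: measurable_funX.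
  by move=> s sr; rewrite ger0_norm; [exact: Dle|rewrite mulr_ge0 ?sqr_ge0 ?powR_ge0].
have D2 : \int[mu]_(s in `]0, rho[) (radD g 2 s ^+ 2 * s `^ (2 * m + 1)) <= (2 + 18 * k1) * A.
  apply: (le_trans (le_Rint_oo Di gP Dle)).
  rewrite RintegralD//; [|exact: integrableZ_oo|exact: integrableZ_oo].
  by rewrite !RintegralZl// -/A (mulrDl 2 (18 * k1) A) lerD2l -(mulrA 18 k1 A) ler_wpM2l.
rewrite /Hk_sq 3!big_ord_recr/= big_ord0 add0e.
have -> : Hk_cst * A = k0 * k1 * A + k1 * A + (2 + 18 * k1) * A by rewrite /Hk_cst; ring.
rewrite 2!EFinD.
apply: leeD; first apply: leeD.
- by apply: (@term (radQ g) _ (2 * m - 3)); [ring|exact: Q1|rewrite -mulrA].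
- by apply: (@term (radP g) _ (2 * m - 3 + 2)); [ring|exact: P1|exact: P2].
- apply: (@term (radD g 2) _ (2 * m + 1)); [ring|exact: Di|exact: D2].
Qed.

Variables (a : R) (G : R * R -> R).
Hypotheses (a0 : 0 < a).
Notation Om := (Omega rho a).
Hypotheses (mG : measurable_fun Om G) (LG : L2 leb2 Om (wt (2 * m + 1) G)).
Hypothesis Gi : forall z, - a < z < a ->
  mu.-integrable `]0, rho[ (EFin \o (fun r => G (r, z) ^+ 2 * r `^ (2 * m + 1))).

Definition secD i (p : R * R) : R := radD (fun s => G (s, p.2)) i p.1.

Lemma section_measurable (F : R * R -> R) z : measurable_fun Om F -> - a < z < a ->
  measurable_fun `]0, rho[ (fun s => F (s, z)).
Proof.
rewrite OmegaE => mF zr; apply: measurable_sectionG mF _; rewrite /= ?in_itv//.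
Qed.

Lemma secD_measurable i : measurable_fun Om (secD i).
Proof.
have mP : measurable_fun Om (secP G) := secP_measurable mG.
have mi : measurable_fun Om (fun p => p.1^-1).
  apply: (@measurable_Omega1 R rho a (fun r => r^-1)).
  apply: (eq_measurable_fun (fun s : R => s `^ (- 1%:R))).
    by move=> s; rewrite inE/= in_itv/= => /andP[s0 _]; rewrite powR_invn ?expr1// ltW.
  by apply: measurable_funTS; exact: measurable_powR.
case: i => [|[|i]]; [exact: secQ_measurable mG|exact: mP|].
have -> : secD i.+2 = (fun p => - G p - 3 * (secP G p / p.1)) by apply/funext => -[r z].
apply: measurable_funB; first exact: measurable_funN.
by apply: measurable_funM => //; exact: measurable_funM.
Qed.

Lemma L2Hk_bound : (L2Hk_sq rho a 2 m secD <=
  (Hk_cst * \int[leb2]_(p in Om) (wt (2 * m + 1) G p ^+ 2))%:E)%E.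
Proof.
pose A z := \int[mu]_(r in `]0, rho[) (wt (2 * m + 1) G (r, z) ^+ 2).
have [_ wi] := LG.
have Ai : mu.-integrable `](- a), a[ (EFin \o A) by exact: Omega_int2 wi.
have AE z : - a < z < a -> A z = \int[mu]_(s in `]0, rho[) (G (s, z) ^+ 2 * s `^ (2 * m + 1)).
  by move=> zr; apply: eq_Rint_oo => s sr; rewrite (@wt_sqr R rho a).
have mHk : measurable_fun `](- a), a[ (fun z => Hk_sq rho 2 m (fun i r => secD i (r, z))).
  rewrite /Hk_sq; apply: emeasurable_sum => i.
  apply: (@measurable_tonelli_rect2 R `]0, rho[%classic `](- a), a[%classic (measurable_itv _) (measurable_itv _)
    (fun p => (`|secD i p| ^+ 2 * p.1 `^ (2 * (m - 2%:R + i%:R)) * p.1)%:E)).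
    rewrite -OmegaE; apply/measurable_EFinP; apply: measurable_funM; last first.
      by apply: (@measurable_Omega1 R rho a id); exact: measurable_id.
    apply: measurable_funM; last first.
      apply: (@measurable_Omega1 R rho a (fun r => r `^ (2 * (m - 2%:R + i%:R)))).
      by apply: measurable_funTS; exact: measurable_powR.
    by apply: measurable_funX; apply: measurableT_comp => //; exact: secD_measurable.
  move=> -[r z] [/=]; rewrite in_itv/= => /andP[r0 _] _.
  by rewrite lee_fin mulr_ge0 ?(ltW r0)// mulr_ge0 ?powR_ge0// exprn_ge0.
rewrite (Omega_fub2 wi) -RintegralZl// -integral_Rint_oo; last exact: integrableZ_oo.
apply: ge0_le_integral => //.
- move=> z _; apply: sume_ge0 => i _; apply: integral_ge0 => r; rewrite /= in_itv/= => /andP[r0 _].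
  by rewrite lee_fin mulr_ge0 ?(ltW r0)// mulr_ge0 ?powR_ge0// exprn_ge0.
- apply/measurable_EFinP; apply: measurable_funM => //; exact: measurable_int_fun Ai.
- move=> z; rewrite /= in_itv/= => zr; rewrite -/(A z) AE//.
  exact: radD_norm (section_measurable mG zr) (Gi zr).
Qed.

End radial_norm.

Lemma zcD {R : realType} (rho a q : R) (F H : R * R -> R) (e : R -> R) (M : R) :
  L2 leb2 (Omega rho a) (wt q F) -> L2 leb2 (Omega rho a) (wt q H) ->
  measurable_fun `](- a), a[ e -> (forall z, `|e z| <= M) ->
  {ae @lebesgue_measure R, forall r, 0 < r < rho ->
    zc a q (fun p => F p + H p) e r = zc a q F e r + zc a q H e r}.
Proof.
move=> LF LH me eM; apply: ae_imp2 (wt_section_L2 LF) (wt_section_L2 LH) => r h1 h2 r0r.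
have F1 := L2_integrable_oo (h1 r0r); have H1 := L2_integrable_oo (h2 r0r).
have F2 := @integrable_mulbnd _ _ R (@lebesgue_measure R) _ (measurable_itv _) _ _ M F1 me (fun z _ => eM z).
have H2 := @integrable_mulbnd _ _ R (@lebesgue_measure R) _ (measurable_itv _) _ _ M H1 me (fun z _ => eM z).
rewrite /zc -mulrDr -RintegralD//; congr (_ * _).
by apply: eq_Rint_oo => z _; rewrite /wt !mulrDl.
Qed.

(** * The estimate *)

Section reconstruction.
Context {R : realType}.
Notation mu := (@lebesgue_measure R).
Variables (rho a m : R).
Hypotheses (rho0 : 0 < rho) (a0 : 0 < a) (m0 : 0 < m) (m1 : m < 1).
Notation Om := (Omega rho a).
Variables (omega psi psir psiz : R * R -> R).
Hypotheses (Lom : L2w rho a m omega) (Lpsi : L2w rho a 0 psi)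
  (Lpsir : L2w rho a 0 psir) (Lpsiz : L2w rho a 0 psiz).
Hypothesis drpsi : forall phi, test_fun rho a phi ->
  Dr (distr rho a psi) phi = distr rho a psir phi.
Hypothesis dzpsi : forall phi, test_fun rho a phi ->
  Dz (distr rho a psi) phi = distr rho a psiz phi.
Hypothesis tr0 : zero_trace rho a psi psir psiz.
Hypothesis weq : forall phi, test_fun rho a phi ->
  - Lap (distr rho a psi) phi - 2 * divr (Dr (distr rho a psi)) phi = distr rho a omega phi.

(** On almost every section both functions have the same sine coefficients: those of [secV] solve
    the radial problem with data [gmode], hence are [Vmode], and [Vmode] agrees almost everywhere
    with the coefficients of psi. *)
Lemma psi_secV (G : R * R -> R) : measurable_fun Om G -> L2 leb2 Om (wt (2 * m + 1) G) ->
  (forall z, - a < z < a -> mu.-integrable `]0, rho[ (EFin \o (fun r => G (r, z) ^+ 2 * r `^ (2 * m + 1)))) ->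
  (forall n, {ae mu, forall r, 0 < r < rho -> zc a (2 * m + 1) G (esin a n) r = gmode a m omega psi n r}) ->
  {ae leb2, forall p, Om p -> secV rho G p = psi p}.
Proof.
move=> mG LG Gi Gn.
have ms n : measurable_fun `](- a), a[ (esin a n) by exact: esin_measurable.
have sb n z : `|esin a n z| <= (Num.sqrt a)^-1 by exact: esin_bound.
have so n k := @esin_orth R a a0 n k.
have [mpsi _] := Lpsi; have LLpsi := L2w_L2 Lpsi.
apply: (sine_sections_inj a0 (secV_measurable mG) mpsi).
have vm : {ae mu, forall r, forall n, 0 < r < rho -> vcoef a psi n r = Vmode rho a m omega psi n r}.
  apply: ae_alln => n.
  exact: (vcoef_mode rho0 a0 m0 m1 Lom Lpsi Lpsir Lpsiz drpsi dzpsi tr0 weq n).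
apply: ae_imp2 vm (wt_section_L2 LLpsi) => r vm' sec r0r; have /andP[r0 rr] := r0r.
set q : R := 2 * 0 + 1 in sec.
have wi := L2_integrable_oo (sec r0r).
have inv : r `^ (- (q / 2)) * r `^ (q / 2) = 1 by rewrite powM// addNr powRr0.
have psiE z : psi (r, z) = r `^ (- (q / 2)) * wt q psi (r, z).
  by rewrite /wt/= mulrCA inv mulr1.
split.
- exact: (secV_section_int rho0 a0 m1 mG LG Gi r0r).
- by apply: eq_integrable_oo (integrableZ_oo (r `^ (- (q / 2))) wi) => z _; rewrite -psiE.
move=> n; have gi := zc_sqr_integrable rho0 a0 ms sb so LG n.
rewrite (secV_coef rho0 a0 m1 mG LG Gi (ms n) (sb n) gi r0r).
have mz := zc_measurable rho0 a0 LG (ms n) (fun z _ => sb n z).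
have mgm := gmode_measurable rho0 a0 Lom Lpsi n.
rewrite (radV_ae mz mgm (Gn n)) ?(ltW r0) ?(ltW rr)//.
rewrite -/(Vmode rho a m omega psi n r) -vm'// /vcoef /zc -RintegralZl//.
  by apply: eq_Rint_oo => z _; rewrite mulrA -psiE.
exact: (@integrable_mulbnd _ _ R mu _ (measurable_itv _) _ _ _ wi (ms n) (fun z _ => sb n z)).
Qed.

Lemma weighted_estimate : exists (psi0 : R -> R) (d : nat -> R * R -> R)
    (Fz Fzr Fzz : R * R -> R),
  [/\ axis_trace rho a psi psi0,
      r_derivs rho a 2 (fun p => psi p - psi0 p.2) d,
      distr_is rho a (Dz (distr rho a psi)) Fz,
      distr_is rho a (Dr (Dz (distr rho a psi))) Fzr /\
      distr_is rho a (Dz (Dz (distr rho a psi))) Fzz &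
      (L2Hk_sq rho a 2 m d + L2w_sq rho a m Fzr + L2w_sq rho a m Fzz
       + (2 * m * (2 - 2 * m))%:E * L2w_sq rho a (m - 1) Fz
       <= (Hk_cst m * 4 + 5 / 2)%:E * L2w_sq rho a m omega)%E].
Proof.
have [Fz [Fzr [Fzz [[Lz bz] [Lzr bzr] [Lzz bzz] Fn Fd]]]] :=
  weak_derivatives_exist rho0 a0 m0 m1 Lom Lpsi Lpsir Lpsiz drpsi dzpsi tr0 weq.
have LLom := L2w_L2 Lom; have [mom _] := Lom; have [mpsi _] := Lpsi.
set q : R := 2 * m + 1 in Lzr bzr Lzz bzz Fn LLom bz.
set B := \int[leb2]_(p in Om) (wt q omega p ^+ 2) in bz bzr bzz.
have ms n : measurable_fun `](- a), a[ (esin a n) by exact: esin_measurable.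
have sb n z : `|esin a n z| <= (Num.sqrt a)^-1 by exact: esin_bound.
(* The right-hand side of the radial equation; its sine coefficients f_n - lam_n^2 v_n are almost
   everywhere [gmode]. *)
pose G0 (p : R * R) := omega p + Fzz p.
have [mzz _] := wt_loc_int rho0 a0 Lzz.
have mG0 : measurable_fun Om G0 by exact: measurable_funD.
have wG0 p : wt q G0 p = wt q omega p + wt q Fzz p by rewrite /wt mulrDl.
have LG0 : L2 leb2 Om (wt q G0).
  have := @L2D _ _ R leb2 Om (measurable_Omega rho a) _ _ LLom Lzz.
  by congr L2; apply/funext => p; rewrite wG0.
have [_ omi] := LLom; have [_ zzi] := Lzz; have [_ G0i] := LG0.
(* The factor 4 comes from (x + y)^2 <= 2 x^2 + 2 y^2, as omega and psi_zz both have squared norm at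
   most B. *)
have bG0 : \int[leb2]_(p in Om) (wt q G0 p ^+ 2) <= 4 * B.
  apply: (@le_trans _ _ (\int[leb2]_(p in Om) (2 * wt q omega p ^+ 2 + 2 * wt q Fzz p ^+ 2))).
    apply: (@le_Rintegral _ _ R leb2 _ _ _ (measurable_Omega rho a) G0i).
      exact: (integrableD_Omega (integrableZ_Omega 2 omi) (integrableZ_Omega 2 zzi)).
    move=> p _; rewrite wG0; move: (wt _ _ _) (wt _ _ _) => x y.
    have := sqr_ge0 (x - y); rewrite -subr_ge0 => h; rewrite -subr_ge0.
    by move: h; rewrite subr0; congr (0 <= _); ring.
  rewrite (Omega_D (integrableZ_Omega 2 omi) (integrableZ_Omega 2 zzi)) !Omega_Zl// -/B.
  have -> : 4 * B = 2 * B + 2 * B by ring.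
  by rewrite lerD2l ler_wpM2l.
have [G [mG LG bG Gi GG0]] := regularize mG0 LG0.
have Gn n : {ae mu, forall r, 0 < r < rho -> zc a q G (esin a n) r = gmode a m omega psi n r}.
  have E1 := zcD LLom Lzz (ms n) (sb n).
  have E2 := Fn n.
  have E3 := vcoef_mode rho0 a0 m0 m1 Lom Lpsi Lpsir Lpsiz drpsi dzpsi tr0 weq n.
  apply: ae_imp2 E1 (ae_imp2 _ E2 E3) => [r e1 e23 r0r|r]; last first.
    by move=> e2 e3; exact: (conj e2 e3).
  have [e2 e3] := e23.
  rewrite GG0// e1// e2// -e3// /gmode /mode_rhs /fcoef; ring.
have psiE := psi_secV mG LG Gi Gn.
exists (fun z => - radQ (fun s => G (s, z)) rho), (secD G), Fz, Fzr, Fzz; split.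
(* The version of psi that is continuous up to the axis; thanks to the regularised G this holds at
   every height, and its value at r = 0 is - [radQ] at rho. *)
- exists (secV rho G); split; first exact: psiE.
  apply: ae_all => z zr; have mz := section_measurable mG zr; have gz := Gi z zr.
  split; last by rewrite /secV /radV /radQ set_itv_ge ?bnd_simp ?ltxx// Rintegral_set0 sub0r.
  apply: continuous_subspaceW (radV_continuous rho0 m1 mz gz).
  by apply: subset_itvl; rewrite bnd_simp.
- move=> i i2; split; first exact: secD_measurable.
  have sec : {ae mu, forall z, - a < z < a -> {ae mu, forall r, 0 < r < rho -> psi (r, z) = secV rho G (r, z)}}.
    have h : {ae leb2, forall p, (`]0, rho[ `*` `](- a), a[) p -> psi p = secV rho G p}.
      by rewrite -OmegaE; apply: ae_imp_leb2 psiE => p e /e ->.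
    apply: ae_imp (ae_rect2 h) => z k zr.
    have zI : [set` `](- a), a[] z by rewrite /= in_itv.
    by apply: ae_imp (k zI) => r e r0r; apply: e; rewrite /= in_itv.
  apply: ae_imp sec => z sec zr; have mz := section_measurable mG zr; have gz := Gi z zr.
  exact: (radial_wderiv rho0 m1 mz gz (section_measurable mpsi zr) (sec zr) i2).
- by split; [exact: wt_loc_int Lz|move=> phi t; have [] := Fd phi t].
- split; split; first exact: (wt_loc_int rho0 a0 Lzr).
  + by move=> phi t; have [] := Fd phi t.
  + exact: (wt_loc_int rho0 a0 Lzz).
  + by move=> phi t; have [] := Fd phi t.
have [_ zri] := Lzr; have [_ zi] := Lz.
rewrite !L2w_sqE !integral_Rint_Omega//.
have mm : 0 < 4 * m * (1 - m) by rewrite !mulr_gt0 ?subr_gt0.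
set Z := \int[leb2]_(p in Om) (wt (2 * (m - 1) + 1) Fz p ^+ 2) in bz *.
(* 2 m (2 - 2 m) equals 4 m (1 - m), the factor by which the modal estimate divides, so this term
   costs at most B. *)
have bz' : 2 * m * (2 - 2 * m) * Z <= B.
  by move: bz; rewrite ler_pdivlMr// mulrC; congr (_ <= _); ring.
have K0 := Hk_cst_ge0 m.
have bHk := le_trans bG bG0.
(* From left to right: [Hk_cst] times the bound for G, then the bounds for psi_zr, psi_zz and the
   weighted psi_z; the last three add up to 5/2 B. *)
apply: (@le_trans _ _ ((Hk_cst m * (4 * B))%:E + (B / 2)%:E + B%:E + B%:E)%E).
  apply: leeD; last by rewrite -EFinM lee_fin.
  apply: leeD; last by rewrite lee_fin.
  apply: leeD; last by rewrite lee_fin.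
  apply: (le_trans (L2Hk_bound rho0 m1 mG LG Gi)).
  by rewrite lee_fin ler_wpM2l.
by rewrite -!EFinD -EFinM lee_fin -/B le_eqVlt; apply/orP; left; apply/eqP; field.
Qed.

End reconstruction.

Theorem theorem1 (R : realType) (rho a mu : R)
    (rho_gt0 : 0 < rho) (a_gt0 : 0 < a) (mu_gt0 : 0 < mu) (mu_lt1 : mu < 1) :
  exists c : R, forall omega psi : R * R -> R,
    L2w rho a mu omega ->
    weak_solution rho a omega psi ->
    exists (psi0 : R -> R) (d : nat -> R * R -> R)
           (psiz psizr psizz : R * R -> R),
      [/\ axis_trace rho a psi psi0,
          r_derivs rho a 2 (fun p => psi p - psi0 p.2) d,
          distr_is rho a (Dz (distr rho a psi)) psiz,
          distr_is rho a (Dr (Dz (distr rho a psi))) psizr /\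
          distr_is rho a (Dz (Dz (distr rho a psi))) psizz &
          (L2Hk_sq rho a 2 mu d + L2w_sq rho a mu psizr + L2w_sq rho a mu psizz
           + (2 * mu * (2 - 2 * mu))%:E * L2w_sq rho a (mu - 1) psiz
           <= c%:E * L2w_sq rho a mu omega)%E].
Proof.
exists (Hk_cst mu * 4 + 5 / 2) => omega psi Lom [[psir [psiz [[Lpsi [[_ dr] Lpsir] [[_ dz] Lpsiz]] tr0]]] weq].
exact: (weighted_estimate rho_gt0 a_gt0 mu_gt0 mu_lt1 Lom Lpsi Lpsir Lpsiz dr dz tr0 weq).
Qed.
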